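(* Let $\Gamma_k$ ($k\ge2$) be a tree with degrees $d_1,\dots,d_k$, and let $S_n^{(\gamma)}$ be its sub-tree count. Assume $ne^{-\zeta(d-1)R_n/2}\to c\in(0,\infty]$. (a) For every $0<a<1/2$ there exists $\gamma_0\in(0,1/2)$ such that for all $0<\gamma<\gamma_0$, as $n\to\infty$, $$d_W\Bigl(\frac{S_n^{(\gamma)}-\mathbb E S_n^{(\gamma)}}{\sqrt{\mathbb{VAR}(S_n^{(\gamma)})}},N\Bigr)=O(n^{-a}),\qquad d_K\Bigl(\frac{S_n^{(\gamma)}-\mathbb E S_n^{(\gamma)}}{\sqrt{\mathbb{VAR}(S_n^{(\gamma)})}},N\Bigr)=O(n^{-a}).$$ (b) If moreover $\alpha/\zeta>d_{(k)}$, then $(S_n-\mathbb E S_n)/\sqrt{\mathbb{VAR}(S_n)}\Rightarrow N$ as $n\to\infty$.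
   Context: Fix an integer $d\ge2$ and parameters $\zeta,\alpha>0$. Geometry. The Poincaré ball $B_d^{(\zeta)}$ is the open unit ball of $\mathbb R^d$ with metric $ds^2=\frac{4}{\zeta^2}\frac{|dx|^2}{(1-|x|^2)^2}$ and hyperbolic distance $d(\cdot,\cdot)$, so $d(0,x)=\zeta^{-1}\log\frac{1+|x|}{1-|x|}$. $B(0,R)$ is the closed hyperbolic ball of radius $R$ about the origin. Random points. Let $R_n\to\infty$ be deterministic. Let $\mathcal P_n$ be a Poisson point process with intensity $n(\rho_{n,\alpha}\times\pi)$: the radial part $d(0,x)$ has density $\rho_{n,\alpha}(r)=\sinh^{d-1}(\alpha r)/\int_0^{R_n}\sinh^{d-1}(\alpha s)\,ds$ on $[0,R_n]$, independent of a uniform direction on $S^{d-1}$. Write $T=R_n-d(0,X)$. Sub-tree counts. Let $\Gamma_k$ be a tree on $[k]$ with edge set $E$ and degrees $d_1,\dots,d_k$, with largest degree $d_{(k)}$. For $\gamma\in(0,1]$ define $$S_n^{(\gamma)}=\sum_{(X_1,\dots,X_k)}\prod_{(i,j)\in E}\mathbf 1\{0<d(X_i,X_j)\le R_n,\ T_i\le\gamma R_n,\ T_j\le\gamma R_n\},$$ with the sum over ordered $k$-tuples of distinct points of $\mathcal P_n$. Write $S_n=S_n^{(1)}$. Distances between laws. $N$ is a standard normal random variable. - Wasserstein distance: $d_W(Y_1,Y_2)=\sup_{h}|\mathbb E h(Y_1)-\mathbb E h(Y_2)|$, over $1$-Lipschitz $h:\mathbb R\to\mathbb R$. - Kolmogorov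 distance: $d_K(Y_1,Y_2)=\sup_x|\mathbb P(Y_1\le x)-\mathbb P(Y_2\le x)|$. - $\Rightarrow$ denotes convergence in distribution. *)

(* Defs.v *)
From HB Require Import structures.
From mathcomp Require Import all_boot all_order all_algebra.
From mathcomp Require Import all_classical all_reals all_analysis.
Set Implicit Arguments. Unset Strict Implicit. Unset Printing Implicit Defensive.
Import Order.TTheory GRing.Theory Num.Theory.
Import numFieldNormedType.Exports.
Local Open Scope classical_set_scope.
Local Open Scope ring_scope.

Section Defs.
Context {R : realType}.

Definition sinhR (x : R) : R := (expR x - expR (- x)) / 2.
Definition tanhR (x : R) : R := (expR x - expR (- x)) / (expR x + expR (- x)).
Definition acoshR (t : R) : R := ln (t + Num.sqrt (t ^+ 2 - 1)).

Definition sqnorm (d : nat) (x : 'rV[R]_d) : R := \sum_(j < d) (x ord0 j) ^+ 2.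

(* hyperbolic distance of the metric 4/zeta^2 |dx|^2/(1-|x|^2)^2 on the
   open unit ball *)
Definition hdist (zeta : R) (d : nat) (x y : 'rV[R]_d) : R :=
  zeta^-1 * acoshR (1 + 2 * sqnorm (x - y) / ((1 - sqnorm x) * (1 - sqnorm y))).

Definition rho_dens (d : nat) (alpha Rn : R) (r : R) : R :=
  (sinhR (alpha * r)) ^+ d.-1 /
  fine (\int[lebesgue_measure]_(s in `[0%R, Rn]) ((sinhR (alpha * s)) ^+ d.-1)%:E)%E.

(* point of the ball at hyperbolic distance r from 0 in the direction of g
   (g/|g| is the direction; for a standard Gaussian vector g it is uniform on
   the sphere S^{d-1}) *)
Definition ball_point (zeta : R) (d : nat) (r : R) (g : 'rV[R]_d) : 'rV[R]_d :=
  (tanhR (zeta * r / 2) / Num.sqrt (sqnorm g)) *: g.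

Definition simple_graph (k : nat) (e : rel 'I_k) : Prop :=
  irreflexive e /\ symmetric e.
Definition is_tree (k : nat) (e : rel 'I_k) : Prop :=
  simple_graph e /\ (forall i j : 'I_k, connect e i j) /\
  #|[set p : 'I_k * 'I_k | (p.1 < p.2)%N && e p.1 p.2]| = k.-1.
Definition degree (k : nat) (e : rel 'I_k) (i : 'I_k) : nat := #|[set j | e i j]|.
Definition max_degree (k : nat) (e : rel 'I_k) : nat := \max_(i < k) degree e i.

Definition subtree_count (zeta : R) (d k : nat) (e : rel 'I_k) (Rn gamma : R)
    (m : nat) (pts : 'I_m -> 'rV[R]_d) : R :=
  \sum_(f : {ffun 'I_k -> 'I_m} | injectiveb f)
    \prod_(p : 'I_k * 'I_k | (p.1 < p.2)%N && e p.1 p.2)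
      ((0 < hdist zeta (pts (f p.1)) (pts (f p.2)) <= Rn) &&
       (Rn - hdist zeta 0 (pts (f p.1)) <= gamma * Rn) &&
       (Rn - hdist zeta 0 (pts (f p.2)) <= gamma * Rn))%:R.

Definition mutually_independent {dT} {T : measurableType dT}
    (P : probability T R) (I : eqType) (X : I -> T -> R) : Prop :=
  forall (J : seq I) (B : I -> set R), uniq J -> (forall i, measurable (B i)) ->
    P (\bigcap_(i in [set` J]) (X i @^-1` B i)) = (\prod_(i <- J) P (X i @^-1` B i))%E.

(* index set of the random ingredients of the Poisson process at stage n:
   the number of points, the radii, and the Gaussian direction coordinates *)
Definition ppp_idx (d : nat) := (unit + (nat + (nat * 'I_d)))%type.

(* Poisson point process with intensity n (rho_{n,alpha} x pi) on B(0,Rn),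
   realised as N ~ Poisson(n) points X_0..X_{N-1} i.i.d. with radial part of
   density rho_{n,alpha} and independent uniform direction on S^{d-1}
   (the direction being G/|G|, G a standard Gaussian vector of R^d) *)
Definition is_hyperbolic_ppp {dT} {T : measurableType dT} (P : probability T R)
    (d : nat) (alpha Rn : R) (n : nat)
    (N : T -> nat) (Rad : nat -> T -> R) (G : nat -> 'I_d -> T -> R) : Prop :=
  let X : ppp_idx d -> T -> R := fun i =>
    match i with
    | inl _ => fun w => (N w)%:R
    | inr (inl m) => Rad m
    | inr (inr (m, j)) => G m j
    end in
  (forall i, measurable_fun setT (X i)) /\
  mutually_independent P X /\
  (forall m : nat, P (N @^-1` [set m]) =
     (expR (- n%:R) * n%:R ^+ m / (m`!)%:R)%:E) /\
  (forall (m : nat) (B : set R), measurable B ->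
     P (Rad m @^-1` B) =
     (\int[lebesgue_measure]_(r in B `&` `[0%R, Rn]) (rho_dens d alpha Rn r)%:E)%E) /\
  (forall (m : nat) (j : 'I_d) (B : set R), measurable B ->
     P (G m j @^-1` B) = normal_prob 0 1 B).

Definition ppp_points {T} (zeta : R) (d : nat) (N : T -> nat) (Rad : nat -> T -> R)
    (G : nat -> 'I_d -> T -> R) (w : T) : 'I_(N w) -> 'rV[R]_d :=
  fun i => ball_point zeta (Rad i w) (\row_j G i j w).

Definition standardize {dT} {T : measurableType dT} (P : probability T R)
    (Y : T -> R) : T -> R :=
  fun w => (Y w - fine ('E_P[Y])) / Num.sqrt (fine ('V_P[Y])).

Definition std_normal_expect (h : R -> R) : \bar R :=
  (\int[lebesgue_measure]_x (h x * normal_pdf 0 1 x)%:E)%E.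

Definition lipschitz1 (h : R -> R) : Prop := forall x y, `|h x - h y| <= `|x - y|.

Definition dW_normal {dT} {T : measurableType dT} (P : probability T R)
    (Y : T -> R) : \bar R :=
  ereal_sup [set (`| \int[P]_w (h (Y w))%:E - std_normal_expect h |)%E
            | h in [set h : R -> R | lipschitz1 h]].

Definition dK_normal {dT} {T : measurableType dT} (P : probability T R)
    (Y : T -> R) : \bar R :=
  ereal_sup [set (`| P [set w | (Y w <= x)%R] - normal_prob 0 1 `]-oo, x]%classic |)%E
            | x in [set: R]].

Definition cvg_dist_normal {dT} {T : measurableType dT} (P : probability T R)
    (Y : nat -> T -> R) : Prop :=
  forall h : R -> R, continuous h -> (exists M, forall x, `|h x| <= M) ->
    (fun n => \int[P]_w (h (Y n w))%:E)%E @ \oo --> std_normal_expect h.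

Definition bigO_pow (u : nat -> \bar R) (a : R) : Prop :=
  exists C : R, exists n0 : nat, forall n, (n0 <= n)%N ->
    (u n <= (C * powR n%:R (- a))%:E)%E.

End Defs.
Arguments ppp_points {R T} zeta {d} N Rad G w _.

(* Main.v *)
(* Only the array recording which pairs of points are within distance R_n, and which
   points satisfy T <= gamma R_n, matters. It is exchangeable and dissociated, so Mecke's
   formula gives, for S = S_n^(gamma), a size-bias identity
     E[(S - E S) H] = n^k E[Phi(Y) (H(g + Y) - H(g))],
   where k fresh points Y are added to the configuration g. Let Z be the sum of
   Phi(y) Phi(z) over pairs of patterns with a common point, so that E Z = Var S. In
   Stein's method the remainder f(b) - f(a) - (b - a) f'(a) is bounded by
   (b - a) (G(b) - G(a)) with G nondecreasing (the equation for f gives such a G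
   both for half-lines and for Lipschitz test functions); a second use of the identity
   then removes third-order terms, and E Z^2 <= (E Z)^2 (1 + D^2) implies d_K, d_W = O(D).
   The conditional expectations of the error terms are handled by averaging over N
   independent replicas of Y and letting N go to infinity.

   E Z^2 - (E Z)^2 only involves overlapping quadruples of patterns, whose union is
   connected: growing a spanning tree one point at a time and using that, given the radii,
   an edge has probability at most C exp(zeta(d-1)/2 (T_i + T_j - R_n)), it is at
   most C n^(4k-3) p^(4k-4) exp(O(gamma) R_n) with p = exp(-zeta(d-1)R_n/2). Two
   copies of the tree glued at a vertex give Var S >= c n^(2k-1) p^(2k-2), whence
   D = O(n^(-1/2 + O(gamma))). For (b), the same spanning trees, with vertex degrees
   at most 2 d_(k) and E exp(s T) finite for s < alpha(d-1), show that S_n - S_n^(gamma)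
   has variance o(Var S_n^(gamma)). *)

Require Import Defs.
From HB Require Import structures.
From mathcomp Require Import all_boot all_order all_algebra.
From mathcomp Require Import all_classical all_reals all_analysis.
From mathcomp Require Import measurable_realfun.
From mathcomp Require Import zify ring lra.
Set Implicit Arguments. Unset Strict Implicit. Unset Printing Implicit Defensive.
Import Order.TTheory GRing.Theory Num.Theory.
Import numFieldNormedType.Exports.
Local Open Scope classical_set_scope.
Local Open Scope ring_scope.

(** A Taylor expansion in Stein's equation would leave a term E[Phi(Y) D^2], with D the increment of
    the count, and for half-lines f' even jumps. The monotone bound avoids both. Put Q = n^k Phi(Y)
    D / Var S, which has mean 1. At standardised counts the remainder is at most E[Q G(g + Y)] -
    E[Q G(g)]. The first term equals E[Z G(S)] / Var S; the second is E[G(S)] up to the fluctuation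
    of the conditional mean of Q given g. They cancel up to the relative standard deviation of Z,
    and the same fluctuation controls E[(Q - 1) f'(g)], so E Z^2 is the only moment to estimate.

    The law of an array on a finite index set is a finite table of numbers, so the Stein argument
    for the counts is algebra on Poisson series of finite sums.

    A loss exp(O(gamma) R_n) is affordable because n p >= c0 forces exp(zeta(d-1)R_n/2) <= n / c0:
    the loss is a power n^(O(gamma)), absorbed by a < 1/2 for small gamma. The same bound n p >= c0
    makes the connected unions with the most points dominate. *)

Lemma ffact_le_exp (m r : nat) : (m ^_ r <= m ^ r)%N.
Proof.
elim: r => [|r IH]; first by rewrite ffactn0.
by rewrite ffactnSr expnSr leq_mul// leq_subr.
Qed.

Lemma ffact_addn (m j i : nat) : (m ^_ (j + i) = m ^_ j * (m - j) ^_ i)%N.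
Proof.
elim: i => [|i IH]; first by rewrite addn0 ffactn0 muln1.
by rewrite addnS !ffactnSr IH -subnDA mulnA.
Qed.

(** * Poisson mixtures of exchangeable arrays *)

Section PoissonMean.
Context {R : realType}.
Implicit Types (a b : nat -> R) (lam : R).

Definition pois lam (m : nat) : R := expR (- lam) * lam ^+ m / m`!%:R.

(** Polynomial growth is the integrability class: a count over m points is at most a power of m, and
    [PE], which is only a [limn], converges absolutely there. *)
Definition pb a := exists C : R, exists q : nat,
  forall m, `|a m| <= C * m.+1%:R ^+ q.

Definition PE lam a : R := limn (series (fun m => pois lam m * a m)).

Lemma pois_ge0 lam m : 0 <= lam -> 0 <= pois lam m.
Proof.
by move=> l0; rewrite /pois !mulr_ge0 ?expR_ge0 ?exprn_ge0 ?invr_ge0.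
Qed.

Lemma exprn_le_expR (x : R) q : 0 <= x -> x ^+ q <= q`!%:R * expR x.
Proof.
case: q => [|q] x0; first by rewrite expr0 mul1r -(expR0 R) ler_expR.
have := @expR_ge1Dxn R x q x0.
rewrite -ler_pdivrMl ?ltr0n ?fact_gt0// mulrC => H.
by apply: le_trans H; rewrite lerDr.
Qed.

Lemma pb_le a b : (forall m, `|a m| <= `|b m|) -> pb b -> pb a.
Proof. by move=> ab [C [q H]]; exists C, q => m; apply: le_trans (H m). Qed.

Lemma pb_ge0 a : pb a -> exists C : R, exists q : nat,
  0 <= C /\ forall m, `|a m| <= C * m.+1%:R ^+ q.
Proof.
move=> [C [q H]]; exists C, q; split => //.
by have := H 0; rewrite expr1n mulr1; apply: le_trans.
Qed.

Lemma pb_cst (c : R) : pb (fun=> c).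
Proof. by exists `|c|, 0 => m; rewrite expr0 mulr1. Qed.

Lemma pb_add a b : pb a -> pb b -> pb (fun m => a m + b m).
Proof.
move=> /pb_ge0[C [q [C0 H]]] /pb_ge0[C' [q' [C'0 H']]].
exists (C + C'), (q + q')%N => m.
have m1 : (1 : R) <= m.+1%:R by rewrite ler1n.
rewrite (le_trans (ler_normD _ _))// mulrDl lerD//.
  by apply: (le_trans (H m)); rewrite ler_wpM2l// exprD ler_peMr ?exprn_ge0// exprn_ege1.
by apply: (le_trans (H' m)); rewrite ler_wpM2l// exprD ler_peMl ?exprn_ge0// exprn_ege1.
Qed.

Lemma pb_mul a b : pb a -> pb b -> pb (fun m => a m * b m).
Proof.
move=> [C [q H]] [C' [q' H']].
exists (C * C'), (q + q')%N => m.
by rewrite normrM exprD mulrACA ler_pM.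
Qed.

Lemma pb_scale (c : R) a : pb a -> pb (fun m => c * a m).
Proof. exact: pb_mul (pb_cst c). Qed.

Lemma pb_opp a : pb a -> pb (fun m => - a m).
Proof. by apply: pb_le => m; rewrite normrN. Qed.

Lemma pb_sub a b : pb a -> pb b -> pb (fun m => a m - b m).
Proof. by move=> pa pb'; apply: pb_add => //; exact: pb_opp. Qed.

Lemma pb_exp a q : pb a -> pb (fun m => a m ^+ q).
Proof.
move=> pa; elim: q => [|q IH]; first exact: pb_cst.
by apply: pb_le (pb_mul pa IH) => m; rewrite exprS.
Qed.

Lemma pb_nat (q : nat) : pb (fun m => (m%:R ^+ q : R)).
Proof.
apply: pb_exp; exists 1, 1%N => m; rewrite mul1r expr1 ger0_norm//.
by rewrite ler_nat.
Qed.

(** By [exprn_le_expR] the polynomial is absorbed by a geometric factor: [m.+1 ^+ q] is at most q!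
    times [expR 1 ^+ m.+1], so an exponential series of parameter [lam * expR 1] dominates. *)
Lemma pb_cvg_normed lam a : 0 <= lam -> pb a ->
  cvgn (series (fun m => `|pois lam m * a m|)).
Proof.
move=> l0 /pb_ge0[C [q [C0 H]]].
pose v := (C * q`!%:R * expR 1 * expR (- lam)) *: exp_coeff (lam * expR 1).
have vE m : v m = C * q`!%:R * expR 1 * expR (- lam) * ((lam * expR 1) ^+ m / m`!%:R).
  by [].
apply: (@series_le_cvg _ _ v) => // [m|m|].
- by rewrite vE !mulr_ge0 ?expR_ge0 ?exprn_ge0 ?invr_ge0 ?mulr_ge0 ?expR_ge0.
- rewrite vE normrM (ger0_norm (pois_ge0 m l0)) /pois.
  have E : `|a m| <= C * q`!%:R * expR 1 * expR 1 ^+ m.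
    apply: (le_trans (H m)); rewrite -!mulrA ler_wpM2l//.
    apply: le_trans (exprn_le_expR _ _) _ => //.
    by rewrite ler_wpM2l// -natr1 expRD -expRM_natl mulr1 mulrC.
  apply: (@le_trans _ _ (expR (- lam) * lam ^+ m / m`!%:R *
      (C * q`!%:R * expR 1 * expR 1 ^+ m))).
    by rewrite ler_wpM2l// !mulr_ge0 ?expR_ge0 ?exprn_ge0 ?invr_ge0.
  rewrite exprMn le_eqVlt; apply/orP; left; apply/eqP.
  by ring.
- by apply: is_cvg_seriesZ; exact: is_cvg_series_exp_coeff.
Qed.

Lemma pb_cvg lam a : 0 <= lam -> pb a ->
  cvgn (series (fun m => pois lam m * a m)).
Proof. by move=> l0 pa; apply: normed_cvg; exact: pb_cvg_normed. Qed.

Lemma PE_eq lam a b : (forall m, a m = b m) -> PE lam a = PE lam b.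
Proof. by move=> /funext ->. Qed.

Lemma PE_add lam a b : 0 <= lam -> pb a -> pb b ->
  PE lam (fun m => a m + b m) = PE lam a + PE lam b.
Proof.
move=> l0 pa pb'; rewrite /PE -lim_seriesD; [|exact: pb_cvg..].
by congr (limn (series _)); apply/funext => m; rewrite /= mulrDr.
Qed.

Lemma PE_scale lam c a : 0 <= lam -> pb a ->
  PE lam (fun m => c * a m) = c * PE lam a.
Proof.
move=> l0 pa; rewrite /PE -[RHS]/(c *: _) -lim_seriesZ; last exact: pb_cvg.
by congr (limn (series _)); apply/funext => m; rewrite /= /GRing.scale /= mulrCA.
Qed.

Lemma PE_opp lam a : 0 <= lam -> pb a -> PE lam (fun m => - a m) = - PE lam a.
Proof.
move=> l0 pa; rewrite -mulN1r -PE_scale//; apply: PE_eq => m.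
by rewrite mulN1r.
Qed.

Lemma PE_sub lam a b : 0 <= lam -> pb a -> pb b ->
  PE lam (fun m => a m - b m) = PE lam a - PE lam b.
Proof. by move=> l0 pa pb'; rewrite PE_add ?PE_opp//; exact: pb_opp. Qed.

Lemma PE_le lam a b : 0 <= lam -> pb a -> pb b -> (forall m, a m <= b m) ->
  PE lam a <= PE lam b.
Proof.
move=> l0 pa pb' ab; apply: ler_lim; [exact: pb_cvg..|].
by apply: nearW => n; rewrite /series /= ler_sum// => m _; rewrite ler_wpM2l// pois_ge0.
Qed.

Lemma PE1 lam : 0 <= lam -> PE lam (fun=> 1) = 1.
Proof.
move=> l0; have H : cvgn (series (exp_coeff lam)) by exact: is_cvg_series_exp_coeff.
have -> : PE lam (fun=> 1) = limn (series (expR (- lam) *: exp_coeff lam)).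
  congr (limn (series _)); apply/funext => m.
  by rewrite /pois /exp_coeff /= mulr1 /GRing.scale /= -mulrA.
rewrite lim_seriesZ// -[limn _]/(expR lam) -[_ *: _]/(_ * _).
by rewrite -expRD addNr expR0.
Qed.

Lemma PE_cst lam c : 0 <= lam -> PE lam (fun=> c) = c.
Proof.
move=> l0; rewrite -[RHS]mulr1 -[X in _ = c * X](PE1 l0) -PE_scale//; last exact: pb_cst.
by apply: PE_eq => m; rewrite mulr1.
Qed.

Lemma PE_sum lam (I : finType) (P : pred I) (f : I -> nat -> R) : 0 <= lam ->
  (forall i, P i -> pb (f i)) ->
  pb (fun m => \sum_(i | P i) f i m) /\
  PE lam (fun m => \sum_(i | P i) f i m) = \sum_(i | P i) PE lam (f i).
Proof.
move=> l0; have E s : (forall i, P i -> pb (f i)) ->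
  pb (fun m => \sum_(i <- s | P i) f i m) /\
  PE lam (fun m => \sum_(i <- s | P i) f i m) = \sum_(i <- s | P i) PE lam (f i).
  move=> H; elim: s => [|i s [IH1 IH2]].
    under eq_fun do rewrite big_nil.
    by split; [exact: pb_cst|rewrite big_nil PE_cst].
  under eq_fun do rewrite big_cons.
  rewrite big_cons; case: ifPn => // Pi.
  by split; [apply: pb_add => //; exact: H|rewrite PE_add ?IH2//; exact: H].
exact: E.
Qed.

(** Since (m + r)^_r / (m + r)! = 1 / m!, the series is that of [a] shifted by r and multiplied by
    lam^r. This is Mecke's formula for the number of points alone. *)
Lemma PE_ffact lam a (r : nat) : 0 <= lam -> pb a ->
  PE lam (fun m => if (r <= m)%N then (m ^_ r)%:R * a (m - r)%N else 0)
  = lam ^+ r * PE lam a.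
Proof.
move=> l0 pa; rewrite -PE_scale//.
set f := (fun m => _).
set g := (fun m => _ * a m).
have E m : pois lam (m + r) * f (m + r)%N = pois lam m * g m.
  rewrite /f /g leq_addl addnK /pois exprD.
  have -> : (m + r)`!%:R = ((m + r) ^_ r)%:R * m`!%:R :> R.
    by rewrite -natrM -{3}(addnK r m) ffact_fact// leq_addl.
  have h1 : ((m + r) ^_ r)%:R != 0 :> R.
    by rewrite pnatr_eq0 -lt0n ffact_gt0 leq_addl.
  have h2 : m`!%:R != 0 :> R by rewrite pnatr_eq0 -lt0n fact_gt0.
  by field; rewrite h1 h2.
have S n : series (fun m => pois lam m * f m) (n + r)%N =
           series (fun m => pois lam m * g m) n.
  elim: n => [|n IH].
    rewrite add0n /series /= [RHS]big_geq// big_nat big1 // => i /andP[_ ir].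
    by rewrite /f leqNgt ir mulr0.
  rewrite addSn; rewrite /series /= !big_nat_recr//= -E; congr (_ + _).
  exact: IH.
have cg : cvgn (series (fun m => pois lam m * g m)).
  by apply: pb_cvg => //; exact: pb_scale.
rewrite /PE; apply/cvg_lim => //.
rewrite -(cvg_shiftn r) /=; apply: cvg_trans cg.
by apply: near_eq_cvg; apply: nearW => n; rewrite S.
Qed.

Lemma pb_ffact a (r : nat) : pb a ->
  pb (fun m => if (r <= m)%N then (m ^_ r)%:R * a (m - r)%N else 0).
Proof.
move=> /pb_ge0[C [q [C0 H]]]; exists C, (r + q)%N => m.
case: leqP => [rm|_]; last by rewrite normr0 mulr_ge0// exprn_ge0.
rewrite normrM ger0_norm// exprD mulrCA ler_pM//.
  by rewrite -natrX ler_nat (leq_trans (ffact_le_exp m r))//; case: (r) => // r'; rewrite leq_exp2r.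
apply: (le_trans (H _)); rewrite ler_wpM2l// lerXn2r ?nnegrE// ler_nat ltnS.
exact: leq_subr.
Qed.

Lemma PE_bin lam j : 0 <= lam ->
  PE lam (fun m => ('C(m, j))%:R) = lam ^+ j / j`!%:R.
Proof.
move=> l0; rewrite -[lam ^+ j]mulr1 -[X in _ * X / _](PE1 l0).
rewrite -PE_ffact//; last exact: pb_cst.
rewrite mulrC -PE_scale//; last exact: (pb_ffact j (pb_cst 1)).
apply: PE_eq => m; rewrite mulr1.
case: leqP => jm; last by rewrite bin_small// mulr0.
by rewrite -bin_ffact natrM mulrC mulfK// pnatr_eq0 -lt0n fact_gt0.
Qed.

(** Choosing disjoint sets of sizes j and j' factorises exactly under the Poisson law. This is why
    disjoint patterns contribute precisely the square of the mean in [second_moment_FZ]. *)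
Lemma PE_bin2 lam j j' : 0 <= lam ->
  PE lam (fun m => ('C(m, j) * 'C(m - j, j'))%:R) =
  (lam ^+ j / j`!%:R) * (lam ^+ j' / j'`!%:R).
Proof.
move=> l0; have f0 i : i`!%:R != 0 :> R by rewrite pnatr_eq0 -lt0n fact_gt0.
have -> : (lam ^+ j / j`!%:R) * (lam ^+ j' / j'`!%:R) =
  (j`!%:R * j'`!%:R)^-1 * (lam ^+ (j + j') * PE lam (fun=> 1)).
  by rewrite PE1// exprD; field; rewrite !f0.
rewrite -PE_ffact//; last exact: pb_cst.
rewrite -PE_scale//; last exact: (pb_ffact (j + j') (pb_cst 1)).
apply: PE_eq => m; rewrite mulr1.
have E : (j`! * j'`! * ('C(m, j) * 'C(m - j, j')) = m ^_ (j + j'))%N.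
  by rewrite ffact_addn -!bin_ffact; nia.
case: leqP => jm; last first.
  rewrite mulr0; apply/eqP; rewrite pnatr_eq0.
  have [mj|mj] := ltnP m j; first by rewrite bin_small.
  by rewrite ['C(m - j, j')]bin_small ?muln0// ltn_subLR// addnC.
by rewrite -E !natrM mulKf// mulf_neq0.
Qed.

End PoissonMean.

(* The off-diagonal entries record adjacency of points, the diagonal ones carry
   the mark [T <= gamma R] of a point. *)
Definition arr (J : finType) := {ffun J * J -> bool}.

Definition pull (J J' : finType) (h : J -> J') (g : arr J') : arr J :=
  [ffun ij => g (h ij.1, h ij.2)].

Lemma pull_comp (J J' J'' : finType) (h : J -> J') (h' : J' -> J'') (g : arr J'') :
  pull h (pull h' g) = pull (h' \o h) g.
Proof. by apply/ffunP => -[i j]; rewrite !ffunE. Qed.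

Lemma eq_pull (J J' : finType) (h h' : J -> J') (g : arr J') :
  h =1 h' -> pull h g = pull h' g.
Proof. by move=> E; apply/ffunP => -[i j]; rewrite !ffunE /= !E. Qed.

(* An exchangeable, consistent and dissociated random array: the law of the
   array on an arbitrary finite index set. *)
Record array_law (R : realType) := ArrayLaw {
  mu : forall J : finType, arr J -> R;
  mu_ge0 : forall J g, 0 <= mu (J := J) g;
  mu_sum1 : forall J, \sum_(g : arr J) mu g = 1;
  mu_pull : forall (J J' : finType) (h : J -> J'), injective h ->
    forall g, \sum_(g' | pull h g' == g) mu g' = mu g;
  mu_dissoc : forall (J1 J2 : finType) (g1 : arr J1) (g2 : arr J2),
    \sum_(g : arr (J1 + J2)%type | (pull inl g == g1) && (pull inr g == g2)) mu g
    = mu g1 * mu g2 }.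

(** * Expectations over arrays and Mecke's formula *)

Section Expectation.
Context {R : realType} (L : array_law R).

Definition E (J : finType) (Psi : arr J -> R) : R := \sum_g mu L g * Psi g.

Lemma E_eq (J : finType) (f h : arr J -> R) : f =1 h -> E f = E h.
Proof. by move=> fh; apply: eq_bigr => g _; rewrite fh. Qed.

Lemma E_add (J : finType) (f h : arr J -> R) : E (fun g => f g + h g) = E f + E h.
Proof. by rewrite /E -big_split; apply: eq_bigr => g _; rewrite mulrDr. Qed.

Lemma E_scale (J : finType) c (f : arr J -> R) : E (fun g => c * f g) = c * E f.
Proof. by rewrite /E big_distrr; apply: eq_bigr => g _; rewrite mulrCA. Qed.

Lemma E_opp (J : finType) (f : arr J -> R) : E (fun g => - f g) = - E f.
Proof. by rewrite /E -sumrN; apply: eq_bigr => g _; rewrite mulrN. Qed.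

Lemma E_sub (J : finType) (f h : arr J -> R) : E (fun g => f g - h g) = E f - E h.
Proof. by rewrite E_add E_opp. Qed.

Lemma E_sum (J I : finType) (P : pred I) (f : I -> arr J -> R) :
  E (fun g => \sum_(i | P i) f i g) = \sum_(i | P i) E (f i).
Proof.
rewrite /E exchange_big; apply: eq_bigr => g _.
by rewrite big_distrr.
Qed.

Lemma E_cst (J : finType) c : E (fun _ : arr J => c) = c.
Proof. by rewrite /E -big_distrl /= mu_sum1 mul1r. Qed.

Lemma E_le (J : finType) (f h : arr J -> R) : (forall g, f g <= h g) -> E f <= E h.
Proof. by move=> fh; apply: ler_sum => g _; rewrite ler_wpM2l ?mu_ge0. Qed.

Lemma E_ge0 (J : finType) (f : arr J -> R) : (forall g, 0 <= f g) -> 0 <= E f.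
Proof. by move=> f0; rewrite -(E_cst J 0); exact: E_le. Qed.

Lemma E_norm_le (J : finType) (f : arr J -> R) c :
  (forall g, `|f g| <= c) -> `|E f| <= c.
Proof.
move=> H; rewrite -(E_cst J c) (le_trans (ler_norm_sum _ _ _))//.
by apply: ler_sum => g _; rewrite normrM ger0_norm ?mu_ge0// ler_wpM2l ?mu_ge0.
Qed.

Lemma E_pull (J J' : finType) (h : J -> J') (Psi : arr J -> R) :
  injective h -> E (fun g => Psi (pull h g)) = E Psi.
Proof.
move=> hi; rewrite /E (partition_big (pull h) xpredT)//=.
apply: eq_bigr => g _; rewrite -(mu_pull L hi g) big_distrl/=.
by apply: eq_bigr => g' /eqP ->.
Qed.

Lemma E_dissoc (J1 J2 : finType) (Psi1 : arr J1 -> R) (Psi2 : arr J2 -> R) :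
  E (fun g : arr (J1 + J2)%type => Psi1 (pull inl g) * Psi2 (pull inr g)) =
  E Psi1 * E Psi2.
Proof.
rewrite /E (partition_big (pull inl) xpredT)//= big_distrl/=.
apply: eq_bigr => g1 _; rewrite (partition_big (pull inr) xpredT)//= big_distrr/=.
apply: eq_bigr => g2 _.
rewrite mulrACA -mu_dissoc big_distrl/=.
by apply: eq_bigr => g /andP[/eqP -> /eqP ->].
Qed.

(** Relabelling through b turns any choice y of points into the standard fresh points [inr], so all
    choices can be compared with a single one. *)
Lemma extend_inj (B : finType) m (y : B -> 'I_m) : injective y ->
  exists b : ('I_(m - #|B|) + B)%type -> 'I_m, bijective b /\ b \o inr =1 y.
Proof.
move=> yi.
pose A := [set x | x \notin codom y]%SET.
have cA : (#|A| = m - #|B|)%N.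
  have -> : A = ~: [set x | x \in codom y] by apply/setP => x; rewrite !inE.
  rewrite cardsCs finset.setCK card_ord; congr (m - _)%N.
  by rewrite cardsE card_codom.
pose b (s : ('I_(m - #|B|) + B)%type) := match s with
  | inl i => enum_val (cast_ord (esym cA) i) | inr j => y j end.
exists b; split=> //.
have bm : (#|B| <= m)%N by rewrite -[X in (_ <= X)%N]card_ord -(card_codom yi) max_card.
apply: inj_card_bij; last by rewrite card_sum !card_ord subnK.
move=> [i|i] [j|j] //= H.
- by move/enum_val_inj: H => /cast_ord_inj ->.
- by have := enum_valP (cast_ord (esym cA) i); rewrite H inE codom_f.
- by have := enum_valP (cast_ord (esym cA) j); rewrite -H inE codom_f.
- by congr inr; apply: yi.
Qed.

(* Equivariance under relabelling of the points. *)
Definition natural (B : finType) (psi : forall J : finType, {ffun B -> J} -> arr J -> R) :=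
  forall (J J' : finType) (b : J -> J') (y : {ffun B -> J}) (g : arr J'),
    bijective b -> psi J' [ffun i => b (y i)] g = psi J y (pull b g).

Definition finr (A B : finType) : {ffun B -> (A + B)%type} := [ffun i => inr i].

(** By exchangeability all m^_#|B| injections have the expectation of the standard one; for m < #|B|
    there are none. *)
Lemma mecke_fixed (B : finType) (psi : forall J : finType, {ffun B -> J} -> arr J -> R) m :
  natural psi ->
  E (fun g : arr 'I_m => \sum_(y : {ffun B -> 'I_m} | injectiveb y) psi _ y g) =
  if (#|B| <= m)%N then
    (m ^_ #|B|)%:R * E (fun g : arr ('I_(m - #|B|) + B)%type => psi _ (finr _ B) g)
  else 0.
Proof.
move=> nat_psi; rewrite E_sum.
case: ifPn => [bm|]; last first.
  rewrite -ltnNge => mb; rewrite big_pred0// => y; apply: negbTE.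
  apply/negP => /injectiveP yi; have := max_card (mem (codom y)).
  by rewrite (card_codom yi) card_ord leqNgt mb.
rewrite (eq_bigr (fun=> E (fun g : arr ('I_(m - #|B|) + B)%type => psi _ (finr _ B) g))).
  have -> : (m ^_ #|B| = #|[set y : {ffun B -> 'I_m} | injectiveb y]%SET|)%N.
    by rewrite card_inj_ffuns card_ord.
  by rewrite cardsE mulr_natl sumr_const.
move=> y /injectiveP yi; have [b [bb by_]] := extend_inj yi.
have -> : y = [ffun i => b (finr _ B i)].
  by apply/ffunP => i; rewrite !ffunE -by_.
rewrite -(E_pull (fun g => psi _ (finr 'I_(m - #|B|) B) g) (bij_inj bb)).
by apply: E_eq => g; rewrite nat_psi.
Qed.

End Expectation.

Section PolyBounded.
Context {R : realType}.

(** Uniformity in g makes the expectation over the array a [pb] sequence, so each linearity or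
    comparison step under [EE] reduces to a growth check. *)
Definition pbu (X : nat -> finType) (K : forall m, arr (X m) -> R) :=
  exists C : R, exists q : nat, 0 <= C /\ forall m g, `|K m g| <= C * m.+1%:R ^+ q.

Variable X : nat -> finType.
Implicit Types K H : forall m, arr (X m) -> R.

Lemma pbu_le K H : (forall m g, `|K m g| <= `|H m g|) -> pbu H -> pbu K.
Proof. by move=> KH [C [q [C0 HC]]]; exists C, q; split=> // m g; apply: le_trans (HC m g). Qed.

Lemma pbu_cst (c : R) : pbu (fun m (_ : arr (X m)) => c).
Proof. by exists `|c|, 0%N; split=> // m g; rewrite expr0 mulr1. Qed.

Lemma pbu_add K H : pbu K -> pbu H -> pbu (fun m g => K m g + H m g).
Proof.
move=> [C [q [C0 HK]]] [C' [q' [C'0 HH]]].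
exists (C + C'), (q + q')%N; split; first exact: addr_ge0.
move=> m g; have m1 : (1 : R) <= m.+1%:R by rewrite ler1n.
rewrite (le_trans (ler_normD _ _))// mulrDl lerD//.
  by apply: (le_trans (HK m g)); rewrite ler_wpM2l// exprD ler_peMr ?exprn_ge0// exprn_ege1.
by apply: (le_trans (HH m g)); rewrite ler_wpM2l// exprD ler_peMl ?exprn_ge0// exprn_ege1.
Qed.

Lemma pbu_mul K H : pbu K -> pbu H -> pbu (fun m g => K m g * H m g).
Proof.
move=> [C [q [C0 HK]]] [C' [q' [C'0 HH]]].
exists (C * C'), (q + q')%N; split; first exact: mulr_ge0.
by move=> m g; rewrite normrM exprD mulrACA ler_pM.
Qed.

Lemma pbu_opp K : pbu K -> pbu (fun m g => - K m g).
Proof. by apply: pbu_le => m g; rewrite normrN. Qed.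

Lemma pbu_sub K H : pbu K -> pbu H -> pbu (fun m g => K m g - H m g).
Proof. by move=> hK hH; apply: pbu_add => //; exact: pbu_opp. Qed.

Lemma pbu_norm K : pbu K -> pbu (fun m g => `|K m g|).
Proof. by apply: pbu_le => m g; rewrite normr_id. Qed.

Lemma pbu_exp K q : pbu K -> pbu (fun m g => K m g ^+ q).
Proof.
move=> pK; elim: q => [|q IH]; first exact: pbu_cst.
by apply: pbu_le (pbu_mul pK IH) => m g; rewrite exprS.
Qed.

End PolyBounded.

Lemma pbu_pull (R : realType) (X Y : nat -> finType) (K : forall m, arr (X m) -> R)
    (h : forall m, X m -> Y m) :
  pbu K -> pbu (fun m (g : arr (Y m)) => K m (pull (h m) g)).
Proof. by move=> [C [q [C0 HK]]]; exists C, q; split. Qed.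

Section PoissonArray.
Context {R : realType} (L : array_law R) (lam : R) (lam0 : 0 <= lam).
Variable X : nat -> finType.
Implicit Types K H : forall m, arr (X m) -> R.

(* Expectation over the array on a Poisson number of points; with [extX] below,
   finitely many deterministic points are added. *)
Definition EE K : R := PE lam (fun m => E L (K m)).

Lemma pbu_pb K : pbu K -> pb (fun m => E L (K m)).
Proof.
by move=> [C [q [C0 HK]]]; exists C, q => m; exact: E_norm_le.
Qed.

Lemma EE_eq K H : (forall m g, K m g = H m g) -> EE K = EE H.
Proof. by move=> KH; apply: PE_eq => m; apply: E_eq => g. Qed.

Lemma EE_add K H : pbu K -> pbu H -> EE (fun m g => K m g + H m g) = EE K + EE H.
Proof.
move=> pK pH; rewrite /EE -PE_add//; [|exact: pbu_pb..].
by apply: PE_eq => m; rewrite E_add.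
Qed.

Lemma EE_scale c K : pbu K -> EE (fun m g => c * K m g) = c * EE K.
Proof.
move=> pK; rewrite /EE -PE_scale//; last exact: pbu_pb.
by apply: PE_eq => m; rewrite E_scale.
Qed.

Lemma EE_opp K : pbu K -> EE (fun m g => - K m g) = - EE K.
Proof.
move=> pK; rewrite -mulN1r -EE_scale//; apply: EE_eq => m g.
by rewrite mulN1r.
Qed.

Lemma EE_sub K H : pbu K -> pbu H -> EE (fun m g => K m g - H m g) = EE K - EE H.
Proof. by move=> pK pH; rewrite EE_add ?EE_opp//; exact: pbu_opp. Qed.

Lemma EE_cst c : EE (fun m _ => c) = c.
Proof.
rewrite -[RHS](PE_cst c lam0); apply: PE_eq => m; exact: E_cst.
Qed.

Lemma EE_le K H : pbu K -> pbu H -> (forall m g, K m g <= H m g) -> EE K <= EE H.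
Proof.
move=> pK pH KH; apply: PE_le => //; [exact: pbu_pb..|].
by move=> m; exact: E_le.
Qed.

Lemma EE_ge0 K : pbu K -> (forall m g, 0 <= K m g) -> 0 <= EE K.
Proof. by move=> pK K0; rewrite -(EE_cst 0); apply: EE_le => //; exact: pbu_cst. Qed.

Lemma EE_norm_le K H : pbu K -> pbu H -> (forall m g, `|K m g| <= H m g) -> `|EE K| <= EE H.
Proof.
move=> pK pH KH; rewrite ler_norml -EE_opp//.
apply/andP; split; apply: EE_le => //; first exact: pbu_opp.
  by move=> m g; have := KH m g; rewrite ler_norml => /andP[].
by move=> m g; have := KH m g; rewrite ler_norml => /andP[].
Qed.

(** Young's inequality with a free weight t, used in place of Cauchy-Schwarz so that no square root
    of an expectation appears. *)
Lemma EE_AMGM K H (t : R) : 0 < t -> pbu K -> pbu H ->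
  `|EE (fun m g => K m g * H m g)| <=
  (t * EE (fun m g => H m g ^+ 2) + t^-1 * EE (fun m g => K m g ^+ 2)) / 2.
Proof.
move=> t0 pK pH.
have pK2 := pbu_exp 2 pK; have pH2 := pbu_exp 2 pH.
rewrite mulrC -EE_scale// -EE_scale// -EE_add; last 2 first.
- exact: pbu_mul (pbu_cst _ _) pH2.
- exact: pbu_mul (pbu_cst _ _) pK2.
have pT : pbu (fun m g => t * H m g ^+ 2 + t^-1 * K m g ^+ 2).
  by apply: pbu_add; apply: pbu_mul => //; exact: pbu_cst.
rewrite -EE_scale//; apply: EE_norm_le; first exact: pbu_mul.
  by apply: pbu_mul => //; exact: pbu_cst.
move=> m g; set a := K m g; set b := H m g.
have t1 : 0 < t^-1 by rewrite invr_gt0.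
have E1 : t * t^-1 = 1 by rewrite mulfV// gt_eqF.
rewrite normrM -(real_normK (num_real a)) -(real_normK (num_real b)).
set a' := `|a|; set b' := `|b|.
have -> : t * b' ^+ 2 + t^-1 * a' ^+ 2 = t^-1 * (t * b' - a') ^+ 2 + 2 * a' * b' * (t * t^-1).
  by transitivity (t * (t * t^-1) * b' ^+ 2 + t^-1 * a' ^+ 2); [rewrite E1; ring|ring].
rewrite E1 mulr1 mulrDr -[2 * a' * b']mulrA mulKf// lerDr.
by rewrite mulr_ge0// mulr_ge0 ?sqr_ge0// ltW.
Qed.

End PoissonArray.

Definition ordX (m : nat) : finType := 'I_m.
Definition extX (B : finType) (m : nat) : finType := ('I_m + B)%type.

Section Mecke.
Context {R : realType} (L : array_law R) (lam : R) (lam0 : 0 <= lam).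

Lemma EE_pull (X Y : nat -> finType) (K : forall m, arr (X m) -> R)
    (h : forall m, X m -> Y m) : (forall m, injective (h m)) ->
  EE L lam (fun m (g : arr (Y m)) => K m (pull (h m) g)) = EE L lam K.
Proof. by move=> hi; apply: PE_eq => m; exact: E_pull. Qed.

(** Given m, the sum is m^_#|B| times the standard term; [PE_ffact] trades this factor for lam^#|B|
    and a Poisson number of points besides the added ones. *)
Lemma mecke (B : finType) (psi : forall J : finType, {ffun B -> J} -> arr J -> R) :
  natural psi ->
  @pbu R (extX B) (fun m g => psi _ (finr 'I_m B) g) ->
  EE L lam (fun m (g : arr (ordX m)) => \sum_(y : {ffun B -> 'I_m} | injectiveb y) psi _ y g)
  = lam ^+ #|B| * EE L lam (fun m (g : arr (extX B m)) => psi _ (finr 'I_m B) g).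
Proof.
move=> npsi ppsi; rewrite /EE -PE_ffact//; last exact: pbu_pb ppsi.
by apply: PE_eq => m; rewrite mecke_fixed.
Qed.

End Mecke.

(** * Pattern counts and the change made by added points *)

Section Counts.
Context {R : realType} (I : finType) (Phi : arr I -> R).

Definition SS (J : finType) (g : arr J) : R :=
  \sum_(u : {ffun I -> J} | injectiveb u) Phi (pull u g).

Definition meets (I1 I2 J : finType) (y : {ffun I1 -> J}) (z : {ffun I2 -> J}) :=
  [exists i, exists j, y i == z j].

(* The patterns meeting the image of y: the change of [SS] when y is removed. *)
Definition DD (B J : finType) (y : {ffun B -> J}) (g : arr J) : R :=
  \sum_(z : {ffun I -> J} | injectiveb z && meets y z) Phi (pull z g).

(* [EE ZZ] is the variance of [SS]: disjoint patterns are independent. *)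
Definition ZZ (J : finType) (g : arr J) : R :=
  \sum_(y : {ffun I -> J} | injectiveb y) Phi (pull y g) * DD y g.

Lemma reindex_bij (J J' : finType) (b : J -> J') (P : pred {ffun I -> J'}) (F : {ffun I -> J'} -> R) :
  bijective b ->
  \sum_(u | P u) F u = \sum_(u : {ffun I -> J} | P [ffun i => b (u i)]) F [ffun i => b (u i)].
Proof.
case=> c bc cb; rewrite (reindex (fun u : {ffun I -> J} => [ffun i => b (u i)]))//.
exists (fun u : {ffun I -> J'} => [ffun i => c (u i)]) => u _; apply/ffunP => i;
  by rewrite !ffunE.
Qed.

Lemma injectiveb_comp (I' J J' : finType) (b : J -> J') (u : {ffun I' -> J}) : injective b ->
  injectiveb [ffun i => b (u i)] = injectiveb u.
Proof.
move=> bi; apply/injectiveP/injectiveP => H i j.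
  by move=> uij; apply: H; rewrite !ffunE uij.
by rewrite !ffunE => /bi /H.
Qed.

Lemma meets_comp (I1 I2 J J' : finType) (b : J -> J') (y : {ffun I1 -> J}) (z : {ffun I2 -> J}) :
  injective b -> meets [ffun i => b (y i)] [ffun i => b (z i)] = meets y z.
Proof.
move=> bi; apply/existsP/existsP => -[i /existsP[j /eqP]].
  by rewrite !ffunE => /bi e; exists i; apply/existsP; exists j; rewrite e.
by move=> e; exists i; apply/existsP; exists j; rewrite !ffunE e.
Qed.

Lemma pull_ffun (I' J J' : finType) (b : J -> J') (u : {ffun I' -> J}) (g : arr J') :
  pull [ffun i => b (u i)] g = pull u (pull b g).
Proof. by apply/ffunP => -[i j]; rewrite !ffunE. Qed.

Lemma SS_bij (J J' : finType) (b : J -> J') (g : arr J') :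
  bijective b -> SS g = SS (pull b g).
Proof.
move=> bb; rewrite /SS (reindex_bij _ _ bb).
apply: eq_big => [u|u _]; first by rewrite injectiveb_comp//; exact: bij_inj.
by rewrite pull_ffun.
Qed.

Lemma DD_bij (B J J' : finType) (b : J -> J') (y : {ffun B -> J}) (g : arr J') :
  bijective b -> DD [ffun i => b (y i)] g = DD y (pull b g).
Proof.
move=> bb; rewrite /DD (reindex_bij _ _ bb).
have bi := bij_inj bb.
apply: eq_big => [u|u _]; first by rewrite injectiveb_comp// meets_comp.
by rewrite pull_ffun.
Qed.

(** A pattern that avoids B takes all its values in [inl], hence is a pattern of the old points; the
    others form [DD]. With B the fresh points, adding them raises the count by [DD]. *)
Lemma SS_split (A B : finType) (g : arr (A + B)%type) :
  SS g = SS (pull inl g) + DD (finr A B) g.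
Proof.
rewrite /SS (bigID (meets (finr A B)))/= addrC; congr (_ + _).
pose h (u : {ffun I -> A}) : {ffun I -> (A + B)%type} := [ffun i => inl (u i)].
have hi : injective h.
  move=> u v /ffunP uv; apply/ffunP => i; have := uv i.
  by rewrite !ffunE => -[].
transitivity (\sum_(u in h @: [set u : {ffun I -> A} | injectiveb u]%SET) Phi (pull u g)).
  apply: eq_bigl => z; apply/andP/imsetP => [[zi nz]|[u]].
    have : forall i, exists a, z i = inl a.
      move=> i; case E : (z i) => [a|b]; first by exists a.
      move/negP: nz; case; apply/existsP; exists b; apply/existsP; exists i.
      by rewrite ffunE E.
    move=> /fin_all_exists[u Hu].
    have zE : z = h (finfun u) by apply/ffunP => i; rewrite !ffunE Hu.
    exists (finfun u) => //; rewrite inE.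
    by move: zi; rewrite zE /h injectiveb_comp//; exact: inl_inj.
  rewrite inE => ui ->; split; first by rewrite /h injectiveb_comp//; exact: inl_inj.
  by apply/negP => /existsP[i /existsP[j]]; rewrite !ffunE.
rewrite big_imset/=; last by move=> u v _ _; exact: hi.
by apply: eq_big => [u|u _]; rewrite ?inE// /h pull_ffun.
Qed.

Hypothesis Phi01 : forall a, 0 <= Phi a <= 1.

Lemma DD_ge0 (B J : finType) (y : {ffun B -> J}) (g : arr J) : 0 <= DD y g.
Proof. by apply: sumr_ge0 => u _; case/andP: (Phi01 (pull u g)). Qed.

Lemma sum_le_card (J : finType) (P : pred {ffun I -> J}) (F : {ffun I -> J} -> R) c :
  0 <= c -> (forall u, `|F u| <= c) -> `|\sum_(u | P u) F u| <= c * #|J|%:R ^+ #|I|.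
Proof.
move=> c0 H; apply: le_trans (ler_norm_sum _ _ _) _.
apply: (@le_trans _ _ (\sum_(u : {ffun I -> J}) c)).
  by rewrite [X in X <= _]big_mkcond; apply: ler_sum => u _; case: ifP.
by rewrite sumr_const card_ffun -[c *+ _]mulr_natr natrX.
Qed.

Lemma Phi_norm a : `|Phi a| <= 1.
Proof. by have /andP[h1 h2] := Phi01 a; rewrite ger0_norm. Qed.

Definition pbX (X : nat -> finType) := exists c : nat, forall m, (#|X m| <= m + c)%N.

Lemma pbX_pow (X : nat -> finType) q : pbX X ->
  @pbu R X (fun m _ => #|X m|%:R ^+ q).
Proof.
move=> [c Hc]; apply: pbu_exp; exists c.+1%:R, 1%N; split=> // m _.
rewrite ger0_norm// expr1 -natrM ler_nat.
have := Hc m; nia.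
Qed.

Lemma pbu_SS (X : nat -> finType) : pbX X -> @pbu R X (fun m g => SS g).
Proof.
move=> pX; apply: pbu_le (pbX_pow #|I| pX) => m g.
rewrite [X in _ <= X]ger0_norm ?exprn_ge0// -[X in _ <= X]mul1r.
by apply: sum_le_card => // u; exact: Phi_norm.
Qed.

Lemma pbu_DD (B : finType) (X : nat -> finType) (y : forall m, {ffun B -> X m}) :
  pbX X -> @pbu R X (fun m g => DD (y m) g).
Proof.
move=> pX; apply: pbu_le (pbX_pow #|I| pX) => m g.
rewrite [X in _ <= X]ger0_norm ?exprn_ge0// -[X in _ <= X]mul1r.
by apply: sum_le_card => // u; exact: Phi_norm.
Qed.

Lemma pbu_ZZ (X : nat -> finType) : pbX X -> @pbu R X (fun m g => ZZ g).
Proof.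
move=> pX; apply: pbu_le (pbX_pow (#|I| + #|I|) pX) => m g.
rewrite [X in _ <= X]ger0_norm ?exprn_ge0// exprD.
apply: sum_le_card; first exact: exprn_ge0.
move=> u; rewrite normrM -[X in _ <= X]mul1r ler_pM//; first exact: Phi_norm.
rewrite -[X in _ <= X]mul1r; apply: sum_le_card => // v; exact: Phi_norm.
Qed.

Lemma pbu_Phi (X : nat -> finType) (y : forall m, I -> X m) :
  @pbu R X (fun m g => Phi (pull (y m) g)).
Proof.
apply: pbu_le (pbu_cst _ 1) => m g; rewrite [X in _ <= X]ger0_norm//.
exact: Phi_norm.
Qed.

End Counts.

Lemma pbX_ord : pbX ordX.
Proof. by exists 0%N => m; rewrite card_ord addn0. Qed.

Lemma pbX_ext (B : finType) : pbX (extX B).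
Proof. by exists #|B| => m; rewrite card_sum card_ord. Qed.

(** * Averaging over replicas of the fresh points *)

Section Replicas.
Context {R : realType} (L : array_law R) (I : finType).

Definition inj_r (A : finType) (N : nat) (r : 'I_N) (x : (A + I)%type) :
    (A + ('I_N * I))%type :=
  match x with inl a => inl a | inr i => inr (r, i) end.

Definition inj_rs (A : finType) (N : nat) (r s : 'I_N) (x : (A + (I + I))%type) :
    (A + ('I_N * I))%type :=
  match x with inl a => inl a | inr (inl i) => inr (r, i) | inr (inr i) => inr (s, i) end.

Definition inj_1 (A : finType) (x : (A + I)%type) : (A + (I + I))%type :=
  match x with inl a => inl a | inr i => inr (inl i) end.
Definition inj_2 (A : finType) (x : (A + I)%type) : (A + (I + I))%type :=
  match x with inl a => inl a | inr i => inr (inr i) end.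

Lemma inj_r_inj A N r : injective (@inj_r A N r).
Proof. by move=> [a|i] [b|j] //= [->]. Qed.

Lemma inj_1_inj A : injective (@inj_1 A).
Proof. by move=> [a|i] [b|j] //= [->]. Qed.

Lemma inj_2_inj A : injective (@inj_2 A).
Proof. by move=> [a|i] [b|j] //= [->]. Qed.

Lemma inj_rs_inj A N r s : r != s -> injective (@inj_rs A N r s).
Proof.
move=> rs [a|[i|i]] [b|[j|j]] //=; [by move=> [->]|by move=> [->]| | |by move=> [->]].
- by move=> [E _]; rewrite E eqxx in rs.
- by move=> [E _]; rewrite E eqxx in rs.
Qed.

(* Averaging over N exchangeable copies of the fresh points replaces Q by a proxy
   of its conditional expectation given the array on A. *)
Lemma replica (A : finType) (Q : arr (A + I)%type -> R) (w : arr A -> R) (N : nat) (t : R) :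
  (0 < N)%N -> 0 < t ->
  E L (fun g => (Q g - 1) * w (pull inl g)) <=
  t / 2 * E L (fun g => w g ^+ 2) +
  t^-1 / 2 * (N%:R^-1 * E L (fun g => Q g ^+ 2) +
    (1 - N%:R^-1) * E L (fun g => Q (pull (@inj_1 A) g) * Q (pull (@inj_2 A) g))
    - 2 * E L Q + 1).
Proof.
move=> N0 t0; have Nn0 : N%:R != 0 :> R by rewrite pnatr_eq0 -lt0n.
pose av (g : arr (A + ('I_N * I))%type) := N%:R^-1 * \sum_r Q (pull (@inj_r A N r) g).
(* [w] sees only A, and each copy has the same law jointly with A, so Q may be replaced by its
   average over the N copies. *)
have E1 : E L (fun g => (Q g - 1) * w (pull inl g)) =
    E L (fun g => (av g - 1) * w (pull inl g)).
  rewrite (E_eq _ (h := fun g => N%:R^-1 * \sum_r ((Q (pull (@inj_r A N r) g) - 1)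
      * w (pull inl (pull (@inj_r A N r) g))))); last first.
    move=> g; rewrite /av.
    under [in RHS]eq_bigr => r _.
      rewrite pull_comp -[inj_r r \o inl]/inl; over.
    rewrite -big_distrl /= sumrB sumr_const card_ord mulrA mulrBr.
    by rewrite -[1 *+ N]mulr_natr mul1r mulVf.
  rewrite E_scale E_sum (eq_bigr (fun=> E L (fun g => (Q g - 1) * w (pull inl g)))).
    by rewrite sumr_const card_ord -[E L _ *+ N]mulr_natr mulrCA mulVf// mulr1.
  move=> r _; exact: (E_pull L (fun g => (Q g - 1) * w (pull inl g)) (@inj_r_inj A N r)).
have E2 : E L (fun g => (av g - 1) ^+ 2) =
    N%:R^-1 * E L (fun g => Q g ^+ 2) +
    (1 - N%:R^-1) * E L (fun g => Q (pull (@inj_1 A) g) * Q (pull (@inj_2 A) g))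
    - 2 * E L Q + 1.
  have -> : E L (fun g => (av g - 1) ^+ 2) =
      E L (fun g => av g ^+ 2) - 2 * E L av + 1.
    rewrite (E_eq _ (h := fun g => (av g ^+ 2 - 2 * av g) + 1)); last by move=> g; ring.
    by rewrite E_add E_sub E_scale E_cst.
  congr (_ - 2 * _ + 1); last first.
    rewrite /av E_scale E_sum (eq_bigr (fun=> E L Q)).
      by rewrite sumr_const card_ord -[E L _ *+ N]mulr_natr mulrCA mulVf// mulr1.
    by move=> r _; exact: E_pull (@inj_r_inj A N r).
  pose q2 := E L (fun g => Q g ^+ 2).
  pose q11 := E L (fun g => Q (pull (@inj_1 A) g) * Q (pull (@inj_2 A) g)).
  (* Of the N^2 pairs of copies, N are diagonal and the others all have the law of two distinct
     copies. *)
  transitivity (N%:R^-1 ^+ 2 * \sum_(r < N) \sum_(s < N) (if s == r then q2 else q11)).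
    have -> : E L (fun g => av g ^+ 2) = E L (fun g => N%:R^-1 ^+ 2 *
       \sum_(r < N) \sum_(s < N) Q (pull (@inj_r A N r) g) * Q (pull (@inj_r A N s) g)).
      apply: E_eq => g; rewrite /av exprMn; congr (_ * _).
      by rewrite expr2 big_distrlr.
    rewrite E_scale E_sum; congr (_ * _); apply: eq_bigr => r _.
    rewrite E_sum; apply: eq_bigr => s _; case: eqVneq => [->|rs].
      exact: (E_pull L (fun g => Q g ^+ 2) (@inj_r_inj A N r)).
    have sr : r != s by rewrite eq_sym.
    rewrite -[q11](E_pull _ _ (inj_rs_inj sr)).
    apply: E_eq => g; rewrite !pull_comp; congr (Q _ * Q _);
      by apply: eq_pull => -[a|i].
  rewrite (eq_bigr (fun=> q2 + N.-1%:R * q11)); last first.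
    move=> r _; rewrite (bigD1 r)//= eqxx; congr (_ + _).
    rewrite (eq_bigr (fun=> q11)); last by move=> s /negPf ->.
    rewrite sumr_const mulr_natl; congr (_ *+ _).
    by rewrite cardC1 card_ord.
  rewrite sumr_const card_ord -[(_ + _) *+ N]mulr_natr.
  have -> : N.-1%:R = N%:R - 1 :> R by rewrite -[in RHS](prednK N0) -natr1 addrK.
  by rewrite -/q2 -/q11; field.
rewrite E1 -E2.
apply: (@le_trans _ _ (E L (fun g => t / 2 * w (pull inl g) ^+ 2 + t^-1 / 2 * (av g - 1) ^+ 2))).
  apply: E_le => g; set a := av g - 1; set b := w _.
  have h : t * t^-1 = 1 by rewrite mulfV// gt_eqF.
  have -> : t / 2 * b ^+ 2 + t^-1 / 2 * a ^+ 2 = t^-1 / 2 * (t * b - a) ^+ 2 + a * b * (t * t^-1).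
    by transitivity (t * (t * t^-1) / 2 * b ^+ 2 + t^-1 / 2 * a ^+ 2);
      [rewrite h; ring|field; rewrite gt_eqF].
  by rewrite h mulr1 lerDr mulr_ge0 ?sqr_ge0// divr_ge0// invr_ge0 ltW.
rewrite E_add !E_scale lerD2r.
rewrite (E_pull L (fun g => w g ^+ 2))//; exact: inl_inj.
Qed.

End Replicas.

Lemma ler_sum_inj (R : numDomainType) (K K' : finType) (h : K -> K')
    (P : pred K) (P' : pred K') (F : K' -> R) :
  injective h -> (forall k, P k -> P' (h k)) -> (forall k, P' k -> 0 <= F k) ->
  \sum_(k | P k) F (h k) <= \sum_(k | P' k) F k.
Proof.
move=> hi PP' F0.
have -> : \sum_(k | P k) F (h k) = \sum_(k' in h @: [set k | P k]%SET) F k'.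
  rewrite big_imset/=; last by move=> u v _ _; exact: hi.
  by apply: eq_bigl => k; rewrite inE.
rewrite [leRHS](bigID (mem (h @: [set k | P k]%SET)))/= -[leLHS]addr0 lerD//.
  rewrite le_eqVlt; apply/orP; left; apply/eqP/eq_bigl => k.
  apply/idP/andP => [H|[]//]; split => //; case/imsetP: H => k'.
  by rewrite inE => /PP' H ->.
by apply: sumr_ge0 => k /andP[/F0].
Qed.

(** * Stein bound for pattern counts *)

Section SizeBias.
Context {R : realType} (L : array_law R) (lam : R) (lam0 : 0 <= lam).
Context (I : finType) (Phi : arr I -> R).
Hypothesis Phi01 : forall a, 0 <= Phi a <= 1.

Definition lingrowth (h : R -> R) := exists C : R, 0 <= C /\ forall x, `|h x| <= C * (1 + `|x|).

Lemma pbu_lin (X : nat -> finType) (K : forall m, arr (X m) -> R) h :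
  lingrowth h -> pbu K -> pbu (fun m g => h (K m g)).
Proof.
move=> [C [C0 H]] pK.
apply: pbu_le (pbu_mul (pbu_cst _ C) (pbu_add (pbu_cst _ 1) (pbu_norm pK))) => m g.
apply: (le_trans (H _)).
by rewrite [leRHS]ger0_norm// mulr_ge0// addr_ge0.
Qed.

Let X := extX I.
Unset Implicit Arguments.
(** [P] weighs the fresh points as a pattern, [A] is the count without them and [D] what they add:
    the count with them is [A + D], and [A] is independent of [P]. *)
Let S m (g : arr (ordX m)) := SS Phi g.
Let P m (g : arr (X m)) := Phi (pull (finr 'I_m I) g).
Let A m (g : arr (X m)) := SS Phi (pull (inl : 'I_m -> X m) g).
Let D m (g : arr (X m)) := DD Phi (finr 'I_m I) g.

Set Implicit Arguments.

Let pS : pbu S. Proof. by apply: pbu_SS => //; exact: pbX_ord. Qed.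
Let pP : pbu P. Proof. exact: pbu_Phi. Qed.
Let pA : pbu A. Proof. exact: (pbu_pull (Y := X) (fun m => (inl : 'I_m -> X m)) pS). Qed.
Let pD : pbu D. Proof. by apply: pbu_DD => //; exact: pbX_ext. Qed.

Lemma finr_inj (A' B : finType) : injective (finr A' B).
Proof. by move=> i j; rewrite !ffunE => -[]. Qed.

Lemma mean_SS : EE L lam S = lam ^+ #|I| * E L Phi.
Proof.
rewrite (mecke L lam0 (psi := fun J y g => Phi (pull y g))) => //.
  congr (_ * _); rewrite -[RHS](PE_cst _ lam0); apply: PE_eq => m.
  exact: E_pull (@finr_inj _ _).
by move=> J J' b y g _; rewrite pull_ffun.
Qed.

Lemma bias_SS h : lingrowth h ->
  EE L lam (fun m g => S m g * h (S m g)) =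
  lam ^+ #|I| * EE L lam (fun m g => P m g * h (A m g + D m g)).
Proof.
move=> hl.
transitivity (EE L lam (fun m (g : arr (ordX m)) =>
   \sum_(y : {ffun I -> 'I_m} | injectiveb y) Phi (pull y g) * h (SS Phi g))).
  by apply: EE_eq => m g; rewrite /S -big_distrl.
rewrite (mecke L lam0 (psi := fun J y g => Phi (pull y g) * h (SS Phi g))).
- congr (_ * _); apply: EE_eq => m g; by rewrite SS_split.
- move=> J J' b y g bb; rewrite pull_ffun; congr (_ * h _); exact: SS_bij.
- apply: pbu_mul => //; apply: pbu_lin => //.
  by apply: pbu_le (pbu_add pA pD) => m g; rewrite SS_split.
Qed.

Lemma indep_SS h : lingrowth h ->
  EE L lam (fun m g => P m g * h (A m g)) = E L Phi * EE L lam (fun m g => h (S m g)).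
Proof.
move=> hl; have ph := pbu_lin hl pS.
rewrite -PE_scale//; last exact: pbu_pb.
apply: PE_eq => m; rewrite mulrC -E_dissoc; apply: E_eq => g.
by rewrite mulrC; congr (_ * Phi _); apply: eq_pull => i; rewrite ffunE.
Qed.

Let sbar := EE L lam S.
Let sig2 := EE L lam (fun m g => S m g ^+ 2) - sbar ^+ 2.

(** Mecke's formula turns E[S h(S)] into the term with h(A + D). Since E S is lam^#|I| times the
    mean of Phi and [A] is independent of [P], the centring E S E[h(S)] is the same integral with
    h(A). *)
Lemma size_bias h : lingrowth h ->
  EE L lam (fun m g => (S m g - sbar) * h (S m g)) =
  lam ^+ #|I| * EE L lam (fun m g => P m g * (h (A m g + D m g) - h (A m g))).
Proof.
move=> hl; have ph := pbu_lin hl pS.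
transitivity (EE L lam (fun m g => S m g * h (S m g)) - sbar * EE L lam (fun m g => h (S m g))).
  rewrite -EE_scale// -EE_sub//; first by apply: EE_eq => m g; rewrite mulrBl.
    exact: pbu_mul.
  by apply: pbu_mul => //; exact: pbu_cst.
rewrite bias_SS// /sbar mean_SS -mulrA -indep_SS// -mulrBr; congr (_ * _).
rewrite -EE_sub//; first by apply: EE_eq => m g; rewrite mulrBr.
  by apply: pbu_mul => //; apply: pbu_lin => //; exact: pbu_add.
by apply: pbu_mul => //; apply: pbu_lin.
Qed.

(** Mecke's formula with summands weighted by [DD]. It is used from right to left: the factor
    [P * D] produced by expanding [size_bias] is traded back for [ZZ] on the original
    configuration. *)
Lemma bias_ZZ h : lingrowth h ->
  EE L lam (fun m (g : arr (ordX m)) => ZZ Phi g * h (S m g)) =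
  lam ^+ #|I| * EE L lam (fun m g => P m g * D m g * h (A m g + D m g)).
Proof.
move=> hl.
transitivity (EE L lam (fun m (g : arr (ordX m)) =>
   \sum_(y : {ffun I -> 'I_m} | injectiveb y) Phi (pull y g) * DD Phi y g * h (SS Phi g))).
  by apply: EE_eq => m g; rewrite /S /ZZ big_distrl.
rewrite (mecke L lam0 (psi := fun J y g => Phi (pull y g) * DD Phi y g * h (SS Phi g))).
- congr (_ * _); apply: EE_eq => m g; by rewrite SS_split.
- move=> J J' b y g bb; rewrite pull_ffun -DD_bij//; congr (_ * _ * h _); exact: SS_bij.
- apply: pbu_mul; first exact: pbu_mul.
  apply: pbu_lin => //.
  by apply: pbu_le (pbu_add pA pD) => m g; rewrite SS_split.
Qed.

Lemma lingrowth_id : lingrowth id.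
Proof. by exists 1; split=> // x; rewrite mul1r lerDr. Qed.

Lemma lingrowth_cst c : lingrowth (fun=> c).
Proof. by exists `|c|; split=> // x; rewrite ler_peMr// lerDl. Qed.

Lemma mean_PD : lam ^+ #|I| * EE L lam (fun m g => P m g * D m g) = EE L lam (fun m (g : arr (ordX m)) => ZZ Phi g).
Proof.
have := bias_ZZ (lingrowth_cst 1).
rewrite (EE_eq _ _ (H := fun m (g : arr (ordX m)) => ZZ Phi g)); last by move=> m g; rewrite mulr1.
by move=> ->; congr (_ * _); apply: EE_eq => m g; rewrite mulr1.
Qed.

(** [size_bias] for the identity expresses the variance through the mean of [P * D], which [mean_PD]
    identifies. *)
Lemma variance_ZZ : sig2 = EE L lam (fun m (g : arr (ordX m)) => ZZ Phi g).
Proof.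
have p2 := pbu_exp 2 pS.
have ps : pbu (fun m g => sbar * S m g) by apply: pbu_mul => //; exact: pbu_cst.
rewrite -mean_PD.
have -> : EE L lam (fun m g => P m g * D m g) =
  EE L lam (fun m g => P m g * (id (A m g + D m g) - id (A m g))).
  by apply: EE_eq => m g; rewrite /=; ring.
rewrite -(size_bias lingrowth_id).
rewrite (EE_eq _ _ (K := fun m g => (S m g - sbar) * id (S m g)) (H := fun m g => S m g ^+ 2 - sbar * S m g)).
  by rewrite EE_sub// EE_scale// -/sbar /sig2 expr2.
by move=> m g /=; ring.
Qed.

Unset Implicit Arguments.
Let PD m g := P m g * D m g.
Set Implicit Arguments.
Let pPD : pbu PD. Proof. exact: pbu_mul. Qed.

Lemma DD_pull_le (B J J' : finType) (b : J -> J') (y : {ffun B -> J}) (g : arr J') :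
  injective b -> DD Phi y (pull b g) <= DD Phi [ffun i => b (y i)] g.
Proof.
move=> bi; rewrite /DD.
under eq_bigr do rewrite -pull_ffun.
apply: (@ler_sum_inj _ _ _ (fun u : {ffun I -> J} => [ffun i => b (u i)]) _ _ (fun z => Phi (pull z g))).
- move=> u v /ffunP uv; apply/ffunP => i; have := uv i; rewrite !ffunE; exact: bi.
- by move=> u; rewrite injectiveb_comp// meets_comp.
- by move=> z _; case/andP: (Phi01 (pull z g)).
Qed.

Let yl (J : finType) (y : {ffun (I + I)%type -> J}) : {ffun I -> J} := [ffun i => y (inl i)].
Let yr (J : finType) (y : {ffun (I + I)%type -> J}) : {ffun I -> J} := [ffun i => y (inr i)].

(** Mecke's formula for two disjoint fresh patterns at once. In Z^2 the pairs of disjoint patterns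
    are only part of a non-negative double sum, and computing each increment without the points of
    the other pattern only lowers it; both losses go in the right direction. *)
Lemma second_moment_PD :
  (lam ^+ #|I|) ^+ 2 * EE L lam (fun m (g : arr (extX (I + I)%type m)) =>
     PD m (pull (@inj_1 I 'I_m) g) * PD m (pull (@inj_2 I 'I_m) g)) <=
  EE L lam (fun m (g : arr (ordX m)) => ZZ Phi g ^+ 2).
Proof.
pose psi (J : finType) (y : {ffun (I + I)%type -> J}) (g : arr J) : R :=
  (Phi (pull (yl y) g) * DD Phi (yl y) g) * (Phi (pull (yr y) g) * DD Phi (yr y) g).
have Phi0 a : 0 <= Phi a by case/andP: (Phi01 a).
have D0 (B J : finType) (y : {ffun B -> J}) g : 0 <= DD Phi y g by apply: DD_ge0.
have npsi : natural psi.
  move=> J J' b y g bb; rewrite /psi.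
  have -> : yl [ffun i => b (y i)] = [ffun i => b (yl y i)].
    by apply/ffunP => i; rewrite !ffunE.
  have -> : yr [ffun i => b (y i)] = [ffun i => b (yr y i)].
    by apply/ffunP => i; rewrite !ffunE.
  by rewrite !pull_ffun -!DD_bij.
have ppsi : @pbu R (extX (I + I)%type) (fun m g => psi _ (finr 'I_m (I + I)%type) g).
  by apply: pbu_mul; apply: pbu_mul; (apply: pbu_Phi => //) || (apply: pbu_DD => //; exact: pbX_ext).
have pZ : @pbu R ordX (fun m g => ZZ Phi g ^+ 2).
  by apply: pbu_exp; apply: pbu_ZZ => //; exact: pbX_ord.
have sumle m (g : arr (ordX m)) :
    0 <= \sum_(y : {ffun (I + I)%type -> 'I_m} | injectiveb y) psi _ y g <= ZZ Phi g ^+ 2.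
  apply/andP; split.
    by apply: sumr_ge0 => y _; rewrite /psi !mulr_ge0.
  rewrite /ZZ expr2 big_distrlr /= pair_big /=.
  apply: (@ler_sum_inj _ _ _ (fun y : {ffun (I + I)%type -> 'I_m} => (yl y, yr y)) _ _
     (fun p => Phi (pull p.1 g) * DD Phi p.1 g * (Phi (pull p.2 g) * DD Phi p.2 g))).
  - move=> u v [/ffunP e1 /ffunP e2]; apply/ffunP => -[i|i].
      by have := e1 i; rewrite !ffunE.
    by have := e2 i; rewrite !ffunE.
  - move=> y /injectiveP yi /=; apply/andP; split; apply/injectiveP => i j.
      by rewrite !ffunE => /yi [].
    by rewrite !ffunE => /yi [].
  - by move=> p _; rewrite !mulr_ge0.
apply: (@le_trans _ _ (EE L lam (fun m (g : arr (ordX m)) =>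
    \sum_(y : {ffun (I + I)%type -> 'I_m} | injectiveb y) psi _ y g))); last first.
  apply: EE_le => //; last by move=> m g; case/andP: (sumle m g).
  apply: pbu_le pZ => m g; have /andP[h1 h2] := sumle m g.
  by rewrite !ger0_norm// sqr_ge0.
rewrite (mecke L lam0 npsi)// card_sum exprD -expr2.
rewrite ler_wpM2l// ?sqr_ge0//; apply: EE_le => //.
  apply: pbu_mul.
    exact: (pbu_pull (Y := extX (I + I)%type) (fun m => (@inj_1 I 'I_m : X m -> _)) pPD).
  exact: (pbu_pull (Y := extX (I + I)%type) (fun m => (@inj_2 I 'I_m : X m -> _)) pPD).
move=> m g; rewrite /psi /PD /P /D.
have e1 : yl (finr 'I_m (I + I)%type) = [ffun i => inj_1 (finr 'I_m I i)].
  by apply/ffunP => i; rewrite !ffunE.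
have e2 : yr (finr 'I_m (I + I)%type) = [ffun i => inj_2 (finr 'I_m I i)].
  by apply/ffunP => i; rewrite !ffunE.
rewrite e1 e2 !pull_ffun ler_pM//; [exact: mulr_ge0|exact: mulr_ge0| |].
  by rewrite ler_wpM2l// DD_pull_le//; exact: inj_1_inj.
by rewrite ler_wpM2l// DD_pull_le//; exact: inj_2_inj.
Qed.

Hypothesis sig2_gt0 : 0 < sig2.
Variable del : R.
Hypothesis del_gt0 : 0 < del.
Hypothesis ZZ2_le : EE L lam (fun m (g : arr (ordX m)) => ZZ Phi g ^+ 2) <= sig2 ^+ 2 * (1 + del ^+ 2).

(** The normalisation that gives [Q] mean 1. Two replicas of [Q] then have mixed moment at most 1 +
    del^2, which stands for a variance at most del^2 of the conditional mean of [Q] given the old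
    points. *)
Let c0 := lam ^+ #|I| / sig2.
Unset Implicit Arguments.
Let Q m g := c0 * PD m g.
Set Implicit Arguments.
Let pQ : pbu Q. Proof. by apply: pbu_mul => //; exact: pbu_cst. Qed.

Let EEQ : EE L lam Q = 1.
Proof.
rewrite EE_scale// /c0 mulrAC mean_PD -variance_ZZ divff//.
by rewrite gt_eqF.
Qed.

Let EEQQ : EE L lam (fun m (g : arr (extX (I + I)%type m)) =>
     Q m (pull (@inj_1 I 'I_m) g) * Q m (pull (@inj_2 I 'I_m) g)) <= 1 + del ^+ 2.
Proof.
have p12 : @pbu R (extX (I + I)%type) (fun m g => PD m (pull (@inj_1 I 'I_m) g) * PD m (pull (@inj_2 I 'I_m) g)).
  apply: pbu_mul.
    exact: (pbu_pull (Y := extX (I + I)%type) (fun m => (@inj_1 I 'I_m : X m -> _)) pPD).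
  exact: (pbu_pull (Y := extX (I + I)%type) (fun m => (@inj_2 I 'I_m : X m -> _)) pPD).
rewrite (EE_eq _ _ (H := fun m g => c0 ^+ 2 *
  (PD m (pull (@inj_1 I 'I_m) g) * PD m (pull (@inj_2 I 'I_m) g)))); last first.
  by move=> m g; rewrite /Q; ring.
rewrite EE_scale// /c0 exprMn exprVn mulrAC ler_pdivrMr ?exprn_gt0//.
by rewrite [leRHS]mulrC; exact: le_trans second_moment_PD ZZ2_le.
Qed.

(** [replica] at each m, integrated over m. With N copies the bracket is at most del^2 + (1 + del^2)
    - 2 + 1 = 2 del^2, and the weight t = del turns it into the summand del. *)
Let conc_le w : lingrowth w ->
  EE L lam (fun m (g : arr (X m)) => (Q m g - 1) * w (A m g)) <=
  del / 2 * EE L lam (fun m (g : arr (ordX m)) => w (S m g) ^+ 2) + del.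
Proof.
move=> wl.
have pw : pbu (fun m g => w (S m g)) by apply: pbu_lin.
have pwA : pbu (fun m g => w (A m g)) by apply: pbu_lin.
have pw2 := pbu_exp 2 pw; have pQ2 := pbu_exp 2 pQ.
have p12 : @pbu R (extX (I + I)%type) (fun m g => Q m (pull (@inj_1 I 'I_m) g) * Q m (pull (@inj_2 I 'I_m) g)).
  apply: pbu_mul.
    exact: (pbu_pull (Y := extX (I + I)%type) (fun m => (@inj_1 I 'I_m : X m -> _)) pQ).
  exact: (pbu_pull (Y := extX (I + I)%type) (fun m => (@inj_2 I 'I_m : X m -> _)) pQ).
set c := EE L lam (fun m g => Q m g ^+ 2).
have c_ge0 : 0 <= c by apply: EE_ge0 => // m g; exact: sqr_ge0.
(* N only has to beat the plain second moment of [Q], which is finite but not controlled; it drops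
   out of the result. *)
pose N := (Num.bound (c / del ^+ 2)).+1.
have Nc : N%:R^-1 * c <= del ^+ 2.
  rewrite mulrC ler_pdivrMr ?ltr0n// -ler_pdivrMl ?exprn_gt0// mulrC.
  have := archi_boundP (divr_ge0 c_ge0 (sqr_ge0 del)) => /ltW/le_trans; apply.
  by rewrite ler_nat.
have EEQQ' := EEQQ.
set q11 := EE L lam (fun m (g : arr (extX (I + I)%type m)) =>
     Q m (pull (@inj_1 I 'I_m) g) * Q m (pull (@inj_2 I 'I_m) g)) in EEQQ' *.
have N1 : 0 <= (N%:R^-1 : R) <= 1 by rewrite invr_ge0 ler0n invf_le1 ?ltr0n// ler1n.
apply: (@le_trans _ _ (del / 2 * EE L lam (fun m (g : arr (ordX m)) => w (S m g) ^+ 2) +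
  del^-1 / 2 * (N%:R^-1 * c + (1 - N%:R^-1) * q11 - 2 * EE L lam Q + 1))).
  rewrite /c /q11 /EE.
  have pb1 := pbu_pb L pw2. have pb2 := pbu_pb L pQ2.
  have pb3 := pbu_pb L p12. have pb4 := pbu_pb L pQ.
  rewrite -[X in _ <= _ + _ * (_ + X)](PE_cst 1 lam0).
  have pbc (x : R) := @pb_cst R x.
  rewrite -!PE_scale// -PE_add//; last 2 first.
  - exact: pb_scale.
  - exact: pb_scale.
  rewrite -PE_sub//; last 2 first.
  - by apply: pb_add; exact: pb_scale.
  - exact: pb_scale.
  rewrite -PE_add//; last first.
    by apply: pb_sub; [apply: pb_add; exact: pb_scale|exact: pb_scale].
  rewrite -PE_scale//; last first.
    by apply: pb_add => //; apply: pb_sub; [apply: pb_add; exact: pb_scale|exact: pb_scale].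
  rewrite -PE_add//; last 2 first.
  - exact: pb_scale.
  - apply: pb_scale; apply: pb_add => //.
    by apply: pb_sub; [apply: pb_add; exact: pb_scale|exact: pb_scale].
  apply: PE_le => //.
  - apply: (@pbu_pb _ _ X (fun m g => (Q m g - 1) * w (A m g))).
    by apply: pbu_mul => //; apply: pbu_sub => //; exact: pbu_cst.
  - apply: pb_add; first exact: pb_scale.
    apply: pb_scale; apply: pb_add => //.
    by apply: pb_sub; [apply: pb_add; exact: pb_scale|exact: pb_scale].
  move=> m; exact: (replica L (Q m) (fun g => w (S m g)) (ltn0Sn _) del_gt0).
rewrite lerD2l.
have h : N%:R^-1 * c + (1 - N%:R^-1) * q11 - 2 * EE L lam Q + 1 <= 2 * del ^+ 2.
  rewrite EEQ.
  have : (1 - N%:R^-1) * q11 <= 1 + del ^+ 2.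
    have /andP[n0 n1] := N1.
    apply: (@le_trans _ _ ((1 - N%:R^-1) * (1 + del ^+ 2))).
      by rewrite ler_wpM2l// subr_ge0.
    by rewrite ler_piMl// ?addr_ge0 ?sqr_ge0// lerBlDr lerDl.
  move: Nc; lra.
apply: (le_trans (ler_wpM2l _ h)); first by rewrite divr_ge0// invr_ge0 ltW.
by rewrite le_eqVlt; apply/orP; left; apply/eqP; field; rewrite gt_eqF.
Qed.

Let conc w : lingrowth w ->
  `|EE L lam (fun m (g : arr (X m)) => (Q m g - 1) * w (A m g))| <=
  del / 2 * EE L lam (fun m (g : arr (ordX m)) => w (S m g) ^+ 2) + del.
Proof.
move=> wl; rewrite ler_norml conc_le// andbT lerNl -EE_opp//; last first.
  by apply: pbu_mul; [apply: pbu_sub => //; exact: pbu_cst|exact: pbu_lin].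
have wl' : lingrowth (fun x => - w x).
  by case: wl => C [C0 H]; exists C; split => // x; rewrite normrN.
have := conc_le wl'.
rewrite (EE_eq _ _ (H := fun m g => - ((Q m g - 1) * w (A m g)))); last by move=> m g; ring.
move=> /le_trans; apply; rewrite lerD2r ler_wpM2l//; first by rewrite divr_ge0// ltW.
by rewrite le_eqVlt; apply/orP; left; apply/eqP; apply: EE_eq => m g; rewrite sqrrN.
Qed.

Unset Implicit Arguments.
Let F (m : nat) (g : arr (ordX m)) := (S m g - sbar) / Num.sqrt sig2.
Set Implicit Arguments.

(** The error splits into E[(Q - 1) fp(A)], bounded by [conc], and a remainder at most E[Q G(A + D)]
    - E[Q G(A)] at standardised arguments. The first mean equals E[Z G] / sig2, the second is near
    E[G] by [conc], and Z / sig2 is near 1, so the leading parts cancel. The constants 6 and 4 are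
    rounded up. *)
Lemma stein_bound (f fp G : R -> R) (C : R) :
  0 <= C -> lingrowth f -> (forall w, `|fp w| <= C) ->
  (forall w, `|G w| <= C * (1 + `|w|)) -> {homo G : x y / x <= y} ->
  (forall a b, a <= b -> `|f b - f a - (b - a) * fp a| <= (b - a) * (G b - G a)) ->
  `|EE L lam (fun m g => fp (F m g) - F m g * f (F m g))| <= del * (6 * C ^+ 2 + 4).
Proof.
move=> C0 fl fpC GC Gh rem.
set s := Num.sqrt sig2.
have s0 : 0 < s by rewrite sqrtr_gt0.
have s2 : s ^+ 2 = sig2 by rewrite sqr_sqrtr// ltW.
pose T x := (x - sbar) / s.
have lT h : lingrowth h -> lingrowth (fun x => h (T x)).
  move=> [B [B0 H]]; exists (B * (1 + s^-1 + `|sbar / s|)); split.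
    by rewrite mulr_ge0// !addr_ge0// invr_ge0 ltW.
  move=> x; apply: (le_trans (H _)); rewrite -mulrA ler_wpM2l//.
  apply: (@le_trans _ _ (1 + (`|x| * s^-1 + `|sbar / s|))).
    rewrite lerD2l /T mulrBl; apply: (le_trans (ler_normB _ _)).
    by rewrite lerD2r normrM [`|s^-1|]ger0_norm// invr_ge0 ltW.
  have : 0 <= s^-1 by rewrite invr_ge0 ltW.
  have := normr_ge0 x; have := normr_ge0 (sbar / s); nra.
have fpl : lingrowth fp.
  by exists C; split=> // x; rewrite (le_trans (fpC x))// ler_peMr// lerDl.
have Gl : lingrowth G by exists C.
have pF : pbu F by apply: (pbu_lin (h := T)) => //; exact: (lT id lingrowth_id).
have pT h : lingrowth h -> pbu (fun m g => h (F m g)).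
  by move=> hl; apply: (pbu_lin (lT h hl)).
have pTA h : lingrowth h -> pbu (fun m g => h (T (A m g))).
  by move=> hl; apply: (pbu_lin (lT h hl)).
have pTB h : lingrowth h -> pbu (fun m g => h (T (A m g + D m g))).
  by move=> hl; apply: (pbu_lin (lT h hl)); exact: pbu_add.
have EF2 : EE L lam (fun m g => F m g ^+ 2) = 1.
  rewrite (EE_eq _ _ (H := fun m g => sig2^-1 * ((S m g - sbar) * (S m g - sbar)))); last first.
    by move=> m g; rewrite /F -/s -s2 exprMn exprVn; ring.
  have pSs : pbu (fun m g => (S m g - sbar)) by apply: pbu_sub => //; exact: pbu_cst.
  rewrite EE_scale//; last exact: pbu_mul.
  rewrite (EE_eq _ _ (K := fun m g => (S m g - sbar) * _) (H := fun m g => (S m g ^+ 2 - (2 * sbar) * S m g) + sbar ^+ 2)); last first.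
    by move=> m g; ring.
  have p1 : pbu (fun m g => 2 * sbar * S m g) by apply: pbu_mul => //; exact: pbu_cst.
  rewrite EE_add//; last 2 first.
  - by apply: pbu_sub => //; exact: pbu_exp.
  - exact: pbu_cst.
  rewrite EE_sub//; last exact: pbu_exp.
  rewrite EE_scale// EE_cst// -/sbar.
  have -> : EE L lam (fun m g => S m g ^+ 2) = sig2 + sbar ^+ 2 by rewrite /sig2 subrK.
  by field; rewrite gt_eqF.
pose c1 := lam ^+ #|I| / s.
have c1_ge0 : 0 <= c1 by rewrite divr_ge0 ?exprn_ge0// ltW.
pose df m g := f (T (A m g + D m g)) - f (T (A m g)).
have pdf : pbu df by apply: pbu_sub; [exact: pTB|exact: pTA].
have pPdf : pbu (fun m g => P m g * df m g) by exact: pbu_mul.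
have EFf : EE L lam (fun m g => F m g * f (F m g)) = c1 * EE L lam (fun m g => P m g * df m g).
  rewrite (EE_eq _ _ (H := fun m g => s^-1 * ((S m g - sbar) * f (T (S m g))))); last first.
    by move=> m g; rewrite /F -/s -/(T _) /T; ring.
  rewrite EE_scale//; last first.
    apply: pbu_mul; first by apply: pbu_sub => //; exact: pbu_cst.
    exact: pT.
  by rewrite (size_bias (lT f fl)) mulrA; congr (_ * _); rewrite mulrC.
have Efp : EE L lam (fun m g => fp (F m g)) = EE L lam (fun m g => fp (T (A m g))).
  by apply: esym; apply: (EE_pull _ _ (fun m g => fp (F m g))) => m; exact: inl_inj.
have QE m g : Q m g = c1 * P m g * (D m g / s).
  by rewrite /Q /c0 /c1 /PD -s2; field; rewrite gt_eqF.
pose rem0 m g := df m g - (D m g / s) * fp (T (A m g)).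
have prem : pbu (fun m g => c1 * P m g * rem0 m g).
  apply: pbu_mul; first by apply: pbu_mul => //; exact: pbu_cst.
  apply: pbu_sub => //; apply: pbu_mul; last exact: pTA.
  by apply: pbu_mul => //; exact: pbu_cst.
have pQfp : pbu (fun m g => (Q m g - 1) * fp (T (A m g))).
  by apply: pbu_mul; [apply: pbu_sub => //; exact: pbu_cst|exact: pTA].
have D_ge0 m g : 0 <= D m g by exact: DD_ge0.
have P_ge0 m g : 0 <= P m g by case/andP: (Phi01 (pull (finr 'I_m I) g)).
have Q_ge0 m g : 0 <= Q m g.
  rewrite QE; apply: mulr_ge0; [exact: mulr_ge0 c1_ge0 (P_ge0 m g)|].
  by apply: divr_ge0 => //; exact: ltW.
(* As c1 P D / s = Q, the product of [c1 * P] with the increment of f is [Q * fp] plus [c1 * P]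
   times the first-order remainder. *)
have main : EE L lam (fun m g => fp (F m g) - F m g * f (F m g)) =
    - EE L lam (fun m g => (Q m g - 1) * fp (T (A m g))) -
    EE L lam (fun m g => c1 * P m g * rem0 m g).
  rewrite EE_sub//; [|exact: pT|by apply: pbu_mul => //; exact: pT].
  rewrite Efp EFf -EE_scale//.
  have pfpA := pTA fp fpl.
  have -> : EE L lam (fun m g => c1 * (P m g * df m g)) =
      EE L lam (fun m g => (Q m g - 1) * fp (T (A m g))) +
      EE L lam (fun m g => fp (T (A m g))) + EE L lam (fun m g => c1 * P m g * rem0 m g).
    rewrite -EE_add// -EE_add//; last exact: pbu_add.
    by apply: EE_eq => m g; rewrite QE /rem0; ring.
  by ring.
have TAB m g : T (A m g + D m g) - T (A m g) = D m g / s by rewrite /T; ring.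
have remle m g : `|c1 * P m g * rem0 m g| <=
    Q m g * G (T (A m g + D m g)) - Q m g * G (T (A m g)).
  rewrite normrM ger0_norm; last exact: mulr_ge0.
  rewrite -mulrBr QE -[leRHS]mulrA ler_wpM2l//; first exact: mulr_ge0.
  rewrite /rem0 /df -TAB; apply: rem.
  by rewrite -subr_ge0 TAB divr_ge0// ltW.
have pQB : pbu (fun m g => Q m g * G (T (A m g + D m g))) by apply: pbu_mul => //; exact: pTB.
have pQA : pbu (fun m g => Q m g * G (T (A m g))) by apply: pbu_mul => //; exact: pTA.
have pZ : @pbu R ordX (fun m g => ZZ Phi g) by apply: pbu_ZZ => //; exact: pbX_ord.
have EZ : EE L lam (fun m (g : arr (ordX m)) => ZZ Phi g) = sig2 by rewrite variance_ZZ.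
have EQB : EE L lam (fun m g => Q m g * G (T (A m g + D m g))) =
    EE L lam (fun m (g : arr (ordX m)) => sig2^-1 * (ZZ Phi g * G (F m g))).
  rewrite EE_scale//; last by apply: pbu_mul => //; exact: pT.
  rewrite (bias_ZZ (lT G Gl)) mulrA.
  rewrite (EE_eq _ _ (H := fun m g => c0 * (P m g * D m g * G (T (A m g + D m g))))).
    rewrite EE_scale//; last by apply: pbu_mul => //; exact: pTB.
    by congr (_ * _); rewrite /c0 mulrC.
  by move=> m g; rewrite /Q /PD; ring.
have pZ1 : @pbu R ordX (fun m g => sig2^-1 * ZZ Phi g - 1).
  by apply: pbu_sub; [apply: pbu_mul => //; exact: pbu_cst|exact: pbu_cst].
have pGF : pbu (fun m g => G (F m g)) by exact: pT.
(* The factor 4 comes from (1 + |x|)^2 <= 2 + 2 x^2 together with E F^2 = 1. *)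
have EG2 : EE L lam (fun m g => G (F m g) ^+ 2) <= 4 * C ^+ 2.
  have pb2 : pbu (fun m g => 2 * C ^+ 2 + 2 * C ^+ 2 * F m g ^+ 2).
    apply: pbu_add; first exact: pbu_cst.
    by apply: pbu_mul; [exact: pbu_cst|exact: pbu_exp].
  apply: (@le_trans _ _ (EE L lam (fun m g => 2 * C ^+ 2 + 2 * C ^+ 2 * F m g ^+ 2))).
    apply: EE_le => //; first exact: pbu_exp.
    move=> m g; have := GC (F m g); set x := F m g => Gx.
    rewrite -(real_normK (num_real (G x))).
    apply: (@le_trans _ _ ((C * (1 + `|x|)) ^+ 2)).
      by rewrite lerXn2r ?nnegrE// mulr_ge0// addr_ge0.
    rewrite exprMn -(real_normK (num_real x)).
    have -> : 2 * C ^+ 2 + 2 * C ^+ 2 * `|x| ^+ 2 = C ^+ 2 * (2 + 2 * `|x| ^+ 2) by ring.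
    rewrite ler_wpM2l ?sqr_ge0//.
    by have := sqr_ge0 (1 - `|x|); rewrite !expr2; lra.
  rewrite EE_add//; [|exact: pbu_cst|by apply: pbu_mul; [exact: pbu_cst|exact: pbu_exp]].
  have pF2 := pbu_exp 2 pF.
  by rewrite EE_cst// EE_scale// EF2; lra.
have Efp2 : EE L lam (fun m g => fp (F m g) ^+ 2) <= C ^+ 2.
  rewrite -[leRHS](EE_cst L lam0 ordX (C ^+ 2)); apply: EE_le => //.
  - by apply: pbu_exp; exact: pT.
  - exact: pbu_cst.
  move=> m g; rewrite -(real_normK (num_real (fp _))).
  by rewrite lerXn2r ?nnegrE.
have EV : EE L lam (fun m (g : arr (ordX m)) => (sig2^-1 * ZZ Phi g - 1) ^+ 2) <= del ^+ 2.
  rewrite (EE_eq _ _ (H := fun m (g : arr (ordX m)) => (sig2 ^- 2 * ZZ Phi g ^+ 2 - 2 * sig2^-1 * ZZ Phi g) + 1)); last first.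
    by move=> m g; field; rewrite gt_eqF.
  have q1 : @pbu R ordX (fun m g => ZZ Phi g ^+ 2) by exact: pbu_exp.
  have q2 : @pbu R ordX (fun m g => sig2 ^- 2 * ZZ Phi g ^+ 2) by apply: pbu_mul => //; exact: pbu_cst.
  have q3 : @pbu R ordX (fun m g => 2 * sig2^-1 * ZZ Phi g) by apply: pbu_mul => //; exact: pbu_cst.
  rewrite EE_add//; [|exact: pbu_sub|exact: pbu_cst].
  rewrite EE_sub// !EE_scale// EE_cst// EZ.
  have := ZZ2_le; rewrite -ler_pdivrMl ?exprn_gt0// => H.
  rewrite -[2 * _ * sig2]mulrA mulVf ?gt_eqF//; lra.
have b1 : `|EE L lam (fun m g => (Q m g - 1) * fp (T (A m g)))| <= del / 2 * C ^+ 2 + del.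
  apply: (le_trans (conc (lT fp fpl))); rewrite lerD2r ler_wpM2l//.
  by rewrite divr_ge0// ltW.
have b2 : `|EE L lam (fun m g => (Q m g - 1) * G (T (A m g)))| <= del / 2 * (4 * C ^+ 2) + del.
  apply: (le_trans (conc (lT G Gl))); rewrite lerD2r ler_wpM2l//.
  by rewrite divr_ge0// ltW.
have b3 := EE_AMGM L lam0 del_gt0 pZ1 pGF.
rewrite main.
have r1 := EE_norm_le L lam0 prem (pbu_sub pQB pQA) remle.
rewrite EE_sub// EQB in r1.
have E2 : EE L lam (fun m (g : arr (ordX m)) => sig2^-1 * (ZZ Phi g * G (F m g))) =
   EE L lam (fun m (g : arr (ordX m)) => (sig2^-1 * ZZ Phi g - 1) * G (F m g)) + EE L lam (fun m g => G (F m g)).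
  rewrite -EE_add//; last exact: pbu_mul.
  by apply: EE_eq => m g; ring.
have E3 : EE L lam (fun m g => Q m g * G (T (A m g))) =
   EE L lam (fun m g => (Q m g - 1) * G (T (A m g))) + EE L lam (fun m g => G (F m g)).
  have -> : EE L lam (fun m g => G (F m g)) = EE L lam (fun m g => G (T (A m g))).
    by apply: esym; apply: (EE_pull _ _ (fun m g => G (F m g))) => m; exact: inl_inj.
  rewrite -EE_add//; [|by apply: pbu_mul; [apply: pbu_sub => //; exact: pbu_cst|exact: pTA]|exact: pTA].
  by apply: EE_eq => m g; ring.
rewrite E2 E3 in r1.
have b3' : del * EE L lam (fun m (g : arr (ordX m)) => G (F m g) ^+ 2) <= del * (4 * C ^+ 2).
  by rewrite ler_wpM2l// ltW.
have b3'' : del^-1 * EE L lam (fun m (g : arr (ordX m)) => (sig2^-1 * ZZ Phi g - 1) ^+ 2) <= del.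
  apply: (le_trans (ler_wpM2l _ EV)); first by rewrite invr_ge0 ltW.
  by rewrite expr2 mulKf// gt_eqF.
have dC : 0 <= del * C ^+ 2 by rewrite mulr_ge0 ?sqr_ge0// ltW.
move: b1 b2 b3 r1 b3' b3''.
set x1 := EE L lam (fun m g => (Q m g - 1) * fp _).
set x2 := EE L lam (fun m g => (Q m g - 1) * G _).
set x3 := EE L lam (fun m g => (sig2^-1 * _ - 1) * _).
set x4 := EE L lam (fun m g => c1 * P m g * _).
move=> b1 b2 b3 r1 b3' b3''.
apply: (le_trans (ler_normB _ _)); rewrite normrN.
have n2 := ler_norm (- x2); rewrite normrN in n2.
have n3 := ler_norm x3.
have d0 : 0 <= del by exact: ltW.
lra.
Qed.

End SizeBias.

(** * First and second moments of general pattern sums *)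

Lemma sum_by_card (R : realType) (T : finType) (D : {set T}) (w : nat) (F : nat -> R) :
  (forall r, (w < r)%N -> F r = 0) ->
  \sum_(A : {set T} | A \subset D) F #|A| = \sum_(r < w.+1) 'C(#|D|, r)%:R * F r.
Proof.
move=> F0.
transitivity (\sum_(A : {set T} | A \subset D) \sum_(r < w.+1) (#|A| == r)%:R * F r).
  apply: eq_bigr => A _; case: (ltnP w #|A|) => wA.
    rewrite F0// big1// => r _; case: eqVneq => [E|]; last by rewrite mul0r.
    by have := ltn_ord r; rewrite -E ltnS leqNgt wA.
  rewrite (bigD1 (Ordinal (wA : (#|A| < w.+1)%N)))//= eqxx mul1r big1 ?addr0//.
  by move=> r rA; case: eqVneq => [E|]; rewrite ?mul0r//; case/eqP: rA; apply: val_inj.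
rewrite exchange_big/=; apply: eq_bigr => r _.
rewrite -big_distrl/=; congr (_ * _).
rewrite -cards_draws -sum1_card natr_sum big_mkcond [RHS]big_mkcond/=.
by apply: eq_bigr => A _; rewrite inE; case: (A \subset D) => //=; case: (#|A| == r).
Qed.

Lemma sum_nat_trunc (R : realType) (G : nat -> R) (a b : nat) :
  (forall r, 0 <= G r) -> (forall r, (b <= r)%N -> G r = 0) ->
  \sum_(0 <= r < a) G r <= \sum_(0 <= r < b) G r.
Proof.
move=> G0 Gb; have [ab|/ltnW ba] := leqP a b.
  by rewrite [leRHS](@big_cat_nat _ _ _ a)//= lerDl sumr_ge0.
rewrite [leLHS](@big_cat_nat _ _ _ b)//=.
have -> : \sum_(b <= r < a) G r = 0 by rewrite big_nat big1// => r /andP[br _]; exact: Gb.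
by rewrite addr0.
Qed.

Definition imf (W J : finType) (v : {ffun W -> J}) : {set J} := [set x | x \in codom v]%SET.

Section Patterns.
Context {R : realType} (L : array_law R) (lam : R) (lam0 : 0 <= lam).
Context (W : finType) (B : arr W -> R) (pat : forall J : finType, pred {ffun W -> J}).
Hypothesis B01 : forall a, 0 <= B a <= 1.
Hypothesis pat_inj : forall (J J' : finType) (b : J -> J') (v : {ffun W -> J}),
  injective b -> pat [ffun i => b (v i)] = pat v.

Definition FZ (J : finType) (g : arr J) : R := \sum_(v : {ffun W -> J} | pat v) B (pull v g).

(* Overlapping pairs, the only ones contributing to the variance of [FZ]. *)
Definition OVL (J : finType) (g : arr J) : R :=
  \sum_(p : {ffun W -> J} * {ffun W -> J} | [&& pat p.1, pat p.2 & meets p.1 p.2])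
    B (pull p.1 g) * B (pull p.2 g).

(** By exchangeability the expected weight of the patterns with a prescribed image depends only on
    the size r of that image. Summing over images gives binomial coefficients, whose Poisson means
    are explicit. *)
Let eb (r : nat) : R :=
  E L (fun g : arr 'I_r => \sum_(v : {ffun W -> 'I_r} | pat v && (imf v == [set: 'I_r]%SET)) B (pull v g)).

Let eb0 r : (#|W| < r)%N -> eb r = 0.
Proof.
move=> Wr; rewrite /eb -[RHS](E_cst L 'I_r 0); apply: E_eq => g.
rewrite big_pred0// => v; apply: negbTE; rewrite negb_and; apply/orP; right.
apply/eqP => /(congr1 (fun A : {set 'I_r} => #|A|)).
rewrite cardsT card_ord cardsE => H.
have := leq_image_card v xpredT; rewrite H.
by rewrite leqNgt -[#|_|]/(#|W|) Wr.
Qed.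

Let sum_image (J J' : finType) (h : J' -> J) (g : arr J) : injective h ->
  \sum_(v : {ffun W -> J} | pat v && (imf v == [set x | x \in codom h]%SET)) B (pull v g) =
  \sum_(v : {ffun W -> J'} | pat v && (imf v == [set: J']%SET)) B (pull v (pull h g)).
Proof.
move=> hi; pose c (v : {ffun W -> J'}) : {ffun W -> J} := [ffun i => h (v i)].
have ci : injective c.
  by move=> u v /ffunP uv; apply/ffunP => i; have := uv i; rewrite !ffunE; exact: hi.
transitivity (\sum_(v in c @: [set v : {ffun W -> J'} | pat v && (imf v == [set: J']%SET)]%SET) B (pull v g)).
  apply: eq_bigl => v; apply/andP/imsetP => [[pv /eqP/setP iv]|[u]].
    have : forall i, exists a, v i = h a.
      move=> i; have := iv (v i); rewrite !inE codom_f => /esym /codomP[a ->].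
      by exists a.
    move=> /fin_all_exists[u Hu].
    have vE : v = c (finfun u) by apply/ffunP => i; rewrite !ffunE Hu.
    exists (finfun u) => //; rewrite inE; apply/andP; split.
      by move: pv; rewrite vE /c pat_inj.
    apply/eqP/setP => x; rewrite !inE; apply/codomP.
    have := iv (h x); rewrite !inE codom_f => /codomP[i]; rewrite Hu => /hi ->.
    by exists i; rewrite ffunE.
  rewrite inE => /andP[pu /eqP/setP iu] ->; split; first by rewrite /c pat_inj.
  apply/eqP/setP => x; rewrite !inE; apply/codomP/codomP => -[y ->].
    by exists (u y); rewrite ffunE.
  have := iu y; rewrite !inE => /codomP[i ->].
  by exists i; rewrite ffunE.
rewrite big_imset/=; last by move=> u v _ _; exact: ci.
by apply: eq_big => [v|v _]; rewrite ?inE// /c pull_ffun.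
Qed.

Let enum_valS (J : finType) (A : {set J}) : [set x | x \in codom (@enum_val _ (mem A))]%SET = A.
Proof.
apply/setP => x; rewrite inE; apply/codomP/idP => [[i ->]|xA]; first exact: enum_valP.
by exists (enum_rank_in xA x); rewrite enum_rankK_in.
Qed.

Let E_image (J : finType) (A : {set J}) :
  E L (fun g : arr J => \sum_(v : {ffun W -> J} | pat v && (imf v == A)) B (pull v g)) = eb #|A|.
Proof.
rewrite -{1}(enum_valS A).
rewrite (E_eq _ (fun g => sum_image g (@enum_val_inj _ (mem A)))).
by rewrite /eb -(E_pull _ _ (@enum_val_inj _ (mem A))).
Qed.

(** Dissociation: the arrays on two disjoint index sets are independent, hence so are the patterns
    that live on them. *)
Let E_image2 (J : finType) (A A' : {set J}) : fintype.disjoint (mem A) (mem A') ->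
  E L (fun g : arr J =>
    (\sum_(v : {ffun W -> J} | pat v && (imf v == A)) B (pull v g)) *
    (\sum_(v : {ffun W -> J} | pat v && (imf v == A')) B (pull v g))) = eb #|A| * eb #|A'|.
Proof.
move=> dA.
pose h (x : ('I_#|A| + 'I_#|A'|)%type) : J :=
  match x with inl i => enum_val i | inr i => enum_val i end.
have hi : injective h.
  move=> [i|i] [j|j] /= H; try by have := enum_val_inj H => ->.
    have := enum_valP i; rewrite H => H1; have := enum_valP j => H2.
    by move/pred0P: dA => /(_ (enum_val j)) /=; rewrite H1 H2.
  have := enum_valP i; rewrite H => H1; have := enum_valP j => H2.
  by move/pred0P: dA => /(_ (enum_val j)) /=; rewrite H1 H2.
rewrite -{1}(enum_valS A) -{1}(enum_valS A').
rewrite /eb -E_dissoc -(E_pull _ _ hi); apply: E_eq => g.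
rewrite (sum_image g (@enum_val_inj _ (mem A))) (sum_image g (@enum_val_inj _ (mem A'))).
by rewrite !pull_comp.
Qed.

Let E_FZ m : E L (fun g : arr 'I_m => FZ g) = \sum_(r < #|W|.+1) 'C(m, r)%:R * eb r.
Proof.
transitivity (\sum_(r < #|W|.+1) 'C(#|[set: 'I_m]%SET|, r)%:R * eb r); last by rewrite cardsT card_ord.
rewrite -sum_by_card//.
rewrite (E_eq _ (h := fun g => \sum_(A : {set 'I_m} | A \subset [set: 'I_m]%SET)
   \sum_(v : {ffun W -> 'I_m} | pat v && (imf v == A)) B (pull v g))).
  by rewrite E_sum; apply: eq_bigr => A _; exact: E_image.
by move=> g; rewrite /FZ (partition_big (@imf _ _) (fun A => A \subset [set: 'I_m]%SET))// => v _; exact: finset.subsetT.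
Qed.

Lemma meets_imf (J : finType) (u v : {ffun W -> J}) : meets u v = ~~ fintype.disjoint (mem (imf u)) (mem (imf v)).
Proof.
apply/existsP/idP => [[i /existsP[j /eqP E]]|].
  apply/negP => /pred0P /(_ (u i)) /=.
  by rewrite !inE codom_f E codom_f.
move=> /pred0Pn[x /andP[]]; rewrite !inE => /codomP[i ->] /codomP[j E].
by exists i; apply/existsP; exists j; rewrite E.
Qed.

Let E_disj m : E L (fun g : arr 'I_m =>
    \sum_(p : {ffun W -> 'I_m} * {ffun W -> 'I_m} | [&& pat p.1, pat p.2 & ~~ meets p.1 p.2])
    B (pull p.1 g) * B (pull p.2 g)) =
  \sum_(r < #|W|.+1) \sum_(s < #|W|.+1) ('C(m, r) * 'C(m - r, s))%:R * (eb r * eb s).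
Proof.
rewrite (E_eq _ (h := fun g => \sum_(A : {set 'I_m} | A \subset [set: 'I_m]%SET)
   \sum_(A' : {set 'I_m} | A' \subset ~: A)
   (\sum_(v : {ffun W -> 'I_m} | pat v && (imf v == A)) B (pull v g)) *
   (\sum_(v : {ffun W -> 'I_m} | pat v && (imf v == A')) B (pull v g)))); last first.
  move=> g; rewrite pair_big_dep/=.
  rewrite (partition_big (fun p : {ffun W -> 'I_m} * {ffun W -> 'I_m} => (imf p.1, imf p.2))
    (fun q => (q.1 \subset [set: 'I_m]%SET) && (q.2 \subset ~: q.1)))/=; last first.
    move=> [u v] /= /and3P[_ _]; rewrite meets_imf negbK finset.subsetT /= => d.
    by rewrite -finset.disjoints_subset disjoint_sym.
  apply: eq_bigr => -[A A'] /= /andP[_ AA'].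
  rewrite big_distrlr/= pair_big_dep/=; apply: eq_bigl => -[u v] /=.
  rewrite xpair_eqE.
  case: eqVneq => [uA|]; last by rewrite !andbF.
  case: eqVneq => [vA|]; last by rewrite !andbF.
  rewrite meets_imf negbK uA vA disjoint_sym finset.disjoints_subset AA'.
  by rewrite !andbT.
rewrite E_sum.
transitivity (\sum_(A : {set 'I_m} | A \subset [set: 'I_m]%SET)
   \sum_(s < #|W|.+1) 'C(m - #|A|, s)%:R * (eb #|A| * eb s)).
  apply: eq_bigr => A _; rewrite E_sum.
  have -> : (m - #|A|)%N = #|~: A| by rewrite [in RHS]finset.cardsCs finset.setCK card_ord.
  rewrite -(sum_by_card (w := #|W|) (~: A) (F := fun s => eb #|A| * eb s)); last by move=> r Wr; rewrite (eb0 Wr) mulr0.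
  apply: eq_bigr => A' AA'; apply: E_image2.
  by rewrite disjoint_sym finset.disjoints_subset.
rewrite (sum_by_card (w := #|W|) _ (F := fun r => \sum_(s < #|W|.+1) 'C(m - r, s)%:R * (eb r * eb s))); last first.
  by move=> r Wr; rewrite big1// => s _; rewrite (eb0 Wr) mul0r mulr0.
apply: eq_bigr => r _; rewrite cardsT card_ord big_distrr/=.
by apply: eq_bigr => s _; rewrite natrM mulrA.
Qed.

Let pbin r : @pb R (fun m => 'C(m, r)%:R).
Proof.
apply: pb_le (pb_nat r) => m; rewrite !ger0_norm ?exprn_ge0//.
rewrite -natrX ler_nat; apply: leq_trans (ffact_le_exp m r).
by rewrite -bin_ffact leq_pmulr// fact_gt0.
Qed.

Let pbin2 r s : @pb R (fun m => ('C(m, r) * 'C(m - r, s))%:R).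
Proof.
apply: pb_le (pb_mul (pb_nat r) (pb_nat s)) => m.
rewrite !ger0_norm ?mulr_ge0 ?exprn_ge0// -!natrX -natrM ler_nat leq_mul//.
  by apply: leq_trans (ffact_le_exp m r); rewrite -bin_ffact leq_pmulr// fact_gt0.
apply: (@leq_trans ((m - r) ^ s)).
  by apply: leq_trans (ffact_le_exp _ s); rewrite -bin_ffact leq_pmulr// fact_gt0.
by case: s => // s; rewrite leq_exp2r// leq_subr.
Qed.

Let B_ge0 a : 0 <= B a. Proof. by case/andP: (B01 a). Qed.
Let B_norm a : `|B a| <= 1. Proof. by have /andP[h1 h2] := B01 a; rewrite ger0_norm. Qed.

Lemma pbu_FZ : @pbu R ordX (fun m g => FZ g).
Proof.
apply: pbu_le (pbX_pow #|W| pbX_ord) => m g.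
rewrite [X in _ <= X]ger0_norm ?exprn_ge0// -[X in _ <= X]mul1r.
by apply: sum_le_card.
Qed.

Lemma pbu_OVL : @pbu R ordX (fun m g => OVL g).
Proof.
apply: pbu_le (pbu_exp 2 pbu_FZ) => m g.
rewrite !ger0_norm ?sqr_ge0//; last by apply: sumr_ge0 => p _; rewrite mulr_ge0.
rewrite /FZ expr2 big_distrlr/= pair_big/= [leRHS](bigID (fun p => meets p.1 p.2))/=.
have -> : OVL g = \sum_(p : {ffun W -> ordX m} * {ffun W -> ordX m} | (pat p.1 && pat p.2) && meets p.1 p.2)
    B (pull p.1 g) * B (pull p.2 g) by apply: eq_bigl => p; rewrite andbA.
by rewrite lerDl; apply: sumr_ge0 => p _; rewrite mulr_ge0.
Qed.

(** Split the double sum by whether the two patterns meet. For disjoint pairs [E_disj] and [PE_bin2]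
    reproduce, term by term, the product of two expansions of the mean. *)
Lemma second_moment_FZ :
  EE L lam (fun m (g : arr (ordX m)) => FZ g ^+ 2) =
  EE L lam (fun m (g : arr (ordX m)) => FZ g) ^+ 2 + EE L lam (fun m (g : arr (ordX m)) => OVL g).
Proof.
have pF2 := pbu_exp 2 pbu_FZ.
transitivity (EE L lam (fun m (g : arr (ordX m)) => (FZ g ^+ 2 - OVL g) + OVL g)).
  by apply: EE_eq => m g; rewrite subrK.
rewrite EE_add//; [|exact: pbu_sub pbu_OVL|exact: pbu_OVL].
congr (_ + _).
have -> : EE L lam (fun m (g : arr (ordX m)) => FZ g) = \sum_(r < #|W|.+1) lam ^+ r / r`!%:R * eb r.
  rewrite /EE (PE_eq _ (b := fun m => \sum_(r < #|W|.+1) eb r * 'C(m, r)%:R)); last first.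
    by move=> m; rewrite E_FZ; apply: eq_bigr => r _; rewrite mulrC.
  have /= [_ ->] := @PE_sum R lam 'I_#|W|.+1 xpredT (fun r m => eb r * 'C(m, r)%:R) lam0
    (fun r _ => pb_scale (eb r) (pbin r)).
  by apply: eq_bigr => r _; rewrite PE_scale// PE_bin// mulrC.
rewrite expr2 big_distrlr/=.
rewrite /EE (PE_eq _ (b := fun m => \sum_(r < #|W|.+1) \sum_(s < #|W|.+1) (eb r * eb s) * ('C(m, r) * 'C(m - r, s))%:R)); last first.
  move=> m; transitivity (E L (fun g : arr 'I_m =>
    \sum_(p : {ffun W -> 'I_m} * {ffun W -> 'I_m} | [&& pat p.1, pat p.2 & ~~ meets p.1 p.2])
    B (pull p.1 g) * B (pull p.2 g))).
    apply: E_eq => g; rewrite /FZ expr2 big_distrlr/= pair_big/= (bigID (fun p => meets p.1 p.2))/=.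
    have -> : OVL g = \sum_(p : {ffun W -> ordX m} * {ffun W -> ordX m} | (pat p.1 && pat p.2) && meets p.1 p.2)
      B (pull p.1 g) * B (pull p.2 g) by apply: eq_bigl => p; rewrite andbA.
    by rewrite addrAC subrr add0r; apply: eq_bigl => p; rewrite andbA.
  by rewrite E_disj; apply: eq_bigr => r _; apply: eq_bigr => s _; rewrite mulrC.
have H r : pb (fun m => \sum_(s < #|W|.+1) (eb r * eb s) * ('C(m, r) * 'C(m - r, s))%:R) /\
  PE lam (fun m => \sum_(s < #|W|.+1) (eb r * eb s) * ('C(m, r) * 'C(m - r, s))%:R) =
  \sum_(s < #|W|.+1) lam ^+ r / r`!%:R * eb r * (lam ^+ s / s`!%:R * eb s).
  have /= [h1 h2] := @PE_sum R lam 'I_#|W|.+1 xpredT (fun s m => (eb r * eb s) * ('C(m, r) * 'C(m - r, s))%:R) lam0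
    (fun s _ => pb_scale (eb r * eb s) (pbin2 r s)).
  split=> //; rewrite h2; apply: eq_bigr => s _.
  by rewrite PE_scale// PE_bin2// mulrC mulrACA.
have /= [_ ->] := @PE_sum R lam 'I_#|W|.+1 xpredT (fun r m => \sum_(s < #|W|.+1) (eb r * eb s) * ('C(m, r) * 'C(m - r, s))%:R) lam0
    (fun r _ => (H r).1).
by apply: eq_bigr => r _; rewrite (H r).2.
Qed.

(** There are at most r^#|W| patterns onto r points, and lam^r / r! <= lam^r. The hypothesis prices
    an image of r points as r - 1 edges at cost q each. *)
Lemma FZ_upper (q c : R) (rmax : nat) : 0 <= q -> 0 <= c ->
  (forall (J : finType) (v : {ffun W -> J}), pat v ->
     (0 < #|imf v| <= rmax)%N /\ E L (fun g => B (pull v g)) <= c * q ^+ (#|imf v|.-1)) ->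
  EE L lam (fun m (g : arr (ordX m)) => FZ g) <=
  \sum_(r < rmax) lam ^+ r.+1 * (r.+1%:R ^+ #|W| * (c * q ^+ r)).
Proof.
move=> q0 c0 H.
have ebr r : eb r <= (0 < r <= rmax)%N%:R * (r%:R ^+ #|W| * (c * q ^+ r.-1)).
  rewrite /eb E_sum.
  apply: (@le_trans _ _ (\sum_(v : {ffun W -> 'I_r}) (0 < r <= rmax)%N%:R * (c * q ^+ r.-1))).
    rewrite big_mkcond; apply: ler_sum => v _; case: ifP => [/andP[pv /eqP iv]|_]; last first.
      by rewrite !mulr_ge0// exprn_ge0.
    have [h1 h2] := H _ v pv; move: h1 h2; rewrite iv cardsT card_ord => -> h2.
    by rewrite mul1r.
  rewrite sumr_const card_ffun card_ord -[_ *+ (r ^ _)]mulr_natr natrX.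
  by rewrite -mulrA [_ * r%:R ^+ _]mulrC.
rewrite /EE (PE_eq _ (b := fun m => \sum_(r < #|W|.+1) eb r * 'C(m, r)%:R)); last first.
  by move=> m; rewrite E_FZ; apply: eq_bigr => r _; rewrite mulrC.
have /= [_ ->] := @PE_sum R lam 'I_#|W|.+1 xpredT (fun r m => eb r * 'C(m, r)%:R) lam0
    (fun r _ => pb_scale (eb r) (pbin r)).
pose G (r : nat) : R := (0 < r <= rmax)%N%:R * (lam ^+ r * (r%:R ^+ #|W| * (c * q ^+ r.-1))).
have G0 r : 0 <= G r by rewrite /G !mulr_ge0// exprn_ge0.
apply: (@le_trans _ _ (\sum_(r < #|W|.+1) G r)).
  apply: ler_sum => r _; rewrite PE_scale// PE_bin// /G.
  have f1 : 0 <= lam ^+ r / r`!%:R <= lam ^+ r.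
    by rewrite divr_ge0 ?exprn_ge0//= ler_piMr ?exprn_ge0// invf_le1 ?ltr0n ?ler1n ?fact_gt0//.
  have /andP[f2 f3] := f1.
  set x := (0 < r <= rmax)%N%:R; set y := r%:R ^+ #|W| * _.
  have -> : x * (lam ^+ r * y) = x * y * lam ^+ r by ring.
  apply: (@le_trans _ _ (x * y * (lam ^+ r / r`!%:R))).
    by rewrite ler_wpM2r.
  by rewrite ler_wpM2l// !mulr_ge0// exprn_ge0.
have -> : \sum_(r < rmax) lam ^+ r.+1 * (r.+1%:R ^+ #|W| * (c * q ^+ r)) = \sum_(0 <= r < rmax.+1) G r.
  rewrite big_nat_recl// {1}/G ltnn /= !mul0r add0r big_mkord; apply: eq_bigr => r _.
  by rewrite /G /= ltn_ord mul1r.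
rewrite -(big_mkord xpredT G); apply: sum_nat_trunc => // r rr.
by rewrite /G [(r <= _)%N]leqNgt rr andbF mul0r.
Qed.

(** All terms are non-negative: keep only the images of size #|J| and, on such an image, the single
    pattern v. *)
Lemma FZ_lower (J : finType) (v : {ffun W -> J}) : pat v -> imf v = [set: J]%SET ->
  lam ^+ #|J| / (#|J|)`!%:R * E L (fun g => B (pull v g)) <=
  EE L lam (fun m (g : arr (ordX m)) => FZ g).
Proof.
move=> pv iv.
have eb_ge0 r : 0 <= eb r by apply: E_ge0 => g; exact: sumr_ge0.
have JW : (#|J| < #|W|.+1)%N.
  rewrite ltnS -cardsT -iv cardsE; exact: leq_image_card.
have le1 : E L (fun g => B (pull v g)) <= eb #|J|.
  rewrite -[X in eb X]cardsT -E_image; apply: E_le => g.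
  by rewrite (bigD1 v)/= ?pv ?iv ?eqxx// lerDl sumr_ge0.
rewrite /EE (PE_eq _ (b := fun m => \sum_(r < #|W|.+1) eb r * 'C(m, r)%:R)); last first.
  by move=> m; rewrite E_FZ; apply: eq_bigr => r _; rewrite mulrC.
have /= [_ ->] := @PE_sum R lam 'I_#|W|.+1 xpredT (fun r m => eb r * 'C(m, r)%:R) lam0
    (fun r _ => pb_scale (eb r) (pbin r)).
have t0 r : 0 <= lam ^+ r / r`!%:R by rewrite divr_ge0// exprn_ge0.
rewrite (bigD1 (Ordinal JW))//= PE_scale// PE_bin// mulrC -[leLHS]addr0 lerD//.
  by rewrite ler_wpM2r.
by apply: sumr_ge0 => r _; rewrite PE_scale// PE_bin// mulr_ge0.
Qed.

End Patterns.

(** * Spanning chains of connected patterns *)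

Section Chains.
Context (J : eqType).
Implicit Types (l : seq (J * J)) (x : J).

(* A tree grown from x0; the list is read from its tail, and each pair is
   (existing vertex, new vertex). *)
Definition verts x0 l : seq J := [seq p.2 | p <- l] ++ [:: x0].

Fixpoint chain x0 l : bool :=
  if l is p :: l' then [&& chain x0 l', p.1 \in verts x0 l' & p.2 \notin verts x0 l']
  else true.

Definition cdeg l x : nat := count (fun p => (p.1 == x) || (p.2 == x)) l.

Definition nbs l x : seq J :=
  [seq (if p.1 == x then p.2 else p.1) | p <- l & (p.1 == x) || (p.2 == x)].

Lemma size_verts x0 l : size (verts x0 l) = (size l).+1.
Proof. by rewrite size_cat size_map addn1. Qed.

Lemma chain_uniq x0 l : chain x0 l -> uniq (verts x0 l).
Proof. by elim: l => //= p l IH /and3P[/IH u _ v]; rewrite v u. Qed.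

Lemma x0_verts x0 l : x0 \in verts x0 l.
Proof. by rewrite mem_cat inE eqxx orbT. Qed.

Lemma chain_mem x0 l p : chain x0 l -> p \in l -> (p.1 \in verts x0 l) && (p.2 \in verts x0 l).
Proof.
elim: l => //= p' l IH /and3P[c w v]; rewrite inE => /orP[/eqP ->|/(IH c)/andP[h1 h2]].
  by rewrite !inE eqxx w orbT.
by rewrite !inE h1 h2 !orbT.
Qed.

Lemma cdeg0 x0 l x : chain x0 l -> x \notin verts x0 l -> cdeg l x = 0%N.
Proof.
move=> c xl; apply/eqP; rewrite -leqn0 leqNgt -has_count; apply/negP => /hasP[p pl].
have /andP[h1 h2] := chain_mem c pl.
by case/orP => /eqP E; move: xl; rewrite -E ?h1 ?h2.
Qed.

Lemma size_nbs l x : size (nbs l x) = cdeg l x.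
Proof. by rewrite size_map size_filter. Qed.

(** Each pair of a chain brings in a new vertex, so no neighbour is listed twice. Hence [cdeg]
    counts distinct neighbours, as [cdeg_le] requires. *)
Lemma nbs_uniq x0 l x : chain x0 l -> uniq (nbs l x) /\ {subset nbs l x <= verts x0 l}.
Proof.
elim: l => [|p l IH] //= /and3P[c w v]; have [u s] := IH c.
have s' : {subset nbs l x <= verts x0 (p :: l)}.
  by move=> y /s yl; rewrite inE yl orbT.
rewrite /nbs /=; case: ifPn => // hp /=.
rewrite -[X in uniq X]/(nbs l x) -[[seq _ | _ <- _ & _]]/(nbs l x) u andbT.
case: (eqVneq p.1 x) hp => [E _|_ /= /eqP E].
  split; first by apply/negP => /s; apply/negP.
  by move=> y; rewrite inE => /orP[/eqP ->|/s'//]; rewrite inE eqxx.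
have : nbs l x = [::].
  by apply/nilP; rewrite /nilp size_nbs (cdeg0 c)// -E.
move=> ->; split => // y; rewrite !inE => /eqP ->.
by rewrite w orbT.
Qed.

End Chains.

Section ChainExists.
Context (J : finType) (r : rel J).

Lemma path_crossing (V : seq J) x p : path r x p -> x \in V -> last x p \notin V ->
  exists w v, [/\ r w v, w \in V & v \notin V].
Proof.
elim: p x => [|y p IH] x /=; first by move=> _ ->.
move=> /andP[rxy py] xV lV; case: (boolP (y \in V)) => yV; first exact: IH py yV lV.
by exists x, y.
Qed.

(** Greedy growth: while a vertex of A is missing, a path from x0 to it must leave the current
    vertex set, and the crossing edge extends the chain. *)
Lemma chain_exists (x0 : J) (A : {set J}) : x0 \in A ->
  (forall y, y \in A -> connect r x0 y) -> (forall x y, r x y -> y \in A) ->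
  exists l, [/\ chain x0 l, all (fun p => r p.1 p.2) l, size l = #|A|.-1
    & verts x0 l =i A].
Proof.
move=> x0A conn rA.
have sub l : all (fun p => r p.1 p.2) l -> {subset verts x0 l <= A}.
  move=> al y; rewrite mem_cat inE => /orP[/mapP[p pl ->]|/eqP ->//].
  by have /rA := allP al p pl.
have E n : (n < #|A|)%N -> exists l, [/\ chain x0 l, all (fun p => r p.1 p.2) l & size l = n].
  elim: n => [|n IH] nA; first by exists [::].
  have [l [c al sl]] := IH (ltnW nA).
  have [y yA yl] : exists2 y, y \in A & y \notin verts x0 l.
    apply/subsetPn; apply/negP => /subset_leq_card.
    rewrite leqNgt; move/card_uniqP: (chain_uniq c) => ->.
    by rewrite size_verts sl nA.
  have /connectP[p pp lp] := conn y yA.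
  rewrite lp in yl.
  have [w [v [rwv wl vl]]] := path_crossing pp (x0_verts x0 l) yl.
  by exists ((w, v) :: l); split => /=; rewrite ?c ?wl ?vl ?rwv ?al ?sl.
have A0 : (0 < #|A|)%N by apply/card_gt0P; exists x0.
have [l [c al sl]] := E #|A|.-1 (ltac:(by rewrite prednK)).
exists l; split=> //; apply/subset_cardP.
  by move/card_uniqP: (chain_uniq c) => ->; rewrite size_verts sl prednK.
by apply/fintype.subsetP; exact: sub.
Qed.

Lemma cdeg_le (x0 x : J) l : symmetric r -> chain x0 l -> all (fun p => r p.1 p.2) l ->
  (cdeg l x <= #|[set y | r x y]%SET|)%N.
Proof.
move=> rs c al; rewrite -size_nbs; have [u _] := nbs_uniq x c.
rewrite -(card_uniqP u); apply/subset_leq_card/fintype.subsetP => y /mapP[p].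
rewrite mem_filter => /andP[h pl] ->; rewrite inE.
have /= rp := allP al p pl.
case: (eqVneq p.1 x) h => [<- _//|_ /= /eqP <-].
by rewrite rs.
Qed.

End ChainExists.

(** The graph that a pattern draws on its image. Points identified by v merge, so it can be
    connected although the graph on W is not. *)
Definition imrel (W J : finType) (eW : rel W) (v : {ffun W -> J}) : rel J :=
  fun x y => [exists i, exists j, [&& eW i j, v i == x & v j == y]].

Lemma imrelP (W J : finType) (eW : rel W) (v : {ffun W -> J}) x y :
  reflect (exists i j, [/\ eW i j, v i = x & v j = y]) (imrel eW v x y).
Proof.
apply: (iffP existsP) => [[i /existsP[j /and3P[h /eqP h1 /eqP h2]]]|[i [j [h h1 h2]]]].
  by exists i, j.
by exists i; apply/existsP; exists j; rewrite h h1 h2 !eqxx.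
Qed.

Lemma imrel_sym (W J : finType) (eW : rel W) (v : {ffun W -> J}) :
  symmetric eW -> symmetric (imrel eW v).
Proof.
move=> es x y; apply/imrelP/imrelP => -[i [j [h h1 h2]]]; exists j, i;
  by rewrite es.
Qed.

Lemma connect_imrel (W J : finType) (eW : rel W) (v : {ffun W -> J}) i j :
  connect eW i j -> connect (imrel eW v) (v i) (v j).
Proof.
move=> /connectP[p]; elim: p i => [|k p IH] i /=; first by move=> _ ->.
move=> /andP[eik pk] jl; apply: (connect_trans (y := v k)).
  by apply: connect1; apply/imrelP; exists i, k.
exact: IH.
Qed.

Lemma chain_image (W J : finType) (eW : rel W) (v : {ffun W -> J}) (i0 : W) :
  (forall i, connect (imrel eW v) (v i0) (v i)) ->
  exists l, [/\ chain (v i0) l, all (fun p => imrel eW v p.1 p.2) l,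
    size l = #|imf v|.-1 & verts (v i0) l =i imf v].
Proof.
move=> H; apply: chain_exists.
- by rewrite inE codom_f.
- by move=> y; rewrite inE => /codomP[i ->]; exact: H.
- by move=> x y /imrelP[i [j [_ _ <-]]]; rewrite inE codom_f.
Qed.

(** * Overlapping pairs and quadruples of patterns *)

Section Splitting.
Context (W W' J : finType).

Definition fl (v : {ffun (W + W')%type -> J}) : {ffun W -> J} := [ffun i => v (inl i)].
Definition fr (v : {ffun (W + W')%type -> J}) : {ffun W' -> J} := [ffun i => v (inr i)].

Lemma sum_split (R : nmodType) (P : {ffun W -> J} -> {ffun W' -> J} -> bool)
    (F : {ffun W -> J} -> {ffun W' -> J} -> R) :
  \sum_(p : {ffun W -> J} * {ffun W' -> J} | P p.1 p.2) F p.1 p.2 =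
  \sum_(v | P (fl v) (fr v)) F (fl v) (fr v).
Proof.
pose h (v : {ffun (W + W')%type -> J}) := (fl v, fr v).
pose h' (p : {ffun W -> J} * {ffun W' -> J}) : {ffun (W + W')%type -> J} :=
  [ffun s => match s with inl i => p.1 i | inr i => p.2 i end].
rewrite (reindex h)//; exists h'.
  by move=> v _; apply/ffunP => -[i|i]; rewrite !ffunE.
by move=> [u v] _; congr (_, _); apply/ffunP => i; rewrite !ffunE.
Qed.

Lemma pull_fl (v : {ffun (W + W')%type -> J}) (g : arr J) : pull (fl v) g = pull inl (pull v g).
Proof. by rewrite pull_comp; apply: eq_pull => i; rewrite ffunE. Qed.

Lemma pull_fr (v : {ffun (W + W')%type -> J}) (g : arr J) : pull (fr v) g = pull inr (pull v g).
Proof. by rewrite pull_comp; apply: eq_pull => i; rewrite ffunE. Qed.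

End Splitting.

Lemma fl_comp (W W' J J' : finType) (b : J -> J') (v : {ffun (W + W')%type -> J}) :
  fl [ffun i => b (v i)] = [ffun i => b (fl v i)].
Proof. by apply/ffunP => i; rewrite !ffunE. Qed.

Lemma fr_comp (W W' J J' : finType) (b : J -> J') (v : {ffun (W + W')%type -> J}) :
  fr [ffun i => b (v i)] = [ffun i => b (fr v i)].
Proof. by apply/ffunP => i; rewrite !ffunE. Qed.

Definition Bpair (R : realType) (W W' : finType) (B : arr W -> R) (B' : arr W' -> R)
  (a : arr (W + W')%type) : R := B (pull inl a) * B' (pull inr a).

(** An overlapping pair of embeddings coded as one map on [I + I]; [pat4] codes an overlapping pair
    of such pairs. In this way [ZZ] and the overlapping part of its square are both sums [FZ]. *)
Definition pat2 (I : finType) (J : finType) (v : {ffun (I + I)%type -> J}) : bool :=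
  [&& injectiveb (fl v), injectiveb (fr v) & meets (fl v) (fr v)].

Definition pat4 (I : finType) (J : finType) (v : {ffun ((I + I) + (I + I))%type -> J}) : bool :=
  [&& pat2 (fl v), pat2 (fr v) & meets (fl v) (fr v)].

Lemma pat2_inj (I : finType) (J J' : finType) (b : J -> J') (v : {ffun (I + I)%type -> J}) :
  injective b -> pat2 [ffun i => b (v i)] = pat2 v.
Proof.
by move=> bi; rewrite /pat2 fl_comp fr_comp !injectiveb_comp// meets_comp.
Qed.

Lemma pat4_inj (I : finType) (J J' : finType) (b : J -> J') (v : {ffun ((I + I) + (I + I))%type -> J}) :
  injective b -> pat4 [ffun i => b (v i)] = pat4 v.
Proof.
by move=> bi; rewrite /pat4 fl_comp fr_comp !pat2_inj// meets_comp.
Qed.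

Lemma Bpair01 (R : realType) (W W' : finType) (B : arr W -> R) (B' : arr W' -> R) :
  (forall a, 0 <= B a <= 1) -> (forall a, 0 <= B' a <= 1) ->
  forall a, 0 <= Bpair B B' a <= 1.
Proof.
move=> h h' a; have /andP[h1 h2] := h (pull inl a); have /andP[h3 h4] := h' (pull inr a).
by rewrite mulr_ge0//= mulr_ile1.
Qed.

Section Instances.
Context {R : realType} (I : finType) (Phi : arr I -> R).

Lemma ZZ_FZ (J : finType) (g : arr J) : ZZ Phi g = FZ (Bpair Phi Phi) (@pat2 I) g.
Proof.
rewrite /ZZ /DD /FZ.
under eq_bigr do rewrite big_distrr/=.
rewrite pair_big_dep/=.
rewrite (sum_split (fun y z => injectiveb y && (injectiveb z && meets y z))
  (fun y z => Phi (pull y g) * Phi (pull z g))).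
by apply: eq_bigr => v _; rewrite pull_fl pull_fr.
Qed.

Lemma OVL_FZ (J : finType) (g : arr J) : OVL (Bpair Phi Phi) (@pat2 I) g =
  FZ (Bpair (Bpair Phi Phi) (Bpair Phi Phi)) (@pat4 I) g.
Proof.
rewrite /OVL /FZ.
rewrite (sum_split (fun y z => [&& pat2 y, pat2 z & meets y z])
  (fun y z => Bpair Phi Phi (pull y g) * Bpair Phi Phi (pull z g))).
by apply: eq_bigr => v _; rewrite pull_fl pull_fr.
Qed.

End Instances.

Definition esum (W W' : finType) (e : rel W) (e' : rel W') : rel (W + W')%type :=
  fun x y => match x, y with
    | inl i, inl j => e i j | inr i, inr j => e' i j | _, _ => false end.

Lemma esum_sym (W W' : finType) (e : rel W) (e' : rel W') :
  symmetric e -> symmetric e' -> symmetric (esum e e').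
Proof. by move=> es es' [i|i] [j|j] //=. Qed.

Section Unions.
Context (W W' J : finType) (e : rel W) (e' : rel W').

Lemma imrel_esum (v : {ffun (W + W')%type -> J}) x y :
  imrel (esum e e') v x y = imrel e (fl v) x y || imrel e' (fr v) x y.
Proof.
apply/imrelP/orP => [[[i|i] [[j|j] [//= h h1 h2]]]|[]/imrelP[i [j [h h1 h2]]]].
- by left; apply/imrelP; exists i, j; rewrite !ffunE.
- by right; apply/imrelP; exists i, j; rewrite !ffunE.
- by exists (inl i), (inl j); move: h1 h2; rewrite !ffunE.
- by exists (inr i), (inr j); move: h1 h2; rewrite !ffunE.
Qed.

Definition vconn (W : finType) (e : rel W) (v : {ffun W -> J}) :=
  forall i j, connect (imrel e v) (v i) (v j).

Lemma vconn_sum (v : {ffun (W + W')%type -> J}) : symmetric e -> symmetric e' ->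
  vconn e (fl v) -> vconn e' (fr v) -> meets (fl v) (fr v) -> vconn (esum e e') v.
Proof.
move=> es es' cl cr /existsP[a /existsP[b /eqP ab]].
set r := imrel (esum e e') v.
have rs : connect_sym r by apply: sym_connect_sym; apply: imrel_sym; exact: esum_sym.
have sl : subrel (connect (imrel e (fl v))) (connect r).
  by apply: connect_sub => x y h; apply: connect1; rewrite /r imrel_esum h.
have sr : subrel (connect (imrel e' (fr v))) (connect r).
  by apply: connect_sub => x y h; apply: connect1; rewrite /r imrel_esum h orbT.
have ca i : connect r (fl v a) (v i).
  case: i => i.
    have -> : v (inl i) = fl v i by rewrite ffunE.
    exact: sl.
  have -> : v (inr i) = fr v i by rewrite ffunE.
  by rewrite ab; exact: sr.
move=> i j; apply: (connect_trans (y := fl v a)); last exact: ca.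
by rewrite rs; exact: ca.
Qed.

Lemma card_imf_sum (v : {ffun (W + W')%type -> J}) : meets (fl v) (fr v) ->
  (#|imf v| < #|imf (fl v)| + #|imf (fr v)|)%N.
Proof.
move=> /existsP[a /existsP[b /eqP ab]].
have -> : imf v = imf (fl v) :|: imf (fr v).
  apply/setP => x; rewrite !inE; apply/codomP/orP => [[[i|i] ->]|[]/codomP[i ->]].
  - by left; apply/codomP; exists i; rewrite ffunE.
  - by right; apply/codomP; exists i; rewrite ffunE.
  - by exists (inl i); rewrite ffunE.
  - by exists (inr i); rewrite ffunE.
rewrite finset.cardsU.
have : (0 < #|imf (fl v) :&: imf (fr v)|)%N.
  by apply/card_gt0P; exists (fl v a); rewrite !inE codom_f ab codom_f.
have : (0 < #|imf (fl v)|)%N by apply/card_gt0P; exists (fl v a); rewrite inE codom_f.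
have : (#|imf (fl v) :&: imf (fr v)| <= #|imf (fl v)|)%N by apply: subset_leq_card; exact: finset.subsetIl.
lia.
Qed.

End Unions.

Lemma card_imf_le (W J : finType) (v : {ffun W -> J}) : (#|imf v| <= #|W|)%N.
Proof. by rewrite cardsE; exact: leq_image_card. Qed.

Lemma card_cset (T : finType) (p : pred T) :
  #|[set x | p x]%classic| = #|[set x | p x]%SET|.
Proof.
apply: eq_card => x; rewrite [RHS]inE; apply/idP/idP; first by move/set_mem.
by move=> px; apply/mem_set.
Qed.

(** * Kernels of the tree counts and their connected unions *)

Section TreeKernel.
Context {R : realType} (k : nat) (e : rel 'I_k).
Hypothesis k2 : (2 <= k)%N.
Hypothesis te : is_tree e.

Let I := ('I_k : finType).
Let es : symmetric e. Proof. by case: te => -[]. Qed.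
Let ec (i j : 'I_k) : connect e i j. Proof. by case: te => _ []. Qed.
Let eirr : irreflexive e. Proof. by case: te => -[]. Qed.

Definition marked (J : finType) (g : arr J) (x : J) := g (x, x).
(** Entries of an array carry no symmetry, so the upper bounds accept an edge in either orientation,
    while the lower bound uses [ladj], which asks for both. *)
Definition adj (J : finType) (g : arr J) (p : J * J) := g p || g (p.2, p.1).
Definition madj (J : finType) (g : arr J) (p : J * J) := [&& adj g p, marked g p.1 & marked g p.2].

(** [Phi1] is the kernel of the unrestricted count, [PhiM] that of the trees with all vertices
    marked, and [PhiD] that of the trees with some unmarked vertex. *)
Definition Phi1 (a : arr I) : R :=
  \prod_(p : 'I_k * 'I_k | (p.1 < p.2)%N && e p.1 p.2) (a p)%:R.
Definition PhiM (a : arr I) : R :=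
  \prod_(p : 'I_k * 'I_k | (p.1 < p.2)%N && e p.1 p.2) [&& a p, marked a p.1 & marked a p.2]%:R.
Definition PhiD (a : arr I) : R := Phi1 a - PhiM a.

Lemma prod_bool (T : finType) (P : pred T) (b : T -> bool) :
  \prod_(p | P p) (b p)%:R = [forall p, P p ==> b p]%:R :> R.
Proof.
case: (boolP [forall p, P p ==> b p]) => [/forallP H|].
  by rewrite big1// => p Pp; have := H p; rewrite Pp /= => ->.
rewrite negb_forall => /existsP[p]; rewrite negb_imply => /andP[Pp bp].
by rewrite (bigD1 p)//= (negbTE bp) mul0r.
Qed.

Lemma bool01 (b : bool) : 0 <= (b%:R : R) <= 1.
Proof. by case: b; rewrite ?lexx ?ler01. Qed.

Lemma Phi1_01 a : 0 <= Phi1 a <= 1. Proof. by rewrite /Phi1 prod_bool bool01. Qed.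
Lemma PhiM_01 a : 0 <= PhiM a <= 1. Proof. by rewrite /PhiM prod_bool bool01. Qed.

Lemma e_lt i j : e i j -> (i < j)%N || (j < i)%N.
Proof.
by case: (ltngtP i j) => // /val_inj ->; rewrite eirr.
Qed.

Definition allE (W : finType) (eW : rel W) (b : W * W -> bool) :=
  [forall p : W * W, eW p.1 p.2 ==> b p].

Lemma PhiM_le a : PhiM a <= (allE e (madj a))%:R.
Proof.
rewrite /PhiM prod_bool ler_nat; case: (boolP [forall p, _]) => // /forallP H.
suff -> : allE e (madj a) by [].
apply/forallP => -[i j] /=; apply/implyP => eij.
have := e_lt eij => /orP[h|h].
  have := H (i, j); rewrite /= h eij /= /madj /adj => /and3P[-> h1 h2].
  by rewrite h1 h2.
have := H (j, i); rewrite /= h es eij /= /madj /adj => /and3P[-> h1 h2].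
by rewrite h1 h2 orbT.
Qed.

Lemma Phi1_le a : Phi1 a <= (allE e (adj a))%:R.
Proof.
rewrite /Phi1 prod_bool ler_nat; case: (boolP [forall p, _]) => // /forallP H.
suff -> : allE e (adj a) by [].
apply/forallP => -[i j] /=; apply/implyP => eij.
have := e_lt eij => /orP[h|h].
  by have := H (i, j); rewrite /= h eij /= /adj => ->.
by have := H (j, i); rewrite /= h es eij /= /adj => ->; rewrite orbT.
Qed.

Lemma PhiD_01 a : 0 <= PhiD a <= 1.
Proof.
rewrite /PhiD /Phi1 /PhiM !prod_bool.
have : ([forall p : 'I_k * 'I_k, ((p.1 < p.2)%N && e p.1 p.2) ==> [&& a p, marked a p.1 & marked a p.2]] ->
  [forall p : 'I_k * 'I_k, ((p.1 < p.2)%N && e p.1 p.2) ==> a p]).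
  move=> /forallP H; apply/forallP => p; apply/implyP => h.
  by have := H p; rewrite h => /and3P[].
set A := [forall p, _ ==> a p]; set M := [forall p, _ ==> [&& a p, _ & _]].
case: M => [/(_ isT) ->|_]; first by rewrite subrr lexx ler01.
by rewrite subr0 bool01.
Qed.

(** Union bound over the vertex that violates the mark. *)
Lemma PhiD_le a : PhiD a <= \sum_(i : 'I_k) (allE e (adj a) && ~~ marked a i)%:R.
Proof.
have : Phi1 a <= (allE e (adj a))%:R := Phi1_le a.
rewrite /PhiD /Phi1 /PhiM !prod_bool.
case: (boolP [forall p, _]) => [/forallP h1 H|_ _]; last first.
  apply: (@le_trans _ _ 0); first by rewrite sub0r oppr_le0.
  exact: sumr_ge0.
case: (boolP [forall p, _]) => [_|]; first by rewrite subrr; exact: sumr_ge0.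
rewrite subr0 negb_forall => /existsP[p]; rewrite negb_imply => /andP[hp].
have := h1 p; rewrite hp /= => -> /=.
have -> : allE e (adj a) by move: H; case: (allE _ _) => //; rewrite ler10.
rewrite negb_and => /orP[h|h].
  by rewrite (bigD1 p.1)//= h lerDl sumr_ge0.
by rewrite (bigD1 p.2)//= h lerDl sumr_ge0.
Qed.

Lemma allE_esum (W W' : finType) (eW : rel W) (eW' : rel W') (J : finType)
    (v : {ffun (W + W')%type -> J}) (b : J * J -> bool) :
  allE eW (fun p => b (fl v p.1, fl v p.2)) -> allE eW' (fun p => b (fr v p.1, fr v p.2)) ->
  allE (esum eW eW') (fun p => b (v p.1, v p.2)).
Proof.
move=> /forallP H /forallP H'; apply/forallP => -[[i|i] [j|j]] //=.
  by have := H (i, j); rewrite /= !ffunE.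
by have := H' (i, j); rewrite /= !ffunE.
Qed.

Lemma allE_pull (W J : finType) (eW : rel W) (v : {ffun W -> J}) (g : arr J) :
  allE eW (adj (pull v g)) = allE eW (fun p => adj g (v p.1, v p.2)).
Proof. by apply: eq_forallb => -[i j]; rewrite /adj !ffunE. Qed.

Lemma allE_mpull (W J : finType) (eW : rel W) (v : {ffun W -> J}) (g : arr J) :
  allE eW (madj (pull v g)) = allE eW (fun p => madj g (v p.1, v p.2)).
Proof. by apply: eq_forallb => -[i j]; rewrite /madj /adj /marked !ffunE. Qed.

Lemma allE_chain (W J : finType) (eW : rel W) (v : {ffun W -> J}) (b : J * J -> bool) l :
  all (fun p => imrel eW v p.1 p.2) l -> allE eW (fun p => b (v p.1, v p.2)) -> all b l.
Proof.
move=> /allP al /forallP H; apply/allP => -[x y] /al /imrelP[i [j [eij /= <- <-]]].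
by have := H (i, j); rewrite /= eij.
Qed.

Lemma vconn_tree (J : finType) (u : {ffun I -> J}) : vconn e u.
Proof. by move=> i j; apply: connect_imrel; exact: ec. Qed.

Let e2 := esum e e.
Let e4 := esum e2 e2.

Lemma vconn_pat2 (J : finType) (v : {ffun (I + I)%type -> J}) : pat2 v -> vconn e2 v.
Proof.
by move=> /and3P[_ _ m]; apply: vconn_sum => //; exact: vconn_tree.
Qed.

Lemma vconn_pat4 (J : finType) (v : {ffun ((I + I) + (I + I))%type -> J}) : pat4 v -> vconn e4 v.
Proof.
move=> /and3P[h1 h2 m].
by apply: vconn_sum => //; [exact: esum_sym|exact: esum_sym|exact: vconn_pat2|exact: vconn_pat2].
Qed.

Lemma card_pat2 (J : finType) (v : {ffun (I + I)%type -> J}) : pat2 v -> (#|imf v| <= (2 * k).-1)%N.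
Proof.
move=> /and3P[_ _ m]; have := card_imf_sum m.
have := card_imf_le (fl v); have := card_imf_le (fr v); rewrite !card_ord; lia.
Qed.

Lemma card_pat4 (J : finType) (v : {ffun ((I + I) + (I + I))%type -> J}) : pat4 v ->
  (#|imf v| <= 4 * k - 3)%N.
Proof.
move=> /and3P[h1 h2 m]; have := card_imf_sum m.
have := card_pat2 h1; have := card_pat2 h2; lia.
Qed.

Lemma imf_gt0 (W J : finType) (v : {ffun W -> J}) (i : W) : (0 < #|imf v|)%N.
Proof. by apply/card_gt0P; exists (v i); rewrite inE codom_f. Qed.

Let i0 : I := Ordinal (ltnW k2).

Lemma imrel_deg (J : finType) (u : {ffun I -> J}) x : injectiveb u ->
  (#|[set y | imrel e u x y]%SET| <= max_degree e)%N.
Proof.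
move=> /injectiveP ui.
case: (pickP (fun i => u i == x)) => [i /eqP ux|none].
  apply: (@leq_trans (degree e i)); last exact: (leq_bigmax i).
  apply: (@leq_trans #|u @: [set j | e i j]%SET|); last by rewrite /degree card_cset; exact: leq_imset_card.
  apply/subset_leq_card/fintype.subsetP => y; rewrite inE => /imrelP[i' [j [eij]]].
  rewrite -ux => /ui E <-; apply: imset_f; by rewrite inE -E.
rewrite (_ : [set y | _]%SET = finset.set0) ?cards0//.
apply/setP => y; rewrite finset.in_set0 finset.in_set; apply/imrelP => -[i [j [_ h _]]].
by have := none i; rewrite h eqxx.
Qed.

Section Bounds.
Variable L : array_law R.

(** Four copies of the tree joined by three overlaps have a connected image of at most 4k - 3
    points. Only the edges of a spanning chain are kept, one fewer than the points. *)
Lemma OV_upper (q : R) (lam : R) : 0 <= lam -> 0 <= q ->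
  (forall (J : finType) (x0 : J) l, chain x0 l ->
     E L (fun g => (all (madj g) l)%:R) <= q ^+ (size l)) ->
  EE L lam (fun m (g : arr (ordX m)) => OVL (Bpair PhiM PhiM) (@pat2 I) g) <=
  \sum_(r < 4 * k - 3) lam ^+ r.+1 * (r.+1%:R ^+ (4 * k) * q ^+ r).
Proof.
move=> lam0 q0 H.
rewrite (EE_eq _ _ (fun m g => OVL_FZ PhiM g)).
have := @FZ_upper R L lam lam0 _ (Bpair (Bpair PhiM PhiM) (Bpair PhiM PhiM)) _ (@pat4_inj I) q 1 (4 * k - 3) q0 ler01.
have -> : (#|{: (I + I) + (I + I)}| = 4 * k)%N by rewrite !card_sum !card_ord; lia.
move=> HH; rewrite (eq_bigr (fun r : 'I_(4 * k - 3) => lam ^+ r.+1 * (r.+1%:R ^+ (4 * k) * (1 * q ^+ r)))); last first.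
  by move=> r _; rewrite mul1r.
apply: HH => J v pv; split; first by rewrite (imf_gt0 v (inl (inl i0))) card_pat4.
have [l [c al sl _]] := chain_image (vconn_pat4 pv (inl (inl i0))).
rewrite mul1r -sl; apply: le_trans (H _ _ _ c); apply: E_le => g.
apply: (@le_trans _ _ (allE e4 (fun p => madj g (v p.1, v p.2)))%:R); last first.
  by rewrite ler_nat; case: (boolP (allE _ _)) => // /(allE_chain al) ->.
have P01 (u : {ffun I -> J}) := PhiM_01 (pull u g).
have P0 (u : {ffun I -> J}) : 0 <= PhiM (pull u g) by case/andP: (P01 u).
have P1 (u : {ffun I -> J}) : PhiM (pull u g) <= (allE e (fun p => madj g (u p.1, u p.2)))%:R.
  by rewrite -allE_mpull; exact: PhiM_le.
have B2 (w : {ffun (I + I)%type -> J}) : Bpair PhiM PhiM (pull w g) <=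
   (allE e2 (fun p => madj g (w p.1, w p.2)))%:R.
  rewrite /Bpair -pull_fl -pull_fr.
  apply: (le_trans (ler_pM (P0 _) (P0 _) (P1 _) (P1 _))).
  rewrite -natrM mulnb ler_nat; case: (boolP (_ && _)) => // /andP[h1 h2].
  by rewrite (allE_esum h1 h2).
have B0 (w : {ffun (I + I)%type -> J}) : 0 <= Bpair PhiM PhiM (pull w g).
  by rewrite /Bpair -pull_fl -pull_fr mulr_ge0.
rewrite {1}/Bpair -pull_fl -pull_fr.
apply: (le_trans (ler_pM (B0 _) (B0 _) (B2 _) (B2 _))).
rewrite -natrM mulnb ler_nat; case: (boolP (_ && _)) => // /andP[h1 h2].
by rewrite (allE_esum h1 h2).
Qed.

(** Only the first of the two overlapping trees keeps its unmarked vertex, with k choices; in the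
    second, [PhiD] is bounded by the presence of the edges. An image vertex has at most [max_degree]
    neighbours from each tree, whence the factor 2. *)
Lemma ZD_upper (q eps : R) (lam : R) : 0 <= lam -> 0 <= q -> 0 <= eps ->
  (forall (J : finType) (x0 x : J) l, chain x0 l -> x \in verts x0 l ->
     (forall y, (cdeg l y <= 2 * max_degree e)%N) ->
     E L (fun g => (all (adj g) l && ~~ marked g x)%:R) <= eps * q ^+ (size l)) ->
  EE L lam (fun m (g : arr (ordX m)) => ZZ PhiD g) <=
  \sum_(r < (2 * k).-1) lam ^+ r.+1 * (r.+1%:R ^+ (2 * k) * (k%:R * eps * q ^+ r)).
Proof.
move=> lam0 q0 eps0 H.
rewrite (EE_eq _ _ (fun m g => ZZ_FZ PhiD g)).
have ke0 : 0 <= k%:R * eps by rewrite mulr_ge0.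
have := @FZ_upper R L lam lam0 _ (Bpair PhiD PhiD) _ (@pat2_inj I) q (k%:R * eps) (2 * k).-1 q0 ke0.
have -> : (#|{: I + I}| = 2 * k)%N by rewrite !card_sum !card_ord; lia.
apply=> J v pv; split; first by rewrite (imf_gt0 v (inl i0)) card_pat2.
have [l [c al sl lv]] := chain_image (vconn_pat2 pv (inl i0)).
have e2s : symmetric e2 by exact: esum_sym.
have deg y : (cdeg l y <= 2 * max_degree e)%N.
  apply: (leq_trans (cdeg_le _ (imrel_sym v e2s) c al)).
  case/and3P: pv => il ir _.
  apply: (@leq_trans #|[set z | imrel e (fl v) y z]%SET :|: [set z | imrel e (fr v) y z]%SET|).
    apply/subset_leq_card/fintype.subsetP => z.
    by rewrite finset.in_setU !finset.in_set imrel_esum.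
  apply: (leq_trans (leq_card_setU _ _)).
  by rewrite mul2n -addnn leq_add// imrel_deg.
rewrite -sl.
apply: (@le_trans _ _ (\sum_(i : 'I_k) E L (fun g => (all (adj g) l && ~~ marked g (v (inl i)))%:R))); last first.
  apply: (@le_trans _ _ (\sum_(i : 'I_k) eps * q ^+ size l)); last first.
    by rewrite sumr_const card_ord -[_ *+ k]mulr_natl mulrA.
  apply: ler_sum => i _; apply: H c _ deg.
  by rewrite lv inE codom_f.
rewrite -E_sum; apply: E_le => g.
rewrite /Bpair -pull_fl -pull_fr.
have D01 (u : {ffun I -> J}) := PhiD_01 (pull u g).
have D1 (u : {ffun I -> J}) : PhiD (pull u g) <= (allE e (fun p => adj g (u p.1, u p.2)))%:R.
  have := Phi1_le (pull u g); rewrite allE_pull; apply: le_trans.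
  by rewrite lerBlDr lerDl; case/andP: (PhiM_01 (pull u g)).
apply: (@le_trans _ _ ((\sum_(i : 'I_k) (allE e (adj (pull (fl v) g)) && ~~ marked (pull (fl v) g) i)%:R)
   * (allE e (fun p => adj g (fr v p.1, fr v p.2)))%:R)).
  apply: ler_pM; [by case/andP: (D01 (fl v))|by case/andP: (D01 (fr v))| |exact: D1].
  exact: PhiD_le.
rewrite big_distrl/=; apply: ler_sum => i _.
rewrite -natrM mulnb ler_nat allE_pull.
case: (boolP (_ && _)) => // /andP[/andP[h1 h2] h3].
rewrite (allE_chain al (allE_esum h1 h3)) /=.
by move: h2; rewrite /marked !ffunE => ->.
Qed.

(** A spanning chain has k - 1 distinct unoriented edges, and a tree has exactly that many, so every
    edge of the tree occurs in it. *)
Lemma tree_chain : exists l : seq ('I_k * 'I_k), [/\ chain i0 l, size l = k.-1 &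
  forall p : 'I_k * 'I_k, e p.1 p.2 -> (p \in l) || ((p.2, p.1) \in l)].
Proof.
have [//|y _|x y _|l [c al sl _]] := @chain_exists 'I_k e i0 [set: 'I_k]%SET; rewrite ?inE//.
rewrite cardsT card_ord in sl.
exists l; split => //.
pose f (p : 'I_k * 'I_k) := if (p.1 < p.2)%N then p else (p.2, p.1).
pose Es := [set p : 'I_k * 'I_k | (p.1 < p.2)%N && e p.1 p.2]%SET.
have fmem p l' : chain i0 l' -> p \in l' -> (f p).1 \in verts i0 l' /\ (f p).2 \in verts i0 l'.
  by move=> c' /(chain_mem c') /andP[h1 h2]; rewrite /f; case: ifP.
have uf l' : chain i0 l' -> uniq (map f l').
  elim: l' => //= p l' IH /and3P[c' wl vl]; rewrite (IH c') andbT.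
  apply/negP => /mapP[p' /(fmem _ _ c')[h1 h2]] E; move: vl; rewrite -E in h1 h2.
  by move: h1 h2; rewrite /f; case: ifP => _ /= h1 h2; rewrite ?h1 ?h2.
have sub : {subset map f l <= Es}.
  move=> q /mapP[p /(allP al)/= ep ->]; rewrite inE /f.
  have := e_lt ep; case: ifP => /= [h _|_ /= h]; first by rewrite h.
  by rewrite h es.
have cE : #|Es| = k.-1 by case: te => _ [_]; rewrite card_cset.
have EE' : map f l =i Es.
  apply/subset_cardP; last by apply/fintype.subsetP.
  by move/card_uniqP: (uf l c) => ->; rewrite size_map sl cE.
move=> [i j] /= eij.
have := e_lt eij => /orP[h|h].
  have : (i, j) \in map f l by rewrite EE' inE /= h.
  move=> /mapP[[a b] pl]; rewrite /f /=; case: ifP => _ [-> ->]; by rewrite pl ?orbT.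
have : (j, i) \in map f l by rewrite EE' inE /= h es.
move=> /mapP[[a b] pl]; rewrite /f /=; case: ifP => _ [-> ->]; by rewrite pl ?orbT.
Qed.

Definition ladj (J : finType) (g : arr J) (p : J * J) :=
  [&& g p, g (p.2, p.1), marked g p.1 & marked g p.2].

(** A second copy of the tree without its vertex i0, which is identified with that of the first
    copy: together they form the glued tree on 2k - 1 points. *)
Let sT := {i : 'I_k | i != i0}.
Let J0 : finType := (I + sT)%type.
Let vr (i : 'I_k) : J0 := if insub i is Some x then inr x else inl i0.

Let vr_inj : injective vr.
Proof.
move=> i j; rewrite /vr; case: insubP => [x xi vx|xi]; case: insubP => [y yj vy|yj] //.
  by move=> [E]; rewrite -vx -vy E.
by move: xi yj; rewrite !negbK => /eqP -> /eqP ->.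
Qed.

Let vr_i0 : vr i0 = inl i0.
Proof. by rewrite /vr; case: insubP => //= x; rewrite eqxx. Qed.

Let vr_inl i j : vr i = inl j -> i = i0 /\ j = i0.
Proof.
rewrite /vr; case: insubP => [//|]; rewrite negbK => /eqP ->.
by move=> [->].
Qed.

Let v0 : {ffun (I + I)%type -> J0} := [ffun s => match s with inl i => inl i | inr i => vr i end].

Let pat_v0 : pat2 v0.
Proof.
apply/and3P; split.
- by apply/injectiveP => i j; rewrite !ffunE => -[].
- by apply/injectiveP => i j; rewrite !ffunE => /vr_inj.
- by apply/existsP; exists i0; apply/existsP; exists i0; rewrite !ffunE vr_i0.
Qed.

Let imf_v0 : imf v0 = [set: J0]%SET.
Proof.
apply/setP => -[i|x]; rewrite !inE; apply/codomP.
  by exists (inl i); rewrite ffunE.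
exists (inr (val x)); rewrite ffunE /vr; case: insubP => [y _ /val_inj ->//|].
by rewrite (valP x).
Qed.

Let card_J0 : #|J0| = (2 * k).-1.
Proof.
rewrite card_sum card_sig card_ord.
rewrite (eq_card (B := predC1 i0)) // cardC1 card_ord; lia.
Qed.

(** The glued pair is again a tree: a chain for the second copy, rooted at the shared vertex, is
    stacked on a chain for the first, and the hypothesis on chains bounds the probability that all
    edges of both are present. *)
Lemma Z_lower (c1 c2 lam : R) : 0 <= lam -> 0 <= c1 -> 0 <= c2 ->
  (forall (J : finType) (x0 : J) l, chain x0 l ->
     c1 * c2 ^+ size l <= E L (fun g => (all (ladj g) l)%:R)) ->
  lam ^+ (2 * k).-1 / ((2 * k).-1)`!%:R * (c1 * c2 ^+ (2 * k.-1)) <=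
  EE L lam (fun m (g : arr (ordX m)) => ZZ PhiM g).
Proof.
move=> lam0 c10 c20 H.
rewrite (EE_eq _ _ (fun m g => ZZ_FZ PhiM g)).
have := @FZ_lower R L lam lam0 _ (Bpair PhiM PhiM) _ (Bpair01 PhiM_01 PhiM_01) (@pat2_inj I) _ _ pat_v0 imf_v0.
rewrite card_J0; apply: le_trans.
rewrite ler_wpM2l ?divr_ge0 ?exprn_ge0//.
have [l [c sl el]] := tree_chain.
pose l1 : seq (J0 * J0) := [seq (inl p.1, inl p.2) | p <- l].
pose l2 : seq (J0 * J0) := [seq (vr p.1, vr p.2) | p <- l].
have v1 l' : verts (inl i0 : J0) [seq (inl p.1, inl p.2) | p <- l'] = [seq inl i | i <- verts i0 l'].
  by rewrite /verts map_cat -!map_comp.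
have c1' l' : chain i0 l' -> chain (inl i0 : J0) [seq (inl p.1, inl p.2) | p <- l'].
  elim: l' => //= p l' IH /and3P[/IH -> wl vl] /=.
  rewrite v1 !mem_map ?wl ?vl//; exact: inl_inj.
have v2 l' : verts (inl i0 : J0) ([seq (vr p.1, vr p.2) | p <- l'] ++ l1) =i
    [seq vr i | i <- verts i0 l'] ++ [seq inl i | i <- verts i0 l].
  move=> x; rewrite [in LHS]/verts map_cat -catA -[X in _ ++ X]/(verts (inl i0 : J0) l1) v1 !mem_cat.
  have -> : [seq vr i | i <- verts i0 l'] = [seq vr i | i <- [seq p.2 | p <- l']] ++ [:: inl i0].
    by rewrite /verts map_cat -vr_i0.
  rewrite mem_cat -!map_comp mem_seq1 -orbA; congr (_ || _).
  case: (eqVneq x (inl i0)) => [->|//].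
  by rewrite /= mem_map ?x0_verts//; exact: inl_inj.
have c2' l' : chain i0 l' -> chain (inl i0 : J0) ([seq (vr p.1, vr p.2) | p <- l'] ++ l1).
  elim: l' => [_|p l' IH] /=; first exact: c1' c.
  move=> /and3P[/IH -> wl vl] /=.
  rewrite !v2 !mem_cat !(mem_map vr_inj) wl /= negb_or vl /=; apply/negP => /mapP[j _] /vr_inl[pi0 _].
  by move: vl; rewrite pi0 x0_verts.
have := H J0 (inl i0) (l2 ++ l1) (c2' l c).
rewrite size_cat !size_map sl addnn -mul2n => /le_trans; apply.
apply: E_le => g; rewrite /Bpair -pull_fl -pull_fr /PhiM !prod_bool.
rewrite -natrM mulnb ler_nat all_cat.
case: (boolP (_ && _)) => // /andP[/allP a2 /allP a1].
have hl (u : 'I_k -> J0) (b : {ffun I -> J0}) : (forall p, p \in l -> ladj g (u p.1, u p.2)) ->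
   (forall i, b i = u i) ->
   [forall p : 'I_k * 'I_k, ((p.1 < p.2)%N && e p.1 p.2) ==>
     [&& pull b g p, marked (pull b g) p.1 & marked (pull b g) p.2]].
  move=> a bu; apply/forallP => -[i j] /=; apply/implyP => /andP[_ eij].
  rewrite /marked !ffunE /= !bu.
  have := el (i, j) eij => /orP[] /a; rewrite /ladj /marked /= => /and4P[h1 h2 h3 h4];
    by rewrite ?h1 ?h2 ?h3 ?h4.
rewrite (hl inl)//; last 2 first.
- by move=> p pl; apply: a1; apply/mapP; exists p.
- by move=> i; rewrite !ffunE.
rewrite (hl vr)//.
- by move=> p pl; apply: a2; apply/mapP; exists p.
- by move=> i; rewrite !ffunE.
Qed.

End Bounds.

End TreeKernel.

(** * The law of the coordinates *)

Section CylinderSpace.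
Context (R : realType) (I : choiceType).

Definition rect (J : seq I) (B : I -> set R) : set (I -> R) :=
  [set u | forall i, i \in J -> B i (u i)].

Definition rects : set (set (I -> R)) :=
  [set A | exists J B, (forall i, measurable (B i)) /\ A = rect J B].

(** The product sigma-algebra on R^I. Once the process is transported there, independence and the
    one-dimensional marginals determine its law by [law_unique]. *)
Definition seqspace := g_sigma_algebraType rects.

Lemma rects_measurable : rects `<=` @measurable _ seqspace.
Proof. exact: sub_sigma_algebra. Qed.

Lemma measurable_rect J B : (forall i, measurable (B i)) -> @measurable _ seqspace (rect J B).
Proof. by move=> mB; apply: rects_measurable; exists J, B. Qed.

Lemma measurable_coord (i : I) : measurable_fun setT (fun u : seqspace => u i).
Proof.
move=> _ A mA; rewrite setTI.
have -> : (fun u : seqspace => u i) @^-1` A = rect [:: i] (fun=> A).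
  apply/seteqP; split => u /=; first by move=> Aui j; rewrite inE => /eqP ->.
  by apply; rewrite inE.
exact: measurable_rect.
Qed.

Lemma rects_setI : setI_closed rects.
Proof.
move=> _ _ [J [B [mB ->]]] [J' [B' [mB' ->]]].
exists (J ++ J'), (fun i => (if i \in J then B i else setT) `&` (if i \in J' then B' i else setT)).
split.
  by move=> i; apply: measurableI; case: ifP.
apply/seteqP; split => u /=.
  move=> [h1 h2] i _; split; case: ifP => // iJ; [exact: h1|exact: h2].
move=> h; split => i iJ.
  by have := h i; rewrite mem_cat iJ => /(_ isT)[].
by have := h i; rewrite mem_cat iJ orbT => /(_ isT)[].
Qed.

Lemma law_unique (m1 m2 : probability seqspace R) :
  (forall J B, uniq J -> (forall i, measurable (B i)) -> m1 (rect J B) = m2 (rect J B)) ->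
  forall A, measurable A -> m1 A = m2 A.
Proof.
move=> H; have H' J B : (forall i, measurable (B i)) -> m1 (rect J B) = m2 (rect J B).
  move=> mB; have -> : rect J B = rect (undup J) B.
    by apply/seteqP; split => u h i; have := h i; rewrite mem_undup.
  by apply: H => //; exact: undup_uniq.
move=> A mA.
refine (@measure_unique _ R seqspace rects (fun=> setT) _ _ _ _ m1 m2 _ _ A mA) => //.
- exact: rects_setI.
- move=> _; exists [::], (fun=> setT); split => //.
  by apply/seteqP; split.
- by rewrite bigcup_const.
- by move=> _ [J [B [mB ->]]]; exact: H'.
- by move=> n; rewrite /= probability_setT ltry.
Qed.

Lemma measurable_to_seqspace d (T : measurableType d) (f : T -> seqspace) :
  (forall i, measurable_fun setT (fun w => f w i)) -> measurable_fun setT f.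
Proof.
move=> mf; apply: (@measurability _ _ T seqspace setT f rects) => //.
move=> _ [_ [J [B [mB ->]]] <-]; rewrite setTI.
have -> : f @^-1` rect J B = \bigcap_(i in [set` J]) ((fun w => f w i) @^-1` B i).
  by apply/seteqP; split => w /= h i iJ; exact: h.
apply: fin_bigcap_measurable => //.
by move=> i _; rewrite -[X in measurable X]setTI; exact: mf.
Qed.

End CylinderSpace.

Section ProductLaw.
Context (R : realType) (I : choiceType) (Lam : probability (seqspace R I) R).
Local Notation U := (seqspace R I).
Let nu (i : I) (B : set R) := Lam [set u : U | B (u i)].
Hypothesis prodlaw : forall J B, uniq J -> (forall i, measurable (B i)) ->
  Lam (rect J B) = (\prod_(i <- J) nu i (B i))%E.

(** Coordinates in D are kept, the others resampled. A product law is preserved by this, so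
    integrating over the second argument with the first one fixed plays the role of conditioning on
    the coordinates in D. *)
Definition merge (D : pred I) (p : U * U) : U := fun i => if D i then p.1 i else p.2 i.

Lemma measurable_merge D : measurable_fun setT (merge D).
Proof.
apply: measurable_to_seqspace => i; rewrite /merge; case: (D i).
  by apply: (measurableT_comp (measurable_coord (R := R) i)); exact: measurable_fst.
by apply: (measurableT_comp (measurable_coord (R := R) i)); exact: measurable_snd.
Qed.

Definition mk_mfun d d' (T : measurableType d) (T' : measurableType d') (f : T -> T')
  (mf : measurable_fun setT f) : {mfun T >-> T'} := mfun_Sub (mem_set mf).

Lemma merge_law (D : pred I) A : measurable A -> Lam A = (Lam \x Lam)%E (merge D @^-1` A).
Proof.
pose m2 : probability U R := distribution (Lam \x Lam)%E (mk_mfun (measurable_merge D)).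
suff H J B : uniq J -> (forall i, measurable (B i)) -> Lam (rect J B) = m2 (rect J B).
  by move: A; apply: (law_unique H).
move=> uJ mB; rewrite /m2 /distribution /pushforward /=.
have -> : mfun_Sub (mem_set (measurable_merge D)) @^-1` rect J B =
    rect (seq.filter D J) B `*` rect (seq.filter (predC D) J) B.
  apply/seteqP; split => -[u v] /=.
    move=> h; split => i; rewrite mem_filter => /andP[Di iJ]; have := h i iJ; rewrite /merge.
      by rewrite Di.
    by rewrite /= in Di; rewrite (negbTE Di).
  move=> [h1 h2] i iJ; rewrite /merge; case: ifPn => Di.
    by apply: h1; rewrite mem_filter Di iJ.
  by apply: h2; rewrite mem_filter /= Di iJ.
rewrite product_measure1E ?measurable_rect//; [|exact: measurable_rect|exact: measurable_rect].
rewrite prodlaw//.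
transitivity ((\prod_(i <- seq.filter D J) nu i (B i)) * (\prod_(i <- seq.filter (predC D) J) nu i (B i)))%E.
  by rewrite !big_filter (bigID D).
by congr (_ * _)%E; apply: esym; apply: prodlaw => //; exact: filter_uniq.
Qed.

Lemma merge_integral (D : pred I) (f : U -> \bar R) : measurable_fun [set: U] f ->
  (forall u, (0 <= f u)%E) ->
  (\int[Lam]_u f u = \int[Lam]_u \int[Lam]_v f (merge D (u, v)))%E.
Proof.
move=> mf f0.
pose m2 : probability U R := distribution (Lam \x Lam)%E (mk_mfun (measurable_merge D)).
rewrite (@eq_measure_integral _ _ _ _ m2); last first.
  by move=> A mA _; exact: (merge_law D mA).
rewrite ge0_integral_distribution//.
have mfm : measurable_fun [set: U * U] (f \o merge D).
  by apply: measurableT_comp => //; exact: measurable_merge.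
exact: (@fubini_tonelli1 _ _ U U R Lam Lam (f \o merge D) mfm (fun p => f0 _)).
Qed.

Lemma merge_indep (D : pred I) (A A' : set U) : measurable A -> measurable A' ->
  (forall u v, (forall i, D i -> u i = v i) -> A u -> A v) ->
  (forall u v, (forall i, ~~ D i -> u i = v i) -> A' u -> A' v) ->
  Lam (A `&` A') = (Lam A * Lam A')%E.
Proof.
move=> mA mA' hA hA'; rewrite (merge_law D); last exact: measurableI.
rewrite -product_measure1E//; congr ((_ \x _)%E _).
apply/seteqP; split => -[u v] /= [h1 h2]; split.
- by apply: hA h1 => i Di; rewrite /merge Di.
- by apply: hA' h2 => i Di; rewrite /merge (negbTE Di).
- by apply: hA h1 => i Di; rewrite /merge Di.
- by apply: hA' h2 => i Di; rewrite /merge (negbTE Di).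
Qed.

Definition reindex (t : I -> I) (u : U) : U := fun i => u (t i).

Lemma measurable_reindex t : measurable_fun setT (reindex t).
Proof. by apply: measurable_to_seqspace => i; exact: measurable_coord. Qed.

Lemma reindex_law (t : I -> I) A : injective t ->
  (forall i B, measurable B -> nu (t i) B = nu i B) ->
  measurable A -> Lam A = Lam (reindex t @^-1` A).
Proof.
move=> ti nut.
pose m2 : probability U R := distribution Lam (mk_mfun (measurable_reindex t)).
suff H J B : uniq J -> (forall i, measurable (B i)) -> Lam (rect J B) = m2 (rect J B).
  by move: A; apply: (law_unique H).
move=> uJ mB; rewrite /m2 /distribution /pushforward /=.
case: J uJ => [|i0 J0] uJ.
  by congr (Lam _); apply/seteqP; split.
set J := i0 :: J0 in uJ *.
(* [B'] has to return [B i] at [t i]; the position in [map t J] recovers i because t is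
   injective. *)
pose B' j := B (nth i0 J (index j (map t J))).
have B'E i : i \in J -> B' (t i) = B i.
  by move=> iJ; rewrite /B' index_map// nth_index.
transitivity (Lam (rect (map t J) B')); last first.
  congr (Lam _); apply/seteqP; split => u h; last first.
    by move=> j /mapP[i iJ ->]; rewrite B'E//; exact: h.
  by move=> i iJ; rewrite -B'E//; apply: h; exact: map_f.
rewrite !prodlaw//; last 2 first.
- by rewrite map_inj_uniq.
- by move=> i; exact: mB.
rewrite big_map; apply: eq_big_seq => i iJ.
by rewrite B'E// nut.
Qed.

End ProductLaw.

(** * Measurability of the geometric functions *)

Section MeasurableGeometry.
Context {R : realType} d0 (T : measurableType d0).

Lemma measurable_invr : measurable_fun [set: R] (fun x : R => x^-1).
Proof.
have -> : (fun x : R => x^-1) = (fun x => if 0 <= x then x `^ (-1) else - ((- x) `^ (-1))).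
  apply/funext => x; case: ifPn => x0; first by rewrite powR_inv1.
  by rewrite powR_inv1 ?invrN ?opprK// oppr_ge0 ltW// ltNge.
apply: measurable_fun_ifT.
- exact: measurable_fun_ler.
- exact: measurable_powR.
- apply: measurable_funN; apply: (@measurableT_comp _ _ _ _ _ _ (fun y : R => y `^ (-1)) _ (@GRing.opp R)).
    exact: measurable_powR.
  exact: oppr_measurable.
Qed.

Lemma measurable_funV (f : T -> R) : measurable_fun setT f -> measurable_fun setT (fun w => (f w)^-1).
Proof. by move=> mf; apply: (measurableT_comp measurable_invr). Qed.

Lemma measurable_fun_sqrt (f : T -> R) : measurable_fun setT f ->
  measurable_fun setT (fun w => Num.sqrt (f w)).
Proof.
move=> mf; apply: measurableT_comp mf.
by apply: continuous_measurable_fun; exact: sqrt_continuous.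
Qed.

Lemma measurable_funexpR (f : T -> R) : measurable_fun setT f ->
  measurable_fun setT (fun w => expR (f w)).
Proof. by move=> mf; apply: measurableT_comp mf; exact: measurable_expR. Qed.

Lemma measurable_sqnorm (d : nat) (f : T -> 'rV[R]_d) :
  (forall j, measurable_fun setT (fun w => f w ord0 j)) ->
  measurable_fun setT (fun w => sqnorm (f w)).
Proof.
move=> mf; apply: measurable_sum => j.
by apply: measurable_funX; exact: mf.
Qed.

Lemma measurable_ball_point (zeta : R) (d : nat) (r : T -> R) (g : T -> 'rV[R]_d) j :
  measurable_fun setT r -> (forall j, measurable_fun setT (fun w => g w ord0 j)) ->
  measurable_fun setT (fun w => ball_point zeta (r w) (g w) ord0 j).
Proof.
move=> mr mg.
under eq_fun do rewrite /ball_point mxE.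
apply: measurable_funM => //; apply: measurable_funM.
  have mz : measurable_fun setT (fun w => zeta * r w / 2).
    by apply: measurable_funM => //; exact: measurable_funM.
  rewrite /tanhR; apply: measurable_funM.
    apply: measurable_funB; apply: measurable_funexpR => //.
    exact: measurable_funN.
  apply: measurable_funV; apply: measurable_funD; apply: measurable_funexpR => //.
  exact: measurable_funN.
by apply: measurable_funV; apply: measurable_fun_sqrt; exact: measurable_sqnorm.
Qed.

Lemma measurable_hdist (zeta : R) (d : nat) (f g : T -> 'rV[R]_d) :
  (forall j, measurable_fun setT (fun w => f w ord0 j)) ->
  (forall j, measurable_fun setT (fun w => g w ord0 j)) ->
  measurable_fun setT (fun w => hdist zeta (f w) (g w)).
Proof.
move=> mf mg; rewrite /hdist; apply: measurable_funM => //.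
rewrite /acoshR.
have mt : measurable_fun setT
    (fun w => 1 + 2 * sqnorm (f w - g w) / ((1 - sqnorm (f w)) * (1 - sqnorm (g w)))).
  apply: measurable_funD => //; apply: measurable_funM.
    apply: measurable_funM => //; apply: measurable_sqnorm => j.
    under eq_fun do rewrite !mxE.
    exact: measurable_funB.
  apply: measurable_funV; apply: measurable_funM;
    by apply: measurable_funB => //; exact: measurable_sqnorm.
apply: (@measurableT_comp _ _ _ _ _ _ (@ln R)); first exact: measurable_ln.
apply: measurable_funD => //.
by apply: measurable_fun_sqrt; apply: measurable_funB => //; exact: measurable_funX.
Qed.

End MeasurableGeometry.

Section FiniteValued.
Context {R : realType} d0 (T : measurableType d0) (P : probability T R) (K : finType) (f : T -> K).
Hypothesis mf : forall k, measurable [set w | f w = k].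

Let Sf (s : seq K) (Q : pred K) : set T := [set w | (f w \in s) && Q (f w)].

Let sum_seq (s : seq K) (Q : pred K) : uniq s ->
  measurable (Sf s Q) /\ P (Sf s Q) = (\sum_(k <- s | Q k) P [set w | f w = k])%E.
Proof.
elim: s => [_|k s IH /= /andP[ks us]].
  have -> : Sf [::] Q = set0 by apply/seteqP; split.
  by rewrite big_nil measure0; split.
have [m1 e1] := IH us; rewrite big_cons.
case: ifPn => Qk; last first.
  have -> : Sf (k :: s) Q = Sf s Q => //.
  apply/seteqP; split => w; rewrite /Sf /= inE; last by move=> /andP[-> ->]; rewrite orbT.
  by case: eqVneq => //= ->; rewrite (negbTE Qk) andbF.
have -> : Sf (k :: s) Q = [set w | f w = k] `|` Sf s Q.
  apply/seteqP; split => w; rewrite /Sf /= inE.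
    by case: eqVneq => [->|_ /=]; [left|right].
  by move=> [->|/andP[-> ->]]; rewrite ?eqxx ?orbT// Qk.
have dis : [set w | f w = k] `&` Sf s Q = set0.
  by apply/seteqP; split => // w [/= fk]; rewrite /Sf /= fk (negbTE ks).
split; first by apply: measurableU => //; exact: mf.
by rewrite (measureU _ (mf k) m1 dis) -e1.
Qed.

Let SfE (Q : pred K) : Sf (enum K) Q = [set w | Q (f w)].
Proof. by apply/seteqP; split => w; rewrite /Sf /= mem_enum inE. Qed.

Lemma measurable_fin (Q : pred K) : measurable [set w | Q (f w)].
Proof. by have [+ _] := sum_seq Q (enum_uniq K); rewrite SfE. Qed.

Lemma sum_fine_fin (Q : pred K) :
  \sum_(k | Q k) fine (P [set w | f w = k]) = fine (P [set w | Q (f w)]).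
Proof.
have [_] := sum_seq Q (enum_uniq K); rewrite SfE => ->.
rewrite sum_fine ?big_enum_cond// => k _.
exact: fin_num_measure.
Qed.

End FiniteValued.

(** * The random array of the point process *)

Section Model.
Context {R : realType} (d : nat) (zeta gamma Rn : R).
Local Notation U := (seqspace R (ppp_idx d)).

Definition ptU (i : nat) (u : U) : 'rV[R]_d :=
  ball_point zeta (u (inr (inl i))) (\row_j u (inr (inr (i, j)))).

Definition adjU (i j : nat) (u : U) : bool :=
  if i == j then Rn - hdist zeta 0 (ptU i u) <= gamma * Rn
  else 0 < hdist zeta (ptU i u) (ptU j u) <= Rn.

Definition arrU (J : finType) (s : J -> nat) (u : U) : arr J :=
  [ffun p => adjU (s p.1) (s p.2) u].

Lemma measurable_ptU i j : measurable_fun [set: U] (fun u => ptU i u ord0 j).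
Proof.
apply: measurable_ball_point => [|j']; first exact: measurable_coord.
apply: (eq_measurable_fun (fun u : U => u (inr (inr (i, j'))))); last exact: measurable_coord.
by move=> u _; rewrite mxE.
Qed.

Lemma measurable_adjU i j (b : bool) : measurable [set u : U | adjU i j u = b].
Proof.
suff m1 : measurable [set u : U | adjU i j u].
  case: b; first exact: m1.
  have -> : [set u : U | adjU i j u = false] = ~` [set u : U | adjU i j u].
    by apply/seteqP; split => u /=; [move=> ->|case: (adjU i j u)].
  exact: measurableC.
have mh : measurable_fun [set: U] (fun u => hdist zeta (ptU i u) (ptU j u)).
  by apply: measurable_hdist => k; exact: measurable_ptU.
have m0 : measurable_fun [set: U] (fun u => hdist zeta 0 (ptU i u)).
  by apply: measurable_hdist => k; [exact: measurable_cst|exact: measurable_ptU].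
rewrite /adjU; case: (i == j).
  rewrite -[X in measurable X]setTI.
  apply: (@measurable_fun_ler _ _ _ _ (fun u => Rn - hdist zeta 0 (ptU i u)) (fun=> gamma * Rn) _ _ measurableT [set true]) => //.
  exact: measurable_funB.
have -> : [set u : U | 0 < hdist zeta (ptU i u) (ptU j u) <= Rn] =
   [set u | 0 < hdist zeta (ptU i u) (ptU j u)] `&` [set u | hdist zeta (ptU i u) (ptU j u) <= Rn].
  by apply/seteqP; split => u /=; [move=> /andP[]|move=> [-> ->]].
apply: measurableI.
  rewrite -[X in measurable X]setTI.
  exact: (@measurable_fun_ltr _ _ _ _ (fun=> 0) (fun u => hdist zeta (ptU i u) (ptU j u)) _ _ measurableT [set true]).
rewrite -[X in measurable X]setTI.
exact: (@measurable_fun_ler _ _ _ _ (fun u => hdist zeta (ptU i u) (ptU j u)) (fun=> Rn) _ _ measurableT [set true]).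
Qed.

Lemma measurable_arrU (J : finType) (s : J -> nat) g : measurable [set u : U | arrU s u = g].
Proof.
have -> : [set u : U | arrU s u = g] = \bigcap_(p in [set: J * J]) [set u : U | adjU (s p.1) (s p.2) u = g p].
  apply/seteqP; split => u /=; first by move=> <- p _; rewrite /= ffunE.
  by move=> H; apply/ffunP => p; rewrite ffunE; exact: H.
apply: fin_bigcap_measurable; first exact: finite_finset.
by move=> p _; exact: measurable_adjU.
Qed.

Variable Lam : probability U R.
Let nu (i : ppp_idx d) (B : set R) := Lam [set u : U | B (u i)].
Hypothesis prodlaw : forall J B, uniq J -> (forall i, measurable (B i)) ->
  Lam (rect J B) = (\prod_(i <- J) nu i (B i))%E.

Definition tidx (t : nat -> nat) (i : ppp_idx d) : ppp_idx d :=
  match i with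
  | inl x => inl x
  | inr (inl m) => inr (inl (t m))
  | inr (inr (m, j)) => inr (inr (t m, j))
  end.

Hypothesis nu_tidx : forall t i B, measurable B -> nu (tidx t i) B = nu i B.

Lemma tidx_inj t : injective t -> injective (tidx t).
Proof.
move=> ti [x|[m|[m j]]] [x'|[m'|[m' j']]] //=.
- by move=> [/ti ->].
- by move=> [/ti -> ->].
Qed.

Lemma adjU_reindex t i j u : injective t -> adjU i j (reindex (tidx t) u) = adjU (t i) (t j) u.
Proof.
by move=> ti; rewrite /adjU (inj_eq ti).
Qed.

(** [reindex_law] needs an injection of all labels, not only of those in J. The labels beyond #|J|
    are shifted above every value of s, which keeps them apart. *)
Lemma extend_nat (J : finType) (s : J -> nat) : injective s ->
  exists t : nat -> nat, injective t /\ forall i : J, t (enum_rank i) = s i.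
Proof.
move=> si; pose M := (\max_i s i).+1.
exists (fun n => if insub n is Some k then s (enum_val (k : 'I_#|J|)) else n + M)%N; split.
  have sM k : (s k < M)%N by rewrite ltnS (leq_bigmax k).
  move=> n n'; case: insubP => [k _ kn|nJ]; case: insubP => [k' _ kn'|nJ'].
  - by move=> /si /enum_val_inj E; rewrite -kn -kn' E.
  - by move=> E; have := sM (enum_val k); rewrite E; lia.
  - by move=> E; have := sM (enum_val k'); rewrite -E; lia.
  - lia.
move=> i; case: insubP => [k _ ki|]; last by rewrite ltn_ord.
by have -> : k = enum_rank i by [apply: val_inj]; rewrite enum_rankK.
Qed.

Definition rk (J : finType) (i : J) : nat := enum_rank i.

Lemma rk_inj (J : finType) : injective (@rk J).
Proof. by move=> i j /val_inj /enum_rank_inj. Qed.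

Lemma arrU_exch (J : finType) (s : J -> nat) g : injective s ->
  Lam [set u | arrU s u = g] = Lam [set u | arrU (@rk J) u = g].
Proof.
move=> si; have [t [ti ts]] := extend_nat si.
rewrite [RHS](reindex_law prodlaw (tidx_inj ti) (nu_tidx t) (measurable_arrU (@rk J) g)).
congr (Lam _); apply/seteqP; split => u /= <-; apply/ffunP => p;
  by rewrite !ffunE adjU_reindex// /rk !ts.
Qed.

Definition muU (J : finType) (g : arr J) : R := fine (Lam [set u | arrU (@rk J) u = g]).

Lemma muU_sum (J : finType) (s : J -> nat) (Q : pred (arr J)) : injective s ->
  \sum_(g | Q g) muU g = fine (Lam [set u | Q (arrU s u)]).
Proof.
move=> si; rewrite -sum_fine_fin; last by move=> g; exact: measurable_arrU.
by apply: eq_bigr => g _; rewrite /muU -(arrU_exch g si).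
Qed.

Lemma muU_ge0 (J : finType) (g : arr J) : 0 <= muU g.
Proof. exact: fine_ge0. Qed.

Lemma muU_sum1 (J : finType) : \sum_(g : arr J) muU g = 1.
Proof.
rewrite (muU_sum xpredT (@rk_inj J)).
by rewrite (_ : [set u | _] = [set: U]) ?probability_setT//; apply/seteqP; split.
Qed.

Lemma pull_arrU (J J' : finType) (h : J -> J') (s : J' -> nat) u :
  pull h (arrU s u) = arrU (s \o h) u.
Proof. by apply/ffunP => p; rewrite !ffunE. Qed.

Lemma muU_pull (J J' : finType) (h : J -> J') : injective h ->
  forall g, \sum_(g' | pull h g' == g) muU g' = muU g.
Proof.
move=> hi g; rewrite (muU_sum _ (@rk_inj J')).
rewrite /muU -(arrU_exch g (s := @rk J' \o h)); last exact: inj_comp (@rk_inj J') hi.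
by congr (fine (Lam _)); apply/seteqP; split => u /=; rewrite pull_arrU => /eqP.
Qed.

Lemma adjU_local (i j : nat) (u v : U) :
  (forall x, (x == inr (inl i)) || (x == inr (inl j)) -> u x = v x) ->
  (forall k, u (inr (inr (i, k))) = v (inr (inr (i, k)))) ->
  (forall k, u (inr (inr (j, k))) = v (inr (inr (j, k)))) -> adjU i j u = adjU i j v.
Proof.
move=> h1 h2 h3; rewrite /adjU /ptU.
have -> : u (inr (inl i)) = v (inr (inl i)) by apply: h1; rewrite eqxx.
have -> : u (inr (inl j)) = v (inr (inl j)) by apply: h1; rewrite eqxx orbT.
have -> : \row_k u (inr (inr (i, k))) = \row_k v (inr (inr (i, k))) by apply/rowP => k; rewrite !mxE.
by have -> : \row_k u (inr (inr (j, k))) = \row_k v (inr (inr (j, k))) by apply/rowP => k; rewrite !mxE.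
Qed.

Definition ofpts (V : pred nat) : pred (ppp_idx d) := fun x =>
  match x with inl _ => false | inr (inl m) => V m | inr (inr (m, _)) => V m end.

Lemma arrU_local (J : finType) (s : J -> nat) (V : pred nat) (u v : U) :
  (forall i, V (s i)) -> (forall x, ofpts V x -> u x = v x) -> arrU s u = arrU s v.
Proof.
move=> sV h; apply/ffunP => p; rewrite !ffunE; apply: adjU_local.
- by move=> x /orP[] /eqP ->; apply: h => /=; exact: sV.
- by move=> k; apply: h => /=; exact: sV.
- by move=> k; apply: h => /=; exact: sV.
Qed.

Lemma muU_dissoc (J1 J2 : finType) (g1 : arr J1) (g2 : arr J2) :
  \sum_(g : arr (J1 + J2)%type | (pull inl g == g1) && (pull inr g == g2)) muU g
  = muU g1 * muU g2.
Proof.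
(* Even labels for J1 and odd labels for J2, so that the two arrays read disjoint sets of
   coordinates selected by parity. *)
pose s (x : (J1 + J2)%type) : nat := match x with inl i => (rk i).*2 | inr j => (rk j).*2.+1 end.
have si : injective s.
  by move=> [i|i] [j|j] /= H; (have /rk_inj -> : rk i = rk j by lia) || (exfalso; lia).
rewrite (muU_sum _ si).
have -> : [set u | (pull inl (arrU s u) == g1) && (pull inr (arrU s u) == g2)] =
   [set u : U | arrU (s \o inl) u = g1] `&` [set u | arrU (s \o inr) u = g2].
  apply/seteqP; split => u /=; first by rewrite !pull_arrU => /andP[/eqP -> /eqP ->].
  by rewrite !pull_arrU => -[-> ->]; rewrite !eqxx.
rewrite (merge_indep prodlaw (D := ofpts (fun m => ~~ odd m))); last first.
- move=> u v h /= <-; apply: esym; apply: (@arrU_local _ _ odd).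
    by move=> j /=; rewrite odd_double.
  by move=> [x|[m|[m j]]] //= om; apply: h; rewrite /= negbK.
- move=> u v h /= <-; apply: esym; apply: (@arrU_local _ _ (fun m => ~~ odd m)).
    by move=> j /=; rewrite odd_double.
  exact: h.
- exact: measurable_arrU.
- exact: measurable_arrU.
have fA (J : finType) g (s' : J -> nat) : Lam [set u | arrU s' u = g] \is a fin_num.
  by apply: fin_num_measure; exact: measurable_arrU.
rewrite fineM//.
rewrite /muU (arrU_exch g1 (s := s \o inl)) ?(arrU_exch g2 (s := s \o inr))//.
- by move=> i j /= /succn_inj/double_inj/rk_inj.
- by move=> i j /= /double_inj/rk_inj.
Qed.

Definition arrayU : array_law R := ArrayLaw muU_ge0 muU_sum1 muU_pull muU_dissoc.

Lemma E_arrayU (J : finType) (s : J -> nat) (b : arr J -> bool) : injective s ->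
  E arrayU (fun g => (b g)%:R) = fine (Lam [set u | b (arrU s u)]).
Proof.
move=> si; rewrite -(muU_sum b si) /E /= [RHS]big_mkcond/=.
apply: eq_bigr => g _; case: (b g) => /=; first by rewrite mulr1.
by rewrite mulr0.
Qed.

Lemma count_indep (J : finType) (s : J -> nat) (x : R) g : injective s ->
  Lam [set u | u (inl tt) = x /\ arrU s u = g] = (nu (inl tt) [set x] * (muU g)%:E)%E.
Proof.
move=> si.
rewrite (_ : [set u | _] = [set u : U | u (inl tt) = x] `&` [set u | arrU s u = g])//.
rewrite (merge_indep prodlaw (D := fun i => i == inl tt)).
- by rewrite (arrU_exch g si) /muU fineK//; apply: fin_num_measure; exact: measurable_arrU.
- rewrite -[X in measurable X]setTI; exact: (measurable_coord (R := R) (inl tt : ppp_idx d) measurableT (measurable_set1 x)).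
- exact: measurable_arrU.
- by move=> u v h /= <-; rewrite h.
- move=> u v h /= <-; apply: esym; apply: (@arrU_local _ _ xpredT) => //.
  by move=> [[]|[m|[m j]]] //= _; apply: h.
Qed.

End Model.

(** * Hyperbolic geometry and Gaussian directions *)

Section Gaussian.
Context {R : realType}.
Local Notation mu := (@lebesgue_measure R).
Local Notation gam := (@normal_prob R 0 1).
Local Notation phi := (@normal_pdf R 0 1).

Lemma phiE x : phi x = (Num.sqrt (pi *+ 2))^-1 * expR (- (x ^+ 2 / 2)).
Proof.
rewrite /normal_pdf oner_eq0 /normal_peak /normal_fun expr1n mul1r subr0.
by rewrite mulNr.
Qed.

Lemma normal_peak_le1 : (Num.sqrt (pi *+ 2))^-1 <= 1 :> R.
Proof.
have h : 1 <= pi *+ 2 :> R by have := pi_ge2 R; rewrite mulr2n; lra.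
rewrite invf_le1 ?sqrtr_gt0 ?(lt_le_trans ltr01 h)//.
by rewrite -[leLHS]sqrtr1 ler_sqrt// (le_trans ler01 h).
Qed.

Lemma phi_le1 x : phi x <= 1.
Proof.
rewrite phiE -[leRHS]mulr1 ler_pM ?invr_ge0 ?sqrtr_ge0 ?expR_ge0 ?normal_peak_le1//.
by rewrite -(expR0 R) ler_expR oppr_le0 divr_ge0// sqr_ge0.
Qed.

Lemma phi_gt0 x : 0 < phi x.
Proof.
rewrite phiE mulr_gt0 ?expR_gt0// invr_gt0 sqrtr_gt0 mulrn_wgt0//.
exact: pi_gt0.
Qed.

Lemma phi_mono (B x : R) : `|x| <= B -> phi B <= phi x.
Proof.
move=> xB; rewrite !phiE ler_wpM2l ?invr_ge0 ?sqrtr_ge0//.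
rewrite ler_expR lerN2 ler_wpM2r// -(real_normK (num_real x)).
by rewrite lerXn2r ?nnegrE// (le_trans _ xB).
Qed.

Lemma ge0_integral_normal (f : R -> \bar R) : (forall x, (0 <= f x)%E) ->
  measurable_fun [set: R] f ->
  (\int[gam]_x f x = \int[mu]_x (f x * (phi x)%:E))%E.
Proof.
move=> f0 mf; have dom := @normal_prob_dominates R 0 1.
rewrite -(Radon_Nikodym_SigmaFinite.change_of_variables dom)//.
apply: ae_eq_integral => //.
- apply: emeasurable_funM => //.
  exact: measurable_int (Radon_Nikodym_SigmaFinite.f_integrable dom).
- apply: emeasurable_funM => //; apply/measurable_EFinP.
  exact: measurable_normal_pdf.
- apply: ae_eqe_mul2l => /=; apply: integral_ae_eq => //.
  + exact: Radon_Nikodym_SigmaFinite.f_integrable.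
  + by apply/measurable_EFinP; exact: measurable_normal_pdf.
  + by move=> A _ mA; rewrite -Radon_Nikodym_SigmaFinite.f_integral.
Qed.

Lemma gaussian_exp_moment (c : R) :
  (\int[gam]_x (expR (c * x))%:E = (expR (c ^+ 2 / 2))%:E)%E.
Proof.
have mexp : measurable_fun [set: R] (fun x => expR (c * x)).
  by apply: measurableT_comp => //; exact: mulrl_measurable.
rewrite ge0_integral_normal//; last exact/measurable_EFinP.

transitivity (\int[mu]_x ((expR (c ^+ 2 / 2))%:E * (normal_pdf c 1 x)%:E))%E.
  apply: eq_integral => x _; rewrite -!EFinM; congr (_%:E).
  rewrite /normal_pdf oner_eq0 /normal_peak /normal_fun expr1n mul1r subr0.
  rewrite mulrCA [RHS]mulrCA; congr (_ * _); rewrite -!expRD; congr expR.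
  by rewrite mulr2n; field.
rewrite ge0_integralZl//=.
- by rewrite integral_normal_pdf mule1.
- by apply/measurable_EFinP; exact: measurable_normal_pdf.
- by move=> x _; rewrite lee_fin normal_pdf_ge0.
Qed.

(** From |x|^q <= q! exp |x| <= q! (exp x + exp (-x)), where both exponential moments are exp (1/2)
    <= e. *)
Lemma gaussian_abs_moment (q : nat) :
  (\int[gam]_x (`|x| ^+ q)%:E <= (2 * q`!%:R * expR 1)%:E)%E.
Proof.
have mexp (c : R) : measurable_fun [set: R] (fun x => expR (c * x)).
  by apply: measurableT_comp => //; exact: mulrl_measurable.
apply: (@le_trans _ _ (\int[gam]_x (q`!%:R%:E * ((expR (1 * x))%:E + (expR (- 1 * x))%:E)))%E).
  apply: ge0_le_integral => //.
  - by apply/measurable_EFinP; apply: measurable_funX; exact: normr_measurable.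
  - apply/measurable_EFinP; apply: measurable_funM => //.
    by apply: measurable_funD; exact: mexp.
  move=> x _; rewrite -EFinD -EFinM lee_fin.
  apply: le_trans (exprn_le_expR q (normr_ge0 x)) _; rewrite ler_wpM2l//.
  rewrite mul1r mulN1r; case: (ger0P x) => x0.
    by rewrite lerDl expR_ge0.
  by rewrite lerDr expR_ge0.
rewrite ge0_integralZl//=; last 2 first.
- by apply: emeasurable_funD; apply/measurable_EFinP; exact: mexp.
- by move=> x _; rewrite -EFinD lee_fin addr_ge0 ?expR_ge0.
rewrite ge0_integralD//=; [|by apply/measurable_EFinP; exact: mexp|by apply/measurable_EFinP; exact: mexp].
rewrite !gaussian_exp_moment -EFinD -EFinM lee_fin.
have e12 : expR (1 / 2) <= expR 1 :> R by rewrite ler_expR; lra.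
rewrite sqrrN expr1n -mulrA [2 * _]mulrCA ler_wpM2l//; lra.
Qed.

Lemma gaussian_itv_ub (a b : R) : a <= b -> (gam `[a, b] <= (b - a)%:E)%E.
Proof.
move=> ab; rewrite /normal_prob.
apply: (@le_trans _ _ (\int[mu]_(x in `[a, b]) 1)%E).
  apply: ge0_le_integral => //=.
  - by move=> x _; rewrite lee_fin normal_pdf_ge0.
  - by apply/measurable_funTS/measurable_EFinP; exact: measurable_normal_pdf.
  - by move=> x _; rewrite lee_fin phi_le1.
rewrite integral_cst//= mul1e lebesgue_measure_itv/= lte_fin.
case: ltP => [_|ba]; first by rewrite -EFinB.
by rewrite lee_fin subr_ge0.
Qed.

Lemma gaussian_itv_lb (a b B : R) : a <= b -> - B <= a -> b <= B ->
  (((b - a) * phi B)%:E <= gam `]a, b])%E.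
Proof.
move=> ab Ba bB; rewrite /normal_prob.
apply: (@le_trans _ _ (\int[mu]_(x in `]a, b]) (phi B)%:E)%E).
  rewrite integral_cst//= lebesgue_measure_itv/= lte_fin muleC.
  case: ltP => [_|ba]; first by rewrite -EFinB -EFinM.
  by rewrite mul0e lee_fin mulr_le0_ge0 ?subr_le0// normal_pdf_ge0.
apply: ge0_le_integral => //=.
- by move=> x _; rewrite lee_fin normal_pdf_ge0.
- by apply/measurable_funTS/measurable_EFinP; exact: measurable_normal_pdf.
move=> x; rewrite in_itv/= => /andP[ax xb]; rewrite lee_fin phi_mono//.
by rewrite ler_norml; lra.
Qed.

End Gaussian.

(** * The hyperbolic law of cosines *)

Section Geometry.
Context {R : realType} (d : nat).
Implicit Types (g u v : 'rV[R]_d).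

Definition ip u v : R := \sum_(j < d) u ord0 j * v ord0 j.
Definition dir g : 'rV[R]_d := (Num.sqrt (sqnorm g))^-1 *: g.
Definition dirdist g1 g2 : R := sqnorm (dir g1 - dir g2).

Lemma sqnorm_ge0 u : 0 <= sqnorm u.
Proof. by apply: sumr_ge0 => j _; exact: sqr_ge0. Qed.

Lemma sqnorm_coord u j : (u ord0 j) ^+ 2 <= sqnorm u.
Proof.
rewrite /sqnorm (bigD1 j)//= lerDl; apply: sumr_ge0 => i _; exact: sqr_ge0.
Qed.

Lemma sqnorm_eq0 u : (sqnorm u == 0) = (u == 0).
Proof.
apply/eqP/eqP => [u0|->]; last by rewrite /sqnorm big1// => j _; rewrite mxE expr0n.
apply/rowP => j; rewrite mxE; apply/eqP; rewrite -sqrf_eq0 eq_le sqr_ge0 andbT.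
by rewrite -u0 sqnorm_coord.
Qed.

Lemma sqnorm_gt0 u : (0 < sqnorm u) = (u != 0).
Proof. by rewrite lt_def sqnorm_ge0 andbT sqnorm_eq0. Qed.

Lemma sqnorm_lin (a b : R) u v :
  sqnorm (a *: u - b *: v) = a ^+ 2 * sqnorm u - 2 * a * b * ip u v + b ^+ 2 * sqnorm v.
Proof.
rewrite /sqnorm /ip !big_distrr/= -sumrB -big_split/=.
by apply: eq_bigr => j _; rewrite !mxE; ring.
Qed.

Lemma sqnormZ (a : R) u : sqnorm (a *: u) = a ^+ 2 * sqnorm u.
Proof. by rewrite /sqnorm big_distrr; apply: eq_bigr => j _; rewrite mxE exprMn. Qed.

Lemma sqnorm_sym u v : sqnorm (u - v) = sqnorm (v - u).
Proof. by apply: eq_bigr => j _; rewrite !mxE -sqrrN opprB. Qed.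

Lemma sqnorm_dir g : g != 0 -> sqnorm (dir g) = 1.
Proof.
move=> g0; rewrite sqnormZ exprVn sqr_sqrtr ?sqnorm_ge0// mulVf//.
by rewrite gt_eqF// sqnorm_gt0.
Qed.

Lemma dirdistE g1 g2 : g1 != 0 -> g2 != 0 -> dirdist g1 g2 = 2 - 2 * ip (dir g1) (dir g2).
Proof.
move=> h1 h2; rewrite /dirdist; have := sqnorm_lin 1 1 (dir g1) (dir g2).
by rewrite !scale1r (sqnorm_dir h1) (sqnorm_dir h2) => ->; ring.
Qed.

Lemma ball_pointE (zeta r : R) g : ball_point zeta r g = tanhR (zeta * r / 2) *: dir g.
Proof. by rewrite /ball_point /dir scalerA. Qed.

Definition coshR (x : R) : R := (expR x + expR (- x)) / 2.

(** The law of cosines cosh cosh - sinh sinh cos(theta), rewritten with 1 - cos(theta) = [dirdist] /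
    2: this separates a radial term from an angular one that is non-negative for non-negative
    radii. *)
Lemma hyperbolic_cosine (zeta r1 r2 : R) g1 g2 : g1 != 0 -> g2 != 0 ->
  let x := ball_point zeta r1 g1 in let y := ball_point zeta r2 g2 in
  1 + 2 * sqnorm (x - y) / ((1 - sqnorm x) * (1 - sqnorm y)) =
  coshR (zeta * (r1 - r2)) + sinhR (zeta * r1) * sinhR (zeta * r2) * dirdist g1 g2 / 2.
Proof.
move=> h1 h2 x y; rewrite /x /y !ball_pointE sqnorm_lin dirdistE//.
rewrite !(sqnormZ (tanhR _)) (sqnorm_dir h1) (sqnorm_dir h2).
set c := ip _ _; rewrite /coshR /sinhR /tanhR.
(* In terms of these exponentials at half the argument both sides are rational functions, so [field]
   decides the identity. *)
set X := expR (zeta * r1 / 2); set Y := expR (zeta * r2 / 2).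
have X0 : X != 0 by rewrite gt_eqF// expR_gt0.
have Y0 : Y != 0 by rewrite gt_eqF// expR_gt0.
have -> : expR (zeta * r1) = X ^+ 2.
  by rewrite /X expr2 -expRD; congr expR; field.
have -> : expR (zeta * r2) = Y ^+ 2.
  by rewrite /Y expr2 -expRD; congr expR; field.
have -> : expR (- (zeta * r1)) = X ^- 2.
  by rewrite /X expr2 -expRD -expRN; congr expR; field.
have -> : expR (- (zeta * r2)) = Y ^- 2.
  by rewrite /Y expr2 -expRD -expRN; congr expR; field.
have -> : expR (zeta * (r1 - r2)) = X ^+ 2 * Y ^- 2.
  by rewrite /X /Y !expr2 -!expRD -expRN -expRD; congr expR; field.
have -> : expR (- (zeta * (r1 - r2))) = X ^- 2 * Y ^+ 2.
  by rewrite /X /Y !expr2 -!expRD -expRN -expRD; congr expR; field.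
have -> : expR (- (zeta * r1 / 2)) = X^-1 by rewrite expRN.
have -> : expR (- (zeta * r2 / 2)) = Y^-1 by rewrite expRN.
have hX : X ^+ 2 + 1 != 0 by rewrite gt_eqF// ltr_wpDl// ?sqr_ge0.
have hY : Y ^+ 2 + 1 != 0 by rewrite gt_eqF// ltr_wpDl// ?sqr_ge0.
have eX : (X - X^-1) / (X + X^-1) = (X ^+ 2 - 1) / (X ^+ 2 + 1).
  by field; rewrite hX X0.
have eY : (Y - Y^-1) / (Y + Y^-1) = (Y ^+ 2 - 1) / (Y ^+ 2 + 1).
  by field; rewrite hY Y0.
have e1 : 1 - ((X - X^-1) / (X + X^-1)) ^+ 2 * 1 = 4 * X ^+ 2 / (X ^+ 2 + 1) ^+ 2.
  by rewrite eX; field; rewrite hX.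
have e2 : 1 - ((Y - Y^-1) / (Y + Y^-1)) ^+ 2 * 1 = 4 * Y ^+ 2 / (Y ^+ 2 + 1) ^+ 2.
  by rewrite eY; field; rewrite hY.
rewrite e1 e2 eX eY; field.
by rewrite hX hY X0 Y0.
Qed.

Lemma expRge1D (x : R) : 1 + x <= expR x. Proof. exact: expR_ge1Dx. Qed.

(** With [acosh_ub] this gives y <= exp (arcosh y) <= 2 y for y >= 1: a bound on the distance is a
    bound on y up to a factor 2. *)
Lemma acosh_le_imp (y z : R) : 1 <= y -> acoshR y <= z -> y <= expR z.
Proof.
move=> y1; rewrite /acoshR => H.
have A0 : 0 < y + Num.sqrt (y ^+ 2 - 1).
  by rewrite ltr_wpDr ?sqrtr_ge0// (lt_le_trans ltr01).
have : y + Num.sqrt (y ^+ 2 - 1) <= expR z by rewrite -[leLHS]lnK// ler_expR.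
by apply: le_trans; rewrite lerDl sqrtr_ge0.
Qed.

Lemma acosh_ub (y z : R) : 1 <= y -> 2 * y <= expR z -> acoshR y <= z.
Proof.
move=> y1 H; rewrite /acoshR.
have y0 : 0 < y by exact: lt_le_trans y1.
have A0 : 0 < y + Num.sqrt (y ^+ 2 - 1) by rewrite ltr_wpDr ?sqrtr_ge0.
rewrite -[leRHS]expRK ler_ln ?posrE ?expR_gt0//; apply: le_trans H.
rewrite mulr_natl mulr2n lerD2l.
rewrite -[leRHS](ger0_norm (ltW y0)) -sqrtr_sqr ler_wsqrtr//.
by rewrite gerBl.
Qed.

Lemma acosh_gt0 (y : R) : 1 < y -> 0 < acoshR y.
Proof.
by move=> y1; rewrite /acoshR ln_gt0// ltr_wpDr ?sqrtr_ge0.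
Qed.

Lemma acosh_cosh (z : R) : 0 <= z -> acoshR (coshR z) = z.
Proof.
move=> z0; rewrite /acoshR /coshR.
set X := expR z; have X0 : X != 0 by rewrite gt_eqF// expR_gt0.
rewrite expRN -/X.
have -> : ((X + X^-1) / 2) ^+ 2 - 1 = ((X - X^-1) / 2) ^+ 2 by field.
rewrite sqrtr_sqr ger0_norm; last first.
  rewrite divr_ge0// subr_ge0 /X -expRN ler_expR; lra.
have -> : (X + X^-1) / 2 + (X - X^-1) / 2 = X by field.
by rewrite /X expRK.
Qed.

Lemma cosh_ge1 (x : R) : 1 <= coshR x.
Proof.
rewrite /coshR expRN; set X := expR x.
have X0 : 0 < X by exact: expR_gt0.
have -> : (X + X^-1) / 2 = 1 + (X - 1) ^+ 2 / X / 2 by field; rewrite gt_eqF.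
by rewrite lerDl !divr_ge0 ?sqr_ge0// ltW.
Qed.

Lemma sinh_ge0 (x : R) : 0 <= x -> 0 <= sinhR x.
Proof. by move=> x0; rewrite /sinhR divr_ge0// subr_ge0 ler_expR; lra. Qed.

Lemma sinh_gt0 (x : R) : 0 < x -> 0 < sinhR x.
Proof. by move=> x0; rewrite /sinhR divr_gt0// subr_gt0 ltr_expR; lra. Qed.

Lemma sinh_ub (x : R) : sinhR x <= expR x / 2.
Proof. by rewrite /sinhR ler_wpM2r// gerBl expR_ge0. Qed.

Lemma sinh_lb (x : R) : 1 <= x -> expR x / 4 <= sinhR x.
Proof.
move=> x1; rewrite /sinhR.
have h1 : 2 <= expR x by apply: le_trans (expRge1D x); lra.
have h2 : expR (- x) <= 1 by rewrite -(expR0 R) ler_expR; lra.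
lra.
Qed.

Section Points.
Variables (zeta : R) (zeta0 : 0 < zeta).

Let arg (r1 r2 : R) g1 g2 :=
  coshR (zeta * (r1 - r2)) + sinhR (zeta * r1) * sinhR (zeta * r2) * dirdist g1 g2 / 2.

Let hdistE (r1 r2 : R) g1 g2 : g1 != 0 -> g2 != 0 ->
  hdist zeta (ball_point zeta r1 g1) (ball_point zeta r2 g2) = zeta^-1 * acoshR (arg r1 r2 g1 g2).
Proof. by move=> h1 h2; rewrite /hdist hyperbolic_cosine. Qed.

Let arg_ge1 (r1 r2 : R) g1 g2 : 0 <= r1 -> 0 <= r2 -> 1 <= arg r1 r2 g1 g2.
Proof.
move=> h1 h2; have := cosh_ge1 (zeta * (r1 - r2)).
have : 0 <= sinhR (zeta * r1) * sinhR (zeta * r2) * dirdist g1 g2 / 2.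
  have p1 : 0 <= sinhR (zeta * r1) by apply: sinh_ge0; rewrite mulr_ge0// ltW.
  have p2 : 0 <= sinhR (zeta * r2) by apply: sinh_ge0; rewrite mulr_ge0// ltW.
  by rewrite divr_ge0// mulr_ge0 ?sqnorm_ge0// mulr_ge0.
rewrite /arg; lra.
Qed.

Lemma hdist_le_dir (r1 r2 R0 : R) g1 g2 : g1 != 0 -> g2 != 0 -> 0 <= r1 -> 0 <= r2 ->
  hdist zeta (ball_point zeta r1 g1) (ball_point zeta r2 g2) <= R0 ->
  sinhR (zeta * r1) * sinhR (zeta * r2) * dirdist g1 g2 / 2 <= expR (zeta * R0).
Proof.
move=> h1 h2 r10 r20; rewrite hdistE// ler_pdivrMl// => /(acosh_le_imp (arg_ge1 _ _ r10 r20)).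
apply: le_trans; rewrite /arg lerDr.
exact: le_trans (cosh_ge1 _).
Qed.

Lemma hdist_dir_le (r1 r2 R0 : R) g1 g2 : g1 != 0 -> g2 != 0 -> 0 <= r1 -> 0 <= r2 ->
  2 * (coshR (zeta * (r1 - r2)) + sinhR (zeta * r1) * sinhR (zeta * r2) * dirdist g1 g2 / 2)
    <= expR (zeta * R0) ->
  hdist zeta (ball_point zeta r1 g1) (ball_point zeta r2 g2) <= R0.
Proof.
move=> h1 h2 r10 r20 H; rewrite hdistE// ler_pdivrMl//.
by apply: acosh_ub => //; exact: arg_ge1.
Qed.

Lemma hdist_dir_gt0 (r1 r2 : R) g1 g2 : g1 != 0 -> g2 != 0 -> 0 < r1 -> 0 < r2 ->
  0 < dirdist g1 g2 ->
  0 < hdist zeta (ball_point zeta r1 g1) (ball_point zeta r2 g2).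
Proof.
move=> h1 h2 r10 r20 D; rewrite hdistE// mulr_gt0 ?invr_gt0// acosh_gt0//.
have := cosh_ge1 (zeta * (r1 - r2)).
have : 0 < sinhR (zeta * r1) * sinhR (zeta * r2) * dirdist g1 g2 / 2.
  have p1 : 0 < sinhR (zeta * r1) by apply: sinh_gt0; rewrite mulr_gt0.
  have p2 : 0 < sinhR (zeta * r2) by apply: sinh_gt0; rewrite mulr_gt0.
  by rewrite divr_gt0// mulr_gt0// mulr_gt0.
rewrite /arg; lra.
Qed.

Lemma hdist0 (r : R) g : g != 0 -> 0 <= r -> hdist zeta 0 (ball_point zeta r g) = r.
Proof.
move=> g0 r0; rewrite /hdist.
have -> : 0 = ball_point zeta 0 g.
  by rewrite ball_pointE mulr0 mul0r /tanhR oppr0 subrr mul0r scale0r.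
rewrite hyperbolic_cosine// sub0r.
have -> : coshR (zeta * - r) = coshR (zeta * r) by rewrite /coshR mulrN opprK addrC.
rewrite /sinhR mulr0 oppr0 subrr !mul0r addr0 acosh_cosh; last by rewrite mulr_ge0// ltW.
by rewrite mulKf// gt_eqF.
Qed.

Lemma hdist_sym (x y : 'rV[R]_d) : hdist zeta x y = hdist zeta y x.
Proof. by rewrite /hdist sqnorm_sym [(1 - _) * _]mulrC. Qed.

Lemma hdist_ge0 (x : 'rV[R]_d) : sqnorm x < 1 -> 0 <= hdist zeta 0 x.
Proof.
move=> x1; rewrite /hdist.
have p : 0 <= 2 * sqnorm (0 - x) / ((1 - sqnorm (0 : 'rV[R]_d)) * (1 - sqnorm x)).
  have -> : sqnorm (0 : 'rV[R]_d) = 0 by apply: big1 => j _; rewrite mxE expr0n.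
  have s0 := sqnorm_ge0 (0 - x).
  apply: divr_ge0; first exact: mulr_ge0.
  by apply: mulr_ge0; rewrite subr_ge0 ?ler01// ltW.
apply: mulr_ge0; first by rewrite invr_ge0 ltW.
rewrite /acoshR ln_ge0//; apply: ler_wpDr; first exact: sqrtr_ge0.
by rewrite lerDl.
Qed.

Lemma sqnorm_ball_point (r : R) g : sqnorm (ball_point zeta r g) < 1.
Proof.
case: (eqVneq g 0) => [->|g0].
  by rewrite ball_pointE /dir !scaler0 [sqnorm 0]big1 ?ltr01// => j _; rewrite mxE expr0n.
rewrite ball_pointE (sqnormZ (tanhR _)) sqnorm_dir// mulr1 /tanhR.
set X := expR _; rewrite expRN -/X; have X0 : 0 < X by exact: expR_gt0.
have hX : 0 < X ^+ 2 + 1 by rewrite ltr_wpDl ?sqr_ge0.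
have -> : (X - X^-1) / (X + X^-1) = (X ^+ 2 - 1) / (X ^+ 2 + 1).
  by field; rewrite !gt_eqF.
rewrite expr_div_n ltr_pdivrMr ?exprn_gt0// mul1r.
rewrite -subr_gt0 (_ : _ - _ = 4 * X ^+ 2); last by ring.
by rewrite mulr_gt0// exprn_gt0.
Qed.

End Points.

End Geometry.

(** * Caps of directions in terms of vector coordinates *)

Section UnitVectors.
Context {R : realType} (d : nat).
Implicit Types (g theta : 'rV[R]_d).

Lemma unit_coord theta : (0 < d)%N -> sqnorm theta = 1 ->
  exists j, 1 <= (theta ord0 j) ^+ 2 * d%:R.
Proof.
move=> d0 t1; have j0 : 'I_d := Ordinal d0.
pose j := [arg max_(j > j0) (theta ord0 j) ^+ 2]%O.
exists j; rewrite -[leLHS]t1 /sqnorm mulr_natr -[X in _ *+ X]card_ord -sumr_const.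
apply: ler_sum => i _; rewrite /j.
by case: arg_maxP => //= k _; apply.
Qed.

Lemma coord_le1 theta j : sqnorm theta = 1 -> `|theta ord0 j| <= 1.
Proof.
move=> t1; rewrite -(@expr_le1 _ 2)// real_normK ?num_real// -t1.
exact: sqnorm_coord.
Qed.

Lemma coord_gt theta j : (0 < d)%N -> sqnorm theta = 1 -> 1 <= (theta ord0 j) ^+ 2 * d%:R ->
  1 <= `|theta ord0 j| * d%:R.
Proof.
move=> d0 t1 /le_trans; apply; rewrite ler_wpM2r// -(real_normK (num_real _)) expr2.
by apply: ler_piMl => //; exact: coord_le1.
Qed.

Lemma dir_scale g k : g ord0 k = Num.sqrt (sqnorm g) * dir g ord0 k.
Proof.
case: (eqVneq g 0) => [->|g0]; first by rewrite /dir scaler0 !mxE mulr0.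
by rewrite mxE mulrA divff ?mul1r// gt_eqF// sqrtr_gt0 sqnorm_gt0.
Qed.

(** If the direction of g is within sg of theta, each coordinate of g is nearly its multiple of the
    large coordinate g_j, with an error proportional to |g_j|. A cap of directions thus becomes a
    slab for the Gaussian coordinates. *)
Lemma dir_close theta g (sg : R) j : (0 < d)%N -> sqnorm theta = 1 ->
  1 <= (theta ord0 j) ^+ 2 * d%:R -> 0 <= sg -> sg * (2 * d%:R) <= 1 ->
  sqnorm (theta - dir g) <= sg ^+ 2 ->
  forall k, `|g ord0 k - g ord0 j * (theta ord0 k / theta ord0 j)|
    <= 2 * d%:R * (d%:R + 1) * sg * `|g ord0 j|.
Proof.
move=> d0 t1 tj sg0 sgd H k.
have tj1 := coord_gt d0 t1 tj.
have D0 : 0 < d%:R :> R by rewrite ltr0n.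
have tjn0 : theta ord0 j != 0.
  by apply/eqP => E; move: tj1; rewrite E normr0 mul0r ler10.
have cl i : `|theta ord0 i - dir g ord0 i| <= sg.
  rewrite -(@ler_pXn2r _ 2) ?nnegrE// real_normK ?num_real//.
  by apply: le_trans H; have := sqnorm_coord (theta - dir g) i; rewrite !mxE.
set a := Num.sqrt (sqnorm g); have a0 : 0 <= a by exact: sqrtr_ge0.
rewrite !(dir_scale g) -/a.
set u := dir g ord0 k; set v := dir g ord0 j.
set p := theta ord0 k; set t := theta ord0 j in tj tj1 tjn0 *.
have kt : `|t|^-1 <= d%:R.
  have t0 : 0 < `|t| by rewrite normr_gt0.
  by rewrite -[leLHS]mul1r ler_pdivrMr// mulrC.
have h1 : `|u - v * (p / t)| <= sg * (1 + d%:R).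
  have -> : u - v * (p / t) = (u - p) + (t - v) * (p / t) by field.
  apply: le_trans (ler_normD _ _) _; rewrite mulrDr mulr1 lerD ?cl//.
    by rewrite distrC cl.
  rewrite normrM ler_pM ?cl// normrM normfV -[leRHS]mul1r ler_pM ?invr_ge0//.
  exact: coord_le1.
(* As |theta_j| >= 1/d and sg <= 1/(2d), the j-th coordinate of the direction is still at least
   1/(2d) in absolute value. *)
have h2 : 1 <= `|v| * (2 * d%:R).
  have : `|t| - `|v| <= sg by apply: le_trans (cl j); exact: lerB_dist.
  move=> h; have := ler_wpM2r (ltW D0) h; lra.
have -> : a * u - a * v * (p / t) = a * (u - v * (p / t)) by ring.
rewrite !normrM (ger0_norm a0).
apply: (@le_trans _ _ (a * (sg * (1 + d%:R)))); first by rewrite ler_wpM2l.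
have h3 : a * (sg * (1 + d%:R)) <= (a * (sg * (1 + d%:R))) * (`|v| * (2 * d%:R)).
  by rewrite ler_peMr// !mulr_ge0// addr_ge0.
by apply: le_trans h3 _; rewrite le_eqVlt; apply/orP; left; apply/eqP; ring.
Qed.

Lemma ipC (u v : 'rV[R]_d) : ip u v = ip v u.
Proof. by apply: eq_bigr => i _; rewrite mulrC. Qed.

(** Converse of [dir_close]. With tau and a at least 1, the identity [key] shows that normalising
    does not increase the distance to theta. The strict inequality at k0 keeps g off the ray of
    theta, so the distance stays positive, as an edge requires. *)
Lemma dir_near theta g (h : R) j k0 : sqnorm theta = 1 -> 1 <= `|g ord0 j| ->
  0 < g ord0 j / theta ord0 j -> k0 != j ->
  (forall k, k != j -> 0 < g ord0 k - g ord0 j * (theta ord0 k / theta ord0 j) <= h) ->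
  0 < sqnorm (theta - dir g) <= d%:R * h ^+ 2.
Proof.
move=> t1 gj tau0 k0j H; set tau := g ord0 j / theta ord0 j in tau0.
have tjn0 : theta ord0 j != 0.
  by apply/eqP => E; move: tau0; rewrite /tau E invr0 mulr0 ltxx.
have tau1 : 1 <= tau.
  rewrite -(gtr0_norm tau0) /tau normrM normfV ler_pdivlMr ?normr_gt0// mul1r.
  exact: le_trans (coord_le1 _ t1) gj.
have E k : g ord0 j * (theta ord0 k / theta ord0 j) = tau * theta ord0 k.
  by rewrite /tau; field.
set a := Num.sqrt (sqnorm g).
have a2 : a ^+ 2 = sqnorm g by rewrite sqr_sqrtr// sqnorm_ge0.
have a1 : 1 <= a.
  rewrite -(@ler_pXn2r _ 2) ?nnegrE ?sqrtr_ge0// expr1n a2.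
  apply: le_trans (sqnorm_coord g j); rewrite -(real_normK (num_real _)).
  by rewrite -[leLHS](expr1n _ 2) lerXn2r ?nnegrE.
have key : sqnorm (g - tau *: theta) = (a - tau) ^+ 2 + tau * a * sqnorm (theta - dir g).
  have := sqnorm_lin 1 tau g theta; rewrite scale1r => ->.
  have := sqnorm_lin 1 a^-1 theta g; rewrite scale1r -/(dir g) => ->.
  rewrite t1 -a2 (ipC theta g); field.
  by rewrite gt_eqF// (lt_le_trans ltr01).
have ub : sqnorm (g - tau *: theta) <= d%:R * h ^+ 2.
  rewrite mulrC mulr_natr -[X in _ *+ X]card_ord -sumr_const.
  apply: ler_sum => k _; rewrite !mxE.
  case: (eqVneq k j) => [->|/H]; rewrite -?E.
    by rewrite mulfV// mulr1 subrr expr0n sqr_ge0.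
  by move=> /andP[p1 p2]; rewrite lerXn2r ?nnegrE ?(ltW p1)// (le_trans (ltW p1)).
have ta : 1 <= tau * a by rewrite -[leLHS]mulr1 ler_pM.
have s0 := sqnorm_ge0 (theta - dir g).
apply/andP; split; last first.
  apply: le_trans ub; rewrite key; apply: le_trans (_ : tau * a * sqnorm (theta - dir g) <= _).
    by rewrite ler_peMl.
  by rewrite lerDr sqr_ge0.
rewrite lt_def s0 andbT; apply/eqP => Z.
have := H _ k0j; rewrite E.
have T0 : theta = dir g by apply/eqP; rewrite -subr_eq0 -sqnorm_eq0 Z.
have eg k : g ord0 k = a * theta ord0 k by rewrite (dir_scale g) -T0.
have -> : tau = a by rewrite /tau eg mulfK.
by rewrite eg subrr ltxx.
Qed.

End UnitVectors.

Section ExtendedProducts.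
Context {R : realType} (I : Type).
Implicit Types (r : seq I) (Q : pred I) (a b : I -> \bar R).

Lemma prode_ge0 r Q a : (forall i, Q i -> (0 <= a i)%E) -> (0 <= \prod_(i <- r | Q i) a i)%E.
Proof. by move=> a0; elim/big_ind: _ => // x y; exact: mule_ge0. Qed.

Lemma lee_prode r Q a b : (forall i, Q i -> (0 <= a i <= b i)%E) ->
  (\prod_(i <- r | Q i) a i <= \prod_(i <- r | Q i) b i)%E.
Proof.
move=> ab; have a0 i : Q i -> (0 <= a i)%E by move=> /ab/andP[].
elim: r => [|i r IH]; first by rewrite !big_nil.
rewrite !big_cons; case: ifP => // Qi; apply: lee_pmul => //.
- exact: a0.
- exact: prode_ge0.
- by have /andP[] := ab i Qi.
Qed.

End ExtendedProducts.

Lemma prode_const {R : realType} (I : finType) (Q : pred I) (c : R) :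
  (\prod_(i | Q i) c%:E = (c ^+ #|Q|)%:E)%E.
Proof. by rewrite prodEFin prodr_const. Qed.

Section MergedMeasure.
Context (R : realType) (I : choiceType) (Lam : probability (seqspace R I) R).
Local Notation U := (seqspace R I).
Let nu (i : I) (B : set R) := Lam [set u : U | B (u i)].
Hypothesis prodlaw : forall J B, uniq J -> (forall i, measurable (B i)) ->
  Lam (rect J B) = (\prod_(i <- J) nu i (B i))%E.

Lemma measurable_merge1 (D : pred I) (u : U) : measurable_fun [set: U] (fun v : U => merge D (u, v)).
Proof.
apply: measurable_to_seqspace => i; rewrite /merge /=; case: (D i) => //.
exact: measurable_coord.
Qed.

Lemma measurable_section (D : pred I) (u : U) (A : set U) : measurable A ->
  measurable [set v : U | A (merge D (u, v))].
Proof. by move=> mA; rewrite -[X in measurable X]setTI; exact: measurable_merge1. Qed.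

Lemma merge_measure (D : pred I) (A : set U) : measurable A ->
  Lam A = (\int[Lam]_u Lam [set v | A (merge D (u, v))])%E.
Proof.
move=> mA; transitivity (\int[Lam]_u (\1_A u)%:E)%E; first by rewrite integral_indic// setIT.
rewrite (merge_integral prodlaw D)//; last first.
  by apply/measurable_EFinP; exact: measurable_indic.
apply: eq_integral => u _.
rewrite -(setIT [set v | _]) -integral_indic//; last exact: measurable_section.
Qed.

Lemma measurable_fun_merge (D : pred I) (A : set U) : measurable A ->
  measurable_fun [set: U] (fun u => Lam [set v | A (merge D (u, v))]).
Proof.
move=> mA; have mm : measurable ((@merge R I D) @^-1` A).
  by rewrite -[X in measurable X]setTI; exact: measurable_merge.
apply: (eq_measurable_fun (Lam \o xsection ((@merge R I D) @^-1` A))).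
  by move=> u _ /=; congr (Lam _); apply/seteqP; split => v /=; rewrite /xsection /= ?in_setE// => /set_mem.
exact: measurable_fun_xsection.
Qed.

Lemma coord_integral (i : I) (m : {measure set (measurableTypeR R) -> \bar R}) (f : measurableTypeR R -> \bar R) :
  (forall B, measurable B -> nu i B = m B) ->
  measurable_fun [set: measurableTypeR R] f -> (forall x, (0 <= f x)%E) ->
  (\int[Lam]_u f (u i) = \int[m]_x f x)%E.
Proof.
move=> H mf f0.
pose X := @mk_mfun _ _ U (measurableTypeR R) (fun u : U => u i) (measurable_coord (R := R) i).
rewrite -(@ge0_integral_distribution _ _ U (measurableTypeR R) R Lam X f)//.
apply: eq_measure_integral => A mA _.
by rewrite -H.
Qed.

End MergedMeasure.

Section DirectionLaw.
Context {R : realType} (d : nat).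
Local Notation U := (seqspace R (ppp_idx d)).
Variable Lam : probability U R.
Let nu (i : ppp_idx d) (B : set R) := Lam [set u : U | B (u i)].
Hypothesis prodlaw : forall J B, uniq J -> (forall i, measurable (B i)) ->
  Lam (rect J B) = (\prod_(i <- J) nu i (B i))%E.
Hypothesis nuG : forall m j B, measurable B -> nu (inr (inr (m, j))) B = normal_prob 0 1 B.
Hypothesis d2 : (2 <= d)%N.

Definition gU (m : nat) (u : U) : 'rV[R]_d := \row_j u (inr (inr (m, j))).

(* A cap of radius r has measure at most dirC r^(d-1). *)
Definition dirC : R :=
  (2 * d%:R) ^+ d.-1 + (2 * (2 * d%:R * (d%:R + 1))) ^+ d.-1 * (2 * (d.-1)`!%:R * expR 1).

Let xG (m : nat) (j : 'I_d) : ppp_idx d := inr (inr (m, j)).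

Let xG_inj m : injective (xG m). Proof. by move=> j j' [->]. Qed.

(** At a fixed value of coordinate j, a cone around theta is controlled by a box in the other d - 1
    independent Gaussian coordinates. *)
Let slab (m : nat) (j : 'I_d) (lo : R -> 'I_d -> set R) : set U :=
  [set u | forall k, k != j -> lo (u (xG m j)) k (u (xG m k))].

Let slab_law m j lo (t : U) : (forall x k, measurable (lo x k)) ->
  Lam [set v | slab m j lo (merge (pred1 (xG m j)) (t, v))] =
  (\prod_(k | k != j) normal_prob 0 1 (lo (t (xG m j)) k))%E.
Proof.
move=> mlo.
pose B (x : ppp_idx d) : set R :=
  match x with inr (inr (_, k)) => lo (t (xG m j)) k | _ => setT end.
pose J := [seq xG m k | k <- enum 'I_d & k != j].
have -> : [set v | slab m j lo (merge (pred1 (xG m j)) (t, v))] = rect J B.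
  apply/seteqP; split => v /= H.
    move=> x /mapP[k]; rewrite mem_filter => /andP[kj _] ->.
    by have := H k kj; rewrite /merge /= eqxx (inj_eq (xG_inj (m := m))) (negbTE kj).
  move=> k kj; rewrite /merge /= eqxx (inj_eq (xG_inj (m := m))) (negbTE kj).
  by apply: (H (xG m k)); apply: map_f; rewrite mem_filter kj mem_enum.
rewrite prodlaw; last 2 first.
- rewrite (map_inj_uniq (@xG_inj m)); apply: filter_uniq; exact: enum_uniq.
- by move=> [x|[x|[x k]]] /=.
by rewrite big_map big_filter big_enum_cond/=; apply: eq_bigr => k _; exact: nuG.
Qed.

(** The cone lies in a slab with sides of length 2 w |g_j|. The Gaussian density is at most 1, so
    each side costs its length, and the moment of |g_j|^(d-1) is finite. *)
Lemma dir_upper m (theta : 'rV[R]_d) (sg : R) (A : set U) : measurable A ->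
  sqnorm theta = 1 -> 0 <= sg ->
  (forall u, A u -> gU m u = 0 \/ sqnorm (theta - dir (gU m u)) <= sg ^+ 2) ->
  (Lam A <= (dirC * sg ^+ d.-1)%:E)%E.
Proof.
move=> mA t1 sg0 H.
have d0 : (0 < d)%N by exact: ltnW.
have D0 : 0 < d%:R :> R by rewrite ltr0n.
set c1 : R := (2 * d%:R) ^+ d.-1.
set c := 2 * (2 * d%:R * (d%:R + 1)) : R.
set c2 := c ^+ d.-1 * (2 * (d.-1)`!%:R * expR 1).
have C2 : 0 <= c2 by rewrite !mulr_ge0 ?exprn_ge0 ?expR_ge0// !mulr_ge0// addr_ge0.
have C1 : 0 <= c1 by rewrite exprn_ge0// mulr_ge0.
have CE : dirC = c1 + c2 by [].
(* For a wide cap the summand c1 sg^(d-1) is already at least 1. *)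
case: (lerP (sg * (2 * d%:R)) 1) => sgd; last first.
  apply: le_trans (probability_le1 _ mA) _; rewrite lee_fin CE mulrDl; apply: ler_wpDr.
    by rewrite mulr_ge0// exprn_ge0.
  by rewrite /c1 -exprMn mulrC; apply: exprn_ege1; exact: ltW.
have [j tj] := unit_coord d0 t1.
pose w : R := 2 * d%:R * (d%:R + 1) * sg.
have w0 : 0 <= w by rewrite !mulr_ge0// addr_ge0.
pose lo (x : R) (k : 'I_d) : set R :=
  `[x * (theta ord0 k / theta ord0 j) - w * `|x|, x * (theta ord0 k / theta ord0 j) + w * `|x|]%classic.
have mco k : measurable_fun [set: U] (fun u : U => u (xG m k)) by exact: measurable_coord.
have mS : measurable (slab m j lo).
  have -> : slab m j lo = \bigcap_(k in [set k | k != j]) [set u : U |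
      `|u (xG m k) - u (xG m j) * (theta ord0 k / theta ord0 j)| <= w * `|u (xG m j)|].
    apply/seteqP; split => u /= h k kj; have := h k kj; rewrite /lo /= in_itv/= ler_distl//.
  apply: fin_bigcap_measurable; first exact: finite_finset.
  move=> k _; rewrite -[X in measurable X]setTI.
  apply: (@measurable_fun_ler _ _ _ _ (fun u : U => `|u (xG m k) - u (xG m j) * (theta ord0 k / theta ord0 j)|) (fun u : U => w * `|u (xG m j)|) _ _ measurableT [set true]) => //.
    by apply: measurableT_comp => //; apply: measurable_funB => //; exact: measurable_funM.
  by apply: measurable_funM => //; exact: measurableT_comp.
apply: (@le_trans _ _ (Lam (slab m j lo))).
  apply: le_measure; rewrite ?inE// => u Au k kj.
  rewrite /lo /= in_itv/= -ler_distl.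
  (* The zero vector has no direction but lies in the slab, whose sides shrink to the point 0
     there. *)
  have := H u Au => -[g0|cl].
    have E i : u (xG m i) = 0 by have := congr1 (fun M : 'rV[R]_d => M ord0 i) g0; rewrite !mxE.
    by rewrite !E mul0r subrr normr0 mulr0.
  by have := dir_close d0 t1 tj sg0 sgd cl k; rewrite !mxE.
rewrite (merge_measure prodlaw (pred1 (xG m j)) mS).
rewrite (eq_integral (fun u : U => (\prod_(k | k != j) normal_prob 0 1 (lo (u (xG m j)) k))%E)); last first.
  by move=> u _; apply: slab_law => x k; exact: measurable_itv.
apply: (@le_trans _ _ (\int[Lam]_u (((2 * w) ^+ d.-1)%:E * (`|u (xG m j)| ^+ d.-1)%:E))%E).
  apply: ge0_le_integral => //.
  - by move=> u _; apply: prode_ge0 => k _; exact: measure_ge0.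
  - apply: (eq_measurable_fun (fun u => Lam [set v | slab m j lo (merge (pred1 (xG m j)) (u, v))])).
      by move=> u _; apply: slab_law => x k; exact: measurable_itv.
    exact: measurable_fun_merge.
  - apply/measurable_EFinP; apply: measurable_funM => //; apply: measurable_funX.
    exact: measurableT_comp.
  move=> u _; rewrite -EFinM -exprMn.
  have -> : (((2 * w * `|u (xG m j)|) ^+ d.-1)%:E = \prod_(k | k != j) (2 * w * `|u (xG m j)|)%:E)%E.
    by rewrite prode_const cardC1 card_ord.
  apply: lee_prode => k kj; apply/andP; split; first exact: measure_ge0.
  apply: le_trans (gaussian_itv_ub _) _.
    by rewrite lerD2l ge0_cp// mulr_ge0.
  by rewrite lee_fin; lra.
rewrite ge0_integralZl//; last 2 first.
- by apply/measurable_EFinP; apply: measurable_funX; exact: measurableT_comp.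
- by rewrite lee_fin exprn_ge0// mulr_ge0.
have mn : measurable_fun [set: R] (fun x : R => (`|x| ^+ d.-1)%:E).
  by apply/measurable_EFinP; apply: measurable_funX; exact: normr_measurable.
rewrite (@coord_integral _ _ Lam (xG m j) (normal_prob (0 : R) 1) (fun x => (`|x| ^+ d.-1)%:E))//; last first.
  by move=> B mB; exact: nuG.
apply: (@le_trans _ _ (((2 * w) ^+ d.-1)%:E * (2 * (d.-1)`!%:R * expR 1)%:E)%E).
  by apply: lee_wpmul2l; [rewrite lee_fin exprn_ge0// mulr_ge0|exact: gaussian_abs_moment].
rewrite -EFinM lee_fin CE (mulrDl c1).
apply: (@le_trans _ _ (c2 * sg ^+ d.-1)); last by rewrite lerDr mulr_ge0// exprn_ge0.
rewrite /c2 /c /w !exprMn le_eqVlt; apply/orP; left; apply/eqP; ring.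
Qed.

(** One density factor for each of the d coordinates used in [dir_lower]: |g_j| <= 2, slopes at most
    d and h <= 1 keep all of them within 3 d. *)
Definition dirc : R := (normal_pdf 0 1 (3 * d%:R)) ^+ d.

Lemma dirc_gt0 : 0 < dirc. Proof. by rewrite exprn_gt0// phi_gt0. Qed.

(** Take g_j in an interval of length 1 with the sign of theta_j, and each other coordinate in an
    interval of length h just above the ray of theta. By [dir_near] such g belong to A, and each of
    the d - 1 other coordinates costs one factor h. *)
Lemma dir_lower m (theta : 'rV[R]_d) (h : R) (A : set U) : measurable A ->
  sqnorm theta = 1 -> 0 <= h <= 1 ->
  (forall u, gU m u != 0 -> 0 < sqnorm (theta - dir (gU m u)) <= d%:R * h ^+ 2 -> A u) ->
  ((dirc * h ^+ d.-1)%:E <= Lam A)%E.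
Proof.
move=> mA t1 /andP[h0 h1] H.
have d0 : (0 < d)%N by exact: ltnW.
have D0 : 0 < d%:R :> R by rewrite ltr0n.
have D2 : 2 <= d%:R :> R by rewrite ler_nat.
have [j tj] := unit_coord d0 t1.
have tj1 := coord_gt d0 t1 tj.
have tjn0 : theta ord0 j != 0.
  by apply/eqP => E; move: tj1; rewrite E normr0 mul0r ler10.
have t0 : 0 < `|theta ord0 j| by rewrite normr_gt0.
have ratio k : `|theta ord0 k / theta ord0 j| <= d%:R.
  rewrite normrM normfV ler_pdivrMr//; apply: le_trans (coord_le1 k t1) _.
  by rewrite mulrC.
have [k0 k0j] : exists k0 : 'I_d, k0 != j.
  have : (0 < #|predC1 j|)%N by rewrite cardC1 card_ord; lia.
  by move=> /card_gt0P[k0 hk]; exists k0.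
pose Ij : set R := if 0 < theta ord0 j then `]1, 2]%classic else `](-2), (-1)]%classic.
have mIj : measurable Ij by rewrite /Ij; case: ifP.
have Ij1 x : Ij x -> 1 <= `|x| <= 2 /\ 0 < x / theta ord0 j.
  rewrite /Ij; case: ifPn => tp; rewrite /= in_itv/= => /andP[x1 x2].
    have x0 : 0 < x by lra.
    by split; [rewrite gtr0_norm//; lra|exact: divr_gt0].
  have tn : theta ord0 j < 0 by rewrite lt_neqAle tjn0 leNgt.
  have x0 : 0 < - x by lra.
  split; first by rewrite -normrN gtr0_norm//; lra.
  by rewrite -mulrNN -invrN divr_gt0// oppr_gt0.
pose lo (x : R) (k : 'I_d) : set R :=
  `]x * (theta ord0 k / theta ord0 j), x * (theta ord0 k / theta ord0 j) + h]%classic.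
have mco k : measurable_fun [set: U] (fun u : U => u (xG m k)) by exact: measurable_coord.
have mS : measurable (slab m j lo).
  have -> : slab m j lo = \bigcap_(k in [set k | k != j])
     ([set u : U | u (xG m j) * (theta ord0 k / theta ord0 j) < u (xG m k)] `&`
      [set u : U | u (xG m k) <= u (xG m j) * (theta ord0 k / theta ord0 j) + h]).
    apply/seteqP; split => u /= hh k kj; have := hh k kj; rewrite /lo /= in_itv/=.
      by move=> /andP[].
    by move=> [-> ->].
  apply: fin_bigcap_measurable; first exact: finite_finset.
  move=> k _; apply: measurableI; rewrite -[X in measurable X]setTI.
    apply: (@measurable_fun_ltr _ _ _ _ (fun u : U => u (xG m j) * (theta ord0 k / theta ord0 j)) (fun u : U => u (xG m k)) _ _ measurableT [set true]) => //.
    exact: measurable_funM.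
  apply: (@measurable_fun_ler _ _ _ _ (fun u : U => u (xG m k)) (fun u : U => u (xG m j) * (theta ord0 k / theta ord0 j) + h) _ _ measurableT [set true]) => //.
  by apply: measurable_funD => //; exact: measurable_funM.
have mI : measurable [set u : U | Ij (u (xG m j))].
  by rewrite -[X in measurable X]setTI; exact: (mco j measurableT _ mIj).
apply: (@le_trans _ _ (Lam ([set u : U | Ij (u (xG m j))] `&` slab m j lo))); last first.
  apply: le_measure; rewrite ?inE//; first exact: measurableI.
  move=> u /= [uj us]; have [/andP[uj1 _] ujp] := Ij1 _ uj.
  apply: H.
    apply/eqP => g0; have := congr1 (fun M : 'rV[R]_d => M ord0 j) g0; rewrite !mxE => E.
    by move: uj1; rewrite /xG E normr0 ler10.
  apply: (dir_near (j := j) (k0 := k0)) => //; rewrite ?mxE//.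
  move=> k kj; have := us k kj; rewrite !mxE /lo /= in_itv/= subr_gt0 lerBlDl.
  by move=> ->.
rewrite (merge_measure prodlaw (pred1 (xG m j))); last exact: measurableI.
set p := normal_pdf 0 1 (3 * d%:R) : R.
have p0 : 0 < p by exact: phi_gt0.
apply: (@le_trans _ _ (\int[Lam]_u (((h * p) ^+ d.-1)%:E * (\1_Ij (u (xG m j)))%:E))%E).
  rewrite ge0_integralZl//; last 2 first.
  - by apply/measurable_EFinP; apply: measurableT_comp => //; exact: measurable_indic.
  - by rewrite lee_fin exprn_ge0// mulr_ge0// ltW.
  rewrite (@coord_integral _ _ Lam (xG m j) (normal_prob (0 : R) 1) (fun x => (\1_Ij x)%:E))//; last 2 first.
  - by move=> B mB; exact: nuG.
  - by apply/measurable_EFinP; exact: measurable_indic.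
  rewrite integral_indic// setIT.
  apply: (@le_trans _ _ (((h * p) ^+ d.-1)%:E * p%:E)%E).
    rewrite -EFinM lee_fin /dirc -/p exprMn -{1}(prednK d0) exprS.
    by rewrite le_eqVlt; apply/orP; left; apply/eqP; ring.
  apply: lee_wpmul2l; first by rewrite lee_fin exprn_ge0// mulr_ge0// ltW.
  rewrite /Ij; case: ifP => _.
    apply: le_trans (gaussian_itv_lb (B := 3 * d%:R) _ _ _); rewrite ?lee_fin -/p; lra.
  apply: le_trans (gaussian_itv_lb (B := 3 * d%:R) _ _ _); rewrite ?lee_fin -/p; lra.
apply: ge0_le_integral => //.
- by move=> u _; rewrite mule_ge0// lee_fin ?exprn_ge0// mulr_ge0// ltW.
- apply/measurable_EFinP; apply: measurable_funM => //.
  by apply: measurableT_comp => //; exact: measurable_indic.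
- by apply: measurable_fun_merge; exact: measurableI.
move=> u _; rewrite indicE; case: (boolP (u (xG m j) \in Ij)) => [uj|_]; last by rewrite mule0.
rewrite mule1 (_ : [set v | _] = [set v | slab m j lo (merge (pred1 (xG m j)) (u, v))]); last first.
  apply/seteqP; split => v /=; first by case.
  by move=> hv; split => //; rewrite /merge /= eqxx; exact: set_mem.
rewrite slab_law; last by move=> x k; exact: measurable_itv.
have -> : (((h * p) ^+ d.-1)%:E = \prod_(k | k != j) (h * p)%:E)%E.
  by rewrite prode_const cardC1 card_ord.
apply: lee_prode => k kj; apply/andP; split; first by rewrite lee_fin mulr_ge0// ltW.
have [/andP[_ u2] _] := Ij1 _ (set_mem uj).
have b : `|u (xG m j) * (theta ord0 k / theta ord0 j)| <= 2 * d%:R by rewrite normrM ler_pM.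
move: b; rewrite ler_norml => /andP[b1 b2].
apply: le_trans (gaussian_itv_lb (B := 3 * d%:R) _ _ _); rewrite ?lee_fin -/p; last 3 first.
- by rewrite lerDl.
- by lra.
- by lra.
by rewrite addrAC subrr add0r.
Qed.

End DirectionLaw.

(** * Edge probabilities along a chain, given the radii *)

Section Chains.
Context {R : realType} (d : nat) (zeta gamma Rn : R).
Local Notation U := (seqspace R (ppp_idx d)).
Variable Lam : probability U R.
Let nu (i : ppp_idx d) (B : set R) := Lam [set u : U | B (u i)].
Hypothesis prodlaw : forall J B, uniq J -> (forall i, measurable (B i)) ->
  Lam (rect J B) = (\prod_(i <- J) nu i (B i))%E.
Hypothesis nuG : forall m j B, measurable B -> nu (inr (inr (m, j))) B = normal_prob 0 1 B.
Hypothesis d2 : (2 <= d)%N.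
Hypothesis zeta0 : 0 < zeta.

Definition rad (m : nat) (u : U) : R := u (inr (inl m)).
Definition good (u : U) : Prop := forall m, 0 < rad m u <= Rn /\ gU m u != 0.
Hypothesis ae_rad : {ae Lam, forall u, forall m, 0 < rad m u <= Rn}.

Lemma ae_good : {ae Lam, forall u, good u}.
Proof.
have ag : {ae Lam, forall u, forall m, gU m u != 0}.
  apply/ae_foralln => m; have j : 'I_d := Ordinal (ltnW d2).
  have mj : measurable [set u : U | u (inr (inr (m, j))) = 0].
    rewrite -[X in measurable X]setTI.
    exact: (measurable_coord (R := R) (inr (inr (m, j)) : ppp_idx d) measurableT (measurable_set1 0)).
  exists [set u : U | u (inr (inr (m, j))) = 0]; split => //.
    have := nuG m j (measurable_set1 0); rewrite /nu /= => ->.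
    apply/eqP; rewrite eq_le measure_ge0 andbT.
    apply: (@le_trans _ _ (normal_prob (0 : R) 1 `[0, 0]%classic)).
      by apply: le_measure; rewrite ?inE// => x /= ->; rewrite in_itv/= lexx.
    by apply: le_trans (gaussian_itv_ub (lexx 0)) _; rewrite subrr.
  move=> u /= /negP; rewrite negbK => /eqP g0.
  by have := congr1 (fun M : 'rV[R]_d => M ord0 j) g0; rewrite !mxE.
near=> u; move=> m; split; move: m; near: u; [exact: ae_rad|exact: ag].
Unshelve. all: by end_near. Qed.

(** Resampling outside this set changes only the direction of point v; all radii and the other
    directions stay frozen. *)
Definition offdir (v : nat) : pred (ppp_idx d) := fun x =>
  if x is inr (inr (m, _)) then m != v else true.

Lemma gU_offdir w v (u v' : U) : gU w (merge (offdir v) (u, v')) = if w == v then gU v v' else gU w u.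
Proof.
by apply/rowP => j; case: (eqVneq w v) => [->|wv]; rewrite !mxE /merge /= ?eqxx ?wv.
Qed.

Lemma ptUE i (u : U) : ptU zeta i u = ball_point zeta (rad i u) (gU i u). Proof. by []. Qed.

Lemma adjU_offdir w v (u v' : U) : w != v -> adjU zeta gamma Rn w v (merge (offdir v) (u, v')) =
  (0 < hdist zeta (ball_point zeta (rad w u) (gU w u)) (ball_point zeta (rad v u) (gU v v')) <= Rn).
Proof. by move=> wv; rewrite /adjU (negbTE wv) !ptUE !gU_offdir eqxx (negbTE wv). Qed.

Lemma adjU_sym w v (u : U) : w != v -> adjU zeta gamma Rn w v u = adjU zeta gamma Rn v w u.
Proof. by move=> wv; rewrite /adjU (negbTE wv) eq_sym (negbTE wv) hdist_sym. Qed.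

Lemma adjU_mark w (u : U) : good u -> adjU zeta gamma Rn w w u = (Rn - rad w u <= gamma * Rn).
Proof.
move=> /(_ w)[/andP[r0 _] g0]; rewrite /adjU eqxx ptUE hdist0//; exact: ltW.
Qed.

Let s : R := zeta * (d%:R - 1) / 2.

(** The first summand comes from a cap of radius 6 exp (zeta x / 2) with x = Rn - r_w - r_v. The
    second makes the bound at least 1 once x >= -1/zeta, since s / zeta = (d - 1) / 2. *)
Definition stepC : R := dirC d * 6 ^+ d.-1 + expR ((d%:R - 1) / 2).
Definition stepc : R := dirc d / d%:R ^+ d.-1.

Lemma dirC_ge0 : 0 <= dirC d :> R.
Proof.
by rewrite addr_ge0 ?mulr_ge0 ?exprn_ge0 ?expR_ge0// !mulr_ge0// addr_ge0.
Qed.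

Lemma stepC_gt0 : 0 < stepC.
Proof. by rewrite ltr_wpDl ?expR_gt0// mulr_ge0 ?exprn_ge0 ?dirC_ge0. Qed.

Lemma stepc_gt0 : 0 < stepc.
Proof. by rewrite divr_gt0 ?dirc_gt0// exprn_gt0// ltr0n ltnW. Qed.

Let dpred : (d.-1)%:R = d%:R - 1 :> R.
Proof. by rewrite -subn1 natrB// ltnW. Qed.

Let expXs (x : R) : (expR (zeta * x / 2)) ^+ d.-1 = expR (s * x).
Proof. by rewrite -expRM_natl dpred; congr expR; rewrite /s; ring. Qed.

(* Probability, given all the radii, that the uniform direction of v brings it
   within distance Rn of w. *)
Definition stepK (w v : nat) (u : U) : R := stepC * expR (s * (Rn - rad w u - rad v u)).

(** By the law of cosines an edge forces sinh sinh [dirdist] / 2 <= exp (zeta Rn). If both radii are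
    at least 1/zeta, sinh is comparable to exp and the direction of v lies in a cap around that of
    w. If one radius is smaller, x > -1/zeta and the bound is trivial. *)
Lemma step_upper w v (u : U) : w != v -> good u ->
  (Lam [set v' : U | adjU zeta gamma Rn w v (merge (offdir v) (u, v'))] <= (stepK w v u)%:E)%E.
Proof.
move=> wv gu.
have mA : measurable [set v' : U | adjU zeta gamma Rn w v (merge (offdir v) (u, v'))].
  exact: (measurable_section (offdir v) u (measurable_adjU zeta gamma Rn w v true)).
have [/andP[rw0 rwR] gw] := gu w; have [/andP[rv0 rvR] _] := gu v.
set x := Rn - rad w u - rad v u.
have C1 : 0 <= dirC d * 6 ^+ d.-1 :> R by rewrite mulr_ge0 ?exprn_ge0 ?dirC_ge0.
have triv : - zeta^-1 <= x ->
    (Lam [set v' : U | adjU zeta gamma Rn w v (merge (offdir v) (u, v'))] <= (stepK w v u)%:E)%E.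
  move=> xz; apply: le_trans (probability_le1 _ mA) _; rewrite lee_fin /stepK -/x.
  apply: (@le_trans _ _ (expR ((d%:R - 1) / 2) * expR (s * x))); last first.
    by rewrite ler_wpM2r ?expR_ge0// lerDr.
  rewrite -expRD -[leLHS]expR0 ler_expR.
  have s0 : 0 <= s by rewrite /s divr_ge0// mulr_ge0 ?(ltW zeta0)// subr_ge0 ler1n ltnW.
  have := ler_wpM2l s0 xz.
  have -> : s * - zeta^-1 = - ((d%:R - 1) / 2) by rewrite /s; field; rewrite gt_eqF.
  lra.
case: (lerP 1 (zeta * rad w u)) => hw; last first.
  apply: triv; rewrite /x.
  have : rad w u < zeta^-1 by rewrite -[ltRHS]mul1r ltr_pdivlMr// mulrC.
  lra.
case: (lerP 1 (zeta * rad v u)) => hv; last first.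
  apply: triv; rewrite /x.
  have : rad v u < zeta^-1 by rewrite -[ltRHS]mul1r ltr_pdivlMr// mulrC.
  lra.
apply: (@le_trans _ _ (dirC d * (6 * expR (zeta * x / 2)) ^+ d.-1)%:E); last first.
  rewrite lee_fin exprMn expXs mulrA /stepK -/x ler_wpM2r ?expR_ge0//.
  by rewrite lerDl expR_ge0.
apply: (dir_upper (m := v) (theta := dir (gU w u)) prodlaw nuG d2 mA).
- exact: sqnorm_dir.
- by rewrite mulr_ge0// expR_ge0.
move=> v' /=; rewrite adjU_offdir// => /andP[_ H].
case: (eqVneq (gU v v') 0) => [|gv]; [by left|right].
have := hdist_le_dir zeta0 gw gv (ltW rw0) (ltW rv0) H.
rewrite /dirdist; set D := sqnorm _ => hD.
have D0 : 0 <= D by exact: sqnorm_ge0.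
have sw := sinh_lb hw; have sv := sinh_lb hv.
have ew : 0 < expR (zeta * rad w u) by exact: expR_gt0.
have ev : 0 < expR (zeta * rad v u) by exact: expR_gt0.
(* Two factors sinh >= exp / 4 and the division by 2 give 32, which 6^2 covers. *)
have e2 : (6 * expR (zeta * x / 2)) ^+ 2 * (expR (zeta * rad w u) * expR (zeta * rad v u)) = 36 * expR (zeta * Rn).
  have E : expR (zeta * x / 2) ^+ 2 * (expR (zeta * rad w u) * expR (zeta * rad v u)) = expR (zeta * Rn).
    by rewrite expr2 -!expRD; congr expR; rewrite /x; field.
  by rewrite exprMn -(mulrA (6 ^+ 2)) E; ring.
rewrite -(ler_pM2r (mulr_gt0 ew ev)) e2.
have h1 : expR (zeta * rad w u) / 4 * (expR (zeta * rad v u) / 4) <= sinhR (zeta * rad w u) * sinhR (zeta * rad v u).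
  by apply: ler_pM => //; rewrite divr_ge0 ?ltW.
have h2 := ler_wpM2r D0 h1.
have e0 := expR_gt0 (zeta * Rn).
have h3 : D * (expR (zeta * rad w u) * expR (zeta * rad v u)) =
   16 * (expR (zeta * rad w u) / 4 * (expR (zeta * rad v u) / 4) * D) by field.
rewrite h3; lra.
Qed.

(** Within K0 of the boundary the radial term is at most exp (zeta K0) <= exp (zeta Rn) / 4, as e^2
    >= 4. A punctured cap of squared radius d h^2 = exp (- zeta Rn) / d around the direction of w
    then suffices for the angular term. *)
Lemma step_lower K0 w v (u : U) : w != v -> good u -> zeta * K0 + 2 <= zeta * Rn ->
  Rn - K0 <= rad w u -> Rn - K0 <= rad v u ->
  ((stepc * expR (- (s * Rn)))%:E <=
   Lam [set v' : U | adjU zeta gamma Rn w v (merge (offdir v) (u, v'))])%E.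
Proof.
move=> wv gu RK kw kv.
have mA : measurable [set v' : U | adjU zeta gamma Rn w v (merge (offdir v) (u, v'))].
  exact: (measurable_section (offdir v) u (measurable_adjU zeta gamma Rn w v true)).
have [/andP[rw0 rwR] gw] := gu w; have [/andP[rv0 rvR] _] := gu v.
have D2 : 2 <= d%:R :> R by rewrite ler_nat.
have D0 : 0 < d%:R :> R by lra.
pose h := expR (zeta * (- Rn) / 2) / d%:R.
have K00 : 0 <= K0 by lra.
have zK : 0 <= zeta * K0 by rewrite mulr_ge0// ltW.
have h01 : 0 <= h <= 1.
  rewrite divr_ge0 ?expR_ge0//= ler_pdivrMr// mul1r.
  apply: le_trans (_ : expR 0 <= _); last by rewrite expR0; lra.
  by rewrite ler_expR mulrN; lra.
have -> : stepc * expR (- (s * Rn)) = dirc d * h ^+ d.-1.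
  by rewrite /h expr_div_n expXs mulrN /stepc; ring.
apply: (dir_lower (m := v) (theta := dir (gU w u)) prodlaw nuG d2 mA) => //.
- exact: sqnorm_dir.
move=> v' gv /andP[D1 Dh] /=; rewrite adjU_offdir//; apply/andP; split.
  exact: hdist_dir_gt0.
apply: hdist_dir_le => //; try exact: ltW.
rewrite /dirdist; move: D1 Dh; set D := sqnorm _ => D1 Dh.
have hc : coshR (zeta * (rad w u - rad v u)) <= expR (zeta * K0).
  have a1 : expR (zeta * (rad w u - rad v u)) <= expR (zeta * K0).
    by rewrite ler_expR ler_wpM2l ?(ltW zeta0)//; lra.
  have a2 : expR (- (zeta * (rad w u - rad v u))) <= expR (zeta * K0).
    by rewrite ler_expR -mulrN ler_wpM2l ?(ltW zeta0)//; lra.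
  rewrite /coshR; lra.
have he : 4 * expR (zeta * K0) <= expR (zeta * Rn).
  apply: le_trans (_ : expR (2 + zeta * K0) <= _); last by rewrite ler_expR; lra.
  rewrite expRD ler_wpM2r ?expR_ge0//.
  have -> : expR 2 = expR 1 * expR 1 :> R by rewrite -expRD; congr expR; ring.
  have e1 : 2 <= expR 1 :> R by have := expRge1D (1 : R); lra.
  by have := ler_pM (ler0n R 2) (ler0n R 2) e1 e1; lra.
have sm (r : R) : 0 < r -> r <= Rn -> 0 <= sinhR (zeta * r) <= expR (zeta * Rn) / 2.
  move=> r0 rR; apply/andP; split; first by apply: sinh_ge0; apply: mulr_ge0; exact: ltW.
  apply: le_trans (sinh_ub _) _; rewrite ler_wpM2r//.
  by rewrite ler_expR ler_wpM2l// ltW.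
have /andP[sw0 sw] := sm _ rw0 rwR; have /andP[sv0 sv] := sm _ rv0 rvR.
have ss := ler_pM sw0 sv0 sw sv.
have ss2 := ler_pM (mulr_ge0 sw0 sv0) (ltW D1) ss Dh.
have E : expR (zeta * Rn) / 2 * (expR (zeta * Rn) / 2) * (d%:R * h ^+ 2) = expR (zeta * Rn) / 4 / d%:R.
  have e2 : expR (zeta * - Rn / 2) ^+ 2 = (expR (zeta * Rn))^-1.
    by rewrite expr2 -expRD -expRN; congr expR; field.
  rewrite /h expr_div_n e2; field; rewrite !gt_eqF ?expR_gt0//.
rewrite E in ss2.
have e0 := expR_gt0 (zeta * Rn).
have : expR (zeta * Rn) / 4 / d%:R <= expR (zeta * Rn) / 4.
  by rewrite ler_pdivrMr// ler_peMr ?divr_ge0 ?(ltW e0)//; lra.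
lra.
Qed.

Lemma measurable_adj1 w v :
  measurable_fun [set: U] (fun u : U => (adjU zeta gamma Rn w v u)%:R%:E : \bar R).
Proof.
pose A := [set u : U | adjU zeta gamma Rn w v u = true].
have mA : measurable A by exact: measurable_adjU.
apply: (eq_measurable_fun (fun u : U => (\1_A u)%:E)); last first.
  by apply/measurable_EFinP; exact: measurable_indic.
move=> u _; rewrite indicE; congr (_%:R%:E); congr nat_of_bool.
by apply/idP/idP => [/set_mem//|h]; exact: mem_set.
Qed.

Lemma step_integral w v (Q : U -> \bar R) : w != v -> measurable_fun [set: U] Q ->
  (forall u, (0 <= Q u)%E) -> (forall u v', Q (merge (offdir v) (u, v')) = Q u) ->
  (\int[Lam]_u ((adjU zeta gamma Rn w v u)%:R%:E * Q u) =
   \int[Lam]_u (Lam [set v' : U | adjU zeta gamma Rn w v (merge (offdir v) (u, v'))] * Q u))%E.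
Proof.
move=> wv mQ Q0 QD.
have mI := measurable_adj1 w v.
rewrite (merge_integral prodlaw (offdir v)); last 2 first.
- exact: emeasurable_funM.
- by move=> u; rewrite mule_ge0// lee_fin.
apply: eq_integral => u _.
rewrite (eq_integral (fun v' : U => ((adjU zeta gamma Rn w v (merge (offdir v) (u, v')))%:R%:E * Q u)%E)); last first.
  by move=> v' _; rewrite QD.
have mA : measurable [set v' : U | adjU zeta gamma Rn w v (merge (offdir v) (u, v'))].
  exact: (measurable_section (offdir v) u (measurable_adjU zeta gamma Rn w v true)).
rewrite ge0_integralZr; [|exact: measurableT|exact: (measurableT_comp mI (measurable_merge1 (offdir v) u))|by move=> v' _; rewrite lee_fin|exact: Q0].
congr (_ * _)%E.
set A := [set v' : U | _] in mA *.
transitivity (\int[Lam]_v' (\1_A v')%:E)%E; last by rewrite integral_indic// setIT.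
apply: eq_integral => v' _; rewrite indicE; congr (_%:R%:E); congr nat_of_bool.
by apply/idP/idP => [h|/set_mem//]; exact: mem_set.
Qed.

Context (J : eqType) (lab : J -> nat).
Hypothesis lab_inj : injective lab.

Definition adjl (l : seq (J * J)) (u : U) : bool :=
  all (fun p => adjU zeta gamma Rn (lab p.1) (lab p.2) u) l.

Definition radial (T : Type) (W : U -> T) : Prop :=
  forall u v, (forall m, rad m u = rad m v) -> W u = W v.

Lemma measurable_adjl l : measurable_fun [set: U] (fun u => (adjl l u)%:R%:E : \bar R).
Proof.
rewrite /adjl; elim: l => [|p l IH] /=; first exact: measurable_cst.
apply: (eq_measurable_fun (fun u : U => ((adjU zeta gamma Rn (lab p.1) (lab p.2) u)%:R%:E *
    (all (fun p => adjU zeta gamma Rn (lab p.1) (lab p.2) u) l)%:R%:E)%E)).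
  by move=> u _; rewrite -EFinM -natrM mulnb.
by apply: emeasurable_funM => //; exact: measurable_adj1.
Qed.

Lemma adjl_offdir x0 l v u v' : chain x0 l -> v \notin verts x0 l ->
  adjl l (merge (offdir (lab v)) (u, v')) = adjl l u.
Proof.
move=> cl vl; apply: eq_in_all => p pl.
have /andP[p1 p2] := chain_mem cl pl.
have np x : x \in verts x0 l -> lab x != lab v.
  by move=> xl; rewrite (inj_eq lab_inj); apply: contraNneq vl => <-.
apply: adjU_local.
- by move=> x /orP[] /eqP ->.
- by move=> k; rewrite /merge /= np.
- by move=> k; rewrite /merge /= np.
Qed.

Lemma adjl_cons p l (W : U -> \bar R) u :
  ((adjl (p :: l) u)%:R%:E * W u = (adjU zeta gamma Rn (lab p.1) (lab p.2) u)%:R%:E * ((adjl l u)%:R%:E * W u))%E.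
Proof. by rewrite muleA -EFinM -natrM mulnb. Qed.

Lemma measurable_rad m : measurable_fun [set: U] (rad m).
Proof. exact: measurable_coord. Qed.

Lemma measurable_stepK w v : measurable_fun [set: U] (stepK w v).
Proof.
apply: measurable_funM => //; apply: measurable_funexpR; apply: measurable_funM => //.
by apply: measurable_funB; [apply: measurable_funB => //|]; exact: measurable_rad.
Qed.

Lemma stepK_ge0 w v u : 0 <= stepK w v u.
Proof. by rewrite mulr_ge0 ?expR_ge0// ltW// stepC_gt0. Qed.

Let neq_chain x0 p l : chain x0 (p :: l) -> lab p.1 != lab p.2.
Proof.
move=> /= /and3P[_ h1 h2]; rewrite (inj_eq lab_inj).
by apply: contraNneq h2 => <-.
Qed.

Let Qinv x0 p l (W : U -> \bar R) : chain x0 (p :: l) -> radial W ->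
  forall u v', ((adjl l (merge (offdir (lab p.2)) (u, v')))%:R%:E * W (merge (offdir (lab p.2)) (u, v')) =
   (adjl l u)%:R%:E * W u)%E.
Proof.
by move=> /= /and3P[cl _ h2] rW u v'; rewrite (adjl_offdir _ _ cl h2); congr (_ * _)%E; exact: rW.
Qed.

(** The newest vertex has a direction that occurs in no earlier edge and not in W, so resampling it
    replaces its edge by [stepK]. This factor is radial and joins W for the induction, which is why
    W is general. *)
Lemma chain_upper x0 l (W : U -> \bar R) : chain x0 l -> radial W ->
  measurable_fun [set: U] W -> (forall u, (0 <= W u)%E) ->
  (\int[Lam]_u ((adjl l u)%:R%:E * W u) <=
   \int[Lam]_u ((\prod_(p <- l) stepK (lab p.1) (lab p.2) u)%:E * W u))%E.
Proof.
elim: l W => [|p l IH] W cl rW mW W0.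
  by rewrite le_eqVlt; apply/orP; left; apply/eqP; apply: eq_integral => u _; rewrite /adjl big_nil.
have mK := measurable_stepK (lab p.1) (lab p.2).
have mA : measurable_fun [set: U] (fun u : U => Lam [set v' : U | adjU zeta gamma Rn (lab p.1) (lab p.2) (merge (offdir (lab p.2)) (u, v'))]).
  exact: (measurable_fun_merge Lam (offdir (lab p.2)) (measurable_adjU zeta gamma Rn (lab p.1) (lab p.2) true)).
rewrite (eq_integral (fun u : U => (adjU zeta gamma Rn (lab p.1) (lab p.2) u)%:R%:E * ((adjl l u)%:R%:E * W u))%E); last first.
  by move=> u _; exact: adjl_cons.
rewrite step_integral; last 4 first.
- exact: neq_chain cl.
- by apply: emeasurable_funM => //; exact: measurable_adjl.
- by move=> u; rewrite mule_ge0// lee_fin.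
- exact: Qinv cl rW.
apply: (@le_trans _ _ (\int[Lam]_u ((stepK (lab p.1) (lab p.2) u)%:E * ((adjl l u)%:R%:E * W u)))%E).
  apply: ae_ge0_le_integral => //.
  - by move=> u _; rewrite !mule_ge0// lee_fin.
  - by apply: emeasurable_funM => //; apply: emeasurable_funM => //; exact: measurable_adjl.
  - by move=> u _; rewrite !mule_ge0// lee_fin ?stepK_ge0.
  - apply: emeasurable_funM; first exact/measurable_EFinP.
    by apply: emeasurable_funM => //; exact: measurable_adjl.
  apply: filterS ae_good => u gu _; apply: lee_wpmul2r; first by rewrite mule_ge0// lee_fin.
  exact: step_upper (neq_chain cl) gu.
apply: le_trans (le_trans (IH (fun u => ((stepK (lab p.1) (lab p.2) u)%:E * W u)%E) _ _ _ _) _).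
- by rewrite le_eqVlt; apply/orP; left; apply/eqP; apply: eq_integral => u _; rewrite muleCA.
- by move: cl => /= /and3P[].
- by move=> u v h; rewrite (rW _ _ h) /stepK !h.
- by apply: emeasurable_funM => //; exact/measurable_EFinP.
- by move=> u; rewrite mule_ge0// lee_fin stepK_ge0.
by rewrite le_eqVlt; apply/orP; left; apply/eqP; apply: eq_integral => u _; rewrite big_cons mulrC EFinM muleA.
Qed.

(** The same induction from below. [step_lower] needs both ends of an edge near the boundary, which
    the support condition on W provides. *)
Lemma chain_lower K0 x0 l (W : U -> \bar R) : zeta * K0 + 2 <= zeta * Rn ->
  chain x0 l -> radial W -> measurable_fun [set: U] W -> (forall u, (0 <= W u)%E) ->
  (forall u x, x \in verts x0 l -> rad (lab x) u < Rn - K0 -> W u = 0%E) ->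
  (((stepc * expR (- (s * Rn))) ^+ size l)%:E * \int[Lam]_u W u <=
   \int[Lam]_u ((adjl l u)%:R%:E * W u))%E.
Proof.
move=> RK; set c := stepc * _.
have c0 : 0 <= c by rewrite mulr_ge0 ?expR_ge0// ltW// stepc_gt0.
elim: l => [|p l IH] cl rW mW W0 supp.
  rewrite expr0 mul1e; rewrite le_eqVlt; apply/orP; left; apply/eqP.
  by apply: eq_integral => u _; rewrite /adjl /= mul1e.
have mA : measurable_fun [set: U] (fun u : U => Lam [set v' : U | adjU zeta gamma Rn (lab p.1) (lab p.2) (merge (offdir (lab p.2)) (u, v'))]).
  exact: (measurable_fun_merge Lam (offdir (lab p.2)) (measurable_adjU zeta gamma Rn (lab p.1) (lab p.2) true)).
have /and3P[cl' p1 p2] : chain x0 (p :: l) by [].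
rewrite [leRHS](eq_integral (fun u : U => (adjU zeta gamma Rn (lab p.1) (lab p.2) u)%:R%:E * ((adjl l u)%:R%:E * W u))%E); last first.
  by move=> u _; exact: adjl_cons.
rewrite step_integral; last 4 first.
- exact: neq_chain cl.
- by apply: emeasurable_funM => //; exact: measurable_adjl.
- by move=> u; rewrite mule_ge0// lee_fin.
- exact: Qinv cl rW.
apply: (@le_trans _ _ (\int[Lam]_u (c%:E * ((adjl l u)%:R%:E * W u)))%E); last first.
  apply: ae_ge0_le_integral => //.
  - by move=> u _; rewrite !mule_ge0// lee_fin.
  - by apply: emeasurable_funM => //; apply: emeasurable_funM => //; exact: measurable_adjl.
  - by move=> u _; rewrite !mule_ge0// lee_fin.
  - by apply: emeasurable_funM => //; apply: emeasurable_funM => //; exact: measurable_adjl.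
  apply: filterS ae_good => u gu _.
  case: (lerP (Rn - K0) (rad (lab p.1) u)) => h1; last first.
    by rewrite (supp _ p.1)// ?inE ?p1 ?orbT// !mule0.
  case: (lerP (Rn - K0) (rad (lab p.2) u)) => h2; last first.
    by rewrite (supp _ p.2)// ?inE ?eqxx// !mule0.
  apply: lee_wpmul2r; first by rewrite mule_ge0// lee_fin.
  exact: (step_lower (neq_chain cl) gu RK).
rewrite ge0_integralZl//; last 2 first.
- by apply: emeasurable_funM => //; exact: measurable_adjl.
- by move=> u _; rewrite mule_ge0// lee_fin.
rewrite /= exprS EFinM -muleA; apply: lee_wpmul2l; first by rewrite lee_fin.
apply: IH => // u x xl; apply: supp.
by rewrite inE xl orbT.
Qed.

End Chains.

Lemma sinh_mono {R : realType} (x y : R) : x <= y -> sinhR x <= sinhR y.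
Proof.
move=> xy; rewrite /sinhR ler_wpM2r//; apply: lerB; rewrite ler_expR//; lra.
Qed.

(** * Radii *)

Section RadialDensity.
Context {R : realType} (d : nat) (alpha Rn : R).
Hypothesis alpha0 : 0 < alpha.
Hypothesis Rbig : 1 + alpha <= alpha * Rn.
Local Notation mu := (@lebesgue_measure R).
Local Notation sh r := ((sinhR (alpha * r)) ^+ d.-1).

(** Constants of the bound rhoC exp (- rhob T) for the radial density: sinh^(d-1) is at most of
    order exp (rhob r), and [rhoC] absorbs the comparison with its value at Rn - 1. *)
Definition rhoC : R := (2 * expR alpha) ^+ d.-1.
Definition rhob : R := alpha * (d.-1)%:R.

Let R1 : 1 <= Rn.
Proof.
have h : alpha * 1 <= alpha * Rn by move: Rbig; rewrite mulr1; lra.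
by rewrite ler_pM2l in h.
Qed.

Let sh_ge0 r : 0 <= r -> 0 <= sh r.
Proof. by move=> r0; apply: exprn_ge0; apply: sinh_ge0; rewrite mulr_ge0// ltW. Qed.

Let sh_mono r r' : 0 <= r -> r <= r' -> sh r <= sh r'.
Proof.
move=> r0 rr; have h : sinhR (alpha * r) <= sinhR (alpha * r').
  by apply: sinh_mono; rewrite ler_wpM2l// ltW.
have h0 : 0 <= sinhR (alpha * r) by apply: sinh_ge0; rewrite mulr_ge0// ltW.
by rewrite lerXn2r// nnegrE// (le_trans h0 h).
Qed.

Lemma measurable_sh (A : set R) : measurable_fun A (fun r => sh r).
Proof.
apply: measurable_funTS; apply: measurable_funX; rewrite /sinhR.
apply: measurable_funM => //; apply: measurable_funB; apply: measurable_funexpR.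
  exact: mulrl_measurable.
apply: measurableT_comp => //; exact: mulrl_measurable.
Qed.

Let Z : R := fine (\int[mu]_(s in `[0%R, Rn]) (sh s)%:E)%E.

(** The integrand increases, so the last unit of the interval contributes at least its value at Rn -
    1. *)
Lemma rho_norm_lb : sh (Rn - 1) <= Z.
Proof.
have m0 : (\int[mu]_(s in `[0%R, Rn]) (sh s)%:E <= (sh Rn * Rn)%:E)%E.
  apply: (@le_trans _ _ (\int[mu]_(s in `[0%R, Rn]) (sh Rn)%:E)%E).
    apply: ge0_le_integral => //=.
    - by move=> x; rewrite in_itv/= => /andP[x0 _]; rewrite lee_fin sh_ge0.
    - by apply/measurable_EFinP; exact: measurable_sh.
    - by move=> x; rewrite in_itv/= => /andP[x0 x1]; rewrite lee_fin sh_mono.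
  rewrite integral_cst//= lebesgue_measure_itv/= lte_fin (lt_le_trans ltr01 R1) oppr0.
  by rewrite adde0 -EFinM.
have l0 : ((sh (Rn - 1))%:E <= \int[mu]_(s in `[0%R, Rn]) (sh s)%:E)%E.
  apply: (@le_trans _ _ (\int[mu]_(s in `[(Rn - 1)%R, Rn]) (sh (Rn - 1))%:E)%E).
    rewrite integral_cst//= lebesgue_measure_itv/= lte_fin gtrBl ltr01.
    by rewrite -EFinB opprB addrCA subrr addr0 mule1.
  apply: (@le_trans _ _ (\int[mu]_(s in `[(Rn - 1)%R, Rn]) (sh s)%:E)%E).
    apply: ge0_le_integral => //=.
    - by move=> x _; rewrite lee_fin sh_ge0// subr_ge0.
    - by apply/measurable_EFinP; exact: measurable_sh.
    - by move=> x; rewrite in_itv/= => /andP[x0 x1]; rewrite lee_fin sh_mono// subr_ge0.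
  apply: ge0_subset_integral => //=.
  - by apply/measurable_EFinP; exact: measurable_sh.
  - by move=> x; rewrite in_itv/= => /andP[x0 _]; rewrite lee_fin sh_ge0.
  - by move=> x /=; rewrite !in_itv/= => /andP[x0 ->]; rewrite andbT; have := R1; lra.
rewrite /Z -lee_fin fineK// ge0_fin_numE ?(le_lt_trans m0)// ?ltry//.
by apply: le_trans l0; rewrite lee_fin sh_ge0// subr_ge0.
Qed.

Let sh_lb : (expR (alpha * (Rn - 1)) / 4) ^+ d.-1 <= sh (Rn - 1).
Proof.
have h : expR (alpha * (Rn - 1)) / 4 <= sinhR (alpha * (Rn - 1)) by apply: sinh_lb; have := Rbig; lra.
have h0 : 0 <= expR (alpha * (Rn - 1)) / 4 by rewrite divr_ge0// expR_ge0.
by rewrite lerXn2r// nnegrE// (le_trans h0 h).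
Qed.

Let q_gt0 : 0 < (expR (alpha * (Rn - 1)) / 4) ^+ d.-1.
Proof. by rewrite exprn_gt0// divr_gt0// expR_gt0. Qed.

Let Z0 : 0 < Z.
Proof. exact: lt_le_trans (lt_le_trans q_gt0 sh_lb) rho_norm_lb. Qed.

Lemma rho_ge0 r : 0 <= r -> 0 <= rho_dens d alpha Rn r.
Proof. by move=> r0; rewrite divr_ge0 ?sh_ge0//; exact: ltW Z0. Qed.

Lemma rho_ub r : 0 <= r -> rho_dens d alpha Rn r <= rhoC * expR (rhob * (r - Rn)).
Proof.
move=> r0; rewrite /rho_dens -/Z ler_pdivrMr ?Z0//.
apply: (@le_trans _ _ (rhoC * expR (rhob * (r - Rn)) * (expR (alpha * (Rn - 1)) / 4) ^+ d.-1)); last first.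
  apply: ler_wpM2l; last exact: le_trans sh_lb rho_norm_lb.
  by rewrite mulr_ge0 ?expR_ge0// exprn_ge0// mulr_ge0// expR_ge0.
have -> : expR (rhob * (r - Rn)) = expR (alpha * (r - Rn)) ^+ d.-1.
  by rewrite -expRM_natl /rhob; congr expR; ring.
rewrite /rhoC -!exprMn.
have -> : 2 * expR alpha * expR (alpha * (r - Rn)) * (expR (alpha * (Rn - 1)) / 4) = expR (alpha * r) / 2.
  have -> : expR (alpha * r) = expR alpha * expR (alpha * (r - Rn)) * expR (alpha * (Rn - 1)).
    by rewrite -!expRD; congr expR; ring.
  by field.
have h0 : 0 <= sinhR (alpha * r) by apply: sinh_ge0; rewrite mulr_ge0// ltW.
have hu := sinh_ub (alpha * r).
by rewrite lerXn2r// nnegrE// (le_trans h0 hu).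
Qed.

Lemma measurable_rho (A : set R) : measurable_fun A (rho_dens d alpha Rn).
Proof. by apply: measurable_funM => //; exact: measurable_sh. Qed.

End RadialDensity.

Section RadiusLaw.
Context {R : realType} (d : nat) (alpha Rn : R).
Hypothesis alpha0 : 0 < alpha.
Hypothesis Rbig : 1 + alpha <= alpha * Rn.
Local Notation U := (seqspace R (ppp_idx d)).
Variable Lam : probability U R.
Let nu (i : ppp_idx d) (B : set R) := Lam [set u : U | B (u i)].
Hypothesis nuR : forall m (B : set R), measurable B -> nu (inr (inl m)) B =
  (\int[lebesgue_measure]_(r in B `&` `[0%R, Rn]) (rho_dens d alpha Rn r)%:E)%E.

Lemma ae_rad : {ae Lam, forall u : U, forall m, 0 < rad m u <= Rn}.
Proof.
apply/ae_foralln => m.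
have mB : measurable (~` `]0, Rn]%classic : set R) by exact: measurableC.
exists [set u : U | (~` `]0, Rn]%classic : set R) (u (inr (inl m)))]; split => //.
- rewrite -[X in measurable X]setTI.
  exact: (measurable_coord (R := R) (inr (inl m) : ppp_idx d) measurableT mB).
- apply: (etrans (nuR m mB)).
  rewrite (_ : _ `&` _ = [set 0]); first by rewrite integral_set1.
  have R0 : 0 <= Rn.
    have h : alpha * 0 <= alpha * Rn by move: Rbig alpha0; rewrite mulr0; lra.
    by rewrite ler_pM2l in h.
  apply/seteqP; split => x /=; rewrite !in_itv/=.
    move=> [h /andP[x0 xR]]; apply/eqP; rewrite eq_le x0 andbT leNgt.
    by apply/negP => xp; apply: h; rewrite xp xR.
  by move=> ->; rewrite ltxx lexx R0.
Qed.

Lemma rad_cell m (j : nat) :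
  (nu (inr (inl m)) `](Rn - j.+1%:R)%R, (Rn - j%:R)%R]%classic <= (rhoC d alpha * expR (- (rhob d alpha * j%:R)))%:E)%E.
Proof.
rewrite nuR//.
have C0 : 0 <= rhoC d alpha * expR (- (rhob d alpha * j%:R)).
  by rewrite mulr_ge0 ?expR_ge0// exprn_ge0// mulr_ge0// expR_ge0.
have b0 : 0 <= rhob d alpha by rewrite mulr_ge0// ltW.
set B := `]Rn - j.+1%:R, Rn - j%:R]%classic : set R.
have mB0 : measurable B by exact: measurable_itv.
have mB : measurable (B `&` `[0, Rn]%classic) by apply: measurableI => //; exact: measurable_itv.
apply: (@le_trans _ _ (\int[lebesgue_measure]_(r in B `&` `[0%R, Rn]) (rhoC d alpha * expR (- (rhob d alpha * j%:R)))%:E)%E).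
  apply: ge0_le_integral => //.
  - by move=> x [_]; rewrite /= in_itv/= => /andP[x0 _]; rewrite lee_fin rho_ge0.
  - by apply/measurable_EFinP; exact: measurable_rho.
  move=> x []; rewrite /B /= !in_itv/= => /andP[_ x1] /andP[x0 _]; rewrite lee_fin.
  apply: le_trans (rho_ub d alpha0 Rbig x0) _; rewrite ler_wpM2l//.
    by rewrite exprn_ge0// mulr_ge0// expR_ge0.
  by rewrite ler_expR -mulrN ler_wpM2l//; lra.
rewrite integral_cst// -[leRHS]mule1; apply: lee_wpmul2l; first by rewrite lee_fin.
apply: (@le_trans _ _ (lebesgue_measure B)); first by apply: le_measure; rewrite ?inE//; exact: subIsetl.
rewrite /B lebesgue_measure_itv/= lte_fin; case: ifP => _ //.
by rewrite -EFinB lee_fin -natr1; lra.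
Qed.

(* Geometric series over unit cells of the radial density rhoC exp(-rhob T). *)
Definition tailC (s' : R) : R :=
  rhoC d alpha * expR s' * expR ((rhob d alpha - s') / 2) / (1 - expR (- ((rhob d alpha - s') / 2))).

Lemma tailC_gt0 s' : s' < rhob d alpha -> 0 < tailC s'.
Proof.
move=> sb; rewrite divr_gt0 ?mulr_gt0 ?expR_gt0 ?exprn_gt0 ?mulr_gt0 ?expR_gt0//.
by rewrite subr_gt0 -[ltRHS]expR0 ltr_expR; lra.
Qed.

Lemma geometric_le (x : R) M : 0 <= x < 1 -> \sum_(j < M) x ^+ j <= (1 - x)^-1.
Proof.
move=> /andP[x0 x1]; have y0 : 0 < 1 - x by lra.
rewrite -[leRHS]mul1r ler_pdivlMr// mulrC.
have -> : (1 - x) * (\sum_(j < M) x ^+ j) = 1 - x ^+ M.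
  by rewrite -[in RHS](expr1n _ M) subrXX; congr (_ * _); apply: eq_bigr => i _; rewrite expr1n mul1r.
by rewrite gerBl exprn_ge0.
Qed.

(** The unit cell j of T weighs at most rhoC exp (- rhob j), while the exponential is at most exp
    (s' (j + 1)) there. One half of the surplus rate rhob - s' pays for the decay in K, the other
    half sums to a geometric series. *)
Lemma rad_tail m (s' K : R) : 0 <= s' -> s' < rhob d alpha -> 0 <= K ->
  (\int[Lam]_u ((expR (s' * (Rn - rad m u)) * (K <= Rn - rad m u)%R%:R)%:E) <=
   (tailC s' * expR (- ((rhob d alpha - s') / 2 * K)))%:E)%E.
Proof.
move=> s0 sb K0; have [dl dlE] : exists dl, dl = (rhob d alpha - s') / 2 by exists ((rhob d alpha - s') / 2).
have dl0 : 0 < dl by rewrite dlE; lra.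
rewrite -dlE.
(* Almost surely 0 <= T <= Rn, so this many unit cells suffice. *)
pose M := (Num.truncn Rn).+1.
pose cell (j : nat) : set R := `]Rn - j.+1%:R, Rn - j%:R]%classic.
have mcell j : measurable (cell j) by exact: measurable_itv.
pose c (j : nat) : R := expR (s' * j.+1%:R) * (K < j.+1%:R)%R%:R.
have c0 j : 0 <= c j by rewrite mulr_ge0 ?expR_ge0.
have mr : measurable_fun [set: U] (rad m) by exact: measurable_rad.
have mi j : measurable_fun [set: U] (fun u => (\1_(cell j) (rad m u))%:E : \bar R).
  by apply/measurable_EFinP; exact: (measurableT_comp (@measurable_indic _ _ R setT _ (mcell j)) mr).
apply: (@le_trans _ _ (\int[Lam]_u (\sum_(j < M) ((c j)%:E * (\1_(cell j) (rad m u))%:E)))%E).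
  apply: ae_ge0_le_integral => //.
  - apply/measurable_EFinP; apply: measurable_funM.
      apply: measurable_funexpR; apply: measurable_funM => //; exact: measurable_funB.
    have mE : measurable [set u : U | K <= Rn - rad m u].
      rewrite -[X in measurable X]setTI.
      apply: (@measurable_fun_ler _ _ _ _ (fun=> K) (fun u : U => Rn - rad m u) _ _ measurableT [set true]) => //.
      exact: measurable_funB.
    apply: (eq_measurable_fun (\1_[set u : U | K <= Rn - rad m u] : U -> R)); last exact: measurable_indic.
    move=> u _; rewrite indicE; congr (_%:R); congr nat_of_bool.
    by apply/idP/idP => [/set_mem//|h]; exact: mem_set.
  - by move=> u _; apply: sume_ge0 => j _; rewrite mule_ge0// lee_fin.
  - by apply: emeasurable_sum => j; apply: emeasurable_funM.
  apply: filterS ae_rad => u /(_ m)/andP[r0 rR] _.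
  set T := Rn - rad m u; have T0 : 0 <= T by rewrite subr_ge0.
  have [j1 j2] := andP (truncn_itv T0).
  have jM : (Num.truncn T < M)%N.
    by rewrite /M ltnS; apply: le_truncn; rewrite /T; lra.
  rewrite (bigD1 (Ordinal jM))//=.
  have -> : \1_(cell (Num.truncn T)) (rad m u) = 1 :> R.
    rewrite indicE mem_set// /cell /= in_itv/=; apply/andP; split; rewrite /T in j1 j2 *; lra.
  rewrite mule1; apply: le_trans (leeDl _ _); last by apply: sume_ge0 => j _; rewrite mule_ge0// lee_fin.
  rewrite lee_fin /c; apply: ler_pM; rewrite ?expR_ge0//.
    by rewrite ler_expR ler_wpM2l// ltW.
  by case: (lerP K T) => // KT; rewrite (le_lt_trans KT j2).
rewrite ge0_integral_sum//; last 2 first.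
- by move=> j; exact: emeasurable_funM.
- by move=> j u _; rewrite mule_ge0// lee_fin.
apply: (@le_trans _ _ (\sum_(j < M) ((c j)%:E * (rhoC d alpha * expR (- (rhob d alpha * j%:R)))%:E))%E).
  apply: lee_sum => j _.
  rewrite ge0_integralZl//; last by rewrite lee_fin.
  apply: lee_wpmul2l; first by rewrite lee_fin.
  apply: le_trans (rad_cell m j).
  have mE : measurable [set u : U | (cell j) (rad m u)].
    by rewrite -[X in measurable X]setTI; exact: (mr measurableT _ (mcell j)).
  rewrite le_eqVlt; apply/orP; left; apply/eqP.
  transitivity (\int[Lam]_u (\1_[set u : U | (cell j) (rad m u)] u)%:E)%E; last first.
    by rewrite integral_indic// setIT.
  by apply: eq_integral => u _; rewrite !indicE.
rewrite [leLHS](eq_bigr (fun j : 'I_M => ((c j) * (rhoC d alpha * expR (- (rhob d alpha * j%:R))))%:E)); last first.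
  by move=> j _; rewrite EFinM.
rewrite sumEFin lee_fin /tailC -dlE.
pose x := expR (- dl).
have x01 : 0 <= x < 1 by rewrite expR_ge0/= /x -[ltRHS]expR0 ltr_expR; lra.
set A := rhoC d alpha * expR s' * expR dl.
have A0 : 0 <= A by rewrite !mulr_ge0 ?expR_ge0// exprn_ge0// mulr_ge0// expR_ge0.
apply: (@le_trans _ _ (\sum_(j < M) A * expR (- (dl * K)) * x ^+ j)); last first.
  have -> : \sum_(j < M) A * expR (- (dl * K)) * x ^+ j = A * expR (- (dl * K)) * \sum_(j < M) x ^+ j.
    by rewrite big_distrr.
  rewrite [leRHS]mulrAC; apply: ler_wpM2l; first by rewrite mulr_ge0// expR_ge0.
  exact: geometric_le.
apply: ler_sum => j _; rewrite /c; case: (ltrP K j.+1%:R) => Kj; last first.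
  by rewrite mulr0 mul0r !mulr_ge0 ?expR_ge0// exprn_ge0// expR_ge0.
rewrite mulr1 /A /x -expRM_natl.
have -> : expR (s' * j.+1%:R) * (rhoC d alpha * expR (- (rhob d alpha * j%:R))) =
   rhoC d alpha * (expR (s' * j.+1%:R) * expR (- (rhob d alpha * j%:R))) by ring.
rewrite -!mulrA ler_wpM2l ?exprn_ge0 ?mulr_ge0 ?expR_ge0//.
rewrite -!expRD ler_expR.
have E : alpha * ((d.-1)%:R * j%:R) = (s' + 2 * dl) * j%:R by rewrite dlE /rhob; field.
rewrite ?/rhob -?mulrA E.
rewrite -natr1 in Kj *.
have := ler_wpM2l (ltW dl0) (ltW Kj); lra.
Qed.

Hypothesis prodlaw : forall J B, uniq J -> (forall i, measurable (B i)) ->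
  Lam (rect J B) = (\prod_(i <- J) nu i (B i))%E.

Lemma prod_radii (J : eqType) (lab : J -> nat) (phi : J -> R -> R) (vs : seq J) :
  injective lab -> uniq vs -> (forall y, measurable_fun [set: R] (phi y)) ->
  (forall y r, 0 <= phi y r) ->
  (\int[Lam]_u (\prod_(y <- vs) phi y (rad (lab y) u))%:E =
   \prod_(y <- vs) \int[Lam]_u (phi y (rad (lab y) u))%:E)%E.
Proof.
move=> li uvs mphi phi0.
have mp y : measurable_fun [set: U] (fun u => phi y (rad (lab y) u)).
  by apply: (measurableT_comp (mphi y)); exact: measurable_rad.
elim: vs uvs => [|y vs IH] /=.
  by move=> _; rewrite big_nil (eq_integral (cst 1%E)) ?integral_cst//= ?probability_setT ?mule1// => u _; rewrite big_nil.
move=> /andP[yvs uvs]; rewrite big_cons -IH//.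
have mP : measurable_fun [set: U] (fun u => \prod_(z <- vs) phi z (rad (lab z) u)).
  by apply: measurable_prod => z _; exact: mp.
pose D : pred (ppp_idx d) := pred1 (inr (inl (lab y))).
rewrite [LHS](merge_integral prodlaw D)//; last 2 first.
- apply/measurable_EFinP; apply: (eq_measurable_fun (fun u => phi y (rad (lab y) u) * \prod_(z <- vs) phi z (rad (lab z) u))).
    by move=> u _; rewrite big_cons.
  exact: measurable_funM.
- by move=> u; rewrite lee_fin prodr_ge0.
rewrite -ge0_integralZr//; last 3 first.
- exact/measurable_EFinP.
- by move=> u _; rewrite lee_fin.
- by apply: integral_ge0 => u _; rewrite lee_fin prodr_ge0.
apply: eq_integral => u _; rewrite -ge0_integralZl//; last 3 first.
- exact/measurable_EFinP.
- by move=> v _; rewrite lee_fin prodr_ge0.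
- by rewrite lee_fin.
apply: eq_integral => v _; rewrite big_cons EFinM; congr (_%:E * _%:E)%E.
  by rewrite /rad /merge /D /= eqxx.
apply: eq_big_seq => z zvs; rewrite /rad /merge /D /=.
case: eqP => // -[] /li zy.
by rewrite -zy zvs in yvs.
Qed.

End RadiusLaw.

(** * Probabilities of marked, unmarked and near-boundary chains *)

Lemma chain_neq (J : eqType) (x0 : J) l p : chain x0 l -> p \in l -> p.1 != p.2.
Proof.
elim: l => //= q l IH /and3P[cl h1 h2]; rewrite inE => /orP[/eqP ->|]; last exact: IH.
by apply: contraNneq h2 => <-.
Qed.

Lemma prod_const_seq (R : realType) (T : Type) (l : seq T) (q : R) : \prod_(p <- l) q = q ^+ size l.
Proof. by elim: l => [|p l IH]; rewrite ?big_nil ?big_cons ?expr0// exprS IH. Qed.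

(** Double counting of incidences; the two ends of an edge differ, so each incidence counts once. *)
Lemma chain_sum (R : realType) (J : eqType) (x0 : J) l (f : J -> R) : chain x0 l ->
  \sum_(p <- l) (f p.1 + f p.2) = \sum_(y <- verts x0 l) (cdeg l y)%:R * f y.
Proof.
move=> cl; have uv := chain_uniq cl.
transitivity (\sum_(p <- l) \sum_(y <- verts x0 l) ((p.1 == y) || (p.2 == y))%:R * f y); last first.
  rewrite exchange_big/=; apply: eq_bigr => y _; rewrite -big_distrl/=; congr (_ * _).
  by rewrite /cdeg -sum1_count natr_sum [RHS]big_mkcond/=; apply: eq_bigr => p _; case: (_ || _).
apply: eq_big_seq => p pl; have /andP[h1 h2] := chain_mem cl pl.
have pn := chain_neq cl pl.
have pick a : a \in verts x0 l -> \sum_(y <- verts x0 l) (a == y)%:R * f y = f a.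
  move=> ha; rewrite (bigD1_seq a)//= eqxx mul1r big1 ?addr0// => y /negbTE h.
  by rewrite eq_sym h mul0r.
rewrite -(pick _ h1) -(pick _ h2) -big_split/=; apply: eq_bigr => y _; rewrite -mulrDl -natrD.
by case: eqVneq => [e1|_]; case: eqVneq => [e2|_] //; rewrite e1 e2 eqxx in pn.
Qed.

Section Bounds.
Context {R : realType} (d : nat) (zeta alpha gamma Rn : R).
Hypotheses (zeta0 : 0 < zeta) (alpha0 : 0 < alpha) (d2 : (2 <= d)%N).
Hypothesis Rbig : 1 + alpha <= alpha * Rn.
Local Notation U := (seqspace R (ppp_idx d)).
Variable Lam : probability U R.
Let nu (i : ppp_idx d) (B : set R) := Lam [set u : U | B (u i)].
Hypothesis nuR : forall m (B : set R), measurable B -> nu (inr (inl m)) B =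
  (\int[lebesgue_measure]_(r in B `&` `[0%R, Rn]) (rho_dens d alpha Rn r)%:E)%E.
Hypothesis nuG : forall m j B, measurable B -> nu (inr (inr (m, j))) B = normal_prob 0 1 B.
Hypothesis prodlaw : forall J B, uniq J -> (forall i, measurable (B i)) ->
  Lam (rect J B) = (\prod_(i <- J) nu i (B i))%E.

Let aer : {ae Lam, forall u : U, forall m, 0 < rad m u <= Rn} := ae_rad alpha0 Rbig nuR.
Let aeg : {ae Lam, forall u : U, good Rn u} := ae_good nuG d2 aer.

Let s : R := zeta * (d%:R - 1) / 2.
Let s0 : 0 <= s.
Proof. by rewrite /s divr_ge0// mulr_ge0 ?(ltW zeta0)// subr_ge0 ler1n ltnW. Qed.

Definition hi (K : R) (m : nat) (u : U) : R := (Rn - rad m u <= K)%R%:R.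
Definition lo (K : R) (m : nat) (u : U) : R := (K <= Rn - rad m u)%R%:R.

Let mT m : measurable_fun [set: U] (fun u : U => Rn - rad m u).
Proof. by apply: measurable_funB => //; exact: measurable_rad. Qed.

Let measurable_bool (b : U -> bool) : measurable [set u | b u] ->
  measurable_fun [set: U] (fun u => (b u)%:R : R).
Proof.
move=> mb; apply: (eq_measurable_fun (\1_[set u : U | b u] : U -> R)); last exact: measurable_indic.
move=> u _; rewrite indicE; congr (_%:R); congr nat_of_bool.
by apply/idP/idP => [/set_mem//|h]; exact: mem_set.
Qed.

Let measurable_hi K m : measurable_fun [set: U] (hi K m).
Proof.
apply: measurable_bool; rewrite -[X in measurable X]setTI.
exact: (@measurable_fun_ler _ _ _ _ (fun u : U => Rn - rad m u) (fun=> K) _ _ measurableT [set true]).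
Qed.

Let measurable_lo K m : measurable_fun [set: U] (lo K m).
Proof.
apply: measurable_bool; rewrite -[X in measurable X]setTI.
exact: (@measurable_fun_ler _ _ _ _ (fun=> K) (fun u : U => Rn - rad m u) _ _ measurableT [set true]).
Qed.

Let Lam_bool (b : U -> bool) : measurable [set u | b u] ->
  Lam [set u | b u] = (\int[Lam]_u ((b u)%:R)%:E)%E.
Proof.
move=> mb; transitivity (\int[Lam]_u (\1_[set u : U | b u] u)%:E)%E.
  by rewrite integral_indic// setIT.
apply: eq_integral => u _; rewrite indicE; congr (_%:R%:E); congr nat_of_bool.
by apply/idP/idP => [/set_mem//|h]; exact: mem_set.
Qed.

Context (J : finType).
Let lab : J -> nat := @rk J.
Let li : injective lab := @rk_inj J.
Let arrJ (u : U) : arr J := arrU zeta gamma Rn lab u.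

Let measurable_arrJ (Q : pred (arr J)) : measurable [set u | Q (arrJ u)].
Proof. by apply: (measurable_fin Lam) => g; exact: measurable_arrU. Qed.

Let arrJE u (x y : J) : arrJ u (x, y) = adjU zeta gamma Rn (lab x) (lab y) u.
Proof. by rewrite ffunE. Qed.

Let markJ u (x : J) : good Rn u -> marked (arrJ u) x = (Rn - rad (lab x) u <= gamma * Rn).
Proof. by move=> gu; rewrite /marked arrJE adjU_mark. Qed.

Let adjJ u (p : J * J) : p.1 != p.2 -> adj (arrJ u) p = adjU zeta gamma Rn (lab p.1) (lab p.2) u.
Proof.
case: p => x y /= xy; rewrite /adj /= !arrJE adjU_sym ?orbb//.
by rewrite (inj_eq li).
Qed.

Lemma fine_le_real (A : set U) (x : R) : measurable A -> (Lam A <= x%:E)%E -> fine (Lam A) <= x.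
Proof. by move=> mA; rewrite -lee_fin fineK// fin_num_measure. Qed.

(** Marked end points have T <= gamma Rn, so the edge bound stepC exp (s (T_i + T_j - Rn)) becomes
    uniform in the radii, with one such factor per edge. *)
Lemma madj_upper x0 l : chain x0 l ->
  fine (Lam [set u | all (madj (arrJ u)) l]) <=
  (stepC d * expR (s * (2 * (gamma * Rn) - Rn))) ^+ size l.
Proof.
move=> cl; set q := stepC d * _.
have q0 : 0 <= q by rewrite mulr_ge0 ?expR_ge0// ltW// stepC_gt0.
have mA : measurable [set u | all (madj (arrJ u)) l] := measurable_arrJ (fun g => all (madj g) l).
apply: fine_le_real => //; rewrite Lam_bool//.
pose W (u : U) : R := \prod_(p <- l) (hi (gamma * Rn) (lab p.1) u * hi (gamma * Rn) (lab p.2) u).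
have W0 u : 0 <= W u by apply: prodr_ge0 => p _; rewrite mulr_ge0.
have mW : measurable_fun [set: U] W by apply: measurable_prod => p _; exact: measurable_funM.
apply: (@le_trans _ _ (\int[Lam]_u ((adjl zeta gamma Rn lab l u)%:R%:E * (W u)%:E))%E).
  apply: ae_ge0_le_integral => //.
  - by apply/measurable_EFinP; exact: measurable_bool.
  - by move=> u _; rewrite mule_ge0// lee_fin.
  - by apply: emeasurable_funM; [exact: measurable_adjl|exact/measurable_EFinP].
  apply: filterS aeg => u gu _; rewrite -EFinM lee_fin.
  case: (boolP (all _ _)) => [/allP al|_]; last by rewrite mulr_ge0.
  have -> : adjl zeta gamma Rn lab l u.
    by apply/allP => p pl; rewrite -adjJ ?(chain_neq cl pl)//; have /and3P[] := al p pl.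
  rewrite mul1r /W big_seq big1// => p pl; have /and3P[_ m1 m2] := al p pl.
  by rewrite markJ// in m1; rewrite markJ// in m2; rewrite /hi m1 m2 mulr1.
apply: le_trans (chain_upper gamma (W := fun u => (W u)%:E) prodlaw nuG d2 zeta0 aer li cl _ _ _) _.
- move=> u v h; congr (_%:E); apply: eq_bigr => p _; by rewrite /hi !h.
- exact/measurable_EFinP.
- by move=> u; rewrite lee_fin.
apply: (@le_trans _ _ (\int[Lam]_u (q ^+ size l)%:E)%E); last first.
  by rewrite integral_cst//= probability_setT mule1.
apply: ge0_le_integral => //.
- by move=> u _; rewrite -EFinM lee_fin mulr_ge0// prodr_ge0// => p _; exact: stepK_ge0.
- apply: emeasurable_funM; apply/measurable_EFinP => //.
  by apply: measurable_prod => p _; exact: measurable_stepK.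
move=> u _; rewrite -EFinM lee_fin /W -big_split/= -prod_const_seq.
apply: ler_prod => p _; apply/andP; split.
  by apply: mulr_ge0; [exact: stepK_ge0|exact: mulr_ge0].
rewrite /hi; case: (lerP (Rn - rad (lab p.1) u)) => h1; last by rewrite mul0r mulr0.
case: (lerP (Rn - rad (lab p.2) u)) => h2; last by rewrite !mulr0.
rewrite !mulr1 /stepK ler_wpM2l ?(ltW (stepC_gt0 _))// ler_expR ler_wpM2l//; lra.
Qed.

(** Collect the exponents of the edge bounds by vertex: y receives exp (s deg(y) T_y), at most exp
    (s' T_y) with s' = 2 D s. The radii are independent and this moment is finite for s' < rhob,
    that is for alpha > zeta D. Each of the size + 1 vertices costs [tailC], and the unmarked one
    adds the small factor. *)
Lemma unmarked_upper (D : nat) x0 x l : chain x0 l -> x \in verts x0 l ->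
  (forall y, (cdeg l y <= 2 * D)%N) -> zeta * (d%:R - 1) * D%:R < rhob d alpha -> 0 <= gamma ->
  fine (Lam [set u | all (adj (arrJ u)) l && ~~ marked (arrJ u) x]) <=
  (tailC d alpha (zeta * (d%:R - 1) * D%:R) *
   expR (- ((rhob d alpha - zeta * (d%:R - 1) * D%:R) / 2 * (gamma * Rn)))) *
  (tailC d alpha (zeta * (d%:R - 1) * D%:R) * stepC d * expR (- (s * Rn))) ^+ size l.
Proof.
move=> cl xl deg; set s' := zeta * _ * _ => sb g0.
have s'0 : 0 <= s' by rewrite /s' !mulr_ge0 ?(ltW zeta0)// subr_ge0 ler1n ltnW.
have s'E : s' = s * (2 * D%:R) by rewrite /s' /s; field.
set tC := tailC d alpha s'; have tC0 : 0 < tC by exact: tailC_gt0.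
set ex := expR (- (_ * _ * (gamma * Rn))).
have R0 : 0 <= Rn.
  have h : alpha * 0 <= alpha * Rn by move: Rbig alpha0; rewrite mulr0; lra.
  by rewrite ler_pM2l in h.
have mA : measurable [set u | all (adj (arrJ u)) l && ~~ marked (arrJ u) x] :=
  measurable_arrJ (fun g => all (adj g) l && ~~ marked g x).
apply: fine_le_real => //; rewrite Lam_bool//.
pose W (u : U) : R := lo (gamma * Rn) (lab x) u.
apply: (@le_trans _ _ (\int[Lam]_u ((adjl zeta gamma Rn lab l u)%:R%:E * (W u)%:E))%E).
  apply: ae_ge0_le_integral => //.
  - by apply/measurable_EFinP; exact: measurable_bool.
  - by move=> u _; rewrite mule_ge0// lee_fin.
  - by apply: emeasurable_funM; [exact: measurable_adjl|apply/measurable_EFinP; exact: measurable_lo].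
  apply: filterS aeg => u gu _; rewrite -EFinM lee_fin.
  case: (boolP (_ && _)) => [/andP[/allP al nm]|_]; last by rewrite mulr_ge0.
  have -> : adjl zeta gamma Rn lab l u.
    by apply/allP => p pl; rewrite -adjJ ?(chain_neq cl pl)//; exact: al.
  rewrite mul1r /W /lo; rewrite markJ// -ltNge in nm.
  by rewrite (ltW nm).
apply: le_trans (chain_upper gamma (W := fun u => (W u)%:E) prodlaw nuG d2 zeta0 aer li cl _ _ _) _.
- by move=> u v h; rewrite /W /lo !h.
- by apply/measurable_EFinP; exact: measurable_lo.
- by move=> u; rewrite lee_fin.
(* Vertices other than x get the level 0, a condition that holds almost surely, so that [rad_tail]
   covers every vertex. *)
pose phi (y : J) (r : R) : R := expR (s' * (Rn - r)) * ((if y == x then gamma * Rn else 0) <= Rn - r)%R%:R.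
have phi0 y r : 0 <= phi y r by rewrite mulr_ge0 ?expR_ge0.
have mphi y : measurable_fun [set: R] (phi y).
  apply: measurable_funM.
    by apply: measurable_funexpR; apply: measurable_funM => //; exact: measurable_funB.
  set K := if _ then _ else _.
  have mE : measurable [set r : R | K <= Rn - r].
    rewrite -[X in measurable X]setTI.
    apply: (@measurable_fun_ler _ _ _ _ (fun=> K) (fun r : R => Rn - r) _ _ measurableT [set true]) => //.
    exact: measurable_funB.
  apply: (eq_measurable_fun (\1_[set r : R | K <= Rn - r] : R -> R)); last exact: measurable_indic.
  move=> u _; rewrite indicE; congr (_%:R); congr nat_of_bool.
  by apply/idP/idP => [/set_mem//|h]; exact: mem_set.
have mP : measurable_fun [set: U] (fun u => \prod_(y <- verts x0 l) phi y (rad (lab y) u)).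
  apply: measurable_prod => y _; apply: (measurableT_comp (mphi y)); exact: measurable_rad.
set p := stepC d * expR (- (s * Rn)).
have p0 : 0 <= p by rewrite mulr_ge0 ?expR_ge0// ltW// stepC_gt0.
apply: (@le_trans _ _ (\int[Lam]_u ((p ^+ size l)%:E * (\prod_(y <- verts x0 l) phi y (rad (lab y) u))%:E))%E).
  apply: ae_ge0_le_integral => //.
  - by move=> u _; rewrite -EFinM lee_fin mulr_ge0// prodr_ge0// => q _; exact: stepK_ge0.
  - apply: emeasurable_funM; apply/measurable_EFinP; last exact: measurable_lo.
    by apply: measurable_prod => q _; exact: measurable_stepK.
  - by move=> u _; rewrite -EFinM lee_fin mulr_ge0 ?exprn_ge0// prodr_ge0.
  - by apply: emeasurable_funM => //; exact/measurable_EFinP.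
  apply: filterS aer => u ru _; rewrite -!EFinM lee_fin /W /lo.
  case: (lerP (gamma * Rn) (Rn - rad (lab x) u)) => hx; last first.
    by rewrite mulr0 mulr_ge0 ?exprn_ge0// prodr_ge0.
  have T0 y : 0 <= Rn - rad (lab y) u by have /andP[_] := ru (lab y); rewrite subr_ge0.
  have -> : \prod_(y <- verts x0 l) phi y (rad (lab y) u) = expR (\sum_(y <- verts x0 l) s' * (Rn - rad (lab y) u)).
    rewrite expR_sum; apply: eq_bigr => y _; rewrite /phi.
    by case: eqP => [->|_]; rewrite ?hx ?T0 mulr1.
  have -> : \prod_(q <- l) stepK zeta Rn (lab q.1) (lab q.2) u =
      p ^+ size l * expR (\sum_(q <- l) (s * (Rn - rad (lab q.1) u) + s * (Rn - rad (lab q.2) u))).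
    rewrite expR_sum -prod_const_seq -big_split/=; apply: eq_bigr => q _.
    by rewrite /stepK /p -[RHS]mulrA -expRD; congr (_ * expR _); rewrite -/s; ring.
  rewrite mulr1 ler_wpM2l ?exprn_ge0// ler_expR.
  rewrite (chain_sum (fun y => s * (Rn - rad (lab y) u)) cl); apply: ler_sum => y _.
  rewrite s'E mulrCA -mulrA ler_wpM2l// ler_wpM2r//.
  by rewrite -natrM ler_nat.
rewrite ge0_integralZl//; last 3 first.
- exact/measurable_EFinP.
- by move=> u _; rewrite lee_fin prodr_ge0.
- by rewrite lee_fin exprn_ge0.
rewrite (prod_radii prodlaw li (chain_uniq cl) mphi phi0).
apply: (@le_trans _ _ ((p ^+ size l)%:E * \prod_(y <- verts x0 l) (tC * (if y == x then ex else 1))%:E)%E).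
  apply: lee_wpmul2l; first by rewrite lee_fin exprn_ge0.
  apply: lee_prode => y _; apply/andP; split.
    by apply: integral_ge0 => u _; rewrite lee_fin.
  rewrite /phi; case: (y == x).
    by apply: (rad_tail alpha0 Rbig nuR) => //; rewrite mulr_ge0.
  have := rad_tail alpha0 Rbig nuR (lab y) s'0 sb (lexx 0).
  by rewrite mulr0 oppr0 expR0.
rewrite prodEFin -EFinM lee_fin big_split/= prod_const_seq size_verts.
rewrite (bigD1_seq x)//=; last exact: chain_uniq cl.
rewrite eqxx big1; last by move=> y /negbTE ->.
rewrite mulr1 le_eqVlt; apply/orP; left; apply/eqP.
by rewrite /p exprS !exprMn; ring.
Qed.

(** Restrict to T <= K0 at every vertex, with K0 such that this has probability at least 1/2. These
    vertices are marked since K0 <= gamma Rn, [chain_lower] applies, and the size + 1 vertices give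
    the powers of 1/2. *)
Lemma ladj_lower (K0 : R) x0 l : chain x0 l -> K0 <= gamma * Rn -> 0 <= K0 ->
  zeta * K0 + 2 <= zeta * Rn ->
  tailC d alpha 0 * expR (- ((rhob d alpha - 0) / 2 * K0)) <= 1 / 2 ->
  1 / 2 * (stepc d * expR (- (s * Rn)) / 2) ^+ size l <=
  fine (Lam [set u | all (ladj (arrJ u)) l]).
Proof.
move=> cl Kg K00 RK tl.
have mA : measurable [set u | all (ladj (arrJ u)) l] := measurable_arrJ (fun g => all (ladj g) l).
rewrite -lee_fin fineK ?fin_num_measure// Lam_bool//.
pose W (u : U) : R := \prod_(y <- verts x0 l) hi K0 (lab y) u.
have W0 u : 0 <= W u by apply: prodr_ge0.
have mW : measurable_fun [set: U] W by apply: measurable_prod => p _; exact: measurable_hi.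
have b0 : 0 < rhob d alpha by rewrite mulr_gt0// ltr0n -subn1 subn_gt0.
apply: (@le_trans _ _ (\int[Lam]_u ((adjl zeta gamma Rn lab l u)%:R%:E * (W u)%:E))%E); last first.
  apply: ae_ge0_le_integral => //.
  - by move=> u _; rewrite mule_ge0// lee_fin.
  - by apply: emeasurable_funM; [exact: measurable_adjl|exact/measurable_EFinP].
  - by apply/measurable_EFinP; exact: measurable_bool.
  apply: filterS aeg => u gu _; rewrite -EFinM lee_fin.
  case: (boolP (adjl _ _ _ _ _ _)) => [/allP al|_]; last by rewrite mul0r.
  rewrite mul1r; case: (boolP (all (fun y => Rn - rad (lab y) u <= K0) (verts x0 l))) => [/allP av|/allPn[y yv yn]]; last first.
    by rewrite /W (big_rem y)//= /hi (negbTE yn) mul0r.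
  have -> : all (ladj (arrJ u)) l.
    apply/allP => p pl; have /andP[h1 h2] := chain_mem cl pl; have pn := chain_neq cl pl.
    apply/and4P; split.
    - by case: p pl {h1 h2 pn} => a b pl; rewrite arrJE; exact: (al _ pl).
    - rewrite arrJE adjU_sym; first exact: (al _ pl).
      by rewrite (inj_eq li) eq_sym.
    - by rewrite markJ//; exact: le_trans (av _ h1) Kg.
    - by rewrite markJ//; exact: le_trans (av _ h2) Kg.
  rewrite -[leRHS](expr1n _ (size (verts x0 l))) -prod_const_seq /W; apply: ler_prod => y _.
    by rewrite /hi ler0n lern1 leq_b1.
apply: le_trans (chain_lower gamma (K0 := K0) (W := fun u => (W u)%:E) prodlaw nuG d2 zeta0 aer li RK cl _ _ _ _); last 4 first.
- by move=> u v h; congr (_%:E); apply: eq_bigr => p _; rewrite /hi !h.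
- exact/measurable_EFinP.
- by move=> u; rewrite lee_fin.
- move=> u x xl h; congr (_%:E); rewrite /W (big_rem x)//= /hi leNgt.
  have -> : K0 < Rn - rad (lab x) u by lra.
  by rewrite mul0r.
pose phi (y : J) (r : R) : R := (Rn - r <= K0)%R%:R.
have mphi y : measurable_fun [set: R] (phi y).
  have mE : measurable [set r : R | Rn - r <= K0].
    rewrite -[X in measurable X]setTI.
    apply: (@measurable_fun_ler _ _ _ _ (fun r : R => Rn - r) (fun=> K0) _ _ measurableT [set true]) => //.
    exact: measurable_funB.
  apply: (eq_measurable_fun (\1_[set r : R | Rn - r <= K0] : R -> R)); last exact: measurable_indic.
  move=> u _; rewrite indicE; congr (_%:R); congr nat_of_bool.
  by apply/idP/idP => [/set_mem//|h]; exact: mem_set.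
have phi0 y r : 0 <= phi y r by [].
rewrite (prod_radii prodlaw li (chain_uniq cl) mphi phi0).
have half y : ((1 / 2 : R)%:E <= \int[Lam]_u (phi y (rad (lab y) u))%:E)%E.
  have t1 : (\int[Lam]_u (lo K0 (lab y) u)%:E <= (1 / 2)%:E)%E.
    apply: (@le_trans _ _ (tailC d alpha 0 * expR (- ((rhob d alpha - 0) / 2 * K0)))%:E); last by rewrite lee_fin.
    apply: le_trans (rad_tail alpha0 Rbig nuR (lab y) (lexx 0) b0 K00).
    rewrite le_eqVlt; apply/orP; left; apply/eqP; apply: eq_integral => u _.
    by rewrite mul0r expR0 mul1r.
  have t2 : (1%:E <= \int[Lam]_u (phi y (rad (lab y) u))%:E + \int[Lam]_u (lo K0 (lab y) u)%:E)%E.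
    rewrite -ge0_integralD//; last 4 first.
    - by move=> u _; rewrite lee_fin.
    - by apply/measurable_EFinP; exact: measurable_hi.
    - by move=> u _; rewrite lee_fin.
    - by apply/measurable_EFinP; exact: measurable_lo.
    apply: (@le_trans _ _ (\int[Lam]_u (1 : R)%:E)%E).
      by rewrite integral_cst//= probability_setT mule1.
    apply: ge0_le_integral => //.
    - by apply: emeasurable_funD; apply/measurable_EFinP; [exact: measurable_hi|exact: measurable_lo].
    move=> u _; rewrite -EFinD lee_fin /phi /lo.
    by case: (lerP (Rn - rad (lab y) u) K0) => h; rewrite ?lerDl// (ltW h) add0r.
  have := le_trans t2 (leeD2l _ t1); rewrite -leeBlDr// -EFinB.
  by apply: le_trans; rewrite lee_fin; lra.
set c := stepc d * _.
have c0 : 0 <= c by rewrite mulr_ge0 ?expR_ge0// ltW// stepc_gt0.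
apply: (@le_trans _ _ ((c ^+ size l)%:E * \prod_(y <- verts x0 l) (1 / 2 : R)%:E)%E).
  rewrite prodEFin prod_const_seq size_verts -EFinM lee_fin le_eqVlt; apply/orP; left; apply/eqP.
  by rewrite exprS exprMn mul1r; ring.
apply: lee_wpmul2l; first by rewrite lee_fin exprn_ge0.
by apply: lee_prode => y _; rewrite half andbT lee_fin.
Qed.

End Bounds.

(** * The Poisson process *)

Section Bridge.
Context {R : realType} (d : nat) (zeta alpha gamma Rn : R) (n : nat).
Context (dT : measure_display) (T : measurableType dT) (P : probability T R).
Context (N : T -> nat) (Rad : nat -> T -> R) (G : nat -> 'I_d -> T -> R).
Hypothesis H : is_hyperbolic_ppp P alpha Rn n N Rad G.
Local Notation U := (seqspace R (ppp_idx d)).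

Definition toU (w : T) : U := fun i =>
  match i with
  | inl _ => (N w)%:R
  | inr (inl m) => Rad m w
  | inr (inr (m, j)) => G m j w
  end.

Lemma measurable_toU : measurable_fun [set: T] toU.
Proof.
apply: measurable_to_seqspace => i.
have [mX _] := H; have := mX i.
by move: i => [x|[m|[m j]]].
Qed.

Definition LamP : probability U R := distribution P (mk_mfun measurable_toU).

Lemma prodlawP J B : uniq J -> (forall i, measurable (B i)) ->
  LamP (rect J B) = (\prod_(i <- J) LamP [set u : U | B i (u i)])%E.
Proof.
move=> uJ mB; have [_ [ind _]] := H.
apply: etrans (etrans _ (ind J B uJ mB)) _; last first.
  by apply: eq_bigr => -[x|[m|[m j]]] _.
rewrite /LamP /distribution /pushforward; congr (P _); apply/seteqP; split => w h i iJ.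
  by have := h i iJ; move: i {iJ} => [x|[m|[m j]]].
by have := h i iJ; move: i {iJ} => [x|[m|[m j]]].
Qed.

Lemma nu_radP m (B : set R) : measurable B -> LamP [set u : U | B (u (inr (inl m)))] =
  (\int[lebesgue_measure]_(r in B `&` `[0%R, Rn]) (rho_dens d alpha Rn r)%:E)%E.
Proof. by move=> mB; have [_ [_ [_ [h _]]]] := H; exact: h. Qed.

Lemma nu_dirP m j (B : set R) : measurable B ->
  LamP [set u : U | B (u (inr (inr (m, j))))] = normal_prob 0 1 B.
Proof. by move=> mB; have [_ [_ [_ [_ h]]]] := H; exact: h. Qed.

Lemma nu_tidxP t i (B : set R) : measurable B ->
  LamP [set u : U | B (u (tidx t i))] = LamP [set u : U | B (u i)].
Proof.
move=> mB; move: i => [x|[m|[m j]]] //=.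
  by rewrite !nu_radP.
by rewrite !nu_dirP.
Qed.

Definition L : array_law R := arrayU zeta gamma Rn prodlawP nu_tidxP.

Definition arrP (m : nat) (w : T) : arr (ordX m) :=
  arrU zeta gamma Rn (fun i : 'I_m => nat_of_ord i) (toU w).

Local Notation cell m g := [set w | N w = m /\ arrP m w = g].

Let cellE m g : cell m g = toU @^-1` [set u : U | u (inl tt) = m%:R /\
  arrU zeta gamma Rn (fun i : 'I_m => nat_of_ord i) u = g].
Proof.
apply/seteqP; split => w /=; first by move=> [-> <-].
by move=> [/eqP]; rewrite eqr_nat => /eqP.
Qed.

Let measurable_cell m g : measurable (cell m g).
Proof.
rewrite cellE -[X in measurable X]setTI; apply: measurable_toU => //.
rewrite (_ : [set u | _] = [set u : U | u (inl tt) = m%:R] `&`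
   [set u | arrU zeta gamma Rn (fun i : 'I_m => nat_of_ord i) u = g])//.
apply: measurableI; last exact: measurable_arrU.
rewrite -[X in measurable X]setTI.
exact: (measurable_coord (R := R) (inl tt : ppp_idx d) measurableT (measurable_set1 _)).
Qed.

Let P_cell m g : P (cell m g) = (pois n%:R m * mu L g)%:E.
Proof.
have E := @count_indep R d zeta gamma Rn LamP prodlawP nu_tidxP 'I_m (fun i => nat_of_ord i) m%:R g (@ord_inj m).
rewrite cellE; apply: (etrans E); rewrite EFinM; congr (_ * _)%E.
have [_ [_ [h _]]] := H; rewrite /pois -(h m).
rewrite /LamP /distribution /pushforward /=; congr (P _); apply/seteqP; split => w /=.
  by move=> /eqP; rewrite eqr_nat => /eqP.
by move=> ->.
Qed.

Implicit Type Psi : forall m, arr (ordX m) -> R.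

Definition ev Psi (w : T) : R := Psi (N w) (arrP (N w) w).

Lemma measurable_ev Psi : measurable_fun [set: T] (ev Psi).
Proof.
move=> _ B mB; rewrite setTI.
have -> : ev Psi @^-1` B = \bigcup_m \bigcup_(g in [set g | B (Psi m g)]) cell m g.
  apply/seteqP; split => w /=.
    by move=> h; exists (N w) => //; exists (arrP (N w) w).
  by move=> [m _ [g hg [Nm Ag]]]; rewrite /ev; move: hg; rewrite -Ag -Nm.
apply: bigcup_measurable => m _; apply: fin_bigcup_measurable; first exact: finite_finset.
by move=> g _; exact: measurable_cell.
Qed.

Let ev_cell Psi m : (forall m g, 0 <= Psi m g) ->
  (\int[P]_(w in [set w | N w = m]) (ev Psi w)%:E = (pois n%:R m * E L (Psi m))%:E)%E.
Proof.
move=> P0.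
transitivity (\int[P]_w (\sum_(g : arr (ordX m)) ((Psi m g)%:E * (\1_(cell m g) w)%:E)))%E.
  rewrite integral_mkcond; apply: eq_integral => w _; rewrite patchE.
  case: (boolP (w \in _)) => [/set_mem Nm|/negP nm].
    rewrite (bigD1 (arrP m w))//= big1 => [|g gw].
      rewrite indicE mem_set//= mule1 adde0 /ev.
      by move: Nm => /= <-.
    rewrite indicE memNset ?mule0// => -[_ /eqP]; rewrite eq_sym; exact/negP.
  rewrite big1// => g _; rewrite indicE memNset ?mule0// => -[h _].
  by apply: nm; exact: mem_set.
rewrite ge0_integral_sum//; last 2 first.
- move=> g; apply: emeasurable_funM => //; apply/measurable_EFinP.
  by apply: measurable_indic; exact: measurable_cell.
- by move=> g w _; rewrite mule_ge0// lee_fin.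
rewrite (eq_bigr (fun g => (pois n%:R m * (mu L g * Psi m g))%:E)); last first.
  move=> g _; rewrite ge0_integralZl//; last 2 first.
  - apply/measurable_EFinP; apply: measurable_indic; exact: measurable_cell.
  - by rewrite lee_fin.
  rewrite integral_indic; [|exact: measurableT|exact: measurable_cell].
  rewrite setIT; transitivity ((Psi m g)%:E * (pois n%:R m * mu L g)%:E)%E.
    by congr (_ * _)%E; exact: P_cell.
  by rewrite -EFinM; congr (_%:E); ring.
by rewrite sumEFin /E big_distrr.
Qed.

(** The number of points and the value of the finite array split the space into countably many
    cells. As the number is independent of the array, a cell has probability [pois] times [mu], and
    the sum over cells is [EE]. *)
Lemma integral_ev_ge0 Psi : pbu Psi -> (forall m g, 0 <= Psi m g) ->
  (\int[P]_w (ev Psi w)%:E = (EE L n%:R Psi)%:E)%E.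
Proof.
move=> pP P0.
have mN m : measurable [set w | N w = m].
  rewrite (_ : [set w | _] = \bigcup_(g in [set: arr (ordX m)]) cell m g).
    apply: fin_bigcup_measurable; first exact: finite_finset.
    by move=> g _; exact: measurable_cell.
  apply/seteqP; split => w /=; first by move=> h; exists (arrP m w).
  by move=> [g _ []].
have cover : [set: T] = \bigcup_m [set w | N w = m].
  by apply/seteqP; split => w //= _; exists (N w).
rewrite [in LHS]cover ge0_integral_bigcup//; last 3 first.
- by rewrite -cover; apply/measurable_EFinP; exact: measurable_ev.
- by move=> w _; rewrite lee_fin; exact: P0.
- by apply/trivIsetP => i j _ _ ij; apply/seteqP; split => w //= [h1 h2]; move: ij; rewrite -h1 -h2 eqxx.
rewrite (eq_eseriesr (g := fun m => (pois n%:R m * E L (Psi m))%:E)); last first.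
  by move=> m _; exact: ev_cell.
rewrite /EE /PE -EFin_lim; last by apply: pb_cvg => //; exact: pbu_pb.
by congr (limn _); apply/funext => k; rewrite /= /series /= sumEFin.
Qed.

Lemma integrable_ev Psi : pbu Psi -> P.-integrable [set: T] (EFin \o ev Psi).
Proof.
move=> pP; apply/integrableP; split; first by apply/measurable_EFinP; exact: measurable_ev.
have := @integral_ev_ge0 (fun m g => `|Psi m g|) (pbu_norm pP) (fun m g => normr_ge0 _).
by rewrite /ev /= => ->; rewrite ltry.
Qed.

Lemma integral_ev Psi : pbu Psi -> (\int[P]_w (ev Psi w)%:E = (EE L n%:R Psi)%:E)%E.
Proof.
move=> pP; pose Q m (g : arr (ordX m)) := `|Psi m g|.
have pQ : pbu Q by exact: pbu_norm.
have pS : pbu (fun m g => Psi m g + Q m g) by exact: pbu_add.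
transitivity (\int[P]_w ((ev (fun m g => Psi m g + Q m g) w)%:E - (ev Q w)%:E))%E.
  by apply: eq_integral => w _; rewrite -EFinB /ev addrK.
rewrite integralB_EFin//; [|exact: integrable_ev|exact: integrable_ev].
rewrite integral_ev_ge0//; last by move=> m g; rewrite /Q; have := ler_norm (- Psi m g); rewrite normrN; lra.
rewrite integral_ev_ge0//; last by move=> m g; exact: normr_ge0.
by rewrite -EFinB EE_add// addrK.
Qed.

Section Count.
Context (k : nat) (e : rel 'I_k).
Hypothesis zeta0 : 0 < zeta.

Lemma subtree_countE w :
  subtree_count zeta e Rn gamma (ppp_points zeta N Rad G w) =
  ev (fun m g => SS (PhiM e) g) w.
Proof.
rewrite /subtree_count /ev /SS; apply: eq_bigr => f fi.
apply: eq_bigr => p /andP[pl _].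
have fn : f p.1 != f p.2.
  by rewrite (inj_eq (injectiveP _ fi)) -val_eqE; apply: contraTneq pl => ->; rewrite ltnn.
rewrite /marked !ffunE /= /adjU !eqxx (inj_eq (@ord_inj _)) (negbTE fn) -andbA.
by [].
Qed.

(** For gamma = 1 the conditions T <= Rn hold at every point, so the array may carry the marks of
    any other gamma. This puts the full and the restricted count on the same array. *)
Lemma subtree_count1E w :
  subtree_count zeta e Rn 1 (ppp_points zeta N Rad G w) =
  ev (fun m g => SS (Phi1 e) g) w.
Proof.
rewrite /subtree_count /ev /SS; apply: eq_bigr => f fi.
apply: eq_bigr => p /andP[pl _].
have fn : f p.1 != f p.2.
  by rewrite (inj_eq (injectiveP _ fi)) -val_eqE; apply: contraTneq pl => ->; rewrite ltnn.
rewrite !ffunE /= /adjU (inj_eq (@ord_inj _)) (negbTE fn).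
have tr i : Rn - hdist zeta 0 (ppp_points zeta N Rad G w i) <= 1 * Rn.
  by rewrite mul1r gerBl hdist_ge0// sqnorm_ball_point.
by rewrite !tr !andbT.
Qed.

End Count.

Lemma expectation_ev Psi : pbu Psi -> ('E_P[ev Psi] = (EE L n%:R Psi)%:E)%E.
Proof. by move=> pP; rewrite unlock integral_ev. Qed.

Lemma variance_ev Psi : pbu Psi ->
  ('V_P[ev Psi] = (EE L n%:R (fun m g => Psi m g ^+ 2) - EE L n%:R Psi ^+ 2)%:E)%E.
Proof.
move=> pP; rewrite /variance unlock expectation_ev//=.
set c := EE L n%:R Psi.
have E : ((ev Psi \- cst c) * (ev Psi \- cst c))%R = ev (fun m g => Psi m g ^+ 2 - 2 * c * Psi m g + c ^+ 2).
  apply/funext => w; rewrite -[LHS]/((ev Psi w - c) * (ev Psi w - c)) /ev; ring.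
rewrite E.
have p2 : pbu (fun m (g : arr (ordX m)) => Psi m g ^+ 2) by exact: pbu_exp.
have p1 : pbu (fun m (g : arr (ordX m)) => 2 * c * Psi m g) by apply: pbu_mul => //; exact: pbu_cst.
rewrite expectation_ev; last by apply: pbu_add; [exact: pbu_sub|exact: pbu_cst].
rewrite EE_add//; [|exact: pbu_sub|exact: pbu_cst].
rewrite EE_sub// EE_scale// -/c EE_cst//; congr (_%:E); ring.
Qed.

Lemma standardize_ev Psi : pbu Psi ->
  standardize P (ev Psi) = ev (fun m g => (Psi m g - EE L n%:R Psi) /
    Num.sqrt (EE L n%:R (fun m g => Psi m g ^+ 2) - EE L n%:R Psi ^+ 2)).
Proof.
by move=> pP; apply/funext => w; rewrite /standardize expectation_ev// variance_ev.
Qed.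

End Bridge.

(** * Stein's equation *)

Section Derivatives.
Context {R : realType}.
Implicit Types (f g : R -> R) (a b x : R).

Definition hasd x f a : Prop := is_derive x 1 f a.

Lemma hasd_eq x f a b : hasd x f a -> a = b -> hasd x f b.
Proof. by move=> + <-. Qed.

Lemma drvD f g x a b : hasd x f a -> hasd x g b ->
  hasd x (fun y => f y + g y) (a + b).
Proof. by move=> df dg; exact: is_deriveD. Qed.

Lemma drvN f x a : hasd x f a -> hasd x (fun y => - f y) (- a).
Proof. by move=> df; exact: is_deriveN. Qed.

Lemma drvM f g x a b : hasd x f a -> hasd x g b ->
  hasd x (fun y => f y * g y) (f x * b + g x * a).
Proof. by move=> df dg; exact: is_deriveM. Qed.

Lemma drvC x a : hasd x (fun=> a) 0.
Proof. exact: is_derive_cst. Qed.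

Lemma drvI x : hasd x (fun y : R => y) 1.
Proof. exact: is_derive_id. Qed.

Lemma drv_comp f g x a b : hasd (g x) f a -> hasd x g b ->
  hasd x (fun y => f (g y)) (a * b).
Proof. by move=> df dg; exact: is_derive1_comp. Qed.

Lemma drv_opp f (f' : R -> R) : (forall w : R, hasd w f (f' w)) ->
  forall w : R, hasd w (fun y => f (- y)) (- f' (- w)).
Proof.
move=> df w; rewrite -mulrN1; apply: (@drv_comp f (fun y => - y)); first exact: df.
by apply: drvN; exact: drvI.
Qed.

Lemma mvt f (f' : R -> R) a b : (forall w : R, hasd w f (f' w)) -> a <= b ->
  exists c, [/\ a <= c, c <= b & f b - f a = (b - a) * f' c].
Proof.
move=> df ab.
have h1 x : x \in `]a, b[%R -> is_derive x 1 f (f' x) by move=> _; exact: df.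
have h2 : {within `[a, b], continuous f}.
  apply: continuous_subspaceT => x; apply: differentiable_continuous.
  by apply/derivable1_diffP; exact: (@ex_derive _ _ _ _ _ _ _ (df x)).
have [c] := @MVT_segment R f f' a b ab h1 h2.
by rewrite in_itv/= => /andP[ac cb] E; exists c; split => //; rewrite E mulrC.
Qed.

Lemma drv_mono f (f' : R -> R) : (forall w : R, hasd w f (f' w)) -> (forall w, 0 <= f' w) ->
  {homo f : x y / x <= y}.
Proof.
move=> df f0 a b ab; have [c [_ _ E]] := mvt df ab.
by rewrite -subr_ge0 E mulr_ge0// subr_ge0.
Qed.

Definition decays f := exists K, forall w, w <= 0 -> `|f w| <= K * expR w.

Lemma decaysD f g : decays f -> decays g -> decays (fun w => f w + g w).
Proof.
move=> [K hK] [K' hK']; exists (K + K') => w w0; rewrite mulrDl.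
by apply: le_trans (ler_normD _ _) _; rewrite lerD ?hK ?hK'.
Qed.

Lemma decaysN f : decays f -> decays (fun w => - f w).
Proof. by move=> [K hK]; exists K => w w0; rewrite normrN hK. Qed.

Lemma decaysZ f a : decays f -> decays (fun w => a * f w).
Proof.
by move=> [K hK]; exists (`|a| * K) => w w0; rewrite normrM -mulrA ler_wpM2l// hK.
Qed.

Lemma decays_poly (q : nat) f K : (forall w, w <= 0 -> `|f w| <= K * expR (2 * w)) ->
  decays (fun w => w ^+ q * f w).
Proof.
move=> hK; exists (q`!%:R * `|K|) => w w0.
rewrite normrM normrX.
have h1 : `|w| ^+ q <= q`!%:R * expR (- w).
  by rewrite ler0_norm//; apply: exprn_le_expR; rewrite oppr_ge0.
have h2 : `|f w| <= `|K| * expR (2 * w).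
  by apply: le_trans (hK w w0) _; rewrite ler_wpM2r ?expR_ge0// ler_norm.
apply: le_trans (ler_pM (exprn_ge0 _ (normr_ge0 w)) (normr_ge0 _) h1 h2) _.
rewrite le_eqVlt; apply/orP; left; apply/eqP.
have -> : expR w = expR (- w) * expR (2 * w) by rewrite -expRD; congr expR; ring.
ring.
Qed.

(** A function that increases on a half-line from the limit 0 is non-negative there. Inequalities
    between Gaussian integrals are proved in this way by differentiation. *)
Lemma mono_ge0 f (f' : R -> R) w0 : (forall w : R, hasd w f (f' w)) ->
  (forall w, w <= w0 -> 0 <= f' w) -> decays f -> 0 <= f w0.
Proof.
move=> df f0 [K hK]; rewrite leNgt; apply/negP => neg.
pose m := - f w0; have m0 : 0 < m by rewrite oppr_gt0.
(* v is so far to the left that |K| exp v <= |K| / (1 - v) < m, while monotonicity forces |f v| >=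
   m. *)
pose v := Num.min (Num.min w0 0) (- (`|K| / m)).
have vw : v <= w0 by rewrite /v !ge_min lexx.
have v0 : v <= 0 by rewrite /v !ge_min lexx orbT.
have vK : v <= - (`|K| / m) by rewrite /v ge_min lexx orbT.
have [c [_ cw E]] := mvt df vw.
have fv : f v <= - m.
  have : 0 <= f w0 - f v by rewrite E mulr_ge0 ?f0// subr_ge0.
  by rewrite /m opprK subr_ge0.
have h1 : m <= `|f v| by rewrite -normrN; apply: le_trans (ler_norm _); lra.
have h2 : m <= `|K| * expR v.
  apply: le_trans h1 (le_trans (hK v v0) _); by rewrite ler_wpM2r ?expR_ge0// ler_norm.
have e0 := expR_gt0 v.
have h3 : (1 - v) * expR v <= 1.
  have := expR_ge1Dx (- v); rewrite -(ler_pM2r e0) -expRD addNr expR0; lra.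
have h4 : `|K| <= m * - v.
  have : `|K| / m <= - v by lra.
  by rewrite ler_pdivrMr// mulrC.
have h5 : (m + `|K|) * expR v <= m.
  apply: le_trans (_ : m * ((1 - v) * expR v) <= _); last by rewrite ler_piMr// ltW.
  have E2 : m * (1 - v) = m + m * - v by ring.
  by rewrite mulrA E2; apply: ler_wpM2r; [exact: ltW|lra].
have : 0 < m * expR v by rewrite mulr_gt0.
lra.
Qed.

End Derivatives.

(** * Gaussian antiderivatives and the Mills ratio *)

Section Normal.
Context {R : realType}.
Local Notation mu := (@lebesgue_measure R).
Local Notation gam := (@normal_prob R 0 1).
Local Notation phi := (@normal_pdf R 0 1).

Let pk : R := (Num.sqrt (pi *+ 2))^-1.

Let pk0 : 0 < pk.
Proof. by rewrite invr_gt0 sqrtr_gt0 mulrn_wgt0// pi_gt0. Qed.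

Definition iphi (w : R) : R := pk^-1 * expR (w ^+ 2 / 2).

Lemma iphi_gt0 w : 0 < iphi w.
Proof. by rewrite mulr_gt0 ?expR_gt0// invr_gt0. Qed.

Lemma phi_iphi w : phi w * iphi w = 1.
Proof.
rewrite phiE /iphi -/pk; have -> : pk * expR (- (w ^+ 2 / 2)) * (pk^-1 * expR (w ^+ 2 / 2)) =
  (pk * pk^-1) * (expR (- (w ^+ 2 / 2)) * expR (w ^+ 2 / 2)) by ring.
by rewrite divff ?gt_eqF// -expRD addNr expR0 mulr1.
Qed.

Lemma phiN w : phi (- w) = phi w.
Proof. by rewrite !phiE sqrrN. Qed.

Lemma iphiN w : iphi (- w) = iphi w.
Proof. by rewrite /iphi sqrrN. Qed.

Let dsq (w : R) : hasd w (fun x : R => x ^+ 2 / 2) w.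
Proof.
have -> : (fun x : R => x ^+ 2 / 2) = (fun x : R => 2^-1 * (x * x)).
  by apply/funext => x; rewrite mulrC expr2.
apply: hasd_eq; first by apply: drvM; [exact: drvC|apply: drvM; exact: drvI].
by rewrite /=; field.
Qed.

Lemma is_derive_iphi (w : R) : hasd w iphi (w * iphi w).
Proof.
apply: hasd_eq.
  by apply: drvM; [exact: drvC|apply: (@drv_comp _ expR); [exact: is_derive_expR|exact: dsq]].
by rewrite /iphi; ring.
Qed.

Lemma is_derive_phi (w : R) : hasd w phi (- w * phi w).
Proof.
have -> : (phi : R -> R) = (fun x => pk * expR (- (x ^+ 2 / 2))) by apply/funext => x; exact: phiE.
apply: hasd_eq.
  apply: drvM; [exact: drvC|apply: (@drv_comp _ expR); [exact: is_derive_expR|apply: drvN; exact: dsq]].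
by rewrite /=; ring.
Qed.

Lemma phi_exp w : phi w <= expR 2 * expR (2 * w).
Proof.
rewrite phiE -/pk -[leRHS]mul1r ler_pM ?expR_ge0 ?(ltW pk0) ?normal_peak_le1//.
rewrite -expRD ler_expR; have := sqr_ge0 (w + 2); rewrite sqrrD; lra.
Qed.

Lemma exp_sum_ge (t : R) : 1 + `|t| <= expR t + expR (- t).
Proof.
case: (ger0P t) => t0.
  by have := expR_ge1Dx t; have := expR_gt0 (- t); lra.
by have := expR_ge1Dx (- t); have := expR_gt0 t; lra.
Qed.

Section Antiderivative.
Variables (g : R -> R) (M : R).
Hypotheses (gc : continuous g) (M0 : 0 <= M).
Hypothesis gM : forall t, `|g t| <= M * (expR t + expR (- t)) * phi t.

Let mg : measurable_fun [set: R] g.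
Proof. exact: continuous_measurable_fun. Qed.

Let mexp (c : R) : measurable_fun [set: R] (fun x : R => expR (c * x)).
Proof. by apply: measurableT_comp => //; exact: mulrl_measurable. Qed.

(** Exponential weighting: exp (b (w - t)) >= 1 on A, after which the integral extends to the whole
    line and is a Gaussian exponential moment. The values b = 2 and b = -2 serve the left and the
    right tail. *)
Let anti_weight (b w : R) (A : set (measurableTypeR R)) : measurable A -> (forall t, A t -> 0 <= b * (w - t)) ->
  (\int[mu]_(t in A) (`|g t|)%:E <=
   (M * expR (b * w) * (expR ((1 - b) ^+ 2 / 2) + expR ((1 + b) ^+ 2 / 2)))%:E)%E.
Proof.
move=> mA hA.
pose q t : R := M * expR (b * w) * (expR ((1 - b) * t) + expR (- (1 + b) * t)).
have q0 t : 0 <= q t by rewrite !mulr_ge0 ?addr_ge0 ?expR_ge0.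
have mq : measurable_fun [set: R] q.
  by apply: measurable_funM => //; apply: measurable_funD; exact: mexp.
apply: (@le_trans _ _ (\int[mu]_(t in A) ((q t)%:E * (phi t)%:E))%E).
  apply: ge0_le_integral => //.
  - by apply/measurable_EFinP; apply: measurable_funTS; exact: measurableT_comp.
  - apply: measurable_funTS; apply: emeasurable_funM; apply/measurable_EFinP => //.
    exact: measurable_normal_pdf.
  move=> t At; rewrite -EFinM lee_fin; apply: le_trans (gM t) _.
  rewrite ler_wpM2r ?(ltW (phi_gt0 t))// /q -mulrA ler_wpM2l//.
  have -> : expR (b * w) * (expR ((1 - b) * t) + expR (- (1 + b) * t)) =
     expR (b * (w - t)) * (expR t + expR (- t)).
    by rewrite !mulrDr -!expRD; congr (expR _ + expR _); ring.
  rewrite ler_peMl ?addr_ge0 ?expR_ge0//.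
  by rewrite -[leLHS]expR0 ler_expR; exact: hA.
apply: (@le_trans _ _ (\int[mu]_t ((q t)%:E * (phi t)%:E))%E).
  apply: ge0_subset_integral => //.
  - by apply: emeasurable_funM; apply/measurable_EFinP => //; exact: measurable_normal_pdf.
  - by move=> t _; rewrite -EFinM lee_fin mulr_ge0// ltW// phi_gt0.
rewrite -ge0_integral_normal//; last exact/measurable_EFinP.
have E : (\int[gam]_x (q x)%:E = \int[gam]_x ((M * expR (b * w))%:E * ((expR ((1 - b) * x))%:E + (expR (- (1 + b) * x))%:E)))%E.
  by apply: eq_integral => t _; rewrite -EFinD -EFinM.
rewrite E.
rewrite ge0_integralZl//; last 3 first.
- by apply: emeasurable_funD; apply/measurable_EFinP; exact: mexp.
- by move=> t _; rewrite -EFinD lee_fin addr_ge0 ?expR_ge0.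
- by rewrite lee_fin mulr_ge0 ?expR_ge0.
rewrite ge0_integralD//; last 2 first.
- by apply/measurable_EFinP; exact: mexp.
- by apply/measurable_EFinP; exact: mexp.
by rewrite !gaussian_exp_moment sqrrN -EFinD -EFinM.
Qed.

Lemma anti_integrable (A : set (measurableTypeR R)) : measurable A -> mu.-integrable A (EFin \o g).
Proof.
move=> mA; apply/integrableP; split.
  by apply/measurable_EFinP; exact: measurable_funTS.
apply: le_lt_trans (ltry (M * expR (0 * 0) * (expR ((1 - 0) ^+ 2 / 2) + expR ((1 + 0) ^+ 2 / 2)))).
by apply: (anti_weight (w := 0)) => // t _; rewrite mul0r.
Qed.

Lemma anti_bound (b w : R) (A : set (measurableTypeR R)) : measurable A -> (forall t, A t -> 0 <= b * (w - t)) ->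
  `|\int[mu]_(t in A) g t| <=
  M * expR (b * w) * (expR ((1 - b) ^+ 2 / 2) + expR ((1 + b) ^+ 2 / 2)).
Proof.
move=> mA hA; have h1 := le_normr_Rintegral mA (anti_integrable mA).
apply: (le_trans h1).
have h := anti_weight mA hA.
rewrite -lee_fin /Rintegral fineK// ge0_fin_numE; last by apply: integral_ge0 => t _; rewrite lee_fin.
exact: le_lt_trans h (ltry _).
Qed.

Definition anti (w : R) : R := \int[mu]_(t in `]-oo, w]) g t.

Lemma is_derive_anti (w : R) : hasd w anti (g w).
Proof.
have ww : w < w + 1 by rewrite ltrDl.
have [|h1 h2] := @continuous_FTC1 R g -oo%O w (w + 1) ww (anti_integrable (measurable_itv _)) _ (@gc w).
  by first [done | rewrite bnd_simp | rewrite ltNye].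
by apply: DeriveDef; [exact: h1|rewrite -derive1E; exact: h2].
Qed.

Lemma anti_lower w : `|anti w| <= M * (expR (1 / 2) + expR (9 / 2)) * expR (2 * w).
Proof.
apply: le_trans (@anti_bound 2 w _ (measurable_itv _) _) _.
  by move=> t; rewrite /= in_itv/= => tw; rewrite mulr_ge0// subr_ge0.
rewrite le_eqVlt; apply/orP; left; apply/eqP.
have -> : (1 - 2) ^+ 2 / 2 = 1 / 2 :> R by field.
have -> : (1 + 2) ^+ 2 / 2 = 9 / 2 :> R by field.
by rewrite mulrAC.
Qed.

Lemma anti_upper w : `|\int[mu]_t g t - anti w| <=
  M * (expR (1 / 2) + expR (9 / 2)) * expR (2 * - w).
Proof.
have -> : \int[mu]_t g t = anti w + \int[mu]_(t in `]w, +oo[) g t.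
  rewrite -Rintegral_setU//; last 2 first.
  - by apply: anti_integrable; apply: measurableU; exact: measurable_itv.
  - apply/disj_setPS => t []; rewrite /= !in_itv/= andbT => h1 h2; lra.
  congr (Rintegral _ _ _); apply/seteqP; split => t //= _; rewrite !in_itv/= andbT.
  by case: (lerP t w); [left|right].
rewrite addrAC subrr add0r.
apply: le_trans (@anti_bound (- 2) w _ (measurable_itv _) _) _.
  by move=> t; rewrite /= in_itv/= andbT => tw; rewrite mulNr -mulrN opprB mulr_ge0// subr_ge0 ltW.
rewrite le_eqVlt; apply/orP; left; apply/eqP.
have -> : (1 - -2) ^+ 2 / 2 = 9 / 2 :> R by field.
have -> : (1 + -2) ^+ 2 / 2 = 1 / 2 :> R by field.
by rewrite mulNr -mulrN; ring.
Qed.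

End Antiderivative.

Let phi_cont : continuous (phi : R -> R).
Proof.
move=> x; apply: differentiable_continuous; apply/derivable1_diffP.
exact: (@ex_derive _ _ _ _ _ _ _ (is_derive_phi x)).
Qed.

Let phi_dom t : `|phi t| <= 1 * (expR t + expR (- t)) * phi t.
Proof.
rewrite gtr0_norm ?phi_gt0// mul1r ler_peMl ?(ltW (phi_gt0 t))//.
by apply: le_trans (exp_sum_ge t); rewrite lerDl.
Qed.

Definition gauss_cdf : R -> R := anti phi.

Lemma gauss_cdfE w : gauss_cdf w = fine (normal_prob 0 1 `]-oo, w]%classic).
Proof. by []. Qed.

Lemma is_derive_Phi (w : R) : hasd w gauss_cdf (phi w).
Proof. exact: (is_derive_anti phi_cont ler01 phi_dom). Qed.

Lemma Phi_decay w : `|gauss_cdf w| <= 1 * (expR (1 / 2) + expR (9 / 2)) * expR (2 * w).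
Proof. exact: (anti_lower phi_cont ler01 phi_dom). Qed.

Lemma Phi_codecay w : `|1 - gauss_cdf w| <= 1 * (expR (1 / 2) + expR (9 / 2)) * expR (2 * - w).
Proof.
have := anti_upper phi_cont ler01 phi_dom w.
by rewrite /Rintegral integral_normal_pdf.
Qed.

Let decK (f : R -> R) (K : R) : (forall w, `|f w| <= K * expR (2 * w)) -> decays f.
Proof.
move=> h; have := @decays_poly R 0 f K (fun w _ => h w).
by move=> [K' hK]; exists K' => w w0; have := hK w w0; rewrite expr0 mul1r.
Qed.

Lemma PhiN w : gauss_cdf (- w) = 1 - gauss_cdf w.
Proof.
(* [D s] has derivative 0 and vanishes at minus infinity; [mono_ge0] with s = 1 and s = -1 gives the
   two inequalities. *)
pose D (s w : R) : R := s * (1 + - gauss_cdf (- w)) + - (s * gauss_cdf w).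
have dD (s x : R) : hasd x (D s) 0.
  apply: hasd_eq.
    apply: drvD.
      apply: drvM; first exact: drvC.
      by apply: drvD; [exact: drvC|apply: drvN; exact: (drv_opp is_derive_Phi)].
    by apply: drvN; apply: drvM; [exact: drvC|exact: is_derive_Phi].
  by rewrite phiN; ring.
have decD s : decays (D s).
  apply: decaysD.
    apply: decaysZ; apply: (@decK _ (1 * (expR (1 / 2) + expR (9 / 2)))) => x.
    by have := Phi_codecay (- x); rewrite opprK.
  by apply: decaysN; apply: decaysZ; apply: decK => x; exact: Phi_decay.
have h s : 0 <= D s (- w) by apply: (mono_ge0 (dD s)).
have := h 1; have := h (-1); rewrite /D opprK; lra.
Qed.

Lemma Phi_ge0 w : 0 <= gauss_cdf w.
Proof.
apply: (mono_ge0 is_derive_Phi) => [x _|]; first exact: ltW (phi_gt0 x).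
by apply: decK => x; exact: Phi_decay.
Qed.

Lemma Phi_le1 w : gauss_cdf w <= 1.
Proof. by have := Phi_ge0 (- w); rewrite PhiN; lra. Qed.

(** Both Mills inequalities integrate from minus infinity: w Phi + phi has derivative Phi, and (1 +
    w^2) Phi + w phi has derivative 2 (w Phi + phi). *)
Lemma mills1_num w : 0 <= w * gauss_cdf w + phi w.
Proof.
apply: (@mono_ge0 _ (fun w => w * gauss_cdf w + phi w) gauss_cdf) => [x|x _|].
- apply: hasd_eq.
    by apply: drvD; [apply: drvM; [exact: drvI|exact: is_derive_Phi]|exact: is_derive_phi].
  by rewrite /=; ring.
- exact: Phi_ge0.
apply: decaysD.
  have := @decays_poly R 1 gauss_cdf _ (fun w _ => Phi_decay w).
  by move=> [K hK]; exists K => x x0; have := hK x x0; rewrite expr1.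
by apply: (@decK _ (expR 2)) => x; rewrite gtr0_norm ?phi_gt0// phi_exp.
Qed.

Lemma mills2_num w : 0 <= (1 + w ^+ 2) * gauss_cdf w + w * phi w.
Proof.
have -> : (1 + w ^+ 2) * gauss_cdf w + w * phi w = gauss_cdf w + w * w * gauss_cdf w + w * phi w by ring.
apply: (@mono_ge0 _ (fun w => gauss_cdf w + w * w * gauss_cdf w + w * phi w) (fun w => 2 * (w * gauss_cdf w + phi w))) => [x|x _|].
- apply: hasd_eq.
    apply: drvD; last by apply: drvM; [exact: drvI|exact: is_derive_phi].
    apply: drvD; first exact: is_derive_Phi.
    by apply: drvM; [apply: drvM; exact: drvI|exact: is_derive_Phi].
  by rewrite /=; ring.
- by rewrite mulr_ge0// mills1_num.
apply: decaysD; first apply: decaysD.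
- by apply: decK => x; exact: Phi_decay.
- have := @decays_poly R 2 gauss_cdf _ (fun w _ => Phi_decay w).
  by move=> [K hK]; exists K => x x0; have := hK x x0; rewrite expr2.
have h : forall x, x <= 0 -> `|phi x| <= expR 2 * expR (2 * x).
  by move=> x _; rewrite gtr0_norm ?phi_gt0// phi_exp.
by have [K hK] := @decays_poly R 1 phi _ h; exists K => x x0; have := hK x x0; rewrite expr1.
Qed.

(** The Mills ratio Phi / phi of the left tail. It solves y' = 1 + w y, so [mills1] makes y
    nondecreasing and [mills2] makes w y nondecreasing. *)
Definition mills (w : R) : R := gauss_cdf w * iphi w.

Lemma mills_ge0 w : 0 <= mills w.
Proof. by rewrite mulr_ge0 ?Phi_ge0// ltW// iphi_gt0. Qed.

Lemma mills1 w : 0 <= 1 + w * mills w.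
Proof.
have -> : 1 + w * mills w = (w * gauss_cdf w + phi w) * iphi w.
  by rewrite mulrDl phi_iphi /mills; ring.
by rewrite mulr_ge0 ?mills1_num// ltW// iphi_gt0.
Qed.

Lemma mills2 w : 0 <= (1 + w ^+ 2) * mills w + w.
Proof.
have -> : (1 + w ^+ 2) * mills w + w = ((1 + w ^+ 2) * gauss_cdf w + w * phi w) * iphi w.
  by rewrite [RHS]mulrDl -(mulrA w (phi w)) phi_iphi /mills; ring.
by rewrite mulr_ge0 ?mills2_num// ltW// iphi_gt0.
Qed.

Lemma is_derive_mills (w : R) : hasd w mills (1 + w * mills w).
Proof.
apply: hasd_eq; first by apply: drvM; [exact: is_derive_Phi|exact: is_derive_iphi].
by rewrite mulrC [iphi w * _]mulrC phi_iphi /mills; ring.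
Qed.

Lemma mills_mono : {homo mills : x y / x <= y}.
Proof. exact: (drv_mono is_derive_mills mills1). Qed.

Lemma wmills_mono : {homo (fun w => w * mills w) : x y / x <= y}.
Proof.
apply: (@drv_mono _ _ (fun w => (1 + w ^+ 2) * mills w + w)) => w; last exact: mills2.
apply: hasd_eq; first by apply: drvM; [exact: drvI|exact: is_derive_mills].
by rewrite /=; ring.
Qed.

(** * Stein's equation for half-lines *)

Section Kolmogorov.
Variable z : R.

(** The bounded solution of f' - w f = 1{w <= z} - Phi(z), written with the Mills ratio of the left
    tail before z and of the right tail after z. *)
Definition kolf (w : R) : R := if w <= z then gauss_cdf (- z) * mills w else gauss_cdf z * mills (- w).

Let kolf_hi w : z <= w -> kolf w = gauss_cdf z * mills (- w).
Proof.
rewrite /kolf le_eqVlt => /orP[/eqP <-|zw]; last by rewrite leNgt zw.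
by rewrite lexx /mills iphiN; ring.
Qed.

Let kolf_lo w : w <= z -> kolf w = gauss_cdf (- z) * mills w.
Proof. by rewrite /kolf => ->. Qed.

(** Each branch is a non-negative multiple of a nondecreasing function, by [wmills_mono] and its
    reflection, and the branches agree at z. *)
Let wkolf_mono : {homo (fun w => w * kolf w) : x y / x <= y}.
Proof.
have P0 := Phi_ge0 z; have P1 := Phi_ge0 (- z).
have lowm x y : x <= y -> y <= z -> x * kolf x <= y * kolf y.
  move=> xy yz; rewrite !kolf_lo ?(le_trans xy)// (mulrCA x) (mulrCA y).
  by rewrite ler_wpM2l//; exact: wmills_mono.
have him x y : z <= x -> x <= y -> x * kolf x <= y * kolf y.
  move=> zx xy; rewrite !kolf_hi ?(le_trans zx)// (mulrCA x) (mulrCA y).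
  rewrite ler_wpM2l//; have := @wmills_mono (- y) (- x); rewrite lerN2 => /(_ xy).
  lra.
move=> x y xy; case: (lerP y z) => yz; first exact: lowm.
case: (lerP z x) => zx; first exact: him.
exact: le_trans (lowm _ _ (ltW zx) (lexx z)) (him _ _ (lexx z) (ltW yz)).
Qed.

Let wkolf_bound w : `|w * kolf w| <= 1.
Proof.
have P0 := Phi_ge0 z; have P1 := Phi_ge0 (- z); have PN := PhiN z.
have hiub v : z <= v -> v * kolf v <= 1.
  move=> zv; rewrite kolf_hi// mulrCA.
  have m := mills1 (- v).
  apply: le_trans (_ : gauss_cdf z * 1 <= _); last by rewrite mulr1 Phi_le1.
  by rewrite ler_wpM2l//; lra.
have lolb v : v <= z -> - 1 <= v * kolf v.
  move=> vz; rewrite kolf_lo// mulrCA.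
  have m := mills1 v.
  apply: le_trans (_ : gauss_cdf (- z) * - 1 <= _); first by rewrite mulrN1 lerN2 Phi_le1.
  by rewrite ler_wpM2l//; lra.
rewrite ler_norml; apply/andP; split; case: (lerP w z) => wz.
- exact: lolb.
- exact: le_trans (lolb _ (lexx z)) (wkolf_mono (ltW wz)).
- exact: le_trans (wkolf_mono wz) (hiub _ (lexx z)).
- exact: hiub (ltW wz).
Qed.

Let kolf_lin : lingrowth kolf.
Proof.
have P0 := Phi_ge0 z; have P1 := Phi_ge0 (- z).
have m0 := mills_ge0.
exists (1 + mills 1); split; first by rewrite addr_ge0.
move=> w; rewrite mulrDr mulr1; apply: ler_wpDr.
  by rewrite mulr_ge0// addr_ge0.
case: (lerP 1 `|w|) => w1.
  have := wkolf_bound w; rewrite normrM => h.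
  apply: le_trans (_ : `|w| * `|kolf w| <= _); first by rewrite ler_peMl.
  by apply: le_trans h _; rewrite lerDl.
move: w1; rewrite ltr_norml => /andP[w1 w2].
apply: ler_wpDl => //; rewrite /kolf; case: ifP => _; rewrite normrM !ger0_norm//.
  by rewrite -[leRHS]mul1r ler_pM ?Phi_le1//; apply: mills_mono; exact: ltW.
by rewrite -[leRHS]mul1r ler_pM ?Phi_le1//; apply: mills_mono; lra.
Qed.

(** The derivative is w f plus a step that drops by 1 at z. As w f is nondecreasing, G = w f + 1{w >
    z} is nondecreasing and its increments dominate the variation of f' in absolute value. *)
Lemma stein_kolmogorov : exists f fp G : R -> R,
  [/\ lingrowth f, forall w, `|fp w| <= 2, forall w, `|G w| <= 2 * (1 + `|w|),
      {homo G : x y / x <= y} &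
      (forall a b, a <= b -> `|f b - f a - (b - a) * fp a| <= (b - a) * (G b - G a)) /\
      (forall w, fp w - w * f w = (w <= z)%R%:R - gauss_cdf z)].
Proof.
have P0 := Phi_ge0 z; have P1 := Phi_ge0 (- z); have PN := PhiN z; have P2 := Phi_le1 z.
exists kolf, (fun w => w * kolf w + ((w <= z)%R%:R - gauss_cdf z)), (fun w => w * kolf w + (z < w)%R%:R).
split.
- exact: kolf_lin.
- move=> w; apply: le_trans (ler_normD _ _) _; have := wkolf_bound w.
  suff : `|(w <= z)%R%:R - gauss_cdf z| <= 1 by lra.
  by rewrite ler_norml; case: (w <= z) => /=; lra.
- move=> w; apply: le_trans (ler_normD _ _) _; have := wkolf_bound w.
  have : `|(z < w)%R%:R| <= 1 :> R by rewrite ger0_norm// lern1 leq_b1.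
  by have := normr_ge0 w; lra.
- move=> x y xy; rewrite lerD ?wkolf_mono// ler_nat.
  by case: (ltrP z x) => // zx; rewrite (lt_le_trans zx xy).
split; last by move=> w; rewrite addrAC subrr add0r.
have lowd (w : R) : hasd w (fun w => gauss_cdf (- z) * mills w) (gauss_cdf (- z) * (1 + w * mills w)).
  apply: hasd_eq; first by apply: drvM; [exact: drvC|exact: is_derive_mills].
  by rewrite /=; ring.
have hid (w : R) : hasd w (fun w => gauss_cdf z * mills (- w)) (gauss_cdf z * (w * mills (- w) - 1)).
  apply: hasd_eq; first by apply: drvM; [exact: drvC|exact: (drv_opp is_derive_mills)].
  by rewrite /=; ring.
have lowm x y : x <= y -> y <= z ->
    exists c, [/\ x <= c, c <= y & kolf y - kolf x = (y - x) * (c * kolf c + (1 - gauss_cdf z))].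
  move=> xy yz; have [c [xc cy E]] := mvt lowd xy; exists c; split => //.
  rewrite !kolf_lo ?(le_trans xy)// ?(le_trans cy)//.
  by rewrite (E : _ - _ = _) -PN; ring.
have him x y : z <= x -> x <= y ->
    exists c, [/\ x <= c, c <= y & kolf y - kolf x = (y - x) * (c * kolf c - gauss_cdf z)].
  move=> zx xy; have [c [xc cy E]] := mvt hid xy; exists c; split => //.
  rewrite !kolf_hi ?(le_trans zx)// ?(le_trans (le_trans zx xc))//.
  by rewrite (E : _ - _ = _); ring.
move=> a b ab; case: (lerP b z) => bz.
  have [c [ac cb E]] := lowm a b ab bz.
  have az := le_trans ab bz; rewrite az E ltNge az /= !mulr0n mulr1n !addr0.
  have h1 := wkolf_mono ac; have h2 := wkolf_mono cb.
  have -> : (b - a) * (c * kolf c + (1 - gauss_cdf z)) - (b - a) * (a * kolf a + (1 - gauss_cdf z)) =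
     (b - a) * (c * kolf c - a * kolf a) by ring.
  rewrite normrM [`|b - a|]ger0_norm ?subr_ge0// ler_wpM2l ?subr_ge0//.
  by rewrite ger0_norm; lra.
case: (ltrP z a) => az.
  have [c [ac cb E]] := him a b (ltW az) ab.
  rewrite E /= mulr0n !mulr1n.
  have h1 := wkolf_mono ac; have h2 := wkolf_mono cb.
  have -> : (b - a) * (c * kolf c - gauss_cdf z) - (b - a) * (a * kolf a + (0 - gauss_cdf z)) =
     (b - a) * (c * kolf c - a * kolf a) by ring.
  rewrite normrM [`|b - a|]ger0_norm ?subr_ge0// ler_wpM2l ?subr_ge0//.
  by rewrite ger0_norm; lra.
(* When z lies between a and b the mean value theorem is applied on each side of the kink, and each
   piece is bounded by its length times the increment of G. *)
have [c1 [ac1 c1z E1]] := lowm a z az (lexx z).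
have [c2 [zc2 c2b E2]] := him z b (lexx z) (ltW bz).
have h1 := wkolf_mono ac1; have h2 := wkolf_mono (le_trans c1z (ltW bz)).
have h3 := wkolf_mono (le_trans az zc2); have h4 := wkolf_mono c2b.
rewrite /= mulr0n !mulr1n addr0.
have -> : kolf b - kolf a - (b - a) * (a * kolf a + (1 - gauss_cdf z)) =
   (z - a) * (c1 * kolf c1 - a * kolf a) + (b - z) * (c2 * kolf c2 - a * kolf a - 1).
  have -> : kolf b - kolf a = (kolf z - kolf a) + (kolf b - kolf z) by ring.
  by rewrite E1 E2; ring.
apply: le_trans (ler_normD _ _) _.
rewrite !normrM [`|z - a|]ger0_norm ?subr_ge0// [`|b - z|]ger0_norm ?subr_ge0 ?(ltW bz)//.
set X := b * kolf b + 1 - _.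
have -> : (b - a) * X = (z - a) * X + (b - z) * X by ring.
rewrite lerD// ler_wpM2l ?subr_ge0 ?(ltW bz)// /X ler_norml; lra.
Qed.

End Kolmogorov.

(** * Stein's equation for Lipschitz functions *)

Section Wasserstein.
Variables (c ka : R).
Hypothesis ka0 : 0 <= ka.

(* The bounds on the half-line w <= 0; the other half follows by reflection. *)
Let half (h I : R -> R) K : lipschitz1 h -> `|h 0 - c| <= ka ->
  (forall w : R, hasd w I ((h w - c) * phi w)) ->
  (forall w, `|I w| <= K * expR (2 * w)) ->
  forall w, w <= 0 ->
  let f := I w * iphi w in let fp := w * f + (h w - c) in
  [/\ `|f| <= 2 + ka * mills 0, `|fp| <= 1 + ka & `|f + w * fp| <= 2 + ka * mills 0].
Proof.
move=> hL h0 dI decI w w0 f fp.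
have decPhi a : decays (fun v => a * gauss_cdf v) by apply: decaysZ; apply: decK => x; exact: Phi_decay.
have decphi : decays phi by apply: (@decK _ (expR 2)) => x; rewrite gtr0_norm ?phi_gt0// phi_exp.
(* With w frozen, [J] has derivative (w - v + s (h v - h w)) phi v, non-negative for v <= w because
   h is 1-Lipschitz; [mono_ge0] then gives J(w) >= 0. *)
have key (s : R) : `|s| <= 1 -> 0 <= w * gauss_cdf w + phi w + s * (I w - (h w - c) * gauss_cdf w).
  move=> s1.
  pose J v := w * gauss_cdf v + phi v + s * (I v + - ((h w - c) * gauss_cdf v)).
  have dJ (v : R) : hasd v J ((w - v + s * (h v - h w)) * phi v).
    apply: hasd_eq.
      apply: drvD.
        by apply: drvD; [apply: drvM; [exact: drvC|exact: is_derive_Phi]|exact: is_derive_phi].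
      apply: drvM; first exact: drvC.
      by apply: drvD; [exact: dI|apply: drvN; apply: drvM; [exact: drvC|exact: is_derive_Phi]].
    by rewrite /=; ring.
  apply: (mono_ge0 dJ).
    move=> v vw; rewrite mulr_ge0 ?(ltW (phi_gt0 v))//.
    have : `|s * (h v - h w)| <= w - v.
      rewrite normrM; apply: le_trans (_ : 1 * `|v - w| <= _).
        by apply: ler_pM => //; exact: hL.
      by rewrite mul1r distrC ger0_norm// subr_ge0.
    by rewrite ler_norml => /andP[]; lra.
  apply: decaysD; first by apply: decaysD.
  by apply: decaysZ; apply: decaysD; [exact: decK decI|apply: decaysN].
have i0 := iphi_gt0 w.
set A := mills w; set u := 1 + w * A.
(* Freezing h at its value in w would give f = (h w - c) A; [key] for s = 1 and s = -1, divided by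
   phi, bounds the deviation by u. *)
have ud : `|f - (h w - c) * A| <= u.
  have -> : f - (h w - c) * A = (I w - (h w - c) * gauss_cdf w) * iphi w by rewrite /f /A /mills; ring.
  have -> : u = (w * gauss_cdf w + phi w) * iphi w by rewrite mulrDl phi_iphi /u /A /mills; ring.
  rewrite normrM (gtr0_norm i0) ler_wpM2r ?(ltW i0)//.
  have k1 := key 1; have k2 := key (- 1); rewrite ?normrN ?normr1 in k1 k2.
  by rewrite ler_norml; have := k1 (lexx _); have := k2 (lexx _); lra.
set x := - w; have x0 : 0 <= x by rewrite /x oppr_ge0.
have wx : w = - x by rewrite /x opprK.
have A0 : 0 <= A by exact: mills_ge0.
have AA : A <= mills 0 by exact: mills_mono.
have u0 : 0 <= u by exact: mills1.
have D0 : 0 <= (1 + x ^+ 2) * A - x.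
  by have -> : (1 + x ^+ 2) * A - x = (1 + w ^+ 2) * A + w; [rewrite /x; ring|exact: mills2].
have uE : u = 1 - x * A by rewrite /u wx; ring.
have m0 := mills_ge0 0.
have hx : `|h w - c| <= x + ka.
  have -> : h w - c = (h w - h 0) + (h 0 - c) by ring.
  apply: le_trans (ler_normD _ _) _; rewrite lerD//.
  by apply: le_trans (hL _ _) _; rewrite subr0 wx normrN ger0_norm.
have xA1 : x * A <= 1 by rewrite uE in u0; lra.
(* The second Mills inequality makes u of order 1 / (1 + x^2), which pays for the factor 1 + x^2 in
   f + w f'. *)
have u1 : (1 + x ^+ 2) * u <= 1.
  have := mulr_ge0 x0 D0; rewrite uE => hh.
  have -> : (1 + x ^+ 2) * (1 - x * A) = 1 - x * ((1 + x ^+ 2) * A - x) by ring.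
  by lra.
have ule1 : u <= 1 by rewrite uE; have := mulr_ge0 x0 A0; lra.
pose del := f - (h w - c) * A.
have fE : f = (h w - c) * A + del by rewrite /del; ring.
have kA : ka * A <= ka * mills 0 by rewrite ler_wpM2l.
split.
- rewrite fE; apply: le_trans (ler_normD _ _) _.
  have : `|(h w - c) * A| <= (x + ka) * A by rewrite normrM (ger0_norm A0) ler_wpM2r.
  by move: ud; rewrite -/del mulrDl; lra.
- have -> : fp = (h w - c) * u + w * del by rewrite /fp fE /u; ring.
  apply: le_trans (ler_normD _ _) _; rewrite !normrM (ger0_norm u0).
  have e1 : `|w| = x by rewrite wx normrN ger0_norm.
  rewrite e1.
  have b1 : `|h w - c| * u <= (x + ka) * u by rewrite ler_wpM2r.
  have b2 : x * `|del| <= x * u by rewrite ler_wpM2l.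
  have b3 : ka * u <= ka by rewrite ler_piMr.
  have b4 : 0 <= (1 - x) ^+ 2 * u by rewrite mulr_ge0 ?sqr_ge0.
  have b5 : (1 - x) ^+ 2 * u = (1 + x ^+ 2) * u - 2 * (x * u) by ring.
  rewrite mulrDl in b1; lra.
- have -> : f + w * fp = (1 + x ^+ 2) * del + (h w - c) * ((1 + x ^+ 2) * A - x).
    by rewrite /fp fE wx; ring.
  apply: le_trans (ler_normD _ _) _; rewrite !normrM (ger0_norm D0).
  have q0 : 0 <= 1 + x ^+ 2 by rewrite addr_ge0 ?sqr_ge0.
  rewrite (ger0_norm q0).
  have b1 : (1 + x ^+ 2) * `|del| <= 1 by apply: le_trans u1; rewrite ler_wpM2l.
  have b2 : `|h w - c| * ((1 + x ^+ 2) * A - x) <= (x + ka) * ((1 + x ^+ 2) * A - x).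
    by rewrite ler_wpM2r.
  have b3 : x * ((1 + x ^+ 2) * A - x) <= 1.
    have -> : x * ((1 + x ^+ 2) * A - x) = x * A - x ^+ 2 * (1 - x * A) by ring.
    have : 0 <= x ^+ 2 * (1 - x * A) by rewrite mulr_ge0 ?sqr_ge0// subr_ge0.
    by lra.
  have b4 : (1 + x ^+ 2) * A - x <= A.
    have -> : (1 + x ^+ 2) * A - x = A - x * (1 - x * A) by ring.
    have : 0 <= x * (1 - x * A) by rewrite mulr_ge0// subr_ge0.
    by lra.
  have b5 : ka * ((1 + x ^+ 2) * A - x) <= ka * mills 0.
    by rewrite ler_wpM2l//; lra.
  rewrite mulrDl in b2; lra.
Qed.

(** The derivative f + w f' of w f is bounded and f' = w f + h - c, so f' is Lipschitz with constant
    L = 3 + ka mills(0), and the linear function G = L w controls the remainder. *)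
Lemma stein_lipschitz_aux (h I : R -> R) K : lipschitz1 h -> `|h 0 - c| <= ka ->
  (forall w : R, hasd w I ((h w - c) * phi w)) ->
  (forall w, `|I w| <= K * expR (2 * w)) -> (forall w, `|I w| <= K * expR (2 * - w)) ->
  exists f fp G : R -> R,
  [/\ lingrowth f, forall w, `|fp w| <= 3 + ka + ka * mills 0,
      forall w, `|G w| <= (3 + ka + ka * mills 0) * (1 + `|w|),
      {homo G : x y / x <= y} &
      (forall a b, a <= b -> `|f b - f a - (b - a) * fp a| <= (b - a) * (G b - G a)) /\
      (forall w, fp w - w * f w = h w - c)].
Proof.
move=> hL h0 dI d1 d2.
pose f w := I w * iphi w; pose fp w := w * f w + (h w - c).
have m0 := mills_ge0 0; have km : 0 <= ka * mills 0 by rewrite mulr_ge0.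
have hL' : lipschitz1 (fun w => h (- w)).
  by move=> x y; apply: le_trans (hL _ _) _; rewrite -opprD normrN.
have bd w : [/\ `|f w| <= 2 + ka * mills 0, `|fp w| <= 1 + ka & `|f w + w * fp w| <= 2 + ka * mills 0].
  case: (lerP w 0) => w0; first exact: (half hL h0 dI d1 w0).
  (* For w > 0 reflect: h(-w) with the antiderivative -I(-w) satisfies the same hypotheses. *)
  have := @half (fun w => h (- w)) (fun w => - I (- w)) K hL' _ _ _ (- w) _.
  rewrite oppr0 opprK iphiN => /(_ h0) H.
  have [|||e1 e2 e3] := H.
  - move=> v; apply: hasd_eq; first by apply: drvN; exact: (drv_opp dI).
    by rewrite /= phiN opprK.
  - by move=> v; rewrite normrN; have := d2 (- v); rewrite opprK.
  - by rewrite oppr_le0 ltW.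
  have E2 : - w * (- I w * iphi w) + (h w - c) = fp w by rewrite /fp /f; ring.
  rewrite E2 in e2 e3.
  split => //; first by rewrite /f -normrN -mulNr.
  by rewrite -normrN opprD /f -mulNr -[- (w * _)]mulNr.
have df (w : R) : hasd w f (fp w).
  apply: hasd_eq; first by apply: drvM; [exact: dI|exact: is_derive_iphi].
  rewrite /fp /f; have := phi_iphi w => E.
  have -> : I w * (w * iphi w) + iphi w * ((h w - c) * phi w) =
    w * (I w * iphi w) + (h w - c) * (phi w * iphi w) by ring.
  by rewrite E mulr1.
have dwf (w : R) : hasd w (fun w => w * f w) (f w + w * fp w).
  apply: hasd_eq; first by apply: drvM; [exact: drvI|exact: df].
  by rewrite /=; ring.
pose L := 3 + ka * mills 0; have L0 : 0 <= L by rewrite /L; lra.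
have lip a b : a <= b -> `|fp b - fp a| <= L * (b - a).
  move=> ab; have ab0 : 0 <= b - a by rewrite subr_ge0.
  have [v [_ _ E]] := mvt dwf ab; have [_ _ e3] := bd v.
  have -> : fp b - fp a = (b * f b - a * f a) + (h b - h a) by rewrite /fp; ring.
  apply: le_trans (ler_normD _ _) _; rewrite E normrM (ger0_norm ab0).
  have : (b - a) * `|f v + v * fp v| <= (b - a) * (2 + ka * mills 0) by rewrite ler_wpM2l.
  have := hL b a; rewrite (ger0_norm ab0) /L; lra.
exists f, fp, (fun w => L * w); split.
- exists (2 + ka * mills 0); split; first by lra.
  move=> w; have [e1 _ _] := bd w; apply: le_trans e1 _.
  by rewrite ler_peMr ?lerDl//; lra.
- by move=> w; have [_ e2 _] := bd w; lra.
- move=> w; rewrite normrM (ger0_norm L0) mulrDr mulr1.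
  have k0 := ka0; have : L * `|w| <= (3 + ka + ka * mills 0) * `|w| by rewrite ler_wpM2r// /L; lra.
  by lra.
- by move=> x y xy; rewrite ler_wpM2l.
split; last by move=> w; rewrite /fp addrAC subrr add0r.
move=> a b ab; have ab0 : 0 <= b - a by rewrite subr_ge0.
have [v [av vb E]] := mvt df ab.
rewrite E -mulrBr normrM (ger0_norm ab0) ler_wpM2l//.
by apply: le_trans (lip _ _ av) _; rewrite -mulrBr ler_wpM2l// lerD2r.
Qed.

End Wasserstein.

(** The bound on E|N| from [gaussian_abs_moment] with q = 1, hence on |h(0) - E h(N)| for every
    1-Lipschitz h. *)
Definition lipK : R := 2 * expR 1.
Definition lipC : R := 3 + lipK + lipK * mills 0.

Lemma lip_cont (h : R -> R) : lipschitz1 h -> continuous h.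
Proof.
move=> hL x; apply/cvgrPdist_le => e e0; near=> t.
apply: le_trans (hL _ _) _; near: t.
by apply: cvgr_dist_le.
Unshelve. all: by end_near. Qed.

(** The solution is the antiderivative of (h - c) phi from minus infinity, divided by phi. As c is
    the mean of h, the total integral vanishes, which gives the same decay at plus infinity. The
    constant [lipC] is the same for all h. *)
Lemma stein_lipschitz (h : R -> R) : lipschitz1 h ->
  std_normal_expect h \is a fin_num /\
  exists f fp G : R -> R,
  [/\ lingrowth f, forall w, `|fp w| <= lipC, forall w, `|G w| <= lipC * (1 + `|w|),
      {homo G : x y / x <= y} &
      (forall a b, a <= b -> `|f b - f a - (b - a) * fp a| <= (b - a) * (G b - G a)) /\
      (forall w, fp w - w * f w = h w - fine (std_normal_expect h))].
Proof.
move=> hL; have hc := lip_cont hL.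
have contM (a : R) : continuous (fun t => (h t - a) * phi t).
  by move=> t; apply: cvgM; [apply: cvgB; [exact: hc|exact: cvg_cst]|exact: phi_cont].
have domM (a : R) t : `|(h t - a) * phi t| <= (1 + `|h 0 - a|) * (expR t + expR (- t)) * phi t.
  rewrite normrM [`|phi t|]gtr0_norm ?phi_gt0// ler_wpM2r ?(ltW (phi_gt0 t))//.
  have := exp_sum_ge t => e1; have n0 := normr_ge0 (h 0 - a); have t0 := normr_ge0 t.
  have : `|h t - a| <= `|t| + `|h 0 - a|.
    have -> : h t - a = (h t - h 0) + (h 0 - a) by ring.
    by apply: le_trans (ler_normD _ _) _; rewrite lerD2r; have := hL t 0; rewrite subr0.
  have : `|h 0 - a| * 1 <= `|h 0 - a| * (expR t + expR (- t)) by rewrite ler_wpM2l//; lra.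
  rewrite mulrDl mul1r; lra.
have pos (a : R) : 0 <= 1 + `|h 0 - a| by rewrite addr_ge0.
have Eh : (std_normal_expect h = \int[mu]_x ((h x - 0) * phi x)%:E)%E.
  by apply: eq_integral => x _; rewrite subr0.
have fin : std_normal_expect h \is a fin_num.
  by rewrite Eh; apply: integrable_fin_num => //; apply: (anti_integrable (contM 0) (pos 0) (domM 0)).
split=> //; set c := fine _.
have intphi : mu.-integrable [set: R] (EFin \o phi).
  exact: (anti_integrable phi_cont ler01 phi_dom).
have tot (a : R) : \int[mu]_t ((h t - a) * phi t) = c - a.
  have -> : (fun t => (h t - a) * phi t) = (fun t => (h t - 0) * phi t - a * phi t).
    by apply/funext => t; ring.
  rewrite RintegralB//; last 2 first.
  - exact: (anti_integrable (contM 0) (pos 0) (domM 0)).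
  - have := @integrableZl _ _ _ mu [set: R] measurableT a _ intphi.
    by apply: eq_integrable => // t _; rewrite /= EFinM.
  congr (_ - _); first by rewrite /c Eh.
  rewrite RintegralZl//.
  by rewrite {1}/Rintegral integral_normal_pdf mulr1.
have hc0 : `|h 0 - c| <= lipK.
  rewrite distrC -(tot (h 0)).
  apply: (le_trans (le_normr_Rintegral measurableT (anti_integrable (contM _) (pos _) (domM _) measurableT))).
  have le : (\int[mu]_t (`|(h t - h 0) * phi t|)%:E <= lipK%:E)%E.
    have := @gaussian_abs_moment R 1; rewrite ge0_integral_normal//; last first.
      by apply/measurable_EFinP; apply: measurable_funX; exact: normr_measurable.
    have -> : (1`!)%:R = 1 :> R by [].
    rewrite mulr1; apply: le_trans.
    apply: ge0_le_integral => //.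
    - apply/measurable_EFinP; apply: measurableT_comp => //.
      exact: continuous_measurable_fun.
    - apply: emeasurable_funM; apply/measurable_EFinP; last exact: measurable_normal_pdf.
      by apply: measurable_funX; exact: normr_measurable.
    move=> t _; rewrite -EFinM lee_fin expr1 normrM [`|phi t|]gtr0_norm ?phi_gt0//.
    by rewrite ler_wpM2r ?(ltW (phi_gt0 t))//; have := hL t 0; rewrite subr0.
  rewrite -lee_fin /Rintegral fineK// ge0_fin_numE; last by apply: integral_ge0 => t _; rewrite lee_fin.
  exact: le_lt_trans le (ltry _).
have K0 : 0 <= lipK by rewrite mulr_ge0 ?expR_ge0.
apply: (@stein_lipschitz_aux c lipK K0 h (anti (fun t => (h t - c) * phi t))
   ((1 + `|h 0 - c|) * (expR (1 / 2) + expR (9 / 2))) hL hc0).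
- by move=> w; exact: (is_derive_anti (contM c) (pos c) (domM c)).
- by move=> w; exact: (anti_lower (contM c) (pos c) (domM c)).
- move=> w; have := anti_upper (contM c) (pos c) (domM c) w.
  by rewrite tot subrr sub0r normrN.
Qed.

End Normal.

(** * Distances to the normal law *)

Section Distances.
Context {R : realType} (d : nat) (zeta alpha gamma Rn : R) (n : nat).
Context (dT : measure_display) (T : measurableType dT) (P : probability T R).
Context (N : T -> nat) (Rad : nat -> T -> R) (G : nat -> 'I_d -> T -> R).
Hypothesis H : is_hyperbolic_ppp P alpha Rn n N Rad G.
Let A := L zeta gamma H.
Let lam : R := n%:R.
Let lam0 : 0 <= lam := ler0n _ _.
Local Notation EX K := (EE A lam K).
Local Notation evP := (ev zeta gamma Rn N Rad G).

Section OneStatistic.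
Context (I : finType) (Phi : arr I -> R).
Hypothesis Phi01 : forall a, 0 <= Phi a <= 1.
Local Notation S := (fun m (g : arr (ordX m)) => SS Phi g).
Let sig2 : R := EX (fun m g => S m g ^+ 2) - EX S ^+ 2.
Hypothesis sig2_gt0 : 0 < sig2.
Let F m (g : arr (ordX m)) : R := (S m g - EX S) / Num.sqrt sig2.

Let pS : pbu S.
Proof. by apply: pbu_SS => //; exact: pbX_ord. Qed.

Let pF : pbu F.
Proof. by apply: pbu_mul; [apply: pbu_sub => //|]; exact: pbu_cst. Qed.

Lemma standardize_SS : standardize P (evP S) = evP F.
Proof. exact: (standardize_ev zeta gamma H pS). Qed.

Variable del : R.
Hypothesis del_gt0 : 0 < del.
Hypothesis ZZ2_le : EX (fun m (g : arr (ordX m)) => ZZ Phi g ^+ 2) <= sig2 ^+ 2 * (1 + del ^+ 2).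

Lemma kolmogorov_bound : (dK_normal P (standardize P (evP S)) <= (del * (6 * 2 ^+ 2 + 4))%:E)%E.
Proof.
apply: ge_ereal_sup => _ [z _ <-]; rewrite standardize_SS.
have [f [fp [Gf [fl fpC GC Gh [rem id]]]]] := stein_kolmogorov z.
have SB := stein_bound lam0 Phi01 sig2_gt0 del_gt0 ZZ2_le (ler0n R 2) fl fpC GC Gh rem.
pose K m (g : arr (ordX m)) : R := (F g <= z)%R%:R.
have pK : pbu K.
  by apply: pbu_le (pbu_cst _ 1) => m g; rewrite normr1 ger0_norm// lern1 leq_b1.
have E1 : EX (fun m (g : arr (ordX m)) => fp (F g) - F g * f (F g)) = EX K - (@gauss_cdf R z).
  transitivity (EX (fun m (g : arr (ordX m)) => K m g - (@gauss_cdf R z))); first by apply: EE_eq => m g; rewrite id.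
  by rewrite EE_sub//; [rewrite EE_cst|exact: pbu_cst].
have mF : measurable_fun [set: T] (evP F) by exact: (measurable_ev zeta gamma H).
have PE1 : P [set w | evP F w <= z] = (EX K)%:E.
  rewrite -(integral_ev zeta gamma H pK).
  have mA : measurable [set w | evP F w <= z].
    rewrite -[X in measurable X]setTI.
    exact: (@measurable_fun_ler _ _ _ _ (evP F) (fun=> z) _ _ measurableT [set true]).
  transitivity (\int[P]_w (\1_[set w | evP F w <= z] w)%:E)%E; first by rewrite integral_indic// setIT.
  apply: eq_integral => w _; rewrite indicE; congr (_%:E); congr (_%:R); congr nat_of_bool.
  by apply/idP/idP => [/set_mem//|h]; exact: mem_set.
have NE : normal_prob 0 1 `]-oo, z]%classic = ((@gauss_cdf R z))%:E.
  by rewrite gauss_cdfE fineK// fin_num_measure.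
rewrite PE1 NE -EFinB abse_EFin lee_fin -E1.
exact: SB.
Qed.

(** A single h with a constant independent of h: the supremum over h yields d_W, and the single
    bound serves the weak convergence. *)
Lemma lipschitz_bound (h : R -> R) : lipschitz1 h ->
  (`| \int[P]_w (h (standardize P (evP S) w))%:E - std_normal_expect h | <=
    (del * (6 * (@lipC R) ^+ 2 + 4))%:E)%E.
Proof.
move=> hL; rewrite standardize_SS.
have [fin [f [fp [Gf [fl fpC GC Gh [rem id]]]]]] := stein_lipschitz hL.
have C0 : 0 <= @lipC R by apply: le_trans (fpC 0).
have SB := stein_bound lam0 Phi01 sig2_gt0 del_gt0 ZZ2_le C0 fl fpC GC Gh rem.
have pK : pbu (fun m (g : arr (ordX m)) => h (F g)).
  apply: (@pbu_lin _ ordX F h) => //; exists (1 + `|h 0|); split; first by rewrite addr_ge0.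
  move=> x; have := hL x 0; rewrite subr0 => hx.
  have -> : h x = (h x - h 0) + h 0 by ring.
  apply: le_trans (ler_normD _ _) _; rewrite mulrDr mulr1 mulrDl mul1r.
  have : 0 <= `|h 0| * `|x| by rewrite mulr_ge0.
  by lra.
have E1 : EX (fun m (g : arr (ordX m)) => fp (F g) - F g * f (F g)) = EX (fun m (g : arr (ordX m)) => h (F g)) - fine (std_normal_expect h).
  transitivity (EX (fun m (g : arr (ordX m)) => h (F g) - fine (std_normal_expect h))); first by apply: EE_eq => m g; rewrite id.
  by rewrite EE_sub//; [rewrite EE_cst|exact: pbu_cst].
have -> : (\int[P]_w (h (evP F w))%:E = (EX (fun m (g : arr (ordX m)) => h (F g)))%:E)%E.
  by rewrite -(integral_ev zeta gamma H pK).
rewrite -(fineK fin) -EFinB abse_EFin lee_fin -E1.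
exact: SB.
Qed.

Lemma wasserstein_bound : (dW_normal P (standardize P (evP S)) <= (del * (6 * (@lipC R) ^+ 2 + 4))%:E)%E.
Proof. by apply: ge_ereal_sup => _ [h hL <-]; exact: lipschitz_bound. Qed.

End OneStatistic.

(** * Comparison of two nested counts *)

Section Comparison.
Context (I : finType) (Phi Phi' : arr I -> R).
Hypothesis Phi01 : forall a, 0 <= Phi a <= 1.
Hypothesis Phi'01 : forall a, 0 <= Phi' a <= 1.
Hypothesis PhiD01 : forall a, 0 <= Phi' a - Phi a <= 1.
Let D (a : arr I) := Phi' a - Phi a.
Let var (Ps : arr I -> R) : R :=
  EX (fun m (g : arr (ordX m)) => SS Ps g ^+ 2) - EX (fun m (g : arr (ordX m)) => SS Ps g) ^+ 2.
Hypothesis var_gt0 : 0 < var Phi.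
Variable eta : R.
Hypothesis eta01 : 0 < eta <= 1.
Hypothesis varD : EX (fun m (g : arr (ordX m)) => ZZ D g) <= eta ^+ 2 * var Phi.

Let ZZ_mono (J : finType) (g : arr J) : ZZ Phi g <= ZZ Phi' g.
Proof.
have le a : Phi a <= Phi' a by have := PhiD01 a; rewrite subr_ge0 => /andP[].
have p a : 0 <= Phi a by have /andP[] := Phi01 a.
apply: ler_sum => y _; apply: ler_pM => //; first exact: sumr_ge0.
by apply: ler_sum => z _; exact: le.
Qed.

Let pb1 (Ps : arr I -> R) : (forall a, 0 <= Ps a <= 1) -> pbu (fun m (g : arr (ordX m)) => SS Ps g).
Proof. by move=> h; apply: pbu_SS => //; exact: pbX_ord. Qed.

Let var_center (Ps : arr I -> R) : (forall a, 0 <= Ps a <= 1) ->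
  EX (fun m (g : arr (ordX m)) => (SS Ps g - EX (fun m (g : arr (ordX m)) => SS Ps g)) ^+ 2) = var Ps.
Proof.
move=> h; have p := pb1 h; set c := EX (fun m (g : arr (ordX m)) => SS Ps g).
have p2 : pbu (fun m (g : arr (ordX m)) => SS Ps g ^+ 2) by exact: pbu_exp.
have p1 : pbu (fun m (g : arr (ordX m)) => 2 * c * SS Ps g) by apply: pbu_mul => //; exact: pbu_cst.
rewrite (EE_eq _ _ (H := fun m (g : arr (ordX m)) => SS Ps g ^+ 2 - 2 * c * SS Ps g + c ^+ 2)); last by move=> m g; ring.
rewrite EE_add//; [|exact: pbu_sub|exact: pbu_cst].
by rewrite EE_sub// EE_scale// -/c EE_cst// /var -/c; ring.
Qed.

(** Let B be the centred smaller count and C the centred difference. The standardised counts differ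
    by C / s' - (s' - s) / (s' s) B. The first term has mean absolute value at most eta; the second
    at most 3 eta, because v' - v <= 3 eta v. *)
Lemma lipschitz_close (h : R -> R) : lipschitz1 h ->
  (`| \int[P]_w (h (standardize P (evP (fun m g => SS Phi' g)) w))%:E -
      \int[P]_w (h (standardize P (evP (fun m g => SS Phi g)) w))%:E | <= (4 * eta)%:E)%E.
Proof.
move=> hL; have /andP[eta0 eta1] := eta01.
rewrite !standardize_SS//.
have vpos := var_gt0; have vD := varD.
set v := var Phi in vpos vD *; set v' := var Phi'.
set m1 := EX (fun m (g : arr (ordX m)) => SS Phi g); set m2 := EX (fun m (g : arr (ordX m)) => SS Phi' g).
have vv' : v <= v'.
  rewrite /v /v' /var !variance_ZZ//; apply: EE_le; [exact: lam0|by apply: pbu_ZZ => //; exact: pbX_ord|by apply: pbu_ZZ => //; exact: pbX_ord|].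
  by move=> m g; exact: ZZ_mono.
have v'0 : 0 < v' by exact: lt_le_trans vv'.
set s := Num.sqrt v; set s' := Num.sqrt v'.
have s0 : 0 < s by rewrite sqrtr_gt0.
have s'0 : 0 < s' by rewrite sqrtr_gt0.
have ss' : s <= s' by rewrite ler_sqrt// ltW.
have s2 : s ^+ 2 = v by rewrite sqr_sqrtr// ltW.
have s'2 : s' ^+ 2 = v' by rewrite sqr_sqrtr// ltW.
pose B m (g : arr (ordX m)) := SS Phi g - m1.
pose C m (g : arr (ordX m)) := SS D g - (m2 - m1).
have SD m (g : arr (ordX m)) : SS D g = SS Phi' g - SS Phi g by rewrite /SS -sumrB.
have mD : EX (fun m (g : arr (ordX m)) => SS D g) = m2 - m1.
  by rewrite (EE_eq _ _ SD) EE_sub//; exact: pb1.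
have pB : pbu B by apply: pbu_sub; [exact: pb1|exact: pbu_cst].
have pC : pbu C by apply: pbu_sub; [exact: pb1|exact: pbu_cst].
have B2 : EX (fun m g => B m g ^+ 2) = v by exact: var_center.
have C2 : EX (fun m g => C m g ^+ 2) <= eta ^+ 2 * v.
  suff -> : EX (fun m g => C m g ^+ 2) = EX (fun m (g : arr (ordX m)) => ZZ D g) by exact: vD.
  rewrite -(variance_ZZ A lam0 PhiD01) -/(var D) -(var_center PhiD01).
  by apply: EE_eq => m g; rewrite /C mD.
have pB2 := pbu_exp 2 pB; have pC2 := pbu_exp 2 pC; have pBC := pbu_mul pB pC.
have absn (K : forall m, arr (ordX m) -> R) (t : R) : 0 < t -> pbu K ->
    EX (fun m g => K m g ^+ 2) <= t ^+ 2 -> EX (fun m g => `|K m g|) <= t.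
  move=> t0 pK hK; have pn := pbu_norm pK.
  have := EE_AMGM A lam0 t0 pn (pbu_cst _ 1).
  rewrite (EE_eq _ _ (H := fun m g => `|K m g|)); last by move=> m g; rewrite mulr1.
  rewrite (EE_eq _ _ (K := fun m (_ : arr (ordX m)) => 1 ^+ 2) (H := fun m _ => 1)); last by move=> m g; rewrite expr1n.
  rewrite EE_cst// (EE_eq _ _ (K := fun m g => `|K m g| ^+ 2) (H := fun m g => K m g ^+ 2)); last by move=> m g; rewrite real_normK ?num_real.
  move=> /(le_trans (ler_norm _)) /le_trans; apply.
  have : t^-1 * EX (fun m g => K m g ^+ 2) <= t.
    by rewrite mulrC ler_pdivrMr// -expr2.
  by rewrite mulr1; lra.
have aB : EX (fun m g => `|B m g|) <= s by apply: absn => //; rewrite B2 s2.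
have es : 0 < eta * s by rewrite mulr_gt0.
have aC : EX (fun m g => `|C m g|) <= eta * s by apply: absn => //; rewrite exprMn s2.
have aBC : `|EX (fun m g => B m g * C m g)| <= eta * v.
  have ei : 0 < eta^-1 by rewrite invr_gt0.
  apply: le_trans (EE_AMGM A lam0 ei pB pC) _; rewrite invrK B2.
  have : eta^-1 * EX (fun m g => C m g ^+ 2) <= eta * v.
    by rewrite mulrC ler_pdivrMr//; apply: le_trans C2 _; rewrite le_eqVlt; apply/orP; left; apply/eqP; ring.
  by lra.
have v'E : v' = v + 2 * EX (fun m g => B m g * C m g) + EX (fun m g => C m g ^+ 2).
  rewrite -B2 -EE_scale// -EE_add//; last by apply: pbu_mul => //; exact: pbu_cst.
  rewrite -EE_add//; last by apply: pbu_add => //; apply: pbu_mul => //; exact: pbu_cst.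
  rewrite /v' -var_center//; apply: EE_eq => m g.
  by rewrite -/m2 /B /C SD; ring.
(* The cross term contributes 2 eta v, the variance of C at most eta^2 v <= eta v. *)
have dv : v' - v <= 3 * eta * v.
  have h1 := ler_norm (EX (fun m g => B m g * C m g)).
  have : eta ^+ 2 * v <= eta * v by rewrite ler_wpM2r ?(ltW vpos)// expr2 ler_piMr// ltW.
  by rewrite v'E; lra.
have ds : (s' - s) / s' <= 3 * eta.
  rewrite ler_pdivrMr//.
  have h1 : (s' - s) * s' <= 3 * eta * (s' * s').
    apply: le_trans (_ : (s' - s) * (s' + s) <= _).
      by rewrite ler_wpM2l ?subr_ge0// lerDl ltW.
    have -> : (s' - s) * (s' + s) = v' - v by rewrite -s2 -s'2; ring.
    apply: le_trans dv _; rewrite ler_wpM2l ?mulr_ge0 ?(ltW eta0)//.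
    by rewrite -expr2 s'2.
  by rewrite mulrA in h1; rewrite ler_pM2r in h1.
pose F m (g : arr (ordX m)) := (SS Phi g - m1) / s.
pose F' m (g : arr (ordX m)) := (SS Phi' g - m2) / s'.
have ph (K : forall m, arr (ordX m) -> R) : pbu K -> pbu (fun m g => h (K m g)).
  move=> pK; apply: (@pbu_lin _ ordX K h) => //; exists (1 + `|h 0|); split; first by rewrite addr_ge0.
  move=> x; have := hL x 0; rewrite subr0 => hx.
  have -> : h x = (h x - h 0) + h 0 by ring.
  apply: le_trans (ler_normD _ _) _; rewrite mulrDr mulr1 mulrDl mul1r.
  have : 0 <= `|h 0| * `|x| by rewrite mulr_ge0.
  by lra.
have pF : pbu F by apply: pbu_mul; [exact: pB|exact: pbu_cst].
have pF' : pbu F'.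
  by apply: pbu_mul; [apply: pbu_sub; [exact: pb1|]|]; exact: pbu_cst.
have -> : (\int[P]_w (h (evP F w))%:E = (EX (fun m g => h (F m g)))%:E)%E.
  exact: (integral_ev zeta gamma H (ph _ pF)).
have -> : (\int[P]_w (h (evP F' w))%:E = (EX (fun m g => h (F' m g)))%:E)%E.
  exact: (integral_ev zeta gamma H (ph _ pF')).
rewrite -EFinB abse_EFin lee_fin -EE_sub//; [|exact: ph|exact: ph].
have pnC := pbu_norm pC; have pnB := pbu_norm pB.
have pRHS : pbu (fun m g => s'^-1 * `|C m g| + ((s' - s) / s' / s) * `|B m g|).
  by apply: pbu_add; apply: pbu_mul => //; exact: pbu_cst.
apply: le_trans (EE_norm_le A lam0 _ pRHS _) _.
- by apply: pbu_sub; exact: ph.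
- move=> m g; apply: le_trans (hL _ _) _.
  have -> : F' m g - F m g = s'^-1 * C m g - ((s' - s) / s' / s) * B m g.
    by rewrite /F' /F /C /B SD; field; rewrite !gt_eqF.
  apply: le_trans (ler_normB _ _) _; rewrite !normrM.
  rewrite [`|s'^-1|]gtr0_norm ?invr_gt0//.
  rewrite [`|s' - s|]ger0_norm ?subr_ge0// [`|s^-1|]gtr0_norm ?invr_gt0//.
rewrite EE_add//; [|by apply: pbu_mul => //; exact: pbu_cst|by apply: pbu_mul => //; exact: pbu_cst].
rewrite !EE_scale//.
have b1 : s'^-1 * EX (fun m g => `|C m g|) <= eta.
  rewrite mulrC ler_pdivrMr//; apply: le_trans aC _; by rewrite ler_wpM2l// ltW.
have b2 : (s' - s) / s' / s * EX (fun m g => `|B m g|) <= 3 * eta.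
  apply: le_trans ds; rewrite -mulrA ler_piMr//.
    by rewrite divr_ge0 ?subr_ge0// ltW.
  by rewrite mulrC ler_pdivrMr// mul1r.
by lra.
Qed.

End Comparison.

End Distances.

(** * From Lipschitz to bounded continuous test functions *)

Section InfConvolution.
Context {R : realType} (h : R -> R) (M : R).
Hypotheses (hc : continuous h) (hM : forall x, `|h x| <= M).

(** The Pasch-Hausdorff envelope: the largest K-Lipschitz function below h. *)
Definition infconv (K x : R) : R := inf [set h y + K * `|x - y| | y in [set: R]].

Section Slope.
Variables (K : R) (K0 : 0 <= K).

Let lb x : lbound [set h y + K * `|x - y| | y in [set: R]] (- M).
Proof.
move=> _ [y _ <-]; have := hM y; rewrite ler_norml => /andP[h1 _].
by rewrite -[leLHS]addr0 lerD// mulr_ge0.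
Qed.

Lemma infconv_le x y : infconv K x <= h y + K * `|x - y|.
Proof. by apply: ge_inf; [exists (- M); exact: lb|exists y]. Qed.

Lemma infconv_ge x z : (forall y, z <= h y + K * `|x - y|) -> z <= infconv K x.
Proof.
move=> H; apply: lb_le_inf; first by exists (h 0 + K * `|x - 0|), 0.
by move=> _ [y _ <-].
Qed.

Lemma infconv_le_fun x : infconv K x <= h x.
Proof. by have := infconv_le x x; rewrite subrr normr0 mulr0 addr0. Qed.

Lemma infconv_bound x : `|infconv K x| <= M.
Proof.
rewrite ler_norml; apply/andP; split.
  by apply: infconv_ge => y; apply: (@lb x (h y + K * `|x - y|)); exists y.
by apply: le_trans (infconv_le_fun x) _; exact: le_trans (ler_norm _) (hM x).
Qed.

Lemma infconv_lip x x' : `|infconv K x - infconv K x'| <= K * `|x - x'|.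
Proof.
have half u v : infconv K u - infconv K v <= K * `|u - v|.
  rewrite lerBlDr -lerBlDl; apply: infconv_ge => y; rewrite lerBlDl.
  apply: le_trans (infconv_le u y) _; rewrite addrCA lerD2l -mulrDr ler_wpM2l//.
  by apply: le_trans (ler_normD _ _); rewrite addrA subrK.
rewrite ler_norml half andbT.
have := half x' x; rewrite distrC; lra.
Qed.

End Slope.

(** For y close to x continuity bounds the loss by eps; at distance at least del the penalty k del
    exceeds the oscillation 2 M of h. *)
Lemma infconv_cvg x : (fun k : nat => infconv k.+1%:R x) @ \oo --> h x.
Proof.
apply/cvgrPdist_le => eps eps0.
have M0 : 0 <= M by apply: le_trans (hM 0).
have /cvgrPdist_le/(_ eps eps0) := @hc x.
move=> /nbhs_ballP[del /= del0 hdel].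
near=> k.
have K0 : 0 <= k.+1%:R :> R by [].
rewrite ger0_norm ?subr_ge0 ?infconv_le_fun// lerBlDl -lerBlDr.
apply: infconv_ge => // y.
case: (ltrP `|x - y| del) => xy.
  have := hdel y xy; rewrite /= ler_norml => /andP[_ h2].
  have : 0 <= k.+1%:R * `|x - y| by rewrite mulr_ge0.
  by move: h2; lra.
have h1 : k.+1%:R * del <= k.+1%:R * `|x - y| by rewrite ler_wpM2l.
have h2 : 2 * M <= k.+1%:R * del.
  rewrite -ler_pdivrMr//; near: k.
  exists (Num.truncn (2 * M / del)) => // k /= hk.
  apply: le_trans (ltW (truncnS_gt (2 * M / del))) _; by rewrite ler_nat ltnS.
have := hM x; have := hM y; rewrite !ler_norml => /andP[a1 a2] /andP[a3 a4].
lra.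
Unshelve. all: by end_near. Qed.

End InfConvolution.

Section Portmanteau.
Context {R : realType} (dT : measure_display) (T : measurableType dT) (P : probability T R).
Variable Y : nat -> T -> R.
Hypothesis mY : forall n, measurable_fun [set: T] (Y n).
Local Notation mu := (@lebesgue_measure R).
Local Notation phi := (@normal_pdf R 0 1).
Hypothesis lipY : forall h : R -> R, lipschitz1 h ->
  (fun n => \int[P]_w (h (Y n w))%:E)%E @ \oo --> std_normal_expect h.

Let phi_cont : continuous (phi : R -> R).
Proof.
move=> x; apply: differentiable_continuous; apply/derivable1_diffP.
exact: (@ex_derive _ _ _ _ _ _ _ (is_derive_phi x)).
Qed.

Let J (h : R -> R) (n : nat) : R := \int[P]_w h (Y n w).
Let e (h : R -> R) : R := \int[mu]_x (h x * phi x).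

Let intJ (h : R -> R) (M : R) n : continuous h -> (forall x, `|h x| <= M) ->
  P.-integrable [set: T] (EFin \o (fun w => h (Y n w))).
Proof.
move=> hc hM; have mh : measurable_fun [set: T] (fun w => h (Y n w)).
  by apply: measurableT_comp => //; exact: continuous_measurable_fun.
apply/integrableP; split; first exact/measurable_EFinP.
apply: le_lt_trans (ltry M).
apply: (@le_trans _ _ (\int[P]_w M%:E)%E); last by rewrite integral_cst//= probability_setT mule1.
apply: ge0_le_integral => //.
- by apply/measurable_EFinP; exact: measurableT_comp.
- by move=> w _ /=; rewrite lee_fin.
Qed.

Let inte (h : R -> R) (M : R) : continuous h -> (forall x, `|h x| <= M) ->
  mu.-integrable [set: R] (EFin \o (fun x => h x * phi x)).
Proof.
move=> hc hM; have M0 : 0 <= M by exact: le_trans (normr_ge0 _) (hM 0).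
apply: (@anti_integrable R (fun x => h x * phi x) M _ M0 _ _ measurableT).
  by move=> x; apply: cvgM; [exact: hc|exact: phi_cont].
move=> t; rewrite normrM [`|phi t|]gtr0_norm ?phi_gt0// ler_wpM2r ?(ltW (phi_gt0 t))//.
apply: le_trans (hM t) _; rewrite ler_peMr//.
by apply: le_trans (exp_sum_ge t); rewrite lerDl.
Qed.

(** The Lipschitz minorants [hk] converge to h from below, so dominated convergence picks one with
    Gaussian mean close to that of h, and its integrals along [Y] converge. Applied to -h this gives
    the opposite bound. *)
Let lower (h : R -> R) M (eps : R) : continuous h -> (forall x, `|h x| <= M) -> 0 < eps ->
  \forall n \near \oo, e h - eps <= J h n.
Proof.
move=> hc hM eps0.
pose hk (k : nat) x := infconv h k.+1%:R x.
have K0 (k : nat) : 0 <= k.+1%:R :> R by [].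
have hkM k x : `|hk k x| <= M by exact: infconv_bound.
(* The hypothesis on [Y] concerns slope 1, hence the rescaling by 1 / k.+1, undone by linearity of
   the integrals. *)
have glip k : lipschitz1 (fun x => k.+1%:R^-1 * hk k x).
  move=> x y; rewrite -mulrBr normrM gtr0_norm ?invr_gt0// ler_pdivrMl//.
  exact: (infconv_lip hM).
have hkE k x : hk k x = k.+1%:R * (k.+1%:R^-1 * hk k x) by rewrite mulVKf.
have gc k := lip_cont (glip k).
have gM k x : `|k.+1%:R^-1 * hk k x| <= k.+1%:R^-1 * M.
  by rewrite normrM gtr0_norm ?invr_gt0// ler_wpM2l// invr_ge0.
have hkc k : continuous (hk k).
  have -> : hk k = (fun x => k.+1%:R * (k.+1%:R^-1 * hk k x)) by apply/funext => x; exact: hkE.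
  by move=> x; apply: cvgM; [exact: cvg_cst|exact: (gc k x)].
have cve : (fun k => e (hk k)) @ \oo --> e h.
  have C : (fun k => \int[mu]_x (hk k x * phi x)%:E)%E @ \oo --> (\int[mu]_x (h x * phi x)%:E)%E.
    apply: (@dominated_cvg _ _ R mu [set: R] measurableT _ _ (fun x => (M * phi x)%:E)) => //.
    - move=> k; apply/measurable_EFinP; apply: measurable_funM; last exact: measurable_normal_pdf.
      exact: continuous_measurable_fun.
    - move=> x _; apply: cvg_EFin; first by near=> k.
      by apply: cvgM; [exact: (infconv_cvg hc hM)|exact: cvg_cst].
    - by apply: (@inte (cst M) `|M|) => // x; exact: cvg_cst.
    - move=> k x _; rewrite abse_EFin lee_fin normrM [`|phi x|]gtr0_norm ?phi_gt0//.
      by rewrite ler_wpM2r// ltW// phi_gt0.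
  have fin : (\int[mu]_x (h x * phi x)%:E)%E \is a fin_num.
    by apply: integrable_fin_num => //; exact: inte hc hM.
  by move: C; rewrite -(fineK fin) => /fine_cvgP[_].
have eps2 : 0 < eps / 2 by rewrite divr_gt0.
have /cvgrPdist_le/(_ _ eps2)[k _ /(_ k (leqnn k)) hk2] := cve.
have ek : e h - eps / 2 <= e (hk k) by move: hk2; rewrite /= ler_norml; lra.
have [fin _] := stein_lipschitz (glip k).
have := lipY (glip k); rewrite -(fineK fin) => /fine_cvgP[_].
have d0 : 0 < eps / 2 / k.+1%:R by rewrite divr_gt0.
move=> /cvgrPdist_le/(_ _ d0); apply: filterS => n /=.
set eg := fine _; set Jg := fine _ => hn.
have egE : e (hk k) = k.+1%:R * eg.
  rewrite /e; have -> : (fun x => hk k x * phi x) = (fun x => k.+1%:R * (k.+1%:R^-1 * hk k x * phi x)).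
    by apply/funext => x; rewrite [in LHS]hkE -[in LHS]mulrA.
  by rewrite RintegralZl//; exact: (inte (gc k) (gM k)).
have JgE : J (hk k) n = k.+1%:R * Jg.
  rewrite /J; have -> : (fun w => hk k (Y n w)) = (fun w => k.+1%:R * (k.+1%:R^-1 * hk k (Y n w))).
    by apply/funext => w; exact: hkE.
  by rewrite RintegralZl//; exact: (intJ n (gc k) (gM k)).
have h1 : J (hk k) n <= J h n.
  apply: le_Rintegral => //; [exact: (intJ n (hkc k) (hkM k))|exact: (intJ n hc hM)|].
  by move=> w _; exact: (infconv_le_fun hM).
have h2 : e (hk k) - J (hk k) n <= eps / 2.
  rewrite egE JgE -mulrBr; apply: le_trans (_ : k.+1%:R * (eps / 2 / k.+1%:R) <= _).
    by rewrite ler_wpM2l//; exact: le_trans (ler_norm _) hn.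
  by rewrite mulrC mulfVK.
lra.
Unshelve. all: by end_near. Qed.

Lemma cvg_dist_lipschitz : cvg_dist_normal P Y.
Proof.
move=> h hc [M hM].
have hcN : continuous (fun x => - h x) by move=> x; apply: cvgN; exact: hc.
have hMN x : `|- h x| <= M by rewrite normrN.
have fJ n : (\int[P]_w (h (Y n w))%:E)%E \is a fin_num.
  by apply: integrable_fin_num => //; exact: (intJ n hc hM).
have fe : std_normal_expect h \is a fin_num.
  by apply: integrable_fin_num => //; exact: (inte hc hM).
rewrite -(fineK fe); apply: cvg_EFin; first by near=> n; exact: fJ.
have JN n : J (fun x => - h x) n = - J h n.
  have := @RintegralZl _ _ _ P [set: T] (fun w => h (Y n w)) (- 1) measurableT (intJ n hc hM).
  by rewrite mulN1r /J => <-; congr Rintegral; apply/funext => w; rewrite mulN1r.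
have eN : e (fun x => - h x) = - e h.
  have := @RintegralZl _ _ _ mu [set: R] (fun x => h x * phi x) (- 1) measurableT (inte hc hM).
  by rewrite mulN1r /e => <-; congr Rintegral; apply/funext => w; rewrite mulN1r mulNr.
apply/cvgrPdist_le => eps eps0; near=> n.
have h1 : e h - eps <= J h n by near: n; exact: lower hc hM eps0.
have h2 : e (fun x => - h x) - eps <= J (fun x => - h x) n by near: n; exact: lower hcN hMN eps0.
rewrite JN eN in h2; rewrite /= ler_norml.
have -> : fine (std_normal_expect h) = e h by [].
have -> : fine (\int[P]_w (h (Y n w))%:E)%E = J h n by [].
lra.
Unshelve. all: by end_near. Qed.

End Portmanteau.

(* The number of edges of a union of trees is at most M, so the sum is dominated by
   its last term as soon as the expected degree x is bounded below. *)
Lemma sum_bound (R : realType) (x c0 b lam : R) (M : nat) (w : nat -> R) :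
  0 < c0 -> c0 <= x -> 0 <= b -> 0 < lam -> (forall r, 0 <= w r) ->
  \sum_(r < M.+1) lam ^+ r.+1 * (w r * (b * (x / lam)) ^+ r) <=
  lam * x ^+ M * \sum_(r < M.+1) w r * b ^+ r * (c0 ^+ r / c0 ^+ M).
Proof.
move=> c00 cx b0 l0 w0; rewrite big_distrr/=; apply: ler_sum => -[r rM] _ /=.
have x0 : 0 < x by exact: lt_le_trans cx.
have -> : lam ^+ r.+1 * (w r * (b * (x / lam)) ^+ r) = lam * (w r * b ^+ r) * x ^+ r.
  by rewrite exprS !exprMn exprVn; field; rewrite expf_neq0// gt_eqF.
have -> : lam * x ^+ M * (w r * b ^+ r * (c0 ^+ r / c0 ^+ M)) = lam * (w r * b ^+ r) * (x ^+ M * (c0 ^+ r / c0 ^+ M)) by ring.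
rewrite ler_wpM2l ?mulr_ge0 ?exprn_ge0 ?(ltW l0)//.
have h : (x / c0) ^+ r <= (x / c0) ^+ M.
  by apply: ler_weXn2l => //; rewrite ler_pdivlMr// mul1r.
rewrite !expr_div_n in h.
have cr : 0 < c0 ^+ r by rewrite exprn_gt0.
move: h; rewrite ler_pdivrMr// => h; apply: le_trans h _.
by rewrite le_eqVlt; apply/orP; left; apply/eqP; ring.
Qed.

Lemma nat_4k3 k : (2 <= k)%N -> (4 * k - 3 = (4 * k - 4).+1)%N. Proof. lia. Qed.
Lemma nat_2kp k : (2 <= k)%N -> ((2 * k).-1 = (2 * k.-1).+1)%N. Proof. lia. Qed.
Lemma nat_2k2 k : (2 <= k)%N -> (2 * k - 2 = 2 * k.-1)%N. Proof. lia. Qed.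
Lemma nat_2kp' k : (2 <= k)%N -> ((2 * k).-1 = (2 * k - 2).+1)%N. Proof. lia. Qed.
Lemma nat_4k4 k : (2 <= k)%N -> (4 * k - 4 = (2 * k - 2) * 2)%N. Proof. lia. Qed.

(** * Moment bounds at a fixed stage n *)

Section PerStage.
Context {R : realType} (d : nat) (zeta alpha gamma Rn : R) (n : nat).
Context (dT : measure_display) (T : measurableType dT) (P : probability T R).
Context (N : T -> nat) (Rad : nat -> T -> R) (G : nat -> 'I_d -> T -> R).
Hypothesis H : is_hyperbolic_ppp P alpha Rn n N Rad G.
Hypotheses (zeta0 : 0 < zeta) (alpha0 : 0 < alpha) (d2 : (2 <= d)%N).
Hypothesis Rbig : 1 + alpha <= alpha * Rn.
Hypothesis gamma0 : 0 <= gamma.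
Context (k : nat) (e : rel 'I_k) (k2 : (2 <= k)%N) (te : is_tree e).
Let A := L zeta gamma H.
Let lam : R := n%:R.
Let lam0 : 0 <= lam := ler0n _ _.
Local Notation EX K := (EE A lam K).
Let s : R := zeta * (d%:R - 1) / 2.
Let p : R := expR (- (s * Rn)).
Let x : R := lam * p.
Variable c0 : R.
Hypotheses (c00 : 0 < c0) (cx : c0 <= x).

Let p0 : 0 < p. Proof. exact: expR_gt0. Qed.

Let lam1 : 0 < lam.
Proof.
rewrite lt_def lam0 andbT; apply/eqP => l0.
by have := lt_le_trans c00 cx; rewrite /x l0 mul0r ltxx.
Qed.

Let px : p = x / lam.
Proof. by rewrite /x mulrAC divff ?mul1r// gt_eqF. Qed.

Let x0 : 0 < x. Proof. exact: lt_le_trans cx. Qed.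

Let Rn0 : 0 <= Rn.
Proof.
have h : alpha * 0 <= alpha * Rn by have := Rbig; have := alpha0; rewrite mulr0; lra.
by rewrite ler_pM2l in h.
Qed.

Let s0 : 0 <= s.
Proof. by rewrite /s divr_ge0// mulr_ge0 ?(ltW zeta0)// subr_ge0 ler1n ltnW. Qed.

Let law (J : finType) (b : arr J -> bool) :
  E A (fun g => (b g)%:R) = fine (LamP H [set u | b (arrU zeta gamma Rn (@rk J) u)]).
Proof. exact: (E_arrayU zeta gamma Rn (prodlawP H) (nu_tidxP H) b (@rk_inj J)). Qed.

(** The price of the marks: the bound for an edge between marked points exceeds by this factor the
    bound at T = 0. *)
Definition growth : R := expR (s * (2 * (gamma * Rn))).

Lemma growth_ge1 : 1 <= growth.
Proof.
rewrite -[leLHS]expR0 ler_expR; apply: mulr_ge0; first exact: s0.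
by apply: mulr_ge0 => //; exact: mulr_ge0.
Qed.

Definition cOV : R := \sum_(r < (4 * k - 4).+1)
  r.+1%:R ^+ (4 * k) * stepC d ^+ r * (c0 ^+ r / c0 ^+ (4 * k - 4)).

Lemma cOV_gt0 : 0 < cOV.
Proof.
rewrite /cOV (bigD1 ord0)//=; apply: ltr_wpDr.
  apply: sumr_ge0 => r _; rewrite !mulr_ge0 ?invr_ge0 ?exprn_ge0 ?(ltW c00)//.
  exact: ltW (stepC_gt0 d).
by rewrite !mulr_gt0 ?invr_gt0 ?exprn_gt0 ?ltr0n//; exact: stepC_gt0.
Qed.

Lemma OV_stage : EX (fun m (g : arr (ordX m)) => OVL (Bpair (PhiM e) (PhiM e)) (@pat2 'I_k) g) <=
  lam * x ^+ (4 * k - 4) * (growth ^+ (4 * k) * cOV).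
Proof.
have C0 := stepC_gt0 (R := R) d.
have b0 : 0 <= stepC d * growth by rewrite mulr_ge0 ?expR_ge0// ltW.
have q0 : 0 <= stepC d * growth * (x / lam).
  by rewrite mulr_ge0// -px ltW.
apply: le_trans (OV_upper k2 te lam0 q0 _) _.
  move=> J y0 l cl; rewrite law.
  have E : stepC d * growth * (x / lam) = stepC d * expR (zeta * (d%:R - 1) / 2 * (2 * (gamma * Rn) - Rn)).
    by rewrite -px /growth /p -mulrA -expRD; congr (_ * expR _); rewrite /s; ring.
  rewrite E; exact: (madj_upper gamma zeta0 alpha0 d2 Rbig (nu_radP H) (nu_dirP H) (prodlawP H) cl).
rewrite (nat_4k3 k2).
apply: le_trans (@sum_bound R x c0 (stepC d * growth) lam (4 * k - 4) (fun r => r.+1%:R ^+ (4 * k)) c00 cx b0 lam1 _) _.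
  by move=> r; rewrite exprn_ge0.
rewrite ler_wpM2l ?mulr_ge0 ?exprn_ge0 ?(ltW x0)// /cOV big_distrr/=.
apply: ler_sum => -[r rM] _ /=; rewrite exprMn.
have -> : r.+1%:R ^+ (4 * k) * (stepC d ^+ r * growth ^+ r) * (c0 ^+ r / c0 ^+ (4 * k - 4)) =
  growth ^+ r * (r.+1%:R ^+ (4 * k) * stepC d ^+ r * (c0 ^+ r / c0 ^+ (4 * k - 4))) by ring.
rewrite ler_wpM2r//.
  by rewrite !mulr_ge0 ?invr_ge0 ?exprn_ge0 ?(ltW c00) ?(ltW C0).
apply: ler_weXn2l; first exact: growth_ge1.
by apply: leq_trans (_ : 4 * k - 4 <= _)%N; [rewrite -ltnS|exact: leq_subr].
Qed.

Definition cvar : R := (1 / 2 * (stepc d / 2) ^+ (2 * k.-1)) / ((2 * k).-1)`!%:R.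

Lemma cvar_gt0 : 0 < cvar.
Proof.
apply: divr_gt0; last by rewrite ltr0n fact_gt0.
apply: mulr_gt0; first by rewrite divr_gt0.
by apply: exprn_gt0; apply: divr_gt0 => //; exact: stepc_gt0.
Qed.

Variable K0 : R.
Hypotheses (K00 : 0 <= K0) (Kg : K0 <= gamma * Rn) (KR : zeta * K0 + 2 <= zeta * Rn).
Hypothesis K0tail : tailC d alpha 0 * expR (- ((rhob d alpha - 0) / 2 * K0)) <= 1 / 2.

Let Z := fun m (g : arr (ordX m)) => ZZ (PhiM e) g : R.

Lemma var_stage : cvar * (lam * x ^+ (2 * k - 2)) <= EX Z.
Proof.
have c2 : 0 <= stepc d * p / 2 by rewrite divr_ge0// mulr_ge0 ?(ltW p0)// ltW// stepc_gt0.
have h2 : 0 <= 1 / 2 :> R by rewrite divr_ge0.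
apply: le_trans (Z_lower k2 te lam0 h2 c2 _); last first.
  move=> J y0 l cl; rewrite law.
  exact: (ladj_lower zeta0 alpha0 d2 Rbig (nu_radP H) (nu_dirP H) (prodlawP H) cl Kg K00 KR K0tail).
rewrite le_eqVlt; apply/orP; left; apply/eqP.
rewrite (nat_2kp k2) (nat_2k2 k2).
rewrite /cvar /x exprS !exprMn.
rewrite (nat_2kp k2).
ring.
Qed.

Lemma EZ_gt0 : 0 < EX Z.
Proof.
apply: lt_le_trans var_stage; apply: mulr_gt0; first exact: cvar_gt0.
by apply: mulr_gt0 => //; exact: exprn_gt0.
Qed.

(** By [second_moment_FZ] the variance of Z is the overlap sum, at most of order lam x^(4k-4) times
    a power of [growth], while (E Z)^2 is at least of order lam^2 x^(4k-4). The powers of x cancel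
    and 1 / lam remains. *)
Lemma ZZ2_stage (del : R) : cOV / cvar ^+ 2 * growth ^+ (4 * k) / lam <= del ^+ 2 ->
  EX (fun m (g : arr (ordX m)) => Z g ^+ 2) <= (EX Z) ^+ 2 * (1 + del ^+ 2).
Proof.
move=> hd.
have E2 : EX (fun m (g : arr (ordX m)) => Z g ^+ 2) = EX Z ^+ 2 +
    EX (fun m (g : arr (ordX m)) => OVL (Bpair (PhiM e) (PhiM e)) (@pat2 'I_k) g).
  have := @second_moment_FZ R A lam lam0 _ (Bpair (PhiM e) (PhiM e)) (@pat2 'I_k)
    (Bpair01 (@PhiM_01 _ _ e) (@PhiM_01 _ _ e)) (@pat2_inj _).
  rewrite -(EE_eq A lam (fun m g => ZZ_FZ (PhiM e) g)).
  by move=> <-; apply: EE_eq => m g; rewrite /Z ZZ_FZ.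
rewrite E2 mulrDr mulr1 lerD2l; apply: le_trans OV_stage _.
have v0 := cvar_gt0; have vs := var_stage.
have u0 : 0 <= cvar * (lam * x ^+ (2 * k - 2)).
  by apply: mulr_ge0; [exact: ltW|apply: mulr_ge0 => //; apply: exprn_ge0; exact: ltW].
apply: (@le_trans _ _ ((cvar * (lam * x ^+ (2 * k - 2))) ^+ 2 * del ^+ 2)); last first.
  by rewrite ler_wpM2r ?sqr_ge0// lerXn2r ?nnegrE// (le_trans u0 vs).
apply: (@le_trans _ _ ((cvar * (lam * x ^+ (2 * k - 2))) ^+ 2 * (cOV / cvar ^+ 2 * growth ^+ (4 * k) / lam))); last first.
  by rewrite ler_wpM2l ?sqr_ge0.
rewrite (nat_4k4 k2).
rewrite le_eqVlt; apply/orP; left; apply/eqP; rewrite exprM.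
move: (x ^+ (2 * k - 2)) (growth ^+ (4 * k)) cOV => X g C.
by field; rewrite !gt_eqF.
Qed.

Definition cD (tC : R) : R := \sum_(r < (2 * k - 2).+1)
  r.+1%:R ^+ (2 * k) * k%:R * (tC * stepC d) ^+ r * (c0 ^+ r / c0 ^+ (2 * k - 2)).

Let s' : R := zeta * (d%:R - 1) * (max_degree e)%:R.

(** The bound for the unmarked part and the lower bound for E Z share the factor lam x^(2k-2), so
    their ratio is a constant times the tail factor of one unmarked vertex. *)
Lemma VD_stage : s' < rhob d alpha ->
  EX (fun m (g : arr (ordX m)) => ZZ (PhiD e) g) <=
  cD (tailC d alpha s') / cvar *
   (tailC d alpha s' * expR (- ((rhob d alpha - s') / 2 * (gamma * Rn)))) * EX Z.
Proof.
move=> sb; set tC := tailC d alpha s'; have tC0 : 0 < tC by exact: tailC_gt0.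
set eps := tC * expR _; have eps0 : 0 <= eps by rewrite mulr_ge0 ?expR_ge0// ltW.
have C0 := stepC_gt0 (R := R) d.
have b0 : 0 <= tC * stepC d by rewrite mulr_ge0// ltW.
have q0 : 0 <= tC * stepC d * (x / lam) by rewrite mulr_ge0// -px ltW.
apply: (@le_trans _ _ (cD tC * eps * (lam * x ^+ (2 * k - 2)))).
  apply: le_trans (ZD_upper k2 te lam0 q0 eps0 _) _.
    move=> J y0 y l cl yl deg; rewrite law -px.
    exact: (unmarked_upper zeta0 alpha0 d2 Rbig (nu_radP H) (nu_dirP H) (prodlawP H) cl yl deg sb gamma0).
  rewrite (nat_2kp' k2).
  rewrite (eq_bigr (fun r : 'I_(2 * k - 2).+1 => lam ^+ r.+1 * ((r.+1%:R ^+ (2 * k) * k%:R * eps) * (tC * stepC d * (x / lam)) ^+ r))); last by move=> r _; ring.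
  apply: le_trans (@sum_bound R x c0 (tC * stepC d) lam (2 * k - 2) (fun r => r.+1%:R ^+ (2 * k) * k%:R * eps) c00 cx b0 lam1 _) _.
    by move=> r; apply: mulr_ge0 => //; apply: mulr_ge0 => //; exact: exprn_ge0.
  rewrite /cD !big_distrl/= big_distrr/=; apply: ler_sum => r _.
  by rewrite le_eqVlt; apply/orP; left; apply/eqP; ring.
have v0 := cvar_gt0; have vs := var_stage.
have D0 : 0 <= cD tC.
  by apply: sumr_ge0 => r _; rewrite !mulr_ge0 ?exprn_ge0 ?invr_ge0 ?exprn_ge0 ?(ltW c00).
have -> : cD tC / cvar * eps * EX Z = cD tC * eps * (cvar^-1 * EX Z) by ring.
apply: ler_wpM2l; first by apply: mulr_ge0; [exact: D0|exact: eps0].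
by rewrite ler_pdivlMl.
Qed.

End PerStage.

(** * Limits in n *)

Section Limits.
Context {R : realType}.

(** The limit c, finite or not, enters the proof through a positive lower bound on n p that holds
    eventually. *)
Lemma cvge_pos (u : nat -> R) (c : \bar R) : (0 < c)%E ->
  (fun n => (u n)%:E) @ \oo --> c -> exists c0, 0 < c0 /\ \forall n \near \oo, c0 <= u n.
Proof.
move=> c0 uc.
have [r [r0 rc]] : exists r : R, 0 < r /\ (r%:E < c)%E.
  move: c c0 {uc} => [r| |] // r0.
    by exists (r / 2); move: r0; rewrite !lte_fin => r0; split; lra.
  by exists 1; rewrite ltry.
exists r; split => //.
have : \forall n \near \oo, [set y : \bar R | (r%:E < y)%E] (u n)%:E.
  by apply: uc; apply: open_nbhs_nbhs; split => //; exact: open_ereal_gt_ereal.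
by apply: filterS => n /=; rewrite lte_fin => /ltW.
Qed.

Lemma exp_small (u : nat -> R) (B c eps : R) : u @ \oo --> +oo -> 0 <= B -> 0 < c -> 0 < eps ->
  \forall n \near \oo, B * expR (- (c * u n)) <= eps.
Proof.
move=> /cvgryPge ud B0 c0 e0.
apply: filterS (ud (B / eps / c)) => n; rewrite ler_pdivrMr// ler_pdivrMr// => h.
rewrite expRN ler_pdivrMr ?expR_gt0//; apply: le_trans h _.
rewrite mulrC ler_wpM2l ?(ltW e0)// mulrC.
by have := expR_ge1Dx (c * u n); lra.
Qed.

Lemma ln_cvgy : (fun n : nat => ln (n%:R : R)) @ \oo --> +oo.
Proof.
apply/cvgryPge => A; exists (Num.truncn (expR A)).+1 => // n /= hn.
rewrite -[leLHS]expRK ler_ln ?posrE ?expR_gt0//.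
  apply: le_trans (ltW (truncnS_gt (expR A))) _; by rewrite ler_nat.
by rewrite ltr0n; exact: leq_trans hn.
Qed.

Lemma cvge_dist (u : nat -> \bar R) (l : \bar R) : l \is a fin_num ->
  (forall eps : R, 0 < eps -> \forall n \near \oo, (`|u n - l| <= eps%:E)%E) ->
  u @ \oo --> l.
Proof.
move=> lf H; rewrite -(fineK lf).
have ff (x : \bar R) (eps : R) : (`|x - l| <= eps%:E)%E -> x \is a fin_num.
  by move: x => [x| |] //; rewrite -(fineK lf).
apply: cvg_EFin.
  by apply: filterS (H 1 ltr01) => n; exact: ff.
apply/cvgrPdist_le => eps e0; apply: filterS (H _ e0) => n hn.
have := ff _ _ hn => xf; move: hn; rewrite -{1}(fineK xf) -{1}(fineK lf) -EFinB abse_EFin lee_fin.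
by rewrite distrC.
Qed.

Lemma tail_level (t b : R) : 0 < t -> 0 < b ->
  exists K, 0 <= K /\ t * expR (- ((b - 0) / 2 * K)) <= 1 / 2.
Proof.
(* This K makes the exponent 2 t, and 2 t <= exp (2 t). *)
move=> t0 b0; exists (4 * t / b); split; first by rewrite divr_ge0 ?mulr_ge0 ?ltW.
have -> : (b - 0) / 2 * (4 * t / b) = 2 * t by field; rewrite gt_eqF.
rewrite expRN ler_pdivrMr ?expR_gt0//.
by have := expR_ge1Dx (2 * t); lra.
Qed.

Lemma abse_dist_trans (x y z : \bar R) (r t : R) :
  (`|x - y| <= r%:E)%E -> (`|y - z| <= t%:E)%E -> (`|x - z| <= (r + t)%:E)%E.
Proof.
move: x y z => [x| |] [y| |] [z| |] //; rewrite -!EFinB !abse_EFin !lee_fin => h1 h2.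
by rewrite -(subrKA y); apply: le_trans (ler_normD _ _) (lerD h1 h2).
Qed.

End Limits.

(** * Rates and convergence along the sequence *)

Section Main.
Context (R : realType) (d : nat) (zeta alpha : R) (Rn : nat -> R).
Context (k : nat) (e : rel 'I_k).
Context (dT : measure_display) (T : measurableType dT) (P : probability T R).
Context (N : nat -> T -> nat) (Rad : nat -> nat -> T -> R) (G : nat -> nat -> 'I_d -> T -> R).
Hypotheses (d2 : (2 <= d)%N) (zeta0 : 0 < zeta) (alpha0 : 0 < alpha).
Hypothesis Rninf : Rn @ \oo --> +oo.
Hypotheses (k2 : (2 <= k)%N) (te : is_tree e).
Hypothesis H : forall n, is_hyperbolic_ppp P alpha (Rn n) n (N n) (Rad n) (G n).
Let s : R := zeta * (d%:R - 1) / 2.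
Variable c0 : R.
Hypothesis c00 : 0 < c0.
Hypothesis cx : \forall n \near \oo, c0 <= n%:R * expR (- (s * Rn n)).

Let S (gamma : R) (n : nat) : T -> R := fun w =>
  subtree_count zeta e (Rn n) gamma (ppp_points zeta (N n) (Rad n) (G n) w).

Let evn gamma n := ev zeta gamma (Rn n) (N n) (Rad n) (G n).
Let EXn gamma n (K : forall m, arr (ordX m) -> R) := EE (L zeta gamma (H n)) n%:R K.

Let SE gamma n : S gamma n = evn gamma n (fun m g => SS (PhiM e) g).
Proof. by apply/funext => w; exact: subtree_countE. Qed.

Let S1E gamma n : S 1 n = evn gamma n (fun m g => SS (Phi1 e) g).
Proof. by apply/funext => w; exact: subtree_count1E. Qed.

Let b0 : 0 < rhob d alpha.
Proof. by rewrite mulr_gt0// ltr0n -subn1 subn_gt0. Qed.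

Definition stage_ok (gamma K0 : R) (n : nat) : Prop :=
  [/\ 1 + alpha <= alpha * Rn n, c0 <= n%:R * expR (- (s * Rn n)),
      K0 <= gamma * Rn n & zeta * K0 + 2 <= zeta * Rn n].

Lemma stages_ok gamma K0 : 0 < gamma -> \forall n \near \oo, stage_ok gamma K0 n.
Proof.
move=> g0; have /cvgryPge Rp := Rninf.
near=> n; split.
- have : (1 + alpha) / alpha <= Rn n by near: n; exact: Rp.
  by rewrite ler_pdivrMr// (mulrC (Rn n)).
- by near: n; exact: cx.
- have : K0 / gamma <= Rn n by near: n; exact: Rp.
  by rewrite ler_pdivrMr// (mulrC (Rn n)).
have : (zeta * K0 + 2) / zeta <= Rn n by near: n; exact: Rp.
by rewrite ler_pdivrMr// (mulrC (Rn n)).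
Unshelve. all: by end_near. Qed.

Section Rate.
Variables (gamma a K0 : R).
Hypotheses (g0 : 0 < gamma) (ga : 8 * k%:R * gamma <= 1 - 2 * a).
Hypothesis K00 : 0 <= K0.
Hypothesis K0tail : tailC d alpha 0 * expR (- ((rhob d alpha - 0) / 2 * K0)) <= 1 / 2.

(** The last factor is c0^(-8 k gamma), the price of replacing exp (s Rn) by n / c0 in
    [growth ^+ (4 * k)]. *)
Definition rateC : R :=
  Num.sqrt (cOV d k c0 / @cvar R d k ^+ 2 * expR (- (8 * k%:R * gamma * ln c0))).

Lemma rateC_gt0 : 0 < rateC.
Proof.
rewrite sqrtr_gt0 !mulr_gt0 ?expR_gt0 ?invr_gt0 ?exprn_gt0//.
  exact: (cOV_gt0 d k c00).
exact: cvar_gt0.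
Qed.

(** From n p >= c0 follows s Rn <= ln n - ln c0, so the power 4k of [growth], which is exp (8 k
    gamma s Rn), is at most (n / c0)^(8 k gamma). Divided by n this is O(n^(-2a)), the square of the
    rate. *)
Lemma rate_stage n : stage_ok gamma K0 n ->
  cOV d k c0 / @cvar R d k ^+ 2 * growth d zeta gamma (Rn n) ^+ (4 * k) / n%:R <=
  (rateC * expR (- (a * ln n%:R))) ^+ 2.
Proof.
move=> [_ cn _ _].
have n0 : 0 < n%:R :> R.
  rewrite lt_def ler0n andbT; apply/eqP => n0.
  by have := lt_le_trans c00 cn; rewrite n0 mul0r ltxx.
have n1 : 1 <= n%:R :> R by rewrite ler1n -(ltr0n R).
have cO := cOV_gt0 d k c00; have cv := @cvar_gt0 R d d2 k.
rewrite /rateC; set A := cOV d k c0 / @cvar R d k ^+ 2.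
have A0 : 0 <= A by rewrite divr_ge0 ?exprn_ge0// ltW.
rewrite exprMn sqr_sqrtr; last by apply: mulr_ge0 => //; exact: expR_ge0.
rewrite /growth; clearbody A.
rewrite -(mulrA A) -(mulrA A (expR _)) ler_wpM2l//.
rewrite ler_pdivrMr//.
have nE : n%:R = expR (ln n%:R) :> R by rewrite lnK// posrE.
rewrite [X in _ <= _ * X]nE -!expRM_natl -!expRD ler_expR.
have sR : s * Rn n <= ln n%:R - ln c0.
  rewrite -ln_div ?posrE// -[leLHS]expRK ler_ln ?posrE ?expR_gt0 ?divr_gt0//.
  by rewrite ler_pdivlMr// mulrC -ler_pdivlMr ?expR_gt0// -expRN.
have kg : 0 <= 8 * k%:R * gamma by rewrite !mulr_ge0// ltW.
have l0 : 0 <= ln n%:R :> R by exact: ln_ge0.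
have h1 := ler_wpM2l kg sR; have h2 := ler_wpM2r l0 ga.
rewrite natrM; rewrite /s in h1; lra.
Qed.

Let stage n : stage_ok gamma K0 n ->
  [/\ 0 < EXn gamma n (fun m g => SS (PhiM e) g ^+ 2) - EXn gamma n (fun m g => SS (PhiM e) g) ^+ 2 &
   EXn gamma n (fun m (g : arr (ordX m)) => ZZ (PhiM e) g ^+ 2) <=
   (EXn gamma n (fun m g => SS (PhiM e) g ^+ 2) - EXn gamma n (fun m g => SS (PhiM e) g) ^+ 2) ^+ 2 *
     (1 + (rateC * expR (- (a * ln n%:R))) ^+ 2)].
Proof.
move=> ok; have hd := rate_stage ok; move: ok => [Rb cn Kg KR].
have g0' := ltW g0.
rewrite /EXn (variance_ZZ (L zeta gamma (H n)) (ler0n R n) (@PhiM_01 _ _ e)).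
split.
  exact: (EZ_gt0 (H n) zeta0 alpha0 d2 Rb k2 te c00 cn K00 Kg KR K0tail).
exact: (ZZ2_stage (H n) zeta0 alpha0 d2 Rb g0' k2 te c00 cn K00 Kg KR K0tail hd).
Qed.

Let del_gt0 n : 0 < rateC * expR (- (a * ln n%:R)).
Proof. by rewrite mulr_gt0 ?rateC_gt0 ?expR_gt0. Qed.

Lemma dK_stage n : stage_ok gamma K0 n ->
  (dK_normal P (standardize P (S gamma n)) <=
    (rateC * expR (- (a * ln n%:R)) * (6 * 2 ^+ 2 + 4))%:E)%E.
Proof.
move=> ok; have [v0 z2] := stage ok; rewrite SE.
exact: (kolmogorov_bound (@PhiM_01 _ _ e) v0 (del_gt0 n) z2).
Qed.

Lemma dW_stage n : stage_ok gamma K0 n ->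
  (dW_normal P (standardize P (S gamma n)) <=
    (rateC * expR (- (a * ln n%:R)) * (6 * (@lipC R) ^+ 2 + 4))%:E)%E.
Proof.
move=> ok; have [v0 z2] := stage ok; rewrite SE.
exact: (wasserstein_bound (@PhiM_01 _ _ e) v0 (del_gt0 n) z2).
Qed.

Lemma lip_stage n h : stage_ok gamma K0 n -> lipschitz1 h ->
  (`| \int[P]_w (h (standardize P (S gamma n) w))%:E - std_normal_expect h | <=
    (rateC * expR (- (a * ln n%:R)) * (6 * (@lipC R) ^+ 2 + 4))%:E)%E.
Proof.
move=> ok hL; have [v0 z2] := stage ok; rewrite SE.
exact: (lipschitz_bound (@PhiM_01 _ _ e) v0 (del_gt0 n) z2 hL).
Qed.

Let s' : R := zeta * (d%:R - 1) * (max_degree e)%:R.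

Definition cmpC : R := cD d k c0 (tailC d alpha s') / @cvar R d k * tailC d alpha s'.

(** Square root of the variance ratio of [VD_stage], which halves the exponent; [|cmpC| + 1] keeps
    it positive. *)
Definition eta (n : nat) : R :=
  Num.sqrt (`|cmpC| + 1) * expR (- ((rhob d alpha - s') / 4 * gamma * Rn n)).

Lemma close_stage n h : stage_ok gamma K0 n -> s' < rhob d alpha -> eta n <= 1 -> lipschitz1 h ->
  (`| \int[P]_w (h (standardize P (S 1 n) w))%:E -
      \int[P]_w (h (standardize P (S gamma n) w))%:E | <= (4 * eta n)%:E)%E.
Proof.
move=> ok sb e1 hL; have [v0 _] := stage ok; move: (ok) => [Rb cn Kg KR].
have g0' := ltW g0.
rewrite (S1E gamma) (SE gamma).
have q0 : 0 < `|cmpC| + 1 by rewrite ltr_wpDl.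
have e0 : 0 < eta n by rewrite mulr_gt0 ?expR_gt0// sqrtr_gt0.
apply: (lipschitz_close (@PhiM_01 _ _ e) (@Phi1_01 _ _ e) (@PhiD_01 _ _ e) v0) => //.
  by rewrite e0.
apply: le_trans (VD_stage (H n) zeta0 alpha0 d2 Rb g0' k2 te c00 cn K00 Kg KR K0tail sb) _.
have Z0 := EZ_gt0 (H n) zeta0 alpha0 d2 Rb k2 te c00 cn K00 Kg KR K0tail.
rewrite (variance_ZZ (L zeta gamma (H n)) (ler0n R n) (@PhiM_01 _ _ e)) ler_wpM2r ?(ltW Z0)//.
rewrite /eta exprMn sqr_sqrtr ?(ltW q0)// -expRM_natl mulrA -/cmpC.
have -> : 2%:R * - ((rhob d alpha - s') / 4 * gamma * Rn n) = - ((rhob d alpha - s') / 2 * (gamma * Rn n)) by field.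
rewrite ler_wpM2r ?expR_ge0//.
by apply: le_trans (ler_norm _) _; rewrite lerDl.
Qed.

End Rate.

Let k0 : 0 < k%:R :> R.
Proof. by rewrite ltr0n; apply: leq_trans k2. Qed.

Lemma rate_normal (a : R) : 0 < a < 1 / 2 ->
  exists gamma0 : R, 0 < gamma0 < 1 / 2 /\ forall gamma : R, 0 < gamma < gamma0 ->
    bigO_pow (fun n => dW_normal P (standardize P (S gamma n))) a /\
    bigO_pow (fun n => dK_normal P (standardize P (S gamma n))) a.
Proof.
move=> /andP[a0 a1]; have [K0 [K00 K0t]] := tail_level (tailC_gt0 b0) b0.
(* The first term keeps gamma0 below 1/2, the second is the condition 8 k gamma <= 1 - 2 a. *)
exists (Num.min (1 / 4) ((1 - 2 * a) / (8 * k%:R))); split.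
  rewrite lt_min gt_min; apply/andP; split; last by apply/orP; left; lra.
  apply/andP; split; first lra.
  by apply: divr_gt0; [|rewrite mulr_gt0//]; lra.
move=> gamma /andP[g0]; rewrite lt_min => /andP[_].
rewrite ltr_pdivlMr ?mulr_gt0// => hg.
have ga : 8 * k%:R * gamma <= 1 - 2 * a by lra.
have [n0 _ ok] := stages_ok K0 g0.
(* The shift to [n0.+1] keeps n positive; at 0 [powR] is not given by the exponential formula. *)
have pw n : (n0.+1 <= n)%N -> powR n%:R (- a) = expR (- (a * ln n%:R)) :> R.
  by move=> hn; rewrite /powR pnatr_eq0 (gtn_eqF (leq_ltn_trans (leq0n _) hn)) mulNr.
split.
  exists (rateC gamma * (6 * (@lipC R) ^+ 2 + 4)), n0.+1 => n hn.
  rewrite (pw _ hn) mulrAC; apply: (dW_stage g0 ga K00 K0t).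
  exact: ok (ltnW hn).
exists (rateC gamma * (6 * 2 ^+ 2 + 4)), n0.+1 => n hn.
rewrite (pw _ hn) mulrAC; apply: (dK_stage g0 ga K00 K0t).
exact: ok (ltnW hn).
Qed.

Lemma cvg_normal : (max_degree e)%:R < alpha / zeta ->
  cvg_dist_normal P (fun n => standardize P (S 1 n)).
Proof.
rewrite ltr_pdivlMr// => mx.
have sb : zeta * (d%:R - 1) * (max_degree e)%:R < rhob d alpha.
  have d1 : 0 < d%:R - 1 :> R by rewrite subr_gt0 ltr1n.
  rewrite /rhob -subn1 natrB ?(ltnW d2)//.
  by move: mx; rewrite -(ltr_pM2r d1) => mx; lra.
have [K0 [K00 K0t]] := tail_level (tailC_gt0 b0) b0.
(* A fixed level admissible for the rate exponent 1/4. It does not move with n: the restricted count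
   converges at a rate, and the distance to the full count decays exponentially in Rn. *)
pose g : R := 1 / (16 * k%:R).
have g0 : 0 < g by rewrite divr_gt0// mulr_gt0.
have ga : 8 * k%:R * g <= 1 - 2 * (1 / 4).
  have -> : 8 * k%:R * g = 1 / 2 by rewrite /g; field; rewrite gt_eqF.
  lra.
apply: cvg_dist_lipschitz => [n|h hL].
  apply: measurable_funM; last exact: measurable_cst.
  apply: measurable_funB; last exact: measurable_cst.
  by rewrite (S1E g); exact: (measurable_ev zeta g (H n)).
have [fin _] := stein_lipschitz hL.
apply: cvge_dist => // eps e0.
have C0 : 0 <= rateC g * (6 * (@lipC R) ^+ 2 + 4).
  apply: mulr_ge0; first exact/ltW/rateC_gt0.
  by apply: addr_ge0 => //; apply: mulr_ge0 => //; exact: sqr_ge0.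
set q : R := Num.sqrt (`|cmpC| + 1).
have q0 : 0 <= q by exact: sqrtr_ge0.
set w : R := (rhob d alpha - zeta * (d%:R - 1) * (max_degree e)%:R) / 4 * g.
have w0 : 0 < w by rewrite mulr_gt0// divr_gt0// subr_gt0.
have e8 : 0 < eps / 8 by rewrite divr_gt0.
have e2 : 0 < eps / 2 by rewrite divr_gt0.
have a4 : 0 < 1 / 4 :> R by rewrite divr_gt0.
near=> n.
have ok : stage_ok g K0 n by near: n; exact: stages_ok.
have h1 : eta g n <= 1 by near: n; exact: (exp_small Rninf q0 w0 ltr01).
have h8 : eta g n <= eps / 8 by near: n; exact: (exp_small Rninf q0 w0 e8).
have h2 : rateC g * (6 * (@lipC R) ^+ 2 + 4) * expR (- (1 / 4 * ln n%:R)) <= eps / 2.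
  by near: n; exact: (exp_small ln_cvgy C0 a4 e2).
apply: le_trans (abse_dist_trans (close_stage g0 ga K00 K0t ok sb h1 hL) (lip_stage g0 ga K00 K0t ok hL)) _.
by rewrite lee_fin mulrAC; lra.
Unshelve. all: by end_near. Qed.

End Main.

Theorem theorem2p6
  (R : realType) (d : nat) (zeta alpha : R) (Rn : nat -> R)
  (k : nat) (e : rel 'I_k)
  (dT : measure_display) (T : measurableType dT) (P : probability T R)
  (N : nat -> T -> nat) (Rad : nat -> nat -> T -> R)
  (G : nat -> nat -> 'I_d -> T -> R) :
  (2 <= d)%N -> 0 < zeta -> 0 < alpha ->
  (forall n, 0 < Rn n) -> Rn @ \oo --> +oo ->
  (2 <= k)%N -> is_tree e ->
  (forall n, is_hyperbolic_ppp P alpha (Rn n) n (N n) (Rad n) (G n)) ->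
  (exists c : \bar R, (0 < c)%E /\
     ((fun n : nat => (n%:R * expR (- (zeta * (d%:R - 1) * Rn n / 2)))%:E)
        @ \oo --> c)) ->
  let S (gamma : R) (n : nat) : T -> R := fun w =>
    subtree_count zeta e (Rn n) gamma
      (ppp_points zeta (N n) (Rad n) (G n) w) in
  (* (a) *)
  (forall a : R, 0 < a < 1 / 2 ->
     exists gamma0 : R, 0 < gamma0 < 1 / 2 /\
       forall gamma : R, 0 < gamma < gamma0 ->
         bigO_pow (fun n => dW_normal P (standardize P (S gamma n))) a /\
         bigO_pow (fun n => dK_normal P (standardize P (S gamma n))) a) /\
  (* (b) *)
  (alpha / zeta > (max_degree e)%:R ->
     cvg_dist_normal P (fun n => standardize P (S 1 n))).
Proof.
move=> d2 zeta0 alpha0 _ Rninf k2 te H [c [c_gt0 cc]] S.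
have [c0 [c00 cx]] := cvge_pos c_gt0 cc.
have {}cx : \forall n \near \oo, c0 <= n%:R * expR (- (zeta * (d%:R - 1) / 2 * Rn n)).
  by apply: filterS cx => n; rewrite (mulrAC _ (Rn n)).
split; first exact: (rate_normal d2 zeta0 alpha0 Rninf k2 te H c00 cx).
exact: (cvg_normal d2 zeta0 alpha0 Rninf k2 te H c00 cx).
Qed.
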